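(* Let $j,k,\ell\le 1$. The problem $\textsc{Minimality}(j,k,\ell)$ reduces to determining whether a given period, exponential period, or period-like integral (given explicitly as an integral) is equal to zero.
   Context: $\textsc{Minimality}(j,k,\ell)$: given polynomials $g_3,g_2,g_1\in\mathbb{Q}[x]$ with $\deg g_3=j$, $\deg g_2=k$, $\deg g_1=\ell$, none of which vanishes at any integer $n\ge 0$, and given initial values $v_{-1},v_0$, decide whether the solution $(v_n)_{n\ge-1}$ of $g_3(n)v_n=g_2(n)v_{n-1}+g_1(n)v_{n-2}$ $(n\ge1)$ is minimal; a non-trivial solution is minimal if some linearly independent solution $(w_n)$ of the same recurrence satisfies $v_n/w_n\to 0$. A period is a complex number whose real and imaginary parts are absolutely convergent integrals $\int_\sigma P(x)/Q(x)\,dx_1\cdots dx_n$ with $P,Q\in\mathbb{Q}[x_1,\dots,x_n]$, $Q\ne0$, and $\sigma\subset\mathbb{R}^n$ defined by polynomial inequalities with rational coefficients. An exponential period is an absolutely convergent integral $\int_\sigma e^{-f(x)}g(x)\,dx_1\cdots dx_n$ with $f,g$ algebraic functions with algebraic coefficients and $\sigma$ a semi-algebraic set defined by polynomials with algebraic coefficients. A period-like integral is an absolutely convergent integral of the same shape where $f$ is an algebraic function and $g$ is a sum of algebraic functions raised to algebraic powers. *)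

(* Defs.v *)
From HB Require Import structures.
From mathcomp Require Import all_boot all_order all_algebra.
From mathcomp Require Import complex.
(* The notations of mpoly clash with those of MathComp-Analysis. *)
From mathcomp Require mpoly.
Import -(notations) mpoly.
From mathcomp Require Import all_classical all_reals all_analysis.

Set Implicit Arguments.
Unset Strict Implicit.
Unset Printing Implicit Defensive.

Import Order.TTheory GRing.Theory Num.Theory numFieldNormedType.Exports.

Local Open Scope classical_set_scope.
Local Open Scope ring_scope.
Local Open Scope complex_scope.

(** * Computable many-one reductions *)

(* Kleene's mu-recursive functions, untyped in the arity: a program is applied
   to a list of arguments, and missing arguments read as 0. *)
Inductive murec : Type :=
| Mzero
| Msucc
| Mproj of nat
| Mcomp of murec & seq murec
| Mprec of murec & murec
| Mmin of murec.

(* [computes p xs y]: the (partial) function denoted by [p] is defined on [xs]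
   and takes the value [y] there. *)
Fixpoint computes (p : murec) (xs : seq nat) (y : nat) {struct p} : Prop :=
  match p with
  | Mzero => y = 0%N
  | Msucc => y = (nth 0%N xs 0).+1
  | Mproj i => y = nth 0%N xs i
  | Mcomp f gs =>
      exists2 ys : seq nat,
        (fix computes_all (gs : seq murec) (ys : seq nat) {struct gs} : Prop :=
           match gs, ys with
           | [::], [::] => True
           | g :: gs', z :: ys' => computes g xs z /\ computes_all gs' ys'
           | _, _ => False
           end) gs ys
        & computes f ys y
  | Mprec f g =>
      (* h 0 = f (x_1, ..), h i.+1 = g (i, h i, x_1, ..), y = h x_0 *)
      exists h : nat -> nat,
        [/\ computes f (behead xs) (h 0%N),
            forall i, (i < nth 0%N xs 0)%N ->
              computes g [:: i, h i & behead xs] (h i.+1)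
          & y = h (nth 0%N xs 0)]
  | Mmin f =>
      computes f (y :: xs) 0%N
      /\ forall z, (z < y)%N -> exists v, computes f (z :: xs) v.+1
  end.

(* A (promise) decision problem: inputs in [I], valid inputs, yes-instances.
   Inputs are Goedel-numbered by [pickle]; on the types used below (built from
   nat, int, rat, {poly rat}, seq, products and sums) [pickle] is an explicit
   coding, ultimately by [CodeSeq.code], and not a choice-based one. *)
Definition reduces_to (I J : countType) (validI yesI : I -> Prop)
    (validJ yesJ : J -> Prop) : Prop :=
  exists p : murec, forall i : I, validI i ->
    exists j : J,
      [/\ computes p [:: pickle i] (pickle j), validJ j & yesI i <-> yesJ j].

(** * The problem Minimality(j, k, l) *)

Section Minimality.
Variable R : realType.

(* Sequences are shifted by one: [u n] stands for v_{n-1}. *)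
Definition solution (g3 g2 g1 : {poly rat}) (u : nat -> R) : Prop :=
  forall n : nat, (1 <= n)%N ->
    ratr g3.[n%:R] * u n.+1 = ratr g2.[n%:R] * u n + ratr g1.[n%:R] * u n.-1.

Definition lin_indep (v w : nat -> R) : Prop :=
  forall a b : R, (forall n, a * v n + b * w n = 0) -> a = 0 /\ b = 0.

(* Since x / 0 = 0, the quotients must be required to be meaningful for all
   large n. *)
Definition minimal (g3 g2 g1 : {poly rat}) (v : nat -> R) : Prop :=
  (exists n, v n != 0) /\
  exists w : nat -> R,
    [/\ solution g3 g2 g1 w, lin_indep v w,
        \forall n \near \oo, w n != 0
      & (fun n => v n / w n) @ \oo --> (0 : R)].

End Minimality.

(* (g3, g2, g1, v_{-1}, v_0) *)
Definition recurrence : countType :=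
  ({poly rat} * {poly rat} * {poly rat} * rat * rat)%type.

Definition valid_recurrence (j k l : nat) (r : recurrence) : Prop :=
  let: (g3, g2, g1, _, _) := r in
  [/\ size g3 = j.+1, size g2 = k.+1, size g1 = l.+1
    & forall n : nat, [/\ g3.[n%:R] != 0, g2.[n%:R] != 0 & g1.[n%:R] != 0]].

Definition is_minimal (R : realType) (r : recurrence) : Prop :=
  let: (g3, g2, g1, a, b) := r in
  exists v : nat -> R,
    [/\ solution g3 g2 g1 v, v 0%N = ratr a, v 1%N = ratr b
      & minimal g3 g2 g1 v].

(** * Lebesgue measure on R^n *)

Notation euclid R n := (n.-tuple (measurableTypeR R)).

Section LebesgueStep.
Variables (R : realType) (n : nat).
Variable m : {sigma_finite_measure set (euclid R n) -> \bar R}.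

Definition tcons (x : measurableTypeR R * euclid R n) : euclid R n.+1 :=
  [tuple of x.1 :: x.2].

Lemma measurable_tcons : measurable_fun setT tcons.
Proof. by apply: measurable_cons. Qed.

Definition lebesgue_step : set (euclid R n.+1) -> \bar R :=
  pushforward (lebesgue_measure \x m)%E tcons.

Let lebesgue_step0 : lebesgue_step set0 = 0%E.
Proof. by rewrite /lebesgue_step /pushforward preimage_set0 measure0. Qed.

Let lebesgue_step_ge0 A : (0 <= lebesgue_step A)%E.
Proof. by rewrite /lebesgue_step /pushforward. Qed.

Let lebesgue_step_sigma_additive : semi_sigma_additive lebesgue_step.
Proof.
move=> F mF tF mUF; rewrite /lebesgue_step /pushforward preimage_bigcup.
apply: measure_semi_sigma_additive.
- by move=> i; rewrite -[X in measurable X]setTI; exact: measurable_tcons.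
- apply/trivIsetP => /= i j _ _ ij; rewrite -preimage_setI.
  by move/trivIsetP : tF => /(_ _ _ _ _ ij) ->//; rewrite preimage_set0.
- by rewrite -preimage_bigcup -[X in measurable X]setTI; exact: measurable_tcons.
Qed.

HB.instance Definition _ := isMeasure.Build _ _ _ lebesgue_step
  lebesgue_step0 lebesgue_step_ge0 lebesgue_step_sigma_additive.

Lemma lebesgue_step_sigma_finite : sigma_finite setT lebesgue_step.
Proof.
have /sigma_finiteP[F [TF ndF Foo]] := sigma_finiteT (@lebesgue_measure R).
have /sigma_finiteP[G [TG ndG Goo]] := sigma_finiteT m.
pose g (x : euclid R n.+1) : measurableTypeR R * euclid R n :=
  (thead x, [tuple of behead x]).
have mg : measurable_fun setT g.
  apply/measurable_fun_pair; first exact: measurable_tnth.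
  exact: measurable_behead.
have gK : cancel tcons g.
  by case=> x t; congr pair; apply: val_inj.
exists (fun i => g @^-1` (F i `*` G i)).
  rewrite predeqE => x; split=> // _.
  have : [set: measurableTypeR R] (g x).1 by [].
  have : [set: euclid R n] (g x).2 by [].
  rewrite TF TG => -[k _ Gk] [l _ Fl]; exists (maxn k l) => //; split.
  - by move: Fl; apply/subsetPset/ndF/leq_maxr.
  - by move: Gk; apply/subsetPset/ndG/leq_maxl.
move=> i; have [mF Fi] := Foo i; have [mG Gi] := Goo i; split.
  by rewrite -[X in measurable X]setTI; apply: mg => //; exact: measurableX.
rewrite /lebesgue_step /pushforward -comp_preimage.
rewrite (_ : g \o tcons = id); last by apply/funext => x /=; rewrite gK.
by rewrite preimage_id product_measure1E// lte_mul_pinfty// ge0_fin_numE.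
Qed.

HB.instance Definition _ := Measure_isSigmaFinite.Build _ _ _ lebesgue_step
  lebesgue_step_sigma_finite.

End LebesgueStep.

Fixpoint lebesgue_n (R : realType) (n : nat) :
    {sigma_finite_measure set (euclid R n) -> \bar R} :=
  match n with
  | 0 => \d_([tuple] : euclid R 0)
  | n'.+1 => lebesgue_step (lebesgue_n R n')
  end.

(** * Complex exponential and powers *)

Section ComplexPowers.
Variable R : realType.
Implicit Types z a : R[i].

Definition cmod z : R := Num.sqrt (complex.Re z ^+ 2 + complex.Im z ^+ 2).

Definition cexp z : R[i] :=
  (expR (complex.Re z))%:C * (cos (complex.Im z) +i* sin (complex.Im z)).

(* principal argument, in ]-pi, pi] *)
Definition carg z : R :=
  let t := acos (complex.Re z / cmod z) in
  if 0 <= complex.Im z then t else - t.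

(* principal branch; 0 to the power a is 0 for a <> 0, and 1 for a = 0 *)
Definition cpow z a : R[i] :=
  if z == 0 then (a == 0)%:R else cexp (a * (ln (cmod z) +i* carg z)).

End ComplexPowers.

(** * Finite descriptions of polynomials, algebraic numbers, semi-algebraic
      sets and algebraic functions *)

(* [:: (c_1, m_1); ..] describes c_1 X^m_1 + .., a monomial being the list of
   its exponents; missing exponents are 0. *)
Definition mpol (C : countType) : countType := seq (C * seq nat).

Definition mpoly_of (C : countType) (K : comNzRingType) (n : nat)
    (val : C -> K) (P : mpol C) : mpoly.mpoly n K :=
  \sum_(t <- P) val t.1 *:
    mpoly.mpolyX K (mpoly.Multinom [tuple nth 0%N t.2 i | i < n]).

Definition mpol_eval (C : countType) (K : comNzRingType) (n : nat)
    (val : C -> K) (P : mpol C) (x : n.-tuple K) : K :=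
  mpoly.meval (tnth x) (mpoly_of n val P).

Definition coeffs_ok (C : countType) (ok : C -> Prop) (P : mpol C) : Prop :=
  {in P, forall t, ok t.1}.

(* (p, (a, b)) describes the unique root of p in [a, b]. *)
Definition ralg : countType := ({poly rat} * (rat * rat))%type.

(* (p, ((a, b), (c, d))) describes the unique root of p in the rectangle
   [a, b] + i [c, d]. *)
Definition calg : countType := ({poly rat} * ((rat * rat) * (rat * rat)))%type.

(* A disjunction of conjunctions of polynomial inequalities: (true, P) stands
   for P > 0 and (false, P) for P >= 0. *)
Definition semialg (C : countType) : countType := seq (seq (bool * mpol C)).

(* (P, B) describes the function f of n real variables x such that y = f(x) is
   the unique complex number with P(x, y) = 0 and (x, Re y, Im y) in B; thus B
   selects a branch of the algebraic function defined by P. *)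
Definition algfun : countType := (mpol calg * semialg ralg)%type.

Section Semantics.
Variable R : realType.

Definition is_ralg (a : ralg) (x : R) : Prop :=
  [/\ a.1 != 0, root (map_poly ratr a.1) x & ratr a.2.1 <= x <= ratr a.2.2].

Definition ralg_ok (a : ralg) : Prop := exists! x : R, is_ralg a x.

Definition ralg_val (a : ralg) : R := xget 0 [set x | is_ralg a x].

Definition is_calg (a : calg) (z : R[i]) : Prop :=
  [/\ a.1 != 0, root (map_poly ratr a.1) z,
      ratr a.2.1.1 <= complex.Re z <= ratr a.2.1.2
    & ratr a.2.2.1 <= complex.Im z <= ratr a.2.2.2].

Definition calg_ok (a : calg) : Prop := exists! z : R[i], is_calg a z.

Definition calg_val (a : calg) : R[i] := xget 0 [set z | is_calg a z].

Definition semialg_ok (C : countType) (ok : C -> Prop) (S : semialg C) : Prop :=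
  {in S, forall c, {in c, forall a, coeffs_ok ok a.2}}.

Definition semialg_set (C : countType) (val : C -> R) (n : nat)
    (S : semialg C) : set (euclid R n) :=
  [set x : n.-tuple R |
     has (all (fun a => if a.1 then 0 < mpol_eval val a.2 x
                        else 0 <= mpol_eval val a.2 x)) S].

Definition algfun_at (n : nat) (f : algfun) (x : n.-tuple R) (y : R[i]) : Prop :=
  mpol_eval calg_val f.1 [tuple of rcons (map (fun t => t%:C) x) y] = 0 /\
  semialg_set ralg_val f.2
    [tuple of rcons (rcons x (complex.Re y)) (complex.Im y)].

Definition algfun_ok (n : nat) (D : set (euclid R n)) (f : algfun) : Prop :=
  [/\ coeffs_ok calg_ok f.1, semialg_ok ralg_ok f.2,
      mpoly_of n.+1 calg_val f.1 != 0
    & forall x, D x -> exists! y, algfun_at f x y].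

Definition algfun_val (n : nat) (f : algfun) (x : n.-tuple R) : R[i] :=
  xget 0 [set y | algfun_at f x y].

End Semantics.

(** * Periods, exponential periods and period-like integrals *)

(* (n, P, Q, sigma) describes the integral of P/Q over sigma in R^n. *)
Definition rat_integral : countType :=
  (nat * mpol rat * mpol rat * semialg rat)%type.

(* real part, imaginary part *)
Definition period : countType := (rat_integral * rat_integral)%type.

(* (n, f, g, sigma) describes the integral of e^{-f} g over sigma in R^n. *)
Definition exp_period : countType :=
  (nat * algfun * algfun * semialg ralg)%type.

(* (n, f, [:: (h_1, a_1); ..], sigma) describes the integral of
   e^{-f} (h_1^a_1 + ..) over sigma in R^n. *)
Definition period_like : countType :=
  (nat * algfun * seq (algfun * calg) * semialg ralg)%type.

Definition integral_desc : countType := (period + exp_period + period_like)%type.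

Section Integrals.
Variable R : realType.

Definition abs_cvg (n : nat) (D : set (euclid R n)) (F : euclid R n -> R) : Prop :=
  (lebesgue_n R n).-integrable D (EFin \o F).

Definition rint (n : nat) (D : set (euclid R n)) (F : euclid R n -> R) : R :=
  Rintegral (lebesgue_n R n) D F.

Definition cabs_cvg (n : nat) (D : set (euclid R n)) (F : euclid R n -> R[i]) : Prop :=
  abs_cvg D (fun x => complex.Re (F x)) /\ abs_cvg D (fun x => complex.Im (F x)).

Definition cint (n : nat) (D : set (euclid R n)) (F : euclid R n -> R[i]) : R[i] :=
  rint D (fun x => complex.Re (F x)) +i* rint D (fun x => complex.Im (F x)).

Definition rat_integrand (n : nat) (P Q : mpol rat) (x : n.-tuple R) : R :=
  mpol_eval ratr P x / mpol_eval ratr Q x.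

Definition rat_integral_ok (I : rat_integral) : Prop :=
  let: (n, P, Q, A) := I in
  mpoly_of n (ratr : rat -> R) Q != 0 /\
  abs_cvg (@semialg_set R _ ratr n A) (rat_integrand P Q).

Definition rat_integral_val (I : rat_integral) : R :=
  let: (n, P, Q, A) := I in
  rint (@semialg_set R _ ratr n A) (rat_integrand P Q).

Definition period_ok (I : period) : Prop :=
  rat_integral_ok I.1 /\ rat_integral_ok I.2.

Definition period_val (I : period) : R[i] :=
  rat_integral_val I.1 +i* rat_integral_val I.2.

Definition exp_integrand (n : nat) (f g : algfun) (x : n.-tuple R) : R[i] :=
  cexp (- algfun_val f x) * algfun_val g x.

Definition exp_period_ok (I : exp_period) : Prop :=
  let: (n, f, g, A) := I in
  let D := @semialg_set R _ (@ralg_val R) n A in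
  [/\ semialg_ok (@ralg_ok R) A, algfun_ok D f, algfun_ok D g
    & cabs_cvg D (exp_integrand f g)].

Definition exp_period_val (I : exp_period) : R[i] :=
  let: (n, f, g, A) := I in
  cint (@semialg_set R _ (@ralg_val R) n A) (exp_integrand f g).

Definition like_integrand (n : nat) (f : algfun) (g : seq (algfun * calg))
    (x : n.-tuple R) : R[i] :=
  cexp (- algfun_val f x) *
  \sum_(t <- g) cpow (algfun_val t.1 x) (calg_val R t.2).

Definition period_like_ok (I : period_like) : Prop :=
  let: (n, f, g, A) := I in
  let D := @semialg_set R _ (@ralg_val R) n A in
  [/\ semialg_ok (@ralg_ok R) A, algfun_ok D f,
      {in g, forall t, algfun_ok D t.1 /\ calg_ok R t.2}
    & cabs_cvg D (like_integrand f g)].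

Definition period_like_val (I : period_like) : R[i] :=
  let: (n, f, g, A) := I in
  cint (@semialg_set R _ (@ralg_val R) n A) (like_integrand f g).

Definition integral_ok (I : integral_desc) : Prop :=
  match I with
  | inl (inl p) => period_ok p
  | inl (inr e) => exp_period_ok e
  | inr l => period_like_ok l
  end.

Definition integral_val (I : integral_desc) : R[i] :=
  match I with
  | inl (inl p) => period_val p
  | inl (inr e) => exp_period_val e
  | inr l => period_like_val l
  end.

Definition integral_zero (I : integral_desc) : Prop := integral_val I = 0.

End Integrals.

(* Main.v *)
Require Import Defs.
From mathcomp Require Import all_boot all_order all_algebra.
From mathcomp Require Import all_classical all_reals all_analysis.

(* A minimal solution of a second-order recurrence, when it exists, is unique up to scaling, so a
   solution v is minimal iff it is proportional to a known minimal solution m, that is iff the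
   Casoratian v 1 * m 0 - v 0 * m 1 vanishes.  With affine coefficients, either the real solutions
   oscillate and none is minimal, or a minimal solution is given explicitly by moments
   m n = \int_0^oo x(y)^n w(y) dy, where the kernel is a product of powers (two distinct
   characteristic roots), has an exponential factor (double root, or degenerate leading
   coefficients), or is of Bessel type.  The Casoratian is then a single integral with rational
   exponents, which unfolds into a two- or three-dimensional integral of the required shape:
   (1 + y)^(-s) is the integral of z^(s-1) over the region under a rational curve, and a sign is
   encoded by the branch of an algebraic function whose exponential integrates to a constant.
   The convergence conditions on the exponents are met after finitely many of the transformations:
   index shift, exchange of the outer coefficients, and v |-> A(S) v for the leading
   characteristic polynomial A.  All of them act on integer parameters, hence computably. *)

(** Two obstacles shape the construction. For distinct roots al, be of A the integral has an
    exponent at each singular point: e0 = b1/a1 at 0, ea at al, eb at be, with sum b3/a3;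
    convergence needs e0 and ea positive. Index shifts raise e0 but leave ea alone. Passing to A(S)
    v adds 1 to ea and to eb, yet can be undone on subdominant solutions only while eb stays
    nonzero; exchanging the outer coefficients turns ea into 1 - eb. So A(S) is iterated if eb > 0,
    and otherwise a single exchange suffices. The other obstacle is the shape of a period-like
    integrand, e^(-f) times a sum of powers, whereas the Casoratian yields a factor W of changing
    sign times a power with irrational exponent. W is moved into the exponential by 6 W = \int_0^oo
    exp(-(u/W)^(1/3)) du. A cube root is used because for W < 0 it has a branch of argument pi/3,
    with positive real part, while u/W and its square root would not decay. Oscillation is proved
    without asymptotics: a quadratic form in two consecutive values serves as an energy and is
    compared with the Casoratian. *)

Module Recursive.
Require Import Defs.
From mathcomp Require Import all_boot all_order all_algebra.
From mathcomp Require Import all_classical all_reals all_analysis.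
From mathcomp Require Import zify ring lra.
Set Implicit Arguments.
Unset Strict Implicit.
Unset Printing Implicit Defensive.
Import Order.TTheory GRing.Theory Num.Theory.

(** * Total recursive functions *)

Definition recn n (f : seq nat -> nat) : Prop :=
  exists p, forall xs, size xs = n -> computes p xs (f xs).

Definition computes_all (xs : seq nat) :=
  fix F (gs : seq murec) (ys : seq nat) {struct gs} : Prop :=
    match gs, ys with
    | [::], [::] => True
    | g :: gs', z :: ys' => computes g xs z /\ F gs' ys'
    | _, _ => False
    end.

Definition all_recn n (gs : seq (seq nat -> nat)) : Prop :=
  foldr (fun g P => recn n g /\ P) True gs.

Lemma eq_recn n f g : (forall xs, size xs = n -> f xs = g xs) ->
  recn n f -> recn n g.
Proof. by move=> fg [p Hp]; exists p => xs Hxs; rewrite -fg //; exact: Hp. Qed.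

Lemma rec_proj n i : recn n (fun xs => nth 0%N xs i).
Proof. by exists (Mproj i). Qed.

Lemma rec_comp m n f gs : recn m f -> size gs = m -> all_recn n gs ->
  recn n (fun xs => f [seq g xs | g : seq nat -> nat <- gs]).
Proof.
move=> [pf Hf] sgs Hgs.
have [ps Hps] : exists ps, forall xs, size xs = n ->
    computes_all xs ps [seq g xs | g : seq nat -> nat <- gs].
  elim: gs Hgs {sgs} => [|g gs IH] /=; first by exists [::].
  move=> [[p Hp] /IH[ps Hps]]; exists (p :: ps) => xs Hxs /=.
  by split; [exact: Hp|exact: Hps].
exists (Mcomp pf ps) => xs Hxs.
by exists [seq g xs | g : seq nat -> nat <- gs];
  [exact: Hps | apply: Hf; rewrite size_map].
Qed.

Lemma rec_un (h : nat -> nat) : recn 1 (fun xs => h (nth 0%N xs 0)) ->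
  forall n f, recn n f -> recn n (fun xs => h (f xs)).
Proof. by move=> Hh n f Hf; apply: (rec_comp (gs := [:: f]) Hh). Qed.

Lemma rec_bin (h : nat -> nat -> nat) :
  recn 2 (fun xs => h (nth 0%N xs 0) (nth 0%N xs 1)) ->
  forall n f g, recn n f -> recn n g -> recn n (fun xs => h (f xs) (g xs)).
Proof. by move=> Hh n f g Hf Hg; apply: (rec_comp (gs := [:: f; g]) Hh). Qed.

Lemma rec_succ n f : recn n f -> recn n (fun xs => (f xs).+1).
Proof. by apply: (rec_un (h := succn)); exists Msucc. Qed.

Lemma rec_const n c : recn n (fun=> c).
Proof. by elim: c => [|c IH]; [exists Mzero | exact: rec_succ IH]. Qed.

(** [Mprec] recurses on the first argument. Composing it with [k] and n projections allows any
    recursive bound and keeps all of [xs] visible to the step function. *)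
Lemma rec_prec n k f g : recn n k -> recn n f -> recn n.+2 g ->
  recn n (fun xs =>
    nat_rect (fun=> nat) (f xs) (fun i a => g [:: i, a & xs]) (k xs)).
Proof.
move=> Hk [pf Hf] [pg Hg].
pose F xs := nat_rect (fun=> nat) (f (behead xs))
  (fun i a => g [:: i, a & behead xs]) (nth 0%N xs 0).
have HF : recn n.+1 F.
  exists (Mprec pf pg) => -[//|x xs] [sxs].
  exists (fun m => nat_rect (fun=> nat) (f xs) (fun i a => g [:: i, a & xs]) m).
  split=> [|i _|//]; first exact: Hf.
  by apply: Hg => /=; rewrite sxs.
have Hp : all_recn n [seq (fun xs => nth 0%N xs i) | i <- iota 0 n].
  by elim: (iota 0 n) => //= i s IH; split=> //; exact: rec_proj.
have := rec_comp (gs := k :: [seq (fun xs => nth 0%N xs i) | i <- iota 0 n]) HF.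
rewrite /= size_map size_iota => /(_ n erefl (conj Hk Hp)).
apply: eq_recn => xs sxs; rewrite /F /=.
suff -> : [seq g0 xs | g0 : seq nat -> nat <-
    [seq (fun xs => nth 0%N xs i) | i <- iota 0 n]] = xs by [].
by rewrite -map_comp /comp -[RHS](mkseq_nth 0%N xs) sxs.
Qed.

Lemma rec_mu n f M : recn n.+1 f ->
  (forall xs, size xs = n -> f (M xs :: xs) = 0%N /\
     forall z, (z < M xs)%N -> f (z :: xs) <> 0%N) ->
  recn n M.
Proof.
move=> [p Hp] HM; exists (Mmin p) => xs sxs; have [M0 Mz] := HM _ sxs; split.
  by rewrite -M0; apply: Hp; rewrite /= sxs.
move=> z /Mz /eqP; rewrite -lt0n => fz; exists (f (z :: xs)).-1.
by rewrite prednK //; apply: Hp; rewrite /= sxs.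
Qed.

Lemma rec_add n f g : recn n f -> recn n g -> recn n (fun xs => f xs + g xs)%N.
Proof.
apply: (rec_bin (h := addn)); apply: (eq_recn (f := fun xs =>
  nat_rect (fun=> nat) (nth 0%N xs 1) (fun i a => (nth 0%N [:: i, a & xs] 1).+1)
    (nth 0%N xs 0))) => [xs _|].
  by elim: (nth _ xs 0) => //= k ->; rewrite addSn.
exact: (rec_prec (rec_proj _ _) (rec_proj _ _) (rec_succ (rec_proj _ _))).
Qed.

Lemma rec_mul n f g : recn n f -> recn n g -> recn n (fun xs => f xs * g xs)%N.
Proof.
apply: (rec_bin (h := muln)); apply: (eq_recn (f := fun xs =>
  nat_rect (fun=> nat) 0%N
    (fun i a => nth 0%N [:: i, a & xs] 3 + nth 0%N [:: i, a & xs] 1)%N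
    (nth 0%N xs 0))) => [xs _|].
  by elim: (nth _ xs 0) => //= k ->; rewrite mulSn.
exact: (rec_prec (rec_proj _ _) (rec_const _ _)
  (rec_add (rec_proj _ _) (rec_proj _ _))).
Qed.

Lemma rec_exp n f g : recn n f -> recn n g -> recn n (fun xs => f xs ^ g xs)%N.
Proof.
apply: (rec_bin (h := expn)); apply: (eq_recn (f := fun xs =>
  nat_rect (fun=> nat) 1%N
    (fun i a => nth 0%N [:: i, a & xs] 2 * nth 0%N [:: i, a & xs] 1)%N
    (nth 0%N xs 1))) => [xs _|].
  by elim: (nth _ xs 1) => //= k ->; rewrite expnS.
exact: (rec_prec (rec_proj _ _) (rec_const _ _)
  (rec_mul (rec_proj _ _) (rec_proj _ _))).
Qed.

Lemma rec_pred n f : recn n f -> recn n (fun xs => (f xs).-1)%N.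
Proof.
apply: (rec_un (h := predn)); apply: (eq_recn (f := fun xs =>
  nat_rect (fun=> nat) 0%N (fun i a => nth 0%N [:: i, a & xs] 0)
    (nth 0%N xs 0))) => [xs _|].
  by case: (nth _ xs 0).
exact: (rec_prec (rec_proj _ _) (rec_const _ _) (rec_proj _ _)).
Qed.

Lemma rec_sub n f g : recn n f -> recn n g -> recn n (fun xs => f xs - g xs)%N.
Proof.
apply: (rec_bin (h := subn)); apply: (eq_recn (f := fun xs =>
  nat_rect (fun=> nat) (nth 0%N xs 0)
    (fun i a => (nth 0%N [:: i, a & xs] 1).-1) (nth 0%N xs 1))) => [xs _|].
  by elim: (nth _ xs 1) => [|k /= ->]; rewrite ?subn0 ?subnS.
exact: (rec_prec (rec_proj _ _) (rec_proj _ _) (rec_pred (rec_proj _ _))).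
Qed.

Definition recB n (b : seq nat -> bool) := recn n (fun xs => b xs : nat).

Lemma rec_leq n f g : recn n f -> recn n g -> recB n (fun xs => f xs <= g xs)%N.
Proof.
move=> Hf Hg; apply: eq_recn (rec_sub (rec_const n 1) (rec_sub Hf Hg)) => xs _.
lia.
Qed.

Lemma rec_eqn n f g : recn n f -> recn n g -> recB n (fun xs => f xs == g xs)%N.
Proof.
move=> Hf Hg; apply: eq_recn (rec_sub (rec_const n 1)
  (rec_add (rec_sub Hf Hg) (rec_sub Hg Hf))) => xs _; lia.
Qed.

Lemma recB_neg n b : recB n b -> recB n (fun xs => ~~ b xs).
Proof. by move=> Hb; apply: eq_recn (rec_sub (rec_const n 1) Hb) => xs _; case: (b xs). Qed.

Lemma recB_and n b c : recB n b -> recB n c -> recB n (fun xs => b xs && c xs).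
Proof. by move=> Hb Hc; apply: eq_recn (rec_mul Hb Hc) => xs _; case: (b xs); case: (c xs). Qed.

Lemma recB_or n b c : recB n b -> recB n c -> recB n (fun xs => b xs || c xs).
Proof.
move=> Hb Hc; apply: eq_recn (recB_neg (recB_and (recB_neg Hb) (recB_neg Hc))).
by move=> xs _; case: (b xs); case: (c xs).
Qed.

Lemma rec_if n b f g : recB n b -> recn n f -> recn n g ->
  recn n (fun xs => if b xs then f xs else g xs).
Proof.
move=> Hb Hf Hg.
apply: eq_recn (rec_add (rec_mul Hb Hf) (rec_mul (recB_neg Hb) Hg)) => xs _.
by case: (b xs); rewrite /= ?mul1n ?mul0n ?addn0.
Qed.

Lemma rec_search n (P : seq nat -> bool) M : recB n.+1 P ->
  (forall xs, size xs = n -> P (M xs :: xs) /\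
     forall z, (z < M xs)%N -> ~~ P (z :: xs)) -> recn n M.
Proof.
move=> HP HM; apply: (rec_mu (recB_neg HP)) => xs /HM[P0 Pz]; rewrite P0.
by split=> // z /Pz ->.
Qed.

Lemma rec_div n f g : recn n f -> recn n g -> recn n (fun xs => f xs %/ g xs)%N.
Proof.
(* The quotient is the least z with a < (z + 1) d; for d = 0 the search stops at 0, the value of
   [a %/ 0]. *)
apply: (rec_bin (h := divn)); apply: (@rec_search _ (fun xs =>
  (nth 0 xs 2 == 0) || ((nth 0 xs 1).+1 <= (nth 0 xs 0).+1 * nth 0 xs 2))%N).
  apply: recB_or; first exact: (rec_eqn (rec_proj _ _) (rec_const _ _)).
  apply: rec_leq; first exact: (rec_succ (rec_proj _ _)).
  exact: (rec_mul (rec_succ (rec_proj _ _)) (rec_proj _ _)).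
move=> xs _ /=; set a := nth 0%N xs 0; set d := nth 0%N xs 1.
have [->|d0] := posnP d; first by rewrite divn0.
split=> [|z zd]; first by rewrite ltn_ceil // orbT.
rewrite /= -leqNgt; apply: leq_trans (leq_divM a d).
by rewrite leq_mul2r zd orbT.
Qed.

Lemma rec_mod n f g : recn n f -> recn n g -> recn n (fun xs => f xs %% g xs)%N.
Proof.
move=> Hf Hg; apply: eq_recn (rec_sub Hf (rec_mul (rec_div Hf Hg) Hg)) => xs _.
by rewrite {1}(divn_eq (f xs) (g xs)) addnC addnK.
Qed.

Lemma rec_dvd n f g : recn n f -> recn n g -> recB n (fun xs => f xs %| g xs)%N.
Proof. by move=> Hf Hg; apply: rec_eqn (rec_mod Hg Hf) (rec_const _ _). Qed.

(** The least positive z such that d divides z a is d / gcd(a, d), so a search replaces Euclid's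
    algorithm. This is the reduced denominator of a / d, which the code of a rational requires. *)
Lemma rec_div_gcd n f g : recn n f -> recn n g ->
  recn n (fun xs => g xs %/ gcdn (f xs) (g xs))%N.
Proof.
apply: (rec_bin (h := fun a d => d %/ gcdn a d)%N).
apply: (@rec_search _ (fun xs => (nth 0 xs 2 == 0) ||
  ((1 <= nth 0 xs 0) && (nth 0 xs 2 %| nth 0 xs 0 * nth 0 xs 1)))%N).
  apply: recB_or; first exact: (rec_eqn (rec_proj _ _) (rec_const _ _)).
  apply: recB_and; first exact: (rec_leq (rec_const _ _) (rec_proj _ _)).
  exact: (rec_dvd (rec_proj _ _) (rec_mul (rec_proj _ _) (rec_proj _ _))).
move=> xs _ /=; set a := nth 0%N xs 0; set d := nth 0%N xs 1.
have [->|d0] := posnP d; first by rewrite div0n.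
have g0 : (0 < gcdn a d)%N by rewrite gcdn_gt0 d0 orbT.
have [Ha Hd] := (dvdn_gcdl a d, dvdn_gcdr a d).
rewrite /=; split.
  rewrite divn_gt0 // dvdn_leq //= mulnC muln_divCA_gcd dvdn_mulr //.
move=> z; rewrite ltnNge; apply: contra => /andP[z0 dz].
apply: dvdn_leq => //.
have : (d %/ gcdn a d %| z * (a %/ gcdn a d))%N.
  by rewrite -(dvdn_pmul2r g0) divnK // -mulnA divnK.
rewrite Gauss_dvdl // coprime_sym /coprime.
by rewrite -(eqn_pmul2r g0) mul1n muln_gcdl !divnK.
Qed.

(** * Codes of lists, numbers, pairs, .. *)

(** The code of [x :: s] is 2^x (2 c + 1) with c the code of [s]: the head is the 2-adic valuation
    and the tail is read off the odd part. On 0, the code of the empty list, head and tail are both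
    0. *)
Definition hdc c := if c == 0%N then 0%N else logn 2 c.
Definition tlc c := ((c %/ 2 ^ hdc c) %/ 2)%N.

Lemma hdc_code x s : hdc (CodeSeq.code (x :: s)) = x.
Proof.
rewrite /hdc /= muln_eq0 -leqn0 leqNgt expn_gt0 /= lognM ?expn_gt0 //.
by rewrite pfactorK // lognE /= dvdn2 /= odd_double /= addn0.
Qed.

Lemma tlc_code x s : tlc (CodeSeq.code (x :: s)) = CodeSeq.code s.
Proof.
by rewrite /tlc hdc_code /= mulKn ?expn_gt0 // divn2 /= uphalf_double.
Qed.

Lemma rec_hdc n f : recn n f -> recn n (fun xs => hdc (f xs)).
Proof.
apply: (rec_un (h := hdc)); apply: (@rec_search _ (fun xs =>
  (nth 0 xs 1 == 0) || ~~ (2 ^ (nth 0 xs 0).+1 %| nth 0 xs 1))%N).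
  apply: recB_or; first exact: (rec_eqn (rec_proj _ _) (rec_const _ _)).
  apply/recB_neg/rec_dvd; last exact: rec_proj.
  exact: (rec_exp (rec_const _ _) (rec_succ (rec_proj _ _))).
move=> xs _ /=; rewrite /hdc; case: eqP => [->//|/eqP].
rewrite -lt0n => c0; rewrite pfactor_dvdn // ltnn /=; split=> // z zc.
by rewrite negbK pfactor_dvdn.
Qed.

Lemma rec_tlc n f : recn n f -> recn n (fun xs => tlc (f xs)).
Proof.
move=> Hf; apply: rec_div (rec_const _ _).
by apply: rec_div Hf (rec_exp (rec_const _ _) (rec_hdc Hf)).
Qed.

Lemma rec_code_cons n f g : recn n f -> recn n (fun xs => CodeSeq.code (g xs)) ->
  recn n (fun xs => CodeSeq.code (f xs :: g xs)).
Proof.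
move=> Hf Hg; apply: rec_mul; first exact: rec_exp (rec_const _ _) Hf.
apply: rec_succ; apply: eq_recn (rec_add Hg Hg) => xs _.
by rewrite addnn.
Qed.

Lemma rec_code_nil n : recn n (fun xs => CodeSeq.code [::]).
Proof. exact: rec_const. Qed.

Definition recT n (T : countType) (F : seq nat -> T) := recn n (fun xs => pickle (F xs)).
Arguments recT n {T} F.

Lemma recT_const n (T : countType) (c : T) : recT n (fun=> c).
Proof. exact: rec_const. Qed.

Lemma recT_pair n (T U : countType) (F : seq nat -> T) (G : seq nat -> U) :
  recT n F -> recT n G -> recT n (fun xs => (F xs, G xs)).
Proof. by move=> HF HG; exact: rec_code_cons HF (rec_code_cons HG (rec_code_nil n)). Qed.

Lemma recT_cons n (T : countType) (F : seq nat -> T) (G : seq nat -> seq T) :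
  recT n F -> recT n G -> recT n (fun xs => F xs :: G xs).
Proof. by move=> HF HG; exact: rec_code_cons HF HG. Qed.

(** A sum is coded as a pair of options, and an option as a list of length at most one, so that 0
    codes the absent component. *)
Lemma recT_inl n (T U : countType) (F : seq nat -> T) : recT n F ->
  recT n (fun xs => inl (F xs) : T + U).
Proof.
move=> HF; apply: rec_code_cons; first exact: rec_code_cons HF (rec_code_nil n).
exact: rec_code_cons (rec_const n 0) (rec_code_nil n).
Qed.

Lemma recT_inr n (T U : countType) (F : seq nat -> U) : recT n F ->
  recT n (fun xs => inr (F xs) : T + U).
Proof.
move=> HF; apply: (rec_code_cons (rec_const n 0)).
exact: rec_code_cons (rec_code_cons HF (rec_code_nil n)) (rec_code_nil n).
Qed.

Lemma recT_if n (T : countType) b (F G : seq nat -> T) : recB n b ->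
  recT n F -> recT n G -> recT n (fun xs => if b xs then F xs else G xs).
Proof.
move=> Hb HF HG; apply: eq_recn (rec_if Hb HF HG) => xs _; by case: (b xs).
Qed.

(** * Integer-valued recursive functions *)

Local Open Scope ring_scope.

(** A difference of two natural functions, which makes ring operations free of case distinctions on
    signs. *)
Definition recZ n (F : seq nat -> int) : Prop :=
  exists g h, [/\ recn n g, recn n h &
    forall xs, size xs = n -> F xs = (g xs)%:Z - (h xs)%:Z].

Lemma recZ_nat n f : recn n f -> recZ n (fun xs => (f xs)%:Z).
Proof. by move=> Hf; exists f, (fun=> 0%N); split=> // [|xs _]; [exact: rec_const|rewrite subr0]. Qed.

Lemma recZ_opp n F : recZ n F -> recZ n (fun xs => - F xs).
Proof. by move=> [g [h [Hg Hh e]]]; exists h, g; split=> // xs sxs; rewrite e // opprB. Qed.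

Lemma recZ_const n c : recZ n (fun=> c).
Proof.
case: c => c; first exact: recZ_nat (rec_const n c).
exact: recZ_opp (recZ_nat (rec_const n c.+1)).
Qed.

Lemma recZ_add n F G : recZ n F -> recZ n G -> recZ n (fun xs => F xs + G xs).
Proof.
move=> [g [h [Hg Hh e]]] [g' [h' [Hg' Hh' e']]].
exists (fun xs => (g xs + g' xs)%N), (fun xs => (h xs + h' xs)%N); split.
- exact: rec_add.
- exact: rec_add.
- by move=> xs sxs; rewrite e // e' // !PoszD; ring.
Qed.

Lemma recZ_mul n F G : recZ n F -> recZ n G -> recZ n (fun xs => F xs * G xs).
Proof.
move=> [g [h [Hg Hh e]]] [g' [h' [Hg' Hh' e']]].
exists (fun xs => (g xs * g' xs + h xs * h' xs)%N),
       (fun xs => (g xs * h' xs + h xs * g' xs)%N); split.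
- by apply: rec_add; apply: rec_mul.
- by apply: rec_add; apply: rec_mul.
- by move=> xs sxs; rewrite e // e' // !PoszD !PoszM; ring.
Qed.

Lemma recZ_if n b F G : recB n b -> recZ n F -> recZ n G ->
  recZ n (fun xs => if b xs then F xs else G xs).
Proof.
move=> Hb [g [h [Hg Hh e]]] [g' [h' [Hg' Hh' e']]].
exists (fun xs => if b xs then g xs else g' xs),
       (fun xs => if b xs then h xs else h' xs); split; try exact: rec_if.
by move=> xs sxs; case: (b xs); rewrite ?e ?e'.
Qed.

Lemma recB_le n F G : recZ n F -> recZ n G -> recB n (fun xs => F xs <= G xs).
Proof.
move=> [g [h [Hg Hh e]]] [g' [h' [Hg' Hh' e']]].
apply: eq_recn (rec_leq (rec_add Hg Hh') (rec_add Hg' Hh)) => xs sxs.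
by rewrite e // e' //; congr nat_of_bool; lia.
Qed.

Lemma recB_lt n F G : recZ n F -> recZ n G -> recB n (fun xs => F xs < G xs).
Proof.
move=> HF HG; apply: eq_recn (recB_neg (recB_le HG HF)) => xs _.
by rewrite ltNge.
Qed.

Lemma recB_eq n F G : recZ n F -> recZ n G -> recB n (fun xs => F xs == G xs).
Proof.
move=> HF HG; apply: eq_recn (recB_and (recB_le HF HG) (recB_le HG HF)) => xs _.
by rewrite eq_le.
Qed.

Lemma rec_abs n F : recZ n F -> recn n (fun xs => `|F xs|%N).
Proof.
move=> [g [h [Hg Hh e]]].
apply: eq_recn (rec_add (rec_sub Hg Hh) (rec_sub Hh Hg)) => xs sxs.
rewrite e //; lia.
Qed.

Lemma recT_int n F : recZ n F -> recT n F.
Proof.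
move=> HF; have Ha := rec_abs HF; have H0 := rec_code_nil n.
apply: eq_recn (rec_if (recB_le (recZ_const n 0) HF)
  (rec_code_cons (rec_code_cons Ha H0) (rec_code_cons (rec_const n 0) H0))
  (rec_code_cons (rec_const n 0)
    (rec_code_cons (rec_code_cons (rec_pred Ha) H0) H0))) => xs _.
by case: (F xs).
Qed.

Definition ratz (z : int) (d : nat) : rat := z%:Q / d%:Q.

(** A rational is coded by its reduced fraction, so numerator and denominator must really be
    computed. For d = 0 the value is 0, coded as 0/1. *)
Lemma recT_ratz n F f : recZ n F -> recn n f -> recT n (fun xs => ratz (F xs) (f xs)).
Proof.
move=> HF Hf; have Ha := rec_abs HF; have Hg := rec_div_gcd Ha Hf.
have Hd := rec_if (rec_eqn Hf (rec_const n 0)) (rec_const n 1) Hg.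
have Hn := rec_div (rec_mul Hg Ha) Hf.
have HN := recZ_if (recB_le (recZ_const n 0) HF) (recZ_nat Hn) (recZ_opp (recZ_nat Hn)).
apply: eq_recn (recT_pair (recT_int HN) (recT_int (recZ_nat Hd))) => xs _.
set d := f xs; set z := F xs.
have -> (q : rat) : pickle q = pickle (numq q, denq q).
  by rewrite -[LHS]/(pickle (valq q)) [valq q]surjective_pairing.
have -> : ratz z d = fracq (z, d%:Z) by rewrite fracqE.
rewrite num_fracq den_fracq /=.
have [->|d0] := posnP d.
  by rewrite /= ?mul0n ?muln0 ?div0n ?divn0 /= ?oppr0; case: ifP.
have -> : (d%:Z != 0) = true by lia.
rewrite mulnC muln_divCA_gcd mulKn //.
by rewrite ltNge; case: (0 <= z); rewrite ?expr0z ?mul1r // expr1z mulN1r.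
Qed.

(** A polynomial is coded by its coefficient list, to which [Poly] adds nothing when the last entry
    is nonzero. *)
Lemma recT_poly n (F : seq nat -> seq rat) : recT n F ->
  (forall xs, last 1 (F xs) != 0) -> recT n (fun xs => Poly (F xs)).
Proof.
move=> HF F0; apply: eq_recn HF => xs _; rewrite -[RHS]/(pickle (polyseq _)).
by rewrite (PolyK (F0 xs)).
Qed.

End Recursive.


Module LinearRecurrences.
Require Import Defs.
Import Recursive.
From mathcomp Require Import all_boot all_order all_algebra.
From mathcomp Require Import all_classical all_reals all_analysis.
From mathcomp Require Import zify ring lra.
Set Implicit Arguments.
Unset Strict Implicit.
Unset Printing Implicit Defensive.
Import Order.TTheory GRing.Theory Num.Theory numFieldNormedType.Exports.
Local Open Scope ring_scope.

(** * Second-order recurrences and minimal solutions *)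

Section Recurrences.
Variable R : realType.
Implicit Types g h u v w m : nat -> R.

Definition sol g3 g2 g1 u :=
  forall n, g3 n * u n.+2 = g2 n * u n.+1 + g1 n * u n.

(** This is v n / w n -> 0 together with the eventual nonvanishing of w, in a form free of
    quotients. *)
Definition dominated v w := forall e : R, 0 < e ->
  exists N, forall n, (N <= n)%N -> `|v n| <= e * `|w n| /\ w n != 0.

Definition mini g3 g2 g1 v :=
  (exists n, v n != 0) /\ exists w, sol g3 g2 g1 w /\ dominated v w.

Definition cas v w n := v n.+1 * w n - v n * w n.+1.

(** Summing the increments bounds x n - x N from below by c times a piece of the harmonic series.
    This divergence replaces asymptotic expansions wherever no exponential gap separates the
    solutions. *)
Lemma harmonic_growth (x : nat -> R) (c : R) N : 0 < c ->
  (forall n, (N <= n)%N -> x n + c / n.+1%:R <= x n.+1) ->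
  forall M : R, exists K, forall n, (K <= n)%N -> M <= x n.
Proof.
move=> c0 Hx M; apply: contrapT => HM.
have mono i k : (N <= i)%N -> x i <= x (i + k)%N.
  move=> Ni; elim: k => [|k IH]; first by rewrite addn0.
  apply: le_trans IH _; rewrite addnS.
  have Nk : (N <= i + k)%N by lia.
  apply: le_trans (Hx _ Nk); rewrite lerDl divr_ge0 ?ler0n //; exact: ltW.
have bd n : (N <= n)%N -> x n <= M.
  move=> Nn; rewrite leNgt; apply/negP => Mx; apply: HM; exists n => k nk.
  by apply: le_trans (ltW Mx) _; rewrite -(subnKC nk); exact: mono.
apply: (@dvg_harmonic R); apply: nondecreasing_is_cvgn.
  apply/nondecreasing_seqP => n; rewrite /series /= big_nat_recr //= lerDl.
  exact: harmonic_ge0.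
exists (series (@harmonic R) N + (M - x N) / c) => _ [n _ <-].
have [nN|Nn] := leqP n N.
  have -> : series (@harmonic R) N =
      series (@harmonic R) n + \sum_(n <= i < N) harmonic i.
    by rewrite /series /= -(big_cat_nat (leq0n n) nN).
  rewrite -addrA lerDl addr_ge0 //.
    by apply: sumr_ge0 => i _; exact: harmonic_ge0.
  by rewrite divr_ge0 ?(ltW c0) // subr_ge0 bd.
have -> : series (@harmonic R) n =
    series (@harmonic R) N + \sum_(N <= i < n) harmonic i.
  by rewrite /series /= -(big_cat_nat (leq0n N) (ltnW Nn)).
rewrite lerD2l ler_pdivlMr //.
suff: x N + (\sum_(N <= i < n) harmonic i) * c <= x n.
  by move=> H; rewrite lerBrDl; apply: le_trans H (bd _ (ltnW Nn)).
have -> : n = (N + (n - N))%N by lia.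
elim: (n - N)%N => [|k IH]; first by rewrite addn0 big_geq // mul0r addr0.
rewrite addnS big_nat_recr /=; last lia.
apply: le_trans (Hx _ (leq_addr _ _)).
by rewrite mulrDl addrA /harmonic [_^-1 * c]mulrC lerD2r.
Qed.

Lemma affine_ev (a b : R) : 0 < a -> exists N, forall n, (N <= n)%N -> 0 < a * n%:R + b.
Proof.
move=> a0; exists (Num.truncn (`|b| / a)).+1 => n Hn.
have : `|b| / a < n%:R.
  by apply: lt_le_trans (truncnS_gt _) _; rewrite ler_nat.
rewrite ltr_pdivrMr // => H.
have := ler_norm (- b); rewrite normrN => H2.
by rewrite mulrC -ltrBlDr sub0r; apply: le_lt_trans H2 H.
Qed.

Section Fixed.
Variables g3 g2 g1 : nat -> R.
Hypothesis g3n0 : forall n, g3 n != 0.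
Hypothesis g1n0 : forall n, g1 n != 0.

Lemma solE u : sol g3 g2 g1 u ->
  forall n, u n.+2 = g2 n / g3 n * u n.+1 + g1 n / g3 n * u n.
Proof. by move=> Hu n; apply: (mulfI (g3n0 n)); rewrite Hu; field; exact: g3n0. Qed.

Lemma sol_ex x y : exists u, [/\ sol g3 g2 g1 u, u 0%N = x & u 1%N = y].
Proof.
pose F := fix F n : R * R := if n is k.+1 then
  ((F k).2, (g2 k * (F k).2 + g1 k * (F k).1) / g3 k) else (x, y).
by exists (fun n => (F n).1); split=> // n /=; field; exact: g3n0.
Qed.

Lemma sol_lin a b u v : sol g3 g2 g1 u -> sol g3 g2 g1 v ->
  sol g3 g2 g1 (fun n => a * u n + b * v n).
Proof. by move=> Hu Hv n; rewrite mulrDr ![g3 n * (_ * _)]mulrCA Hu Hv; ring. Qed.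

Lemma sol_eq u v : sol g3 g2 g1 u -> sol g3 g2 g1 v ->
  u 0%N = v 0%N -> u 1%N = v 1%N -> forall n, u n = v n.
Proof.
move=> Hu Hv e0 e1 n; suff: u n = v n /\ u n.+1 = v n.+1 by case.
by elim: n => // n [en en1]; split=> //; rewrite solE // [RHS]solE // en en1.
Qed.

Lemma sol0 u N : sol g3 g2 g1 u -> u N = 0 -> u N.+1 = 0 -> forall n, u n = 0.
Proof.
move=> Hu; elim: N => [|N IH] uN uN1.
  apply: (@sol_eq u (fun=> 0)) => // n; by rewrite !mulr0 addr0.
apply: IH => //; have /eqP := Hu N.
by rewrite uN uN1 !mulr0 add0r eq_sym mulf_eq0 (negbTE (g1n0 N)) => /eqP.
Qed.

Lemma sol_n0 u : sol g3 g2 g1 u -> (exists n, u n != 0) <-> u 0%N != 0 \/ u 1%N != 0.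
Proof.
move=> Hu; split=> [[n]|[?|?]]; [|by exists 0%N|by exists 1%N].
have [u0|] := eqVneq (u 0%N) 0; last by left.
have [u1|] := eqVneq (u 1%N) 0; last by right.
by rewrite (@sol0 u 0) // eqxx.
Qed.

(** The Casoratian of the two basic solutions never vanishes because g1 does not, so Cramer's rule
    solves for data at any N. Dominant solutions are started this way, at an index after which the
    coefficients have settled signs. *)
Lemma sol_ex_at N x y : exists u, [/\ sol g3 g2 g1 u, u N = x & u N.+1 = y].
Proof.
have [e1 [E1 e10 e11]] := sol_ex 1 0; have [e2 [E2 e20 e21]] := sol_ex 0 1.
have d0 k : cas e2 e1 k != 0.
  rewrite /cas; elim: k => [|n IH]; first by rewrite e10 e11 e20 e21; lra.
  rewrite (solE E1) (solE E2).
  rewrite (_ : _ - _ = - (g1 n / g3 n) * (e2 n.+1 * e1 n - e2 n * e1 n.+1)); last by ring.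
  by rewrite mulf_neq0 // oppr_eq0 mulf_neq0 // invr_eq0.
have {}d0 := d0 N; pose d := cas e2 e1 N; rewrite -/d in d0.
exists (fun n => ((x * e2 N.+1 - y * e2 N) / d) * e1 n + ((y * e1 N - x * e1 N.+1) / d) * e2 n).
split; first exact: sol_lin.
- by move: d0; rewrite /d /cas => d0; field.
- by move: d0; rewrite /d /cas => d0; field.
Qed.

Lemma cas_rec v w : sol g3 g2 g1 v -> sol g3 g2 g1 w ->
  forall n, cas v w n.+1 = - (g1 n / g3 n) * cas v w n.
Proof. by move=> Hv Hw n; rewrite /cas (solE Hv) (solE Hw); ring. Qed.

Lemma cas_n0 v w n : sol g3 g2 g1 v -> sol g3 g2 g1 w ->
  (cas v w n != 0) = (cas v w 0 != 0).
Proof.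
move=> Hv Hw; elim: n => // n <-; rewrite cas_rec // mulf_eq0 oppr_eq0.
by rewrite mulf_eq0 invr_eq0 (negbTE (g1n0 n)) (negbTE (g3n0 n)).
Qed.

Lemma sol_span v m w : sol g3 g2 g1 v -> sol g3 g2 g1 m -> sol g3 g2 g1 w ->
  cas v m 0 != 0 -> exists a b, forall n, w n = a * v n + b * m n.
Proof.
move=> Hv Hm Hw c0; pose d := cas v m 0.
exists ((w 1%N * m 0%N - w 0%N * m 1%N) / d), ((w 0%N * v 1%N - w 1%N * v 0%N) / d).
apply: sol_eq => //; first exact: sol_lin.
- by move: c0; rewrite /d /cas => c0; field.
- by move: c0; rewrite /d /cas => c0; field.
Qed.

(** The dominating solution is w = a v + b m; in |v| <= e1 |w| the term a v is absorbed on the left,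
    which leaves v = o(m). *)
Lemma mini_o v m : sol g3 g2 g1 v -> sol g3 g2 g1 m -> cas v m 0 != 0 ->
  mini g3 g2 g1 v -> forall e : R, 0 < e ->
  exists N, forall n, (N <= n)%N -> `|v n| <= e * `|m n|.
Proof.
move=> Hv Hm c0 [_ [w [Hw dvw]]] e e0.
have [a [b wE]] := sol_span Hv Hm Hw c0.
(* The two bounds make e1 |a| at most 1/2 and e1 |b| at most e/2. *)
pose e1 := Num.min (2 * (`|a| + 1))^-1 (e / (2 * (`|b| + 1))).
have a1 : 0 < `|a| + 1 by have := normr_ge0 a; lra.
have b1 : 0 < `|b| + 1 by have := normr_ge0 b; lra.
have e10 : 0 < e1 by rewrite lt_min invr_gt0 divr_gt0 // mulr_gt0.
have [N HN] := dvw e1 e10; exists N => n /HN[Hn _].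
have e1a : e1 * (`|a| + 1) <= 1 / 2.
  apply: (@le_trans _ _ ((2 * (`|a| + 1))^-1 * (`|a| + 1))).
    by rewrite ler_pM2r // ge_min lexx.
  by rewrite le_eqVlt (_ : _ == _) //; apply/eqP; field; lra.
have e1b : e1 * (`|b| + 1) <= e / 2.
  apply: (@le_trans _ _ (e / (2 * (`|b| + 1)) * (`|b| + 1))).
    by rewrite ler_pM2r // ge_min lexx orbT.
  by rewrite le_eqVlt (_ : _ == _) //; apply/eqP; field; lra.
have := ler_normD (a * v n) (b * m n); rewrite -wE !normrM => Hw'.
have {}Hn : `|v n| <= e1 * (`|a| * `|v n| + `|b| * `|m n|).
  by apply: le_trans Hn _; rewrite ler_pM2l.
have := normr_ge0 (v n); have := normr_ge0 (m n) => m0 v0.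
have : e1 * `|a| * `|v n| <= 1/2 * `|v n|.
  by rewrite ler_wpM2r // (le_trans _ e1a) // ler_pM2l // lerDl.
have : e1 * `|b| * `|m n| <= e/2 * `|m n|.
  by rewrite ler_wpM2r // (le_trans _ e1b) // ler_pM2l // lerDl.
lra.
Qed.

(** If they were independent, each would be negligible against the other, so both would vanish from
    some index on, against the nonzero Casoratian. *)
Lemma mini_cas v m : sol g3 g2 g1 v -> sol g3 g2 g1 m ->
  mini g3 g2 g1 v -> mini g3 g2 g1 m -> cas v m 0 = 0.
Proof.
move=> Hv Hm Mv Mm; apply/eqP/negPn/negP => c0.
have c0' : cas m v 0 != 0.
  by move: c0; rewrite -oppr_eq0 /cas opprB mulrC [v 1%N * _]mulrC.
have h0 : (0 : R) < 1/2 by lra.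
have [N HN] := mini_o Hv Hm c0 Mv h0; have [K HK] := mini_o Hm Hv c0' Mm h0.
have z n : (N + K <= n)%N -> v n = 0 /\ m n = 0.
  move=> Hn; have Nn : (N <= n)%N by lia. have Kn : (K <= n)%N by lia.
  have := HN _ Nn; have := HK _ Kn => A B.
  have := normr_ge0 (v n); have := normr_ge0 (m n) => m0 v0.
  by split; apply/eqP; rewrite -normr_le0; lra.
have := cas_n0 (N + K) Hv Hm; rewrite c0 /cas.
have [-> ->] := z _ (leqnn _); have [|-> ->] := z (N + K).+1; first lia.
by rewrite !mulr0 subrr eqxx.
Qed.

Lemma dominated_scale c v w : dominated v w -> dominated (fun n => c * v n) w.
Proof.
move=> dvw e e0; have c1 : 0 < `|c| + 1 by have := normr_ge0 c; lra.
have [N HN] := dvw (e / (`|c| + 1)) (divr_gt0 e0 c1).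
exists N => n /HN[Hn ->]; split=> //; rewrite normrM.
apply: le_trans (ler_wpM2l (normr_ge0 c) Hn) _.
rewrite mulrA ler_wpM2r // mulrCA ler_piMr ?(ltW e0) //.
by rewrite ler_pdivrMr // mul1r lerDl.
Qed.

Lemma mini_crit m v : sol g3 g2 g1 m -> mini g3 g2 g1 m -> sol g3 g2 g1 v ->
  mini g3 g2 g1 v <->
  (v 0%N != 0 \/ v 1%N != 0) /\ v 1%N * m 0%N - v 0%N * m 1%N = 0.
Proof.
move=> Hm Mm Hv; split=> [Mv|[v0 c0]].
  by split; [apply/(sol_n0 Hv); case: Mv|exact: mini_cas Hv Hm Mv Mm].
have [c [vE c1]] : exists c, (forall n, v n = c * m n) /\ c != 0.
  have [/(sol_n0 Hm) m0 _] := Mm.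
  have [c [e0 e1]] : exists c, v 0%N = c * m 0%N /\ v 1%N = c * m 1%N.
    case: m0 => m0; [exists (v 0%N / m 0%N)|exists (v 1%N / m 1%N)].
      split; apply: (mulIf m0); first by field.
      by transitivity (v 0%N * m 1%N); [lra|field].
    split; apply: (mulIf m0); last by field.
    by transitivity (v 1%N * m 0%N); [lra|field].
  exists c; split.
    apply: sol_eq => // n; rewrite [g3 n * _]mulrCA Hm; ring.
  by apply: contraPneq v0 => c_0; rewrite e0 e1 c_0 !mul0r eqxx; case.
split; first exact/(sol_n0 Hv).
have [_ [w [Hw dmw]]] := Mm; exists w; split=> // e e0.
have [N HN] := dominated_scale c dmw e0; exists N => n /HN.
by rewrite vE.
Qed.

Lemma mini_shift v : sol g3 g2 g1 v ->
  mini g3 g2 g1 v <->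
  mini (g3 \o succn) (g2 \o succn) (g1 \o succn) (v \o succn).
Proof.
move=> Hv; split=> [[v0 [w [Hw dvw]]]|[[n v0] [w [Hw dvw]]]]; split.
- move/(sol_n0 Hv): v0 => v0; have [v1|] := eqVneq (v 1%N) 0; last by exists 0%N.
  exists 1%N => /=; case: v0; last by rewrite v1 eqxx.
  apply: contra => /eqP v2; have /eqP := Hv 0%N.
  by rewrite v1 v2 !mulr0 add0r eq_sym mulf_eq0 (negbTE (g1n0 0)).
- exists (w \o succn); split=> [n /=|e /dvw[N HN]]; first exact: Hw.
  by exists N => n Nn; apply: HN; exact: leqW.
- by exists n.+1.
(* The dominating solution is continued one step backwards, which g1 0 != 0 permits. *)
- exists (fun n => if n is k.+1 then w k else (g3 0%N * w 1%N - g2 0%N * w 0%N) / g1 0%N).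
  split=> [[|k] /=|e /dvw[N HN]]; first by field; exact: g1n0.
    exact: Hw.
  by exists N.+1 => -[//|k] Hk; apply: HN.
Qed.

End Fixed.

Lemma mini_gauge_sub g3 g2 g1 h3 h2 h1 c l v :
  (forall n, c n != 0) -> (forall n, l n != 0) ->
  (forall n, h3 n = l n * g3 n * c n.+2) ->
  (forall n, h2 n = l n * g2 n * c n.+1) ->
  (forall n, h1 n = l n * g1 n * c n) ->
  mini g3 g2 g1 v -> mini h3 h2 h1 (fun n => v n / c n).
Proof.
move=> c0 l0 e3 e2 e1 [[k vk] [w [Hw dvw]]]; split.
  by exists k; rewrite mulf_neq0 // invr_eq0.
exists (fun n => w n / c n); split=> [n|e /dvw[N HN]].
  rewrite e3 e2 e1; transitivity (l n * (g3 n * w n.+2)).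
    by field; rewrite !c0.
  by rewrite Hw; field; rewrite !c0.
exists N => n /HN[Hn wn]; split; last by rewrite mulf_neq0 // invr_eq0.
by rewrite !normrM mulrA ler_wpM2r.
Qed.

Lemma sol_gauge g3 g2 g1 h3 h2 h1 c l v :
  (forall n, c n != 0) ->
  (forall n, h3 n = l n * g3 n * c n.+2) ->
  (forall n, h2 n = l n * g2 n * c n.+1) ->
  (forall n, h1 n = l n * g1 n * c n) ->
  sol g3 g2 g1 v -> sol h3 h2 h1 (fun n => v n / c n).
Proof.
move=> c0 e3 e2 e1 Hw n; rewrite e3 e2 e1.
transitivity (l n * (g3 n * v n.+2)); first by field; rewrite !c0.
by rewrite Hw; field; rewrite !c0.
Qed.

Lemma mini_ext g3 g2 g1 v w : (forall n, v n = w n) ->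
  mini g3 g2 g1 v -> mini g3 g2 g1 w.
Proof. by move=> /funext ->. Qed.

Lemma mini_gauge g3 g2 g1 h3 h2 h1 c l v :
  (forall n, c n != 0) -> (forall n, l n != 0) ->
  (forall n, h3 n = l n * g3 n * c n.+2) ->
  (forall n, h2 n = l n * g2 n * c n.+1) ->
  (forall n, h1 n = l n * g1 n * c n) ->
  mini g3 g2 g1 v <-> mini h3 h2 h1 (fun n => v n / c n).
Proof.
move=> c0 l0 e3 e2 e1; split; first exact: mini_gauge_sub e1.
move=> Hm; have H := @mini_gauge_sub h3 h2 h1 g3 g2 g1 (fun n => (c n)^-1)
  (fun n => (l n)^-1) (fun n => v n / c n).
apply: mini_ext (H _ _ _ _ _ Hm) => [n|n|n|n|n|n].
- by rewrite invrK -mulrA mulVf // mulr1.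
- by rewrite invr_eq0.
- by rewrite invr_eq0.
- by rewrite e3; field; rewrite l0 c0.
- by rewrite e2; field; rewrite l0 c0.
- by rewrite e1; field; rewrite l0 c0.
Qed.

End Recurrences.
End LinearRecurrences.


Module SubdominantGrowth.
Require Import Defs.
Import Recursive LinearRecurrences.
From mathcomp Require Import all_boot all_order all_algebra.
From mathcomp Require Import all_classical all_reals all_analysis.
From mathcomp Require Import zify ring lra.
Set Implicit Arguments.
Unset Strict Implicit.
Unset Printing Implicit Defensive.
Import Order.TTheory GRing.Theory Num.Theory numFieldNormedType.Exports.
Local Open Scope ring_scope.

(** * Criteria for the existence of minimal solutions *)

Section Criteria.
Variable R : realType.
Implicit Types g h u v w m : nat -> R.

Let half_gt0 : 0 < 1 / 2 :> R. Proof. lra. Qed.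

Lemma bernoulli_exp (h : R) n : 0 <= h -> 1 + n%:R * h <= (1 + h) ^+ n.
Proof.
move=> h0; elim: n => [|n IH]; first by rewrite mul0r addr0.
rewrite exprS; apply: le_trans (ler_wpM2l _ IH); last lra.
rewrite -natr1; have : 0 <= n%:R * h * h by rewrite !mulr_ge0.
lra.
Qed.

Lemma geometric_ev (x y C e : R) : 0 < x -> x < y -> 0 < e ->
  exists N, forall n, (N <= n)%N -> C * x ^+ n <= e * y ^+ n.
Proof.
move=> x0 xy e0; pose h := y / x - 1.
have h0 : 0 < h by rewrite subr_gt0 ltr_pdivlMr // mul1r.
have [N HN] := affine_ev (e - C) (mulr_gt0 e0 h0).
exists N => n /HN H; have {1}-> : y = (1 + h) * x by rewrite /h; field; lra.
rewrite exprMn mulrA ler_wpM2r ?exprn_ge0 ?(ltW x0) //.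
apply: le_trans (ler_wpM2l (ltW e0) (bernoulli_exp n (ltW h0))).
lra.
Qed.

(** Exponential rate at most [al]. Quantifying over all rho > al makes the notion stable under
    multiplication by polynomials in n. *)
Definition small (al : R) v := forall rho : R, al < rho ->
  exists2 C : R, 0 <= C & forall n, `|v n| <= C * rho ^+ n.

Section Small.
Variable al : R.
Hypothesis al0 : 0 < al.

Lemma small_lin a b v w : small al v -> small al w -> small al (fun n => a * v n + b * w n).
Proof.
have al_gt0 := al0.
move=> Sv Sw rho /[dup] /Sv[C C0 HC] /Sw[D D0 HD].
exists (`|a| * C + `|b| * D); first by rewrite addr_ge0 // mulr_ge0.
move=> n; apply: le_trans (ler_normD _ _) _; rewrite !normrM mulrDl -!mulrA.
by rewrite lerD // ler_wpM2l.
Qed.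

Lemma small_shift v : small al v -> small al (fun n => v n.+1).
Proof.
have al_gt0 := al0.
move=> Sv rho ar; have [C C0 HC] := Sv rho ar; exists (C * rho) => [|n].
  by rewrite mulr_ge0 //; apply: ltW; apply: lt_trans ar.
by rewrite -mulrA -exprS.
Qed.

Lemma small_affine a b v : small al v -> small al (fun n => (a * n%:R + b) * v n).
Proof.
have al_gt0 := al0.
move=> Sv rho ar.
have [r1 ar1 r1r] : exists2 r1 : R, al < r1 & r1 < rho.
  by exists ((al + rho) / 2); lra.
have [C C0 HC] := Sv r1 ar1.
have r10 : 0 < r1 by lra.
pose h := rho / r1 - 1.
have h0 : 0 < h by rewrite subr_gt0 ltr_pdivlMr // mul1r.
have hE : rho = (1 + h) * r1 by rewrite /h; field; lra.
clearbody h.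
have ah : 0 <= `|a| / h by rewrite divr_ge0 // ltW.
exists (C * (`|a| / h + `|b|)) => [|n]; first by rewrite mulr_ge0 // addr_ge0.
rewrite normrM hE.
have H1 := bernoulli_exp n (ltW h0).
have nh : 0 <= n%:R * h by rewrite mulr_ge0 // ltW.
rewrite exprMn [leRHS](_ : _ = (`|a| / h + `|b|) * (1 + h) ^+ n * (C * r1 ^+ n)); last by ring.
apply: ler_pM => //; apply: le_trans (ler_normD _ _) _.
rewrite normrM normr_nat mulrDl lerD //; last by rewrite ler_peMr //; lra.
apply: (@le_trans _ _ (`|a| / h * (n%:R * h))).
  by rewrite le_eqVlt (_ : _ == _) //; apply/eqP; field; lra.
by rewrite ler_wpM2l //; lra.
Qed.

(** The bound |v n| <= D rho^n is kept by induction because the source costs C rho^n <= D (rho - al)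
    rho^n. *)
Lemma small_sum v s : (forall n, v n.+1 = al * v n + s n) -> small al s -> small al v.
Proof.
have al_gt0 := al0.
move=> vE Ss rho ar; have [C C0 HC] := Ss rho ar.
pose D := `|v 0%N| + C / (rho - al).
have ar0 : 0 < rho - al by lra.
have D1 : C / (rho - al) <= D by rewrite /D lerDr.
have D0 : `|v 0%N| <= D by rewrite /D lerDl divr_ge0 // ltW.
clearbody D.
have rho0 : 0 < rho by lra.
exists D => [|n]; first exact: le_trans D0.
elim: n => [|n IH]; first by rewrite expr0 mulr1.
rewrite vE; apply: le_trans (ler_normD _ _) _; rewrite normrM (gtr0_norm al0).
have : al * `|v n| <= al * (D * rho ^+ n) by rewrite ler_pM2l.
have := HC n; rewrite exprS.
have : C * rho ^+ n <= D * (rho - al) * rho ^+ n.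
  by rewrite ler_wpM2r ?exprn_ge0 ?(ltW rho0) // -ler_pdivrMr.
lra.
Qed.

Lemma small_dominated v w rho N : small al v -> al < rho ->
  (forall n, (N <= n)%N -> rho ^+ n <= `|w n|) -> dominated v w.
Proof.
have al_gt0 := al0.
move=> Sv ar Hw e e0.
have [r1 ar1 r1r] : exists2 r1 : R, al < r1 & r1 < rho.
  by exists ((al + rho) / 2); lra.
have [C C0 HC] := Sv r1 ar1.
have [K HK] := @geometric_ev r1 rho C e (lt_trans al0 ar1) r1r e0.
exists (N + K)%N => n Hn; have Nn : (N <= n)%N by lia. have Kn : (K <= n)%N by lia.
split.
  by apply: le_trans (HC n) _; apply: le_trans (HK _ Kn) _; rewrite ler_pM2l // Hw.
rewrite -normr_gt0; apply: lt_le_trans (Hw _ Nn); rewrite exprn_gt0 //; lra.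
Qed.

Section Gap.
Variables (g3 g2 g1 : nat -> R).
Hypothesis g3n0 : forall n, g3 n != 0.
Hypothesis g1n0 : forall n, g1 n != 0.
(** An exponential gap above [al]. It identifies minimal with small nonzero solutions, and
    smallness, unlike domination, can be carried through the operator A(S). *)
Definition grows := exists w (rho : R) N, [/\ sol g3 g2 g1 w, al < rho &
  forall n, (N <= n)%N -> rho ^+ n <= `|w n|].
Hypothesis Hg : grows.

Lemma small_mini v : sol g3 g2 g1 v -> (exists n, v n != 0) -> small al v -> mini g3 g2 g1 v.
Proof.
have al_gt0 := al0.
move=> Hv v0 Sv; have [w [rho [N [Hw ar Hr]]]] := Hg.
by split=> //; exists w; split=> //; exact: small_dominated Sv ar Hr.
Qed.

Variable m : nat -> R.
Hypothesis Hm : sol g3 g2 g1 m.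
Hypothesis m0 : exists n, m n != 0.
Hypothesis Sm : small al m.

(** A small solution independent of m would make all solutions small, including the growing one. *)
Lemma small_cas v : sol g3 g2 g1 v -> small al v <-> cas v m 0 = 0.
Proof.
have al_gt0 := al0.
move=> Hv; have Mm := small_mini Hm m0 Sm; split=> [Sv|c0].
  apply/eqP/negPn/negP => c0; have [w [rho [N [Hw ar Hr]]]] := Hg.
  have [a [b wE]] := sol_span g3n0 Hv Hm Hw c0.
  have Sw : small al w.
    have -> : w = fun n => a * v n + b * m n by apply/funext.
    exact: small_lin.
  have [K HK] := @small_dominated w w rho N Sw ar Hr (1/2) half_gt0.
  have [] := HK K (leqnn K); have := normr_ge0 (w K); rewrite -normr_gt0; lra.
have [v0|v0] := pselect (v 0%N = 0 /\ v 1%N = 0).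
  have -> : v = fun=> 0.
    apply/funext => n; case: v0 => v0 v1.
    by apply: (@sol_eq _ _ _ _ g3n0 v (fun=> 0)) => // k; rewrite !mulr0 addr0.
  by move=> rho ar; exists 0 => // n; rewrite normr0 mul0r.
have Mv : mini g3 g2 g1 v.
  apply/(mini_crit g3n0 g1n0 Hm Mm Hv); split; last exact: c0.
  by have [e|] := eqVneq (v 0%N) 0; [right; apply/eqP => e1; apply: v0|left].
have [c vE] : exists c : R, forall n, v n = c * m n.
  rewrite /cas in c0.
  have Hc c : sol g3 g2 g1 (fun n => c * m n).
    by move=> n; rewrite [g3 n * _]mulrCA Hm; ring.
  have [e|m00] := eqVneq (m 0%N) 0.
    have m10 : m 1%N != 0.
      by have /(sol_n0 g3n0 g1n0 Hm) [|] := m0; rewrite ?e ?eqxx.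
    exists (v 1%N / m 1%N); apply: (sol_eq g3n0 Hv (Hc _)); last by field.
    by apply: (mulIf m10); transitivity (v 1%N * m 0%N); [lra|field].
  exists (v 0%N / m 0%N); apply: (sol_eq g3n0 Hv (Hc _)); first by field.
  by apply: (mulIf m00); transitivity (v 0%N * m 1%N); [lra|field].
have -> : v = fun n => c * m n + 0 * m n by apply/funext => n; rewrite vE mul0r addr0.
exact: small_lin.
Qed.

Lemma mini_small v : sol g3 g2 g1 v ->
  mini g3 g2 g1 v <-> (v 0%N != 0 \/ v 1%N != 0) /\ small al v.
Proof.
have al_gt0 := al0.
move=> Hv; rewrite (small_cas Hv).
exact: (mini_crit g3n0 g1n0 Hm (small_mini Hm m0 Sm) Hv).
Qed.

End Gap.
End Small.

(** The sequence (-1)^n w n satisfies a recurrence with nonnegative coefficients - g2 and g1, so the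
    lower bound rho^n propagates without cancellation. *)
Lemma grows_alternating g3 g2 g1 (al rho : R) N : 0 < al -> al < rho ->
  (forall n, g3 n != 0) -> (forall n, g1 n != 0) ->
  (forall n, (N <= n)%N ->
    [/\ 0 < g3 n, g2 n <= 0, 0 <= g1 n & g3 n * rho ^+ 2 <= - g2 n * rho + g1 n]) ->
  grows al g3 g2 g1.
Proof.
move=> al0 ar g30 g10 Hg.
have [w [Hw wN wN1]] := sol_ex_at g2 g30 g10 N ((- rho) ^+ N) ((- rho) ^+ N.+1).
exists w, rho, N; split=> // n Nn.
suff: rho ^+ n <= (-1) ^+ n * w n /\ rho ^+ n.+1 <= (-1) ^+ n.+1 * w n.+1.
  move=> [H _]; apply: le_trans H _; apply: le_trans (ler_norm _) _.
  by rewrite normrM normrX normrN1 expr1n mul1r.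
rewrite -(subnKC Nn); elim: (n - N)%N => [|k [IH IH1]].
  rewrite addn0 wN wN1 !(exprNn rho) !mulrA -!exprD !addnn -!mul2n.
  by rewrite !exprM sqrrN expr1n !expr1n !mul1r.
rewrite addnS; split=> //.
have [g0 g2' g1' Hr] := Hg (N + k)%N (leq_addr _ _).
set i := (N + k)%N in IH IH1 g0 g2' g1' Hr *.
rewrite -(ler_pM2l g0) [leRHS]mulrCA Hw.
move: IH IH1; rewrite !exprS => IH IH1.
have -> : -1 * (-1 * (-1) ^+ i) * (g2 i * w i.+1 + g1 i * w i) =
  - g2 i * (-1 * (-1) ^+ i * w i.+1) + g1 i * ((-1) ^+ i * w i) by ring.
have H1 : - g2 i * (rho * rho ^+ i) <= - g2 i * (-1 * (-1) ^+ i * w i.+1).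
  by rewrite ler_wpM2l // oppr_ge0.
have H2 : g1 i * rho ^+ i <= g1 i * ((-1) ^+ i * w i) by rewrite ler_wpM2l.
have : g3 i * rho ^+ 2 * rho ^+ i <= (- g2 i * rho + g1 i) * rho ^+ i.
  by rewrite ler_wpM2r // exprn_ge0 //; lra.
lra.
Qed.

(** The invariant |w (n+1)| >= rho |w n| is kept because the middle term outweighs the last one. *)
Lemma grows_abs g3 g2 g1 (al rho : R) N : 0 < al -> al < rho ->
  (forall n, g3 n != 0) -> (forall n, g1 n != 0) ->
  (forall n, (N <= n)%N ->
    0 < g3 n /\ g3 n * rho ^+ 2 + `|g1 n| <= `|g2 n| * rho) ->
  grows al g3 g2 g1.
Proof.
move=> al0 ar g30 g10 Hg; have r0 : 0 < rho by lra.
have [w [Hw wN wN1]] := sol_ex_at g2 g30 g10 N (rho ^+ N) (rho ^+ N.+1).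
exists w, rho, N; split=> // n Nn.
suff: rho ^+ n <= `|w n| /\ rho * `|w n| <= `|w n.+1| by case.
rewrite -(subnKC Nn); elim: (n - N)%N => [|k [IH IH1]].
  by rewrite addn0 wN wN1 !normrX exprS gtr0_norm.
have [g0 Hr] := Hg (N + k)%N (leq_addr _ _).
rewrite addnS; split; first by rewrite exprS; apply: le_trans IH1; rewrite ler_pM2l.
set i := (N + k)%N in IH IH1 g0 Hr *.
have E : g3 i * `|w i.+2| = `|g2 i * w i.+1 + g1 i * w i|.
  by rewrite -Hw normrM gtr0_norm.
have := lerB_normD (g2 i * w i.+1) (g1 i * w i); rewrite -E !normrM => H.
rewrite -(ler_pM2l g0).
have H1 : `|g1 i| * (rho * `|w i|) <= `|g1 i| * `|w i.+1| by rewrite ler_wpM2l.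
have H2 : (g3 i * rho ^+ 2 + `|g1 i|) * `|w i.+1| <= `|g2 i| * rho * `|w i.+1|.
  by rewrite ler_wpM2r.
have H3 : rho * (`|g2 i| * `|w i.+1| - `|g1 i| * `|w i|) <= rho * (g3 i * `|w i.+2|).
  by rewrite ler_pM2l.
rewrite -(ler_pM2l r0); lra.
Qed.

Lemma dominated_unbounded m w N :
  (forall n, (N <= n)%N -> 0 < m n) ->
  (forall M : R, exists K, forall n, (K <= n)%N -> M * m n <= `|w n|) ->
  dominated m w.
Proof.
move=> m0 H e e0; have [K HK] := H e^-1.
exists (N + K)%N => n Hn; have Nn : (N <= n)%N by lia. have Kn : (K <= n)%N by lia.
have mn := m0 _ Nn; have := HK _ Kn; rewrite (gtr0_norm mn) => Hw; split.
  by rewrite -(ler_pM2l (x := e^-1)) ?invr_gt0 // mulrA mulVf ?mul1r // gt_eqF.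
by rewrite -normr_gt0; apply: lt_le_trans Hw; rewrite mulr_gt0 // invr_gt0.
Qed.

(* The solution [w] alternates in sign, and [|w n| / m n] increases along each parity class. *)
Lemma mini_alternating g3 g2 g1 m (c : R) N : 0 < c ->
  (forall n, g3 n != 0) -> (forall n, g1 n != 0) -> sol g3 g2 g1 m ->
  (forall n, (N <= n)%N -> [/\ 0 < g3 n, g2 n < 0, 0 < g1 n, 0 < m n &
     c * (g3 n * m n.+2) <= n.+1%:R * (- g2 n * m n.+1)]) ->
  mini g3 g2 g1 m.
Proof.
move=> c0 g30 g10 Hm H.
have m0 n : (N <= n)%N -> 0 < m n by move=> /H[].
split; first by exists N; rewrite gt_eqF // m0.
have [w [Hw wN wN1]] := sol_ex_at g2 g30 g10 N
  ((-1) ^+ N * m N) ((-1) ^+ N.+1 * m N.+1).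
exists w; split=> //; pose z n : R := (-1) ^+ n * w n; pose r n : R := z n / m n.
have zE n : g3 n * z n.+2 = - g2 n * z n.+1 + g1 n * z n.
  by rewrite /z mulrCA Hw !exprS; ring.
have r1 n : (N <= n)%N -> 1 <= r n /\ 1 <= r n.+1.
  move=> Nn; rewrite -(subnKC Nn); elim: (n - N)%N => [|k [IH IH1]].
    rewrite addn0 /r /z wN wN1 !mulrA -!exprD !addnn -!mul2n !exprM sqrrN !expr1n !mul1r.
    by rewrite !divff // gt_eqF // m0.
  rewrite addnS; split=> //; set i := (N + k)%N in IH IH1 *.
  have [G3 G2 G1 mi _] := H i (leq_addr _ _).
  have mi1 : 0 < m i.+1 by rewrite m0 // /i; lia.
  have mi2 : 0 < m i.+2 by rewrite m0 // /i; lia.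
  move: IH IH1; rewrite /r !ler_pdivlMr // !mul1r => IH IH1.
  rewrite -(ler_pM2l G3) zE Hm.
  have : g1 i * m i <= g1 i * z i by rewrite ler_pM2l.
  have : 0 <= - g2 i * m i.+1 by rewrite mulr_ge0 // ?oppr_ge0 ltW.
  have : - g2 i * m i.+1 <= - g2 i * z i.+1 by rewrite ler_pM2l // oppr_gt0.
  lra.
have rS n : (N <= n)%N -> r n + c / n.+1%:R <= r n.+2.
  move=> Nn; have [G3 G2 G1 mi Hc] := H n Nn.
  have mi1 : 0 < m n.+1 by rewrite m0 //; lia.
  have mi2 : 0 < m n.+2 by rewrite m0 //; lia.
  have [R0 R1] := r1 n Nn.
  have z0 : z n = r n * m n by rewrite /r mulfVK // gt_eqF.
  have z1 : z n.+1 = r n.+1 * m n.+1 by rewrite /r mulfVK // gt_eqF.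
  rewrite [r n.+2]/r ler_pdivlMr // -(ler_pM2l G3) zE z0 z1.
  have E : g1 n * m n = g3 n * m n.+2 - g2 n * m n.+1 by rewrite Hm; ring.
  have -> : g1 n * (r n * m n) = r n * (g3 n * m n.+2) - r n * (g2 n * m n.+1).
    by rewrite mulrCA E; ring.
  have H1 : c / n.+1%:R * (g3 n * m n.+2) <= - g2 n * m n.+1.
    by rewrite mulrAC ler_pdivrMr // [leRHS]mulrC.
  have H2 : 0 < - g2 n * m n.+1 by rewrite mulr_gt0 // oppr_gt0.
  have : - g2 n * m n.+1 <= r n.+1 * (- g2 n * m n.+1) by rewrite ler_peMl // ltW.
  have : 0 <= r n * (- g2 n * m n.+1) by rewrite mulr_ge0 // ltW //; lra.
  move: H1; move: (c / _) => d H1; lra.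
apply: (dominated_unbounded m0) => M.
(* On one parity class n = 2 k + b one has n + 1 <= 2 (k + 1), whence the constant c / 2. *)
have par b : exists K, forall k, (K <= k)%N -> M <= r (k.*2 + nat_of_bool b)%N.
  apply: (@harmonic_growth _ (fun k => r (k.*2 + nat_of_bool b)%N) (c / 2) N); first lra.
  move=> k Nk /=; have Nk2 : (N <= k.*2 + nat_of_bool b)%N by rewrite -addnn; lia.
  have := rS _ Nk2; rewrite doubleS !addSn; apply: le_trans.
  rewrite lerD2l -mulrA ler_pM2l // -invfM lef_pV2 ?posrE //.
  by rewrite -natrM ler_nat -addnn; case: (b); lia.
have [K0 HK0] := par false; have [K1 HK1] := par true.
exists (N + K0.*2 + K1.*2)%N => n Hn.
have Nn : (N <= n)%N by lia.
have mn := m0 _ Nn.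
have : M <= r n.
  rewrite -(odd_double_half n) addnC; have := odd_double_half n.
  by case: (odd n) => /= E; [apply: HK1|apply: HK0]; rewrite -addnn in E; lia.
rewrite /r ler_pdivlMr // => H1; apply: le_trans H1 _; apply: le_trans (ler_norm _) _.
by rewrite /z normrM normrX normrN1 expr1n mul1r.
Qed.

(** P is the Casoratian of m with the second solution w, hence w / m increases by P n / (m n m
    (n+1)) >= c / (n + 1) at each step and is unbounded. *)
Lemma mini_positive g3 g2 g1 m (P : nat -> R) (c : R) N : 0 < c ->
  (forall n, g3 n != 0) -> (forall n, g1 n != 0) -> sol g3 g2 g1 m ->
  0 < P N -> (forall n, (N <= n)%N -> g3 n * P n.+1 = - g1 n * P n) ->
  (forall n, (N <= n)%N -> 0 < m n /\ c * (m n * m n.+1) <= n.+1%:R * P n) ->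
  mini g3 g2 g1 m.
Proof.
move=> c0 g30 g10 Hm P0 HP H.
have m0 n : (N <= n)%N -> 0 < m n by move=> /H[].
split; first by exists N; rewrite gt_eqF // m0.
have [w [Hw wN wN1]] := sol_ex_at g2 g30 g10 N 0 (P N / m N).
exists w; split=> //; pose t n : R := w n / m n.
have C n : (N <= n)%N -> cas w m n = P n.
  move=> Nn; rewrite -(subnKC Nn); elim: (n - N)%N => [|k IH].
    by rewrite addn0 /cas wN wN1 mul0r subr0 mulfVK // gt_eqF // m0.
  rewrite addnS (cas_rec g30 Hw Hm) IH; apply: (mulfI (g30 (N + k)%N)).
  by rewrite HP ?leq_addr //; field; exact: g30.
have tS n : (N <= n)%N -> t n + c / n.+1%:R <= t n.+1.
  move=> Nn; have [mn Hn] := H n Nn; have mn1 : 0 < m n.+1 by rewrite m0 //; lia.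
  have := C n Nn; rewrite /cas => E.
  rewrite addrC -lerBrDr.
  have -> : t n.+1 - t n = P n / (m n * m n.+1).
    by rewrite -E /t; field; rewrite !gt_eqF.
  by rewrite ler_pdivlMr ?mulr_gt0 // mulrAC ler_pdivrMr // [leRHS]mulrC.
apply: (dominated_unbounded m0) => M.
have [K HK] := harmonic_growth c0 tS M.
exists (N + K)%N => n Hn; have Nn : (N <= n)%N by lia. have Kn : (K <= n)%N by lia.
have := HK _ Kn; rewrite /t ler_pdivlMr ?m0 // => H1.
exact: le_trans H1 (ler_norm _).
Qed.

End Criteria.
End SubdominantGrowth.


Module Oscillation.
Require Import Defs.
Import Recursive LinearRecurrences SubdominantGrowth.
From mathcomp Require Import all_boot all_order all_algebra.
From mathcomp Require Import all_classical all_reals all_analysis.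
From mathcomp Require Import zify ring lra.
Set Implicit Arguments.
Unset Strict Implicit.
Unset Printing Implicit Defensive.
Import Order.TTheory GRing.Theory Num.Theory numFieldNormedType.Exports.
Local Open Scope ring_scope.

(** * Oscillating recurrences have no minimal solution *)

Section Oscillation.
Variable R : realType.
Implicit Types g h u v w m : nat -> R.

(** An energy at x = w (n+1), y = w n: with the coefficients frozen, one step of the recurrence
    multiplies it by - g1 / g3, the factor that also governs the Casoratian. *)
Definition qform (a b c x y : R) : R := a * x ^+ 2 - b * x * y - c * y ^+ 2.

(** If w kept its sign, r n = - w (n+1) / w n would stay negative; but it increases by the form
    divided by g3 w (n+1) w n, which is at least (c / C) / (n + 1). *)
Lemma sol_changes_sign g3 g2 g1 (c C : R) N w : 0 < c ->
  (forall n, (N <= n)%N -> 0 < g3 n /\ g3 n <= C * n.+1%:R) ->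
  (forall n x y, (N <= n)%N -> c * `|x * y| <= qform (g3 n) (g2 n) (g1 n) x y) ->
  sol g3 g2 g1 w ->
  forall K, exists2 n, (K <= n)%N & w n.+1 * w n <= 0.
Proof.
move=> c0 Hg HS Hw K; apply: contrapT => H.
have pos n : (K <= n)%N -> 0 < w n.+1 * w n.
  by move=> Kn; rewrite ltNge; apply/negP => le0; apply: H; exists n.
have C0 : 0 < C.
  have [g0 gC] := Hg N (leqnn N); have := lt_le_trans g0 gC.
  by rewrite pmulr_lgt0.
pose r n : R := - (w n.+1 / w n).
have rS n : (K + N <= n)%N -> r n + (c / C) / n.+1%:R <= r n.+1.
  move=> Hn; have Kn : (K <= n)%N by lia. have Nn : (N <= n)%N by lia.
  have [g0 gC] := Hg n Nn; have p0 := pos n Kn.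
  have w0 : w n != 0 by move: p0; apply: contraTneq => ->; rewrite mulr0 ltxx.
  have w1 : w n.+1 != 0 by move: p0; apply: contraTneq => ->; rewrite mul0r ltxx.
  have -> : r n.+1 = r n + qform (g3 n) (g2 n) (g1 n) (w n.+1) (w n) / (g3 n * (w n.+1 * w n)).
    have -> : r n.+1 = - (g3 n * w n.+2) / (g3 n * w n.+1).
      by rewrite /r; field; rewrite w1 gt_eqF.
    by rewrite Hw /r /qform; field; rewrite w0 w1 gt_eqF.
  have q0 : 0 < g3 n * (w n.+1 * w n) by apply: mulr_gt0.
  rewrite lerD2l ler_pdivlMr //.
  apply: le_trans (HS n _ _ Nn); rewrite gtr0_norm //.
  rewrite [leLHS]mulrA ler_wpM2r ?(ltW p0) //.
  rewrite mulrAC ler_pdivrMr // -mulrA ler_pM2l //.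
  by rewrite mulrC ler_pdivrMr // [leRHS]mulrC.
have [N1 HN1] := harmonic_growth (divr_gt0 c0 C0) rS 0.
pose n := (K + N1)%N; have := HN1 n (leq_addl _ _).
have p0 := pos n (leq_addr _ _).
have w0 : w n != 0 by move: p0; apply: contraTneq => ->; rewrite mulr0 ltxx.
rewrite /r oppr_ge0 => le0.
have : w n.+1 / w n * (w n ^+ 2) <= 0 by rewrite mulr_le0_ge0 // sqr_ge0.
rewrite expr2 mulrA mulfVK //; by rewrite leNgt p0.
Qed.

(* At a sign change of [w] the Casoratian would be negligible against [w n.+1 * w n]. *)
Lemma oscillating_not_mini g3 g2 g1 (c C : R) (L : nat -> R) N : 0 < c ->
  (forall n, g3 n != 0) -> (forall n, g1 n != 0) ->
  (forall n, (N <= n)%N -> [/\ 0 < g3 n, g3 n <= C * n.+1%:R, g1 n < 0 & 0 < L n]) ->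
  (forall n x y, (N <= n)%N -> c * `|x * y| <= qform (g3 n) (g2 n) (g1 n) x y) ->
  (forall n x y, (N <= n)%N -> x * y <= 0 ->
     c * (L n * `|x * y|) <= qform (g3 n) (g2 n) (g1 n) x y) ->
  (forall w (P : nat -> R), sol g3 g2 g1 w ->
     (forall n, (N <= n)%N -> 0 < P n /\ g3 n * P n.+1 = - g1 n * P n) ->
     exists K, forall n, (N <= n)%N ->
       qform (g3 n) (g2 n) (g1 n) (w n.+1) (w n) <= K * (L n * P n)) ->
  forall v, sol g3 g2 g1 v -> ~ mini g3 g2 g1 v.
Proof.
move=> c0 g30 g10 Hg HS HX HE v Hv Mv; have [v0 [w [Hw dvw]]] := Mv.
have cas0 : cas v w 0 != 0.
  apply/negP => /eqP c00.
  have w0 : w 0%N != 0 \/ w 1%N != 0.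
    apply/(sol_n0 g30 g10 Hw); have [M HM] := dvw 1 ltr01.
    by exists M; case: (HM M (leqnn M)).
  have Hcw k : sol g3 g2 g1 (fun n => k * w n).
    by move=> n; rewrite [g3 n * _]mulrCA Hw; ring.
  have [k vE] : exists k : R, forall n, v n = k * w n.
    rewrite /cas in c00; case: w0 => w0.
      exists (v 0%N / w 0%N); apply: (sol_eq g30 Hv (Hcw _)); first by field.
      by apply: (mulIf w0); transitivity (v 0%N * w 1%N); [lra|field].
    exists (v 1%N / w 1%N); apply: (sol_eq g30 Hv (Hcw _)); last by field.
    by apply: (mulIf w0); transitivity (v 1%N * w 0%N); [lra|field].
  have k0 : k != 0.
    by case: v0 => n; rewrite vE; apply: contra => /eqP ->; rewrite mul0r.
  have k20 : 0 < `|k| / 2 by rewrite divr_gt0 ?normr_gt0.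
  have [M HM] := dvw _ k20.
  have [] := HM M (leqnn M); rewrite vE normrM -normr_gt0 => H1 H2.
  have k1 : 0 < `|k| by rewrite normr_gt0.
  by move: H1; rewrite ler_pM2r //; lra.
pose P n : R := `|cas v w n|.
have HP n : (N <= n)%N -> 0 < P n /\ g3 n * P n.+1 = - g1 n * P n.
  move=> Nn; have [g0 _ g1' _] := Hg n Nn; split.
    by rewrite normr_gt0 (cas_n0 g30 g10 n Hv Hw).
  rewrite /P (cas_rec g30 Hv Hw) normrM normrN normrM normfV.
  by rewrite (gtr0_norm g0) (ltr0_norm g1'); field; rewrite gt_eqF.
have [K HK] := HE w P Hw HP.
pose K' := `|K| + 1; have K'0 : 0 < K' by rewrite /K'; have := normr_ge0 K; lra.
have KK' : K <= K' by rewrite /K'; have := ler_norm K; lra.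
(* With this constant, the upper bound on the form at a sign change is half of its lower bound c L
   |w (n+1) w n|. *)
have [M HM] := dvw (c / (4 * K')) ltac:(by rewrite divr_gt0 // mulr_gt0).
have Hg' n : (N <= n)%N -> 0 < g3 n /\ g3 n <= C * n.+1%:R by move=> /Hg[].
have [n Mn ww] := sol_changes_sign c0 Hg' HS Hw (M + N).
have Nn : (N <= n)%N by lia. have [P0 _] := HP n Nn.
have [_ _ _ L0] := Hg n Nn.
have [|D1 _] := HM n.+1; first by lia.
have [|D0 _] := HM n; first by lia.
have PB : P n <= c / (2 * K') * `|w n.+1 * w n|.
  rewrite /P /cas; apply: le_trans (ler_normB _ _) _; rewrite !normrM.
  have A : `|v n.+1| * `|w n| <= c / (4 * K') * `|w n.+1| * `|w n| by rewrite ler_wpM2r.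
  have B : `|v n| * `|w n.+1| <= c / (4 * K') * `|w n| * `|w n.+1| by rewrite ler_wpM2r.
  have -> : c / (2 * K') * (`|w n.+1| * `|w n|) =
    c / (4 * K') * `|w n.+1| * `|w n| + c / (4 * K') * `|w n| * `|w n.+1|.
    by field; rewrite gt_eqF.
  exact: lerD.
have H1 := HX n _ _ Nn ww; have H2 := HK n Nn.
have H3 : K * (L n * P n) <= K' * (L n * P n) by rewrite ler_wpM2r // mulr_ge0 // ltW.
have H4 : K' * (L n * P n) <= K' * (L n * (c / (2 * K') * `|w n.+1 * w n|)).
  by rewrite ler_pM2l // ler_pM2l.
have E4 : K' * (L n * (c / (2 * K') * `|w n.+1 * w n|)) = c * (L n * `|w n.+1 * w n|) / 2.
  by field; rewrite gt_eqF.
have : 0 < c * (L n * `|w n.+1 * w n|).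
  rewrite !mulr_gt0 //; rewrite normr_gt0; apply: contraTneq PB => ->.
  by rewrite normr0 mulr0 leNgt P0.
lra.
Qed.

Section AffineOsc.
Variables a3 b3 a2 b2 a1 b1 : R.
Let g3 n : R := a3 * n%:R + b3.
Let g2 n : R := a2 * n%:R + b2.
Let g1 n : R := a1 * n%:R + b1.

Lemma affine_le (a b : R) n : a * n%:R + b <= (`|a| + `|b|) * n.+1%:R.
Proof.
rewrite -natr1 mulrDr mulr1 mulrDl -addrA lerD //.
  by rewrite ler_wpM2r // ler_norm.
apply: le_trans (ler_norm b) _; have : 0 <= `|b| * n%:R by rewrite mulr_ge0.
have := normr_ge0 a; lra.
Qed.

Lemma qform_affine n x y : qform (g3 n) (g2 n) (g1 n) x y =
  n%:R * qform a3 a2 a1 x y + qform b3 b2 b1 x y.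
Proof. by rewrite /qform /g3 /g2 /g1; ring. Qed.

(** The first term is the step with coefficients frozen at n; the second, the leading form, is the
    change of the coefficients from n to n + 1. *)
Lemma osc_step n w : g3 n != 0 -> sol g3 g2 g1 w ->
  g3 n * qform (g3 n.+1) (g2 n.+1) (g1 n.+1) (w n.+2) (w n.+1) =
  - g1 n * qform (g3 n) (g2 n) (g1 n) (w n.+1) (w n) +
  g3 n * qform a3 a2 a1 (w n.+2) (w n.+1).
Proof.
move=> g0 Hw.
have -> : w n.+2 = (g2 n * w n.+1 + g1 n * w n) / g3 n by rewrite -Hw; field.
move: g0; rewrite /qform /g3 /g2 /g1 -!natr1 => g0; field.
exact: g0.
Qed.

(* [S n <= K (n - C0) P n] where [S n] is the quadratic form at [n], because
   [S n.+1 = - g1 n / g3 n * S n + A] with [A <= S n.+1 / (n.+1 - C0)]. *)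
Lemma osc_quadratic (C0 c : R) : 0 < a3 -> a1 < 0 -> 0 <= a2 -> 0 < c ->
  (a2 = 0 -> 0 <= b2) ->
  (forall n, g3 n != 0) -> (forall n, g1 n != 0) ->
  (forall x y, 0 <= qform a3 a2 a1 x y) ->
  (forall x y, c * `|x * y| <= C0 * qform a3 a2 a1 x y + qform b3 b2 b1 x y) ->
  forall v, sol g3 g2 g1 v -> ~ mini g3 g2 g1 v.
Proof.
move=> a30 a10 a20 c0 b20 g30 g10 HA HF.
have [N1 HN1] := affine_ev (b3 : R) (ltac:(lra) : 0 < a3 / 2).
have [N2 HN2] := affine_ev (- b1 : R) (ltac:(lra) : 0 < - a1 / 2).
have [N3 HN3] := affine_ev (- C0 : R) ltr01.
have [N4 HN4] : exists N, forall n, (N <= n)%N -> 0 <= g2 n.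
  have [a2z|a2z] := eqVneq a2 0.
    by exists 0%N => n _; rewrite /g2 a2z mul0r add0r b20.
  have a2p : 0 < a2 by rewrite lt_neqAle eq_sym a2z.
  by have [N HN] := affine_ev b2 a2p; exists N => n /HN/ltW.
pose N := (N1 + N2 + N3 + N4 + 1)%N.
pose c1 := Num.min c (Num.min (a3 / 2) (- a1 / 2)).
have c10 : 0 < c1 by rewrite !lt_min c0 /=; apply/andP; split; lra.
have c1c : c1 <= c by rewrite ge_min lexx.
have c1a : c1 <= a3 / 2 by rewrite !ge_min lexx orbT.
have c1b : c1 <= - a1 / 2 by rewrite !ge_min lexx !orbT.
have Hn n : (N <= n)%N ->
    [/\ 0 < a3 / 2 * n%:R + b3, 0 < - a1 / 2 * n%:R - b1, 0 < n%:R - C0, 0 <= g2 n & (0 < n)%N].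
  move=> Nn; have [h1 h2 h3 h4] : [/\ (N1 <= n)%N, (N2 <= n)%N, (N3 <= n)%N & (N4 <= n)%N].
    by move: Nn; rewrite /N; clear; move=> Nn; split; lia.
  have n1 : (0 < n)%N by move: Nn; rewrite /N; clear; lia.
  split; [exact: HN1|exact: HN2| |exact: HN4|exact: n1].
  by have := HN3 n h3; rewrite mul1r.
clearbody N.
have HSA n x y : (n%:R - C0) * qform a3 a2 a1 x y + c * `|x * y| <=
    qform (g3 n) (g2 n) (g1 n) x y.
  by rewrite qform_affine; have := HF x y; lra.
have HS n x y : (N <= n)%N -> c1 * `|x * y| <= qform (g3 n) (g2 n) (g1 n) x y.
  move=> /Hn[_ _ h _ _]; apply: le_trans (HSA n x y).
  have : 0 <= (n%:R - C0) * qform a3 a2 a1 x y by rewrite mulr_ge0 // ltW.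
  have : c1 * `|x * y| <= c * `|x * y| by rewrite ler_wpM2r.
  lra.
(* Dividing n - C0 by 1 + |C0| keeps the weight at most n, as the lower bound at sign changes
   requires; the energy bound changes only by a constant. *)
apply: (@oscillating_not_mini g3 g2 g1 c1 (`|a3| + `|b3|)
  (fun n => (n%:R - C0) / (1 + `|C0|)) N) => //.
- move=> n Nn; have [h1 h2 h3 h4 n0] := Hn n Nn.
  have np : 0 < n%:R :> R by rewrite ltr0n.
  have A3 : 0 <= a3 / 2 * n%:R by rewrite mulr_ge0 //; lra.
  have A1 : 0 <= - a1 / 2 * n%:R by rewrite mulr_ge0 //; lra.
  split; [rewrite /g3; lra|exact: affine_le|rewrite /g1; lra|].
  by rewrite divr_gt0 // ltr_wpDr.
- move=> n x y Nn xy; have [h1 h2 h3 h4 n0] := Hn n Nn.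
  have np : 1 <= n%:R :> R by rewrite ler1n.
  have A3 : c1 * n%:R <= g3 n.
    have : c1 * n%:R <= a3 / 2 * n%:R by rewrite ler_wpM2r.
    rewrite /g3; lra.
  have A1 : c1 * n%:R <= - g1 n.
    have : c1 * n%:R <= - a1 / 2 * n%:R by rewrite ler_wpM2r.
    rewrite /g1; lra.
  have LB : (n%:R - C0) / (1 + `|C0|) <= n%:R.
    have := normr_ge0 C0 => C00.
    rewrite ler_pdivrMr ?ltr_wpDr //.
    have : `|C0| <= n%:R * `|C0| by rewrite ler_peMl.
    have := ler_norm (- C0); rewrite normrN; lra.
  apply: (@le_trans _ _ (c1 * n%:R * `|x * y|)).
    by rewrite -mulrA ler_pM2l // ler_wpM2r.
  have B3 : c1 * n%:R * x ^+ 2 <= g3 n * x ^+ 2 by rewrite ler_wpM2r // sqr_ge0.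
  have B1 : c1 * n%:R * y ^+ 2 <= - g1 n * y ^+ 2 by rewrite ler_wpM2r // sqr_ge0.
  have B2 : 0 <= - (g2 n * (x * y)) by rewrite -mulrN mulr_ge0 // oppr_ge0.
  have XY : c1 * n%:R * `|x * y| <= c1 * n%:R * (x ^+ 2 + y ^+ 2).
    rewrite ler_wpM2l //; first by rewrite mulr_ge0 // ltW.
    rewrite ler0_norm //; have := sqr_ge0 (x + y); have := sqr_ge0 x; have := sqr_ge0 y.
    rewrite sqrrD -mulr_natr; lra.
  rewrite /qform; lra.
- move=> w P Hw HP; pose S n : R := qform (g3 n) (g2 n) (g1 n) (w n.+1) (w n).
  have [P0 _] := HP N (leqnn N); have [_ _ hN _ _] := Hn N (leqnn N).
  pose K := S N / ((N%:R - C0) * P N).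
  exists (K * (1 + `|C0|)) => n Nn.
  have -> : K * (1 + `|C0|) * ((n%:R - C0) / (1 + `|C0|) * P n) = K * ((n%:R - C0) * P n).
    have : 1 + `|C0| != 0 by rewrite gt_eqF // ltr_wpDr.
    by move=> h; field.
  rewrite -/(S n) -(subnKC Nn); elim: (n - N)%N => [|k IH].
    rewrite addn0 /K le_eqVlt (_ : _ == _) //; apply/eqP; field.
    by rewrite !gt_eqF.
  have Nk : (N <= N + k)%N by exact: leq_addr.
  rewrite addnS; move: (N + k)%N Nk IH => i Ni IH.
  have [h1 h2 h3 h4 i0] := Hn i Ni.
  have [|k1 k2 k3 k4 _] := Hn i.+1; first exact: leqW.
  have [Pi PE] := HP i Ni.
  have ip : 0 < i%:R :> R by rewrite ltr0n.
  have G3 : 0 < g3 i.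
    have A3 : 0 <= a3 / 2 * i%:R by rewrite mulr_ge0 //; lra.
    by rewrite /g3; lra.
  have G1 : 0 < - g1 i.
    have A1 : 0 <= - a1 / 2 * i%:R by rewrite mulr_ge0 //; lra.
    by rewrite /g1; lra.
  have ES := osc_step (g30 i) Hw; rewrite -/(S i) -/(S i.+1) in ES.
  have HA1 := HSA i.+1 (w i.+2) (w i.+1); rewrite -/(S i.+1) in HA1.
  have cxy : 0 <= c * `|w i.+2 * w i.+1| by rewrite mulr_ge0 // ltW.
  have i1 : i.+1%:R = i%:R + 1 :> R by rewrite natr1.
  rewrite i1 in k3 HA1 *.
  move: ES HA1 cxy PE; set Q := qform a3 a2 a1 _ _ => ES HA1 cxy PE.
  have T1 : (i%:R + 1 - C0) * Q <= S i.+1 by move: HA1 cxy; clear; lra.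
  have T2 : g3 i * ((i%:R + 1 - C0) * Q) <= g3 i * S i.+1 by rewrite ler_pM2l.
  have T3 : - g1 i * S i <= - g1 i * (K * ((i%:R - C0) * P i)) by rewrite ler_pM2l.
  have T4 : g3 i * S i.+1 * (i%:R - C0) <=
      (i%:R + 1 - C0) * (- g1 i * (K * ((i%:R - C0) * P i))).
    have T5 : (i%:R + 1 - C0) * (- g1 i * S i) <=
      (i%:R + 1 - C0) * (- g1 i * (K * ((i%:R - C0) * P i))) by rewrite ler_pM2l.
    have ES' := congr1 (fun t => (i%:R + 1 - C0) * t) ES.
    move: T5 T2 ES'; move: (g3 i) (g1 i) (S i) (S i.+1) (P i) => ? ? ? ? ?; clear; lra.
  have E5 : (i%:R + 1 - C0) * (- g1 i * (K * ((i%:R - C0) * P i))) =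
     g3 i * (K * ((i%:R + 1 - C0) * P i.+1)) * (i%:R - C0).
    transitivity ((i%:R + 1 - C0) * (i%:R - C0) * K * (- g1 i * P i)); first by ring.
    by rewrite -PE; ring.
  by move: T4; rewrite E5 ler_pM2r // ler_pM2l.
Qed.

End AffineOsc.
End Oscillation.
End Oscillation.


(** * Oscillation when only the last coefficient may depend on n *)

Module OscillationLowDegree.
Require Import Defs.
Import Recursive LinearRecurrences SubdominantGrowth Oscillation.
From mathcomp Require Import all_boot all_order all_algebra.
From mathcomp Require Import all_classical all_reals all_analysis.
From mathcomp Require Import zify ring lra.
Set Implicit Arguments.
Unset Strict Implicit.
Unset Printing Implicit Defensive.
Import Order.TTheory GRing.Theory Num.Theory numFieldNormedType.Exports.
Local Open Scope ring_scope.

Section OscillationLowDegree.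
Variable R : realType.
Implicit Types w v : nat -> R.

Definition aff (a b : R) (n : nat) : R := a * n%:R + b.

(** Energy and Casoratian are multiplied by the same factor - b1 / b3, so their ratio is constant
    and the weight 1 suffices. *)
Lemma osc_constant (b3 b2 b1 c : R) : 0 < b3 -> b1 < 0 -> 0 < c ->
  (forall x y, c * `|x * y| <= qform b3 b2 b1 x y) ->
  forall v, sol (aff 0 b3) (aff 0 b2) (aff 0 b1) v ->
    ~ mini (aff 0 b3) (aff 0 b2) (aff 0 b1) v.
Proof.
move=> b30 b10 c0 HF.
have affE b n : aff 0 b n = b by rewrite /aff mul0r add0r.
apply: (@oscillating_not_mini _ _ _ _ c b3 (fun=> 1) 0) => //.
- by move=> n; rewrite affE gt_eqF.
- by move=> n; rewrite affE lt_eqF.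
- by move=> n _; rewrite !affE; split=> //; rewrite ler_peMr ?ler1n // ltW.
- by move=> n x y _; rewrite !affE.
- by move=> n x y _ _; rewrite !affE mul1r.
- move=> w P Hw HP; have [P0 _] := HP 0%N (leqnn _).
  exists (qform b3 b2 b1 (w 1%N) (w 0%N) / P 0%N) => n _; rewrite !affE mul1r.
  elim: n => [|n IH]; first by rewrite mulfVK // gt_eqF.
  have [Pn] := HP n (leq0n _); have := Hw n; rewrite !affE => E PE.
  rewrite -(ler_pM2l b30) [leRHS]mulrCA PE.
  have -> : b3 * qform b3 b2 b1 (w n.+2) (w n.+1) = - b1 * qform b3 b2 b1 (w n.+1) (w n).
    have -> : w n.+2 = (b2 * w n.+1 + b1 * w n) / b3 by rewrite -E; field; rewrite gt_eqF.
    by rewrite /qform; field; rewrite gt_eqF.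
  by rewrite [leRHS]mulrCA ler_pM2l // oppr_gt0.
Qed.

Definition sqn n : R := Num.sqrt n%:R.

Lemma sqn_sqr n : sqn n ^+ 2 = n%:R. Proof. by rewrite sqr_sqrtr. Qed.

Lemma sqn_S n : sqn n.+1 <= sqn n + 1 /\ 0 <= sqn n.
Proof.
have h : 0 <= sqn n by rewrite sqrtr_ge0.
split=> //; rewrite -(@ler_pXn2r _ 2) ?nnegrE ?sqrtr_ge0 ?addr_ge0 //.
by rewrite sqn_sqr -natr1 -sqn_sqr sqrrD1 -mulr_natr; lra.
Qed.

Lemma sqn_ev (M : R) : exists N, forall n, (N <= n)%N -> M < sqn n.
Proof.
have [N HN] := affine_ev (- M ^+ 2) (@ltr01 R); exists N => n /HN.
rewrite mul1r subr_gt0 -sqn_sqr => H; have [_ s0] := sqn_S n.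
rewrite ltNge; apply/negP => sM; move: H; apply/negP; rewrite -leNgt.
by rewrite ler_pXn2r ?nnegrE //; apply: le_trans sM.
Qed.

(** Here r, x, y stand for sqrt n, w (n+1), w n. The modified energy of [osc_linear] gains a/2 (h
    y^2 + b3 x^2) in one step, so its relative gain is at most 1 / ((r - M) (2 r + 1)), where M = m
    + 1/2 + 3 D. That is at most the relative growth of sqrt n - M, since sqrt (n+1) - sqrt n >= 1 /
    (2 sqrt n + 1). In M, m accounts for the middle coefficient and D for b1 and the half-step
    correction. *)
Lemma osc_linear_step (a b3 b2 b1 m D r x y : R) :
  0 < a -> 0 < b3 -> 0 <= m -> b2 ^+ 2 <= 4 * m ^+ 2 * a * b3 ->
  `|b1| + a / 2 = a * D -> 1 <= r -> D < r ^+ 2 -> m + 1/2 + 3 * D < r ->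
  let h := a * r ^+ 2 - b1 in
  a / 2 * (h * y ^+ 2 + b3 * x ^+ 2) * ((r - (m + 1/2 + 3 * D)) * (2 * r + 1)) <=
  h * (b3 * x ^+ 2 - b2 * x * y + (h - a / 2) * y ^+ 2).
Proof.
move=> a0 b30 m0 Hb2 HD r1 Dr Mr; lazy zeta.
pose h : R := a * r ^+ 2 - b1; rewrite -/h; pose M : R := m + 1/2 + 3 * D.
have nb0 := normr_ge0 b1.
have D0 : 0 < D by rewrite -(pmulr_rgt0 _ a0) -HD; lra.
have r0 : 0 < r by lra.
have r20 : 0 < r ^+ 2 by rewrite exprn_gt0.
have [y2 x2] : 0 <= y ^+ 2 /\ 0 <= x ^+ 2 by rewrite !sqr_ge0.
pose Q : R := b3 * x ^+ 2 + a * r ^+ 2 * y ^+ 2.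
have bx : 0 <= b3 * x ^+ 2 by rewrite mulr_ge0 // ltW.
have ay : 0 <= a * r ^+ 2 * y ^+ 2 by apply: mulr_ge0 => //; apply: mulr_ge0; exact: ltW.
have Q0 : 0 <= Q by rewrite addr_ge0.
have nb := ler_norm b1; have nb' := ler_norm (- b1); rewrite normrN in nb'.
have F1 : b2 * r * (x * y) <= m * Q.
  have [mz|mz] := eqVneq m 0.
    have b2z : b2 = 0.
      apply/eqP; rewrite -sqrf_eq0 eq_le sqr_ge0 andbT.
      by move: Hb2; rewrite mz expr0n /= mulr0 !mul0r.
    by rewrite mz b2z !mul0r.
  have mp : 0 < m by rewrite lt_neqAle eq_sym mz.
  have mb : 0 < 4 * m * b3 by rewrite !mulr_gt0.
  rewrite -subr_ge0 -(pmulr_rge0 _ mb).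
  have -> : 4 * m * b3 * (m * Q - b2 * r * (x * y)) =
    (2 * m * b3 * x - b2 * r * y) ^+ 2 + (4 * m ^+ 2 * a * b3 - b2 ^+ 2) * (r * y) ^+ 2.
    by rewrite /Q; ring.
  by rewrite addr_ge0 ?sqr_ge0 // mulr_ge0 ?sqr_ge0 // subr_ge0.
have F2 : a * D * y ^+ 2 * r ^+ 2 <= D * Q.
  have : 0 <= D * (b3 * x ^+ 2) by rewrite mulr_ge0 // ltW.
  rewrite /Q; clear; lra.
have b1D : (b1 + a / 2) * y ^+ 2 <= a * D * y ^+ 2.
  by rewrite ler_wpM2r //; move: HD nb; clear; lra.
have b1D' : - b1 * y ^+ 2 <= a * D * y ^+ 2.
  by rewrite ler_wpM2r //; move: HD nb' a0; clear; lra.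
have HE : Q * (r ^+ 2 - m * r - D) <=
    r ^+ 2 * (b3 * x ^+ 2 - b2 * x * y + (h - a / 2) * y ^+ 2).
  have G1 : r * (b2 * r * (x * y)) <= r * (m * Q) by rewrite ler_pM2l.
  have G2 : r ^+ 2 * ((b1 + a / 2) * y ^+ 2) <= r ^+ 2 * (a * D * y ^+ 2) by rewrite ler_pM2l.
  have -> : r ^+ 2 * (b3 * x ^+ 2 - b2 * x * y + (h - a / 2) * y ^+ 2) =
    r ^+ 2 * Q - r * (b2 * r * (x * y)) - r ^+ 2 * ((b1 + a / 2) * y ^+ 2).
    by rewrite /h /Q; field.
  move: G1 G2 F2; clearbody Q; clear; lra.
have HL : r ^+ 2 * (h * y ^+ 2 + b3 * x ^+ 2) <= Q * (r ^+ 2 + D).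
  have G2 : r ^+ 2 * (- b1 * y ^+ 2) <= r ^+ 2 * (a * D * y ^+ 2) by rewrite ler_pM2l.
  have -> : r ^+ 2 * (h * y ^+ 2 + b3 * x ^+ 2) = r ^+ 2 * Q + r ^+ 2 * (- b1 * y ^+ 2).
    by rewrite /h /Q; ring.
  move: G2 F2; clearbody Q; clear; lra.
have h0 : a * (r ^+ 2 - D) <= h by rewrite /h; move: HD nb a0; clear; lra.
have hp : 0 < a * (r ^+ 2 - D) by rewrite mulr_gt0 // subr_gt0.
have M0 : 0 <= M / 2 by rewrite /M; move: m0 D0; clear; lra.
have U0 : 0 <= r ^+ 2 - m * r - D.
  have : 0 <= r * (r - m - D) by rewrite mulr_ge0 //; move: Mr D0 r0; clear; lra.
  have : D <= r * D by rewrite ler_peMl // ltW.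
  clear; lra.
have rM : 0 <= (r - M) * (r + 1/2) by rewrite mulr_ge0 // /M; move: Mr r0; clear; lra.
have key : (r ^+ 2 + D) * ((r - M) * (r + 1/2)) <= (r ^+ 2 - D) * (r ^+ 2 - m * r - D).
  rewrite -subr_ge0.
  have -> : (r ^+ 2 - D) * (r ^+ 2 - m * r - D) - (r ^+ 2 + D) * ((r - M) * (r + 1/2)) =
    3 * D * r ^+ 2 * (r - 1) + (M / 2) * r ^+ 2 + D * (2 * m + 3 * D) * r + D ^+ 2 + D * (M / 2).
    by rewrite /M; field.
  have D1 := ltW D0; have R0 := ltW r0; have R1 : 0 <= r - 1 by rewrite subr_ge0.
  by rewrite !addr_ge0 // ?mulr_ge0 ?sqr_ge0 // ?addr_ge0 ?mulr_ge0.
rewrite -(ler_pM2l r20).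
apply: (@le_trans _ _ (a * Q * ((r ^+ 2 + D) * ((r - M) * (r + 1/2))))).
  have -> : r ^+ 2 * (a / 2 * (h * y ^+ 2 + b3 * x ^+ 2) * ((r - (m + 1/2 + 3 * D)) * (2 * r + 1)))
    = a * ((r - M) * (r + 1/2)) * (r ^+ 2 * (h * y ^+ 2 + b3 * x ^+ 2)).
    by rewrite /M; field.
  have -> : a * Q * ((r ^+ 2 + D) * ((r - M) * (r + 1/2))) =
    a * ((r - M) * (r + 1/2)) * (Q * (r ^+ 2 + D)) by ring.
  by rewrite ler_wpM2l // mulr_ge0 // ltW.
apply: (@le_trans _ _ (a * Q * ((r ^+ 2 - D) * (r ^+ 2 - m * r - D)))).
  by rewrite ler_wpM2l // mulr_ge0 // ltW.
have -> : a * Q * ((r ^+ 2 - D) * (r ^+ 2 - m * r - D)) =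
  a * (r ^+ 2 - D) * (Q * (r ^+ 2 - m * r - D)) by ring.
rewrite [leRHS]mulrCA; apply: ler_pM => //; first exact: ltW.
by rewrite mulr_ge0.
Qed.

(** At a sign change the form controls sqrt n |x y|, so the energy may exceed the Casoratian by a
    factor of order sqrt n only. The plain energy gains a b3 x^2 per step, too much when x^2
    dominates. Replacing h n by h n - a/2, its value half a step earlier, symmetrizes the gain into
    a/2 (h y^2 + b3 x^2), comparable with a/2 times the energy. *)
Lemma osc_linear (a1 b3 b2 b1 : R) : a1 < 0 -> 0 < b3 -> 0 < b2 ->
  (forall n, aff a1 b1 n != 0) ->
  forall v, sol (aff 0 b3) (aff 0 b2) (aff a1 b1) v ->
    ~ mini (aff 0 b3) (aff 0 b2) (aff a1 b1) v.
Proof.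
move=> a10 b30 b20 g10.
have [a [a0 aE]] : exists a : R, 0 < a /\ a1 = - a by exists (- a1); split; lra.
have affE b n : aff 0 b n = b by rewrite /aff mul0r add0r.
have [m [m1 mb]] : exists m : R, 1 <= m /\ b2 ^+ 2 <= 4 * m ^+ 2 * a * b3.
  have q0 : 0 <= b2 ^+ 2 / (4 * a * b3).
    by rewrite divr_ge0 ?sqr_ge0 // !mulr_ge0 // ltW.
  exists (1 + b2 ^+ 2 / (4 * a * b3)); split; first lra.
  apply: (@le_trans _ _ (4 * (1 + b2 ^+ 2 / (4 * a * b3)) * a * b3)).
    have -> : 4 * (1 + b2 ^+ 2 / (4 * a * b3)) * a * b3 = 4 * a * b3 + b2 ^+ 2 by field; lra.
    by rewrite lerDr !mulr_ge0 // ltW.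
  by rewrite !ler_pM2r // ler_pM2l // expr2 ler_peMr //; lra.
have [D [D0 HD]] : exists D : R, 0 < D /\ `|b1| + a / 2 = a * D.
  have HD : `|b1| + a / 2 = a * ((`|b1| + a / 2) / a) by field; lra.
  exists ((`|b1| + a / 2) / a); split=> //.
  by rewrite -(pmulr_rgt0 _ a0) -HD; have := normr_ge0 b1; lra.
have [M mE] : exists M : R, M = m + 1/2 + 3 * D by exists (m + 1/2 + 3 * D).
have b34 : 0 < 4 * b3 by rewrite mulr_gt0.
have ab : 0 < 4 * b3 * a by rewrite mulr_gt0.
(* Beyond e the discriminant condition (b2 + 1)^2 <= 4 b3 h n holds, which makes the form at least
   |x y|. *)
have [e [e0 eE]] : exists e : R, 0 <= e /\ 4 * b3 * a * e = (b2 + 1) ^+ 2.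
  exists ((b2 + 1) ^+ 2 / (4 * b3 * a)); split; last by field; lra.
  by rewrite divr_ge0 ?sqr_ge0 // ltW.
have [N HN] := sqn_ev (M + D + 1 + e).
have Hn n : (N <= n)%N -> [/\ M < sqn n, D < sqn n ^+ 2, 1 <= sqn n &
   (b2 + 1) ^+ 2 + 4 * b3 * a <= 4 * b3 * (a * n%:R - b1) /\ a / 2 * n%:R <= a * n%:R - b1].
  move=> /HN H; clear HN; have r1 : 1 <= sqn n by lra.
  have rr : sqn n <= sqn n ^+ 2 by rewrite expr2 ler_peMl //; lra.
  have r2 : D + e + 1 < n%:R by rewrite -(sqn_sqr n); lra.
  have nb := ler_norm b1.
  split; [lra|lra|exact: r1|split].
    have T1 : a * (D + e + 1) <= a * n%:R by rewrite ler_pM2l // ltW.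
    have T2 : a * e + a <= a * n%:R - b1 by move: T1 HD nb a0; clear; lra.
    have T3 : 4 * b3 * (a * e + a) <= 4 * b3 * (a * n%:R - b1) by rewrite ler_pM2l.
    by move: T3 eE; clear; lra.
  have r4 : 3 * D < sqn n by lra.
  have T1 : a * (2 * D) <= a * n%:R by rewrite ler_pM2l // -(sqn_sqr n); lra.
  by move: T1 HD nb a0; clear; lra.
clear HN.
have Eg1 n : aff a1 b1 n = - (a * n%:R - b1) by rewrite /aff aE; ring.
have [c1 [c10 c11 c1a c1b]] : exists c1 : R, [/\ 0 < c1, c1 <= 1, c1 <= b3 & c1 <= a / 2].
  exists (Num.min 1 (Num.min b3 (a / 2))); split.
  - by rewrite !lt_min ltr01 b30 /=; lra.
  - by rewrite ge_min lexx.
  - by rewrite !ge_min lexx orbT.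
  - by rewrite !ge_min lexx !orbT.
apply: (@oscillating_not_mini _ _ _ _ c1 b3 (fun n => sqn n - M) N) => //.
- by move=> n; rewrite affE gt_eqF.
- move=> n /Hn[h1 h2 h3 [h4 h5]]; rewrite !affE Eg1; split=> //.
  + by rewrite ler_peMr ?ler1n // ltW.
  + rewrite oppr_lt0 -(pmulr_rgt0 _ b34); have := sqr_ge0 (b2 + 1).
    by move: h4 ab; clear; lra.
  + by rewrite subr_gt0.
- move=> n x y /Hn[h1 h2 h3 [h4 h5]]; rewrite !affE Eg1.
  apply: (@le_trans _ _ `|x * y|); first by rewrite ler_piMl.
  rewrite /qform; move: h4; set h := a * n%:R - b1 => h4.
  have T : (b2 + 1) * `|x * y| <= b3 * x ^+ 2 + h * y ^+ 2.
    rewrite -subr_ge0 -(pmulr_rge0 _ b34).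
    have -> : 4 * b3 * (b3 * x ^+ 2 + h * y ^+ 2 - (b2 + 1) * `|x * y|) =
      (2 * b3 * `|x| - (b2 + 1) * `|y|) ^+ 2 + (4 * b3 * h - (b2 + 1) ^+ 2) * `|y| ^+ 2.
      by rewrite normrM -(real_normK (num_real x)) -(real_normK (num_real y)); ring.
    by rewrite addr_ge0 ?sqr_ge0 // mulr_ge0 ?sqr_ge0 //; move: h4 ab; clear; lra.
  have : b2 * (x * y) <= b2 * `|x * y| by rewrite ler_pM2l // ler_norm.
  by move: T; clear; lra.
- move=> n x y /Hn[h1 h2 h3 [h4 h5]] xy; rewrite !affE Eg1.
  have M0 : 0 <= M by move: mE m1 D0; clear; lra.
  have T1 : c1 * ((sqn n - M) * `|x * y|) <= c1 * (sqn n * `|x * y|).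
    by rewrite ler_pM2l // ler_wpM2r // gerBl.
  apply: le_trans T1 _; rewrite ler0_norm //.
  have c2 : c1 / 2 * (x + sqn n * y) ^+ 2 >= 0 by rewrite mulr_ge0 ?sqr_ge0 // divr_ge0 // ltW.
  have E : c1 / 2 * (x + sqn n * y) ^+ 2 =
    c1 / 2 * x ^+ 2 + c1 * (sqn n * (x * y)) + c1 / 2 * n%:R * y ^+ 2.
    by rewrite -sqn_sqr; field.
  have X2 : c1 * x ^+ 2 <= b3 * x ^+ 2 by rewrite ler_wpM2r // sqr_ge0.
  have Y2 : c1 * (n%:R * y ^+ 2) <= a / 2 * (n%:R * y ^+ 2).
    by rewrite ler_wpM2r // mulr_ge0 // sqr_ge0.
  have Y3 : a / 2 * n%:R * y ^+ 2 <= (a * n%:R - b1) * y ^+ 2 by rewrite ler_wpM2r // sqr_ge0.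
  have X0 : 0 <= c1 * x ^+ 2 by rewrite mulr_ge0 ?sqr_ge0 // ltW.
  have Y0 : 0 <= c1 * (n%:R * y ^+ 2) by apply: mulr_ge0; [exact: ltW|rewrite mulr_ge0 // sqr_ge0].
  have B0 : 0 <= - (b2 * (x * y)) by rewrite -mulrN mulr_ge0 ?oppr_ge0 // ltW.
  by rewrite /qform; move: c2 E X2 Y2 Y3 X0 Y0 B0; clear; lra.
- move=> w P Hw HP.
  pose h n : R := a * n%:R - b1.
  pose E n : R := b3 * w n.+1 ^+ 2 - b2 * w n.+1 * w n + (h n - a / 2) * w n ^+ 2.
  have [P0 _] := HP N (leqnn N); have [rN _ _ _] := Hn N (leqnn N).
  have step n : (N <= n)%N -> b3 * (E n.+1) * (sqn n - M) <= h n * E n * (sqn n.+1 - M).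
    move=> Nn; have [h1 h2 h3 [h4 h5]] := Hn n Nn.
    have [s1 s2] := sqn_S n; have [_ s3] := sqn_S n.+1.
    have m0 : 0 <= m by apply: le_trans m1.
    have := @osc_linear_step a b3 b2 b1 m D (sqn n) (w n.+1) (w n) a0 b30 m0 mb HD h3 h2.
    rewrite -mE sqn_sqr -/(h n) -/(E n) => /(_ h1) K.
    have EE : b3 * E n.+1 = h n * E n + a / 2 * (h n * w n ^+ 2 + b3 * w n.+1 ^+ 2).
      have := Hw n; rewrite !affE Eg1 -/(h n) => W.
      have -> : E n.+1 = b3 * w n.+2 ^+ 2 - b2 * w n.+2 * w n.+1 + (h n + a / 2) * w n.+1 ^+ 2.
        by rewrite /E /h -natr1; field.
      have -> : w n.+2 = (b2 * w n.+1 - h n * w n) / b3.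
        by rewrite -mulNr -W; field; rewrite gt_eqF.
      by rewrite /E; field; rewrite gt_eqF.
    rewrite EE; have -> : sqn n.+1 - M = (sqn n - M) + (sqn n.+1 - sqn n) by ring.
    have s4 : 0 < sqn n.+1 + sqn n by move: s3 h3; clear; lra.
    have dr : sqn n.+1 - sqn n = (sqn n.+1 + sqn n)^-1.
      have s5 : sqn n.+1 + sqn n != 0 by rewrite gt_eqF.
      apply: (mulIf s5); rewrite mulVf //.
      transitivity (sqn n.+1 ^+ 2 - sqn n ^+ 2); first by ring.
      by rewrite !sqn_sqr -natr1; ring.
    have r21 : 0 < 2 * sqn n + 1 by move: s2; clear; lra.
    have dr2 : (2 * sqn n + 1)^-1 <= sqn n.+1 - sqn n.
      by rewrite dr lef_pV2 ?posrE //; move: s1; clear; lra.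
    have h6 : 0 <= h n.
      apply: le_trans h5; rewrite mulr_ge0 //; move: a0; clear; lra.
    have rM : 0 <= sqn n - M by rewrite subr_ge0 ltW.
    have hE0 : 0 <= h n * E n.
      apply: le_trans K; apply: mulr_ge0; last first.
        by apply: mulr_ge0 => //; exact: ltW.
      apply: mulr_ge0; first by rewrite divr_ge0 // ltW.
      apply: addr_ge0; first by rewrite mulr_ge0 // sqr_ge0.
      by apply: mulr_ge0; [exact: ltW|exact: sqr_ge0].
    rewrite [leLHS]mulrDl [leRHS]mulrDr lerD2l.
    apply: (@le_trans _ _ (h n * E n * (2 * sqn n + 1)^-1)); last by rewrite ler_wpM2l.
    by rewrite ler_pdivlMr // -[leLHS]mulrA.
  pose K := `|E N| / ((sqn N - M) * P N).
  have rN0 : 0 < sqn N - M by rewrite subr_gt0.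
  have HE n : (N <= n)%N -> E n <= K * ((sqn n - M) * P n).
    move=> Nn; rewrite -(subnKC Nn); elim: (n - N)%N => [|k IH].
      by rewrite addn0 /K mulfVK ?ler_norm // mulf_neq0 // gt_eqF.
    have Ni : (N <= N + k)%N by exact: leq_addr.
    rewrite addnS; move: (N + k)%N Ni IH => i Ni IH.
    have [h1 h2 h3 [h4 h5]] := Hn i Ni.
    have [|k1 _ _ _] := Hn i.+1; first exact: leqW.
    have [Pi PE] := HP i Ni; move: PE; rewrite !affE Eg1 opprK -/(h i) => PE.
    have ri : 0 < sqn i - M by rewrite subr_gt0.
    have ri1 : 0 < sqn i.+1 - M by rewrite subr_gt0.
    have hi : 0 < h i.
      by have := mulr_gt0 b30 (HP i.+1 (leqW Ni)).1; rewrite PE pmulr_lgt0.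
    rewrite -(ler_pM2l b30) -(ler_pM2r ri); apply: le_trans (step i Ni) _.
    have -> : b3 * (K * ((sqn i.+1 - M) * P i.+1)) * (sqn i - M) =
       h i * (K * ((sqn i - M) * P i)) * (sqn i.+1 - M).
      transitivity (K * (sqn i.+1 - M) * (sqn i - M) * (b3 * P i.+1)); first by ring.
      by rewrite PE; ring.
    by rewrite ler_pM2r // ler_pM2l.
  exists (2 * K) => n Nn; have HEn := HE n Nn.
  have [_ _ _ [h4 _]] := Hn n Nn.
  rewrite !affE Eg1 -/(h n) in h4 *.
  have T : a / 2 * w n ^+ 2 <= E n.
    rewrite -subr_ge0 -(pmulr_rge0 _ b34).
    have -> : 4 * b3 * (E n - a / 2 * w n ^+ 2) =
      (2 * b3 * w n.+1 - b2 * w n) ^+ 2 + (4 * b3 * h n - 4 * b3 * a - b2 ^+ 2) * w n ^+ 2.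
      by rewrite /E; field.
    rewrite addr_ge0 ?sqr_ge0 // mulr_ge0 ?sqr_ge0 //.
    by move: h4 b20; clear; rewrite sqrrD1 -mulr_natr; lra.
  have -> : qform b3 b2 (- h n) (w n.+1) (w n) = E n + a / 2 * w n ^+ 2.
    by rewrite /qform /E; field.
  by rewrite -[2 * K * _]mulrA; move: T HEn; clear; lra.
Qed.
End OscillationLowDegree.
End OscillationLowDegree.


Module AffineRecurrences.
Require Import Defs.
Import Recursive LinearRecurrences SubdominantGrowth Oscillation OscillationLowDegree.
From mathcomp Require Import all_boot all_order all_algebra.
From mathcomp Require Import all_classical all_reals all_analysis.
From mathcomp Require Import zify ring lra.
Set Implicit Arguments.
Unset Strict Implicit.
Unset Printing Implicit Defensive.
Import Order.TTheory GRing.Theory Num.Theory numFieldNormedType.Exports.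
Local Open Scope ring_scope.

(** * Transformations of recurrences with affine coefficients *)

Section Affine.
Variable R : realType.
Implicit Types (v w m u : nat -> R) (a b : R).

Definition asol a3 b3 a2 b2 a1 b1 := sol (aff a3 b3) (aff a2 b2) (aff a1 b1).
Definition amini a3 b3 a2 b2 a1 b1 := mini (aff a3 b3) (aff a2 b2) (aff a1 b1).

Lemma aff_succ a b : aff a b \o succn = aff a (a + b).
Proof. by apply/funext => n; rewrite /aff /= -natr1; ring. Qed.

Lemma amini_shift a3 b3 a2 b2 a1 b1 v :
  (forall n, aff a3 b3 n != 0) -> (forall n, aff a1 b1 n != 0) ->
  asol a3 b3 a2 b2 a1 b1 v ->
  asol a3 (a3 + b3) a2 (a2 + b2) a1 (a1 + b1) (v \o succn) /\
  (amini a3 b3 a2 b2 a1 b1 v <->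
   amini a3 (a3 + b3) a2 (a2 + b2) a1 (a1 + b1) (v \o succn)).
Proof.
move=> g3 g1 Hv; rewrite /asol /amini -!aff_succ; split; first by move=> n; exact: Hv.
exact: mini_shift.
Qed.

(* The gauge [c n] with [c n.+1 / c n = g1 n / g3 (n - 1)] exchanges the outer coefficients. *)
Lemma amini_swap a3 b3 a2 b2 a1 b1 v : b3 - a3 != 0 ->
  (forall n, aff a3 b3 n != 0) -> (forall n, aff a1 b1 n != 0) ->
  asol a3 b3 a2 b2 a1 b1 v ->
  exists u, [/\ asol a1 (a1 + b1) a2 b2 a3 (b3 - a3) u,
    u 0%N = v 0%N * b1, u 1%N = v 1%N * (b3 - a3) &
    amini a3 b3 a2 b2 a1 b1 v <-> amini a1 (a1 + b1) a2 b2 a3 (b3 - a3) u].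
Proof.
move=> b30 g3 g1 Hv; have b10 : b1 != 0 by have := g1 0%N; rewrite /aff mulr0 add0r.
have g3' n : aff a3 (b3 - a3) n != 0.
  case: n => [|n]; first by rewrite /aff mulr0 add0r.
  by have := g3 n; congr (_ != _); rewrite /aff -natr1; ring.
pose c := fix c n : R := if n is k.+1 then c k * aff a1 b1 k / aff a3 (b3 - a3) k
  else b1^-1.
have c0 n : c n != 0.
  elim: n => [|n IH] /=; first by rewrite invr_eq0.
  by rewrite !mulf_neq0 // invr_eq0.
have cS n : c n.+2 = c n.+1 * aff a1 (a1 + b1) n / aff a3 b3 n.
  by rewrite -[c n.+2]/(c n.+1 * aff a1 b1 n.+1 / aff a3 (b3 - a3) n.+1); congr (_ * _ / _);
    rewrite /aff -natr1; ring.
have H3 n : aff a1 (a1 + b1) n = (c n.+1)^-1 * aff a3 b3 n * c n.+2.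
  by rewrite cS; field; rewrite c0 g3.
have H2 n : aff a2 b2 n = (c n.+1)^-1 * aff a2 b2 n * c n.+1 by field; exact: c0.
have H1 n : aff a3 (b3 - a3) n = (c n.+1)^-1 * aff a1 b1 n * c n.
  by rewrite /=; field; rewrite c0 g1 g3'.
exists (fun n => v n / c n); split.
- exact: (sol_gauge c0 H3 H2 H1 Hv).
- by rewrite /= invrK.
- by rewrite /= /aff mulr0 !add0r; field; rewrite b10 b30.
- by apply: (mini_gauge _ c0 _ H3 H2 H1) => n; rewrite invr_eq0.
Qed.

Lemma amini_flip a3 b3 a2 b2 a1 b1 v : asol a3 b3 a2 b2 a1 b1 v ->
  exists u, [/\ asol a3 b3 (- a2) (- b2) a1 b1 u, u 0%N = v 0%N, u 1%N = - v 1%N &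
    amini a3 b3 a2 b2 a1 b1 v <-> amini a3 b3 (- a2) (- b2) a1 b1 u].
Proof.
move=> Hv; pose c n : R := (-1) ^+ n.
have c0 n : c n != 0 by rewrite signr_eq0.
have cc n : c n * c n = 1 by rewrite -expr2 sqrr_sign.
have H3 n : aff a3 b3 n = c n * aff a3 b3 n * c n.+2.
  by rewrite /c !exprS !mulN1r opprK mulrAC cc mul1r.
have H2 n : aff (- a2) (- b2) n = c n * aff a2 b2 n * c n.+1.
  by rewrite /c exprS mulN1r mulrN mulrAC cc mul1r /aff; ring.
have H1 n : aff a1 b1 n = c n * aff a1 b1 n * c n by rewrite mulrAC cc mul1r.
exists (fun n => v n / c n); split.
- exact: (sol_gauge c0 H3 H2 H1 Hv).
- by rewrite /c expr0 divr1.
- by rewrite /c expr1 invrN1 mulrN1.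
- exact: (mini_gauge _ c0 c0 H3 H2 H1).
Qed.

Lemma amini_neg a3 b3 a2 b2 a1 b1 v :
  (asol a3 b3 a2 b2 a1 b1 v <-> asol (- a3) (- b3) (- a2) (- b2) (- a1) (- b1) v) /\
  (amini a3 b3 a2 b2 a1 b1 v <-> amini (- a3) (- b3) (- a2) (- b2) (- a1) (- b1) v).
Proof.
have affN a b n : aff (- a) (- b) n = - aff a b n by rewrite /aff; ring.
have H w : asol a3 b3 a2 b2 a1 b1 w <-> asol (- a3) (- b3) (- a2) (- b2) (- a1) (- b1) w.
  by split=> Hw n; have := Hw n; rewrite !affN => E; lra.
split; first exact: H.
by split=> -[v0 [w [Hw dvw]]]; split=> //; exists w; split=> //; apply/H.
Qed.

(* [A(S) v] for the shift operator [S] and [A = a3 X^2 - a2 X - a1]. *)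
Definition ashift a3 a2 a1 v n : R := a3 * v n.+2 - a2 * v n.+1 - a1 * v n.

(** Write the recurrence as (n A(S) + B(S)) v = 0. The commutation rule A(S) n = n A(S) + S A'(S)
    gives (n A + B + S A') (A v) = 0, and S A' = 2 a3 S^2 - a2 S. *)
Lemma ashift_sol a3 b3 a2 b2 a1 b1 v : asol a3 b3 a2 b2 a1 b1 v ->
  asol a3 (b3 + 2 * a3) a2 (b2 + a2) a1 b1 (ashift a3 a2 a1 v).
Proof.
move=> Hv n; have := Hv n; have := Hv n.+1; have := Hv n.+2.
rewrite /aff -(natr1 n.+1) -(natr1 n) => E2 E1 E0; apply/eqP; rewrite -subr_eq0; apply/eqP.
transitivity (a3 * ((a3 * (n%:R + 1 + 1) + b3) * v n.+4 -
    ((a2 * (n%:R + 1 + 1) + b2) * v n.+3 + (a1 * (n%:R + 1 + 1) + b1) * v n.+2))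
  - a2 * ((a3 * (n%:R + 1) + b3) * v n.+3 -
    ((a2 * (n%:R + 1) + b2) * v n.+2 + (a1 * (n%:R + 1) + b1) * v n.+1))
  - a1 * ((a3 * n%:R + b3) * v n.+2 -
    ((a2 * n%:R + b2) * v n.+1 + (a1 * n%:R + b1) * v n))).
  by rewrite /ashift; ring.
by rewrite E2 E1 E0 !subrr !mulr0 !subr0.
Qed.

Lemma small_ashift (al : R) a3 a2 a1 v : 0 < al -> small al v -> small al (ashift a3 a2 a1 v).
Proof.
move=> al0 Sv.
have S1 := small_shift al0 Sv; have S2 := small_shift al0 S1.
have := small_lin al0 1 (- a1) (small_lin al0 a3 (- a2) S2 S1) Sv.
by congr small; apply/funext => n; rewrite /ashift; ring.
Qed.

(** Here A(S) = - a2 (S - al), so v satisfies a first-order recurrence with a small source. *)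
Lemma ashift_small_lin (al : R) a2 a1 v : 0 < al -> a2 != 0 -> a1 = - a2 * al ->
  small al (ashift 0 a2 a1 v) -> small al v.
Proof.
move=> al0 a20 e1 S.
apply: (@small_sum _ al al0 v (fun n => - a2^-1 * ashift 0 a2 a1 v n + 0 * v n)).
  by move=> n; rewrite /ashift e1; field.
rewrite (_ : (fun _ => _) = fun n => - a2^-1 * ashift 0 a2 a1 v n + 0 * ashift 0 a2 a1 v n).
  exact: small_lin.
by apply/funext => n; rewrite !mul0r.
Qed.

(* If [l = B - (b3/a3) A] then [(X - al) l be = (X - al) l - (l' / a3) A]. *)
Lemma ashift_small_quad (al be : R) a3 b3 a2 b2 a1 b1 v : 0 < al -> a3 != 0 ->
  a2 = a3 * (al + be) -> a1 = - a3 * al * be ->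
  b3 * be ^+ 2 - b2 * be - b1 != 0 ->
  asol a3 b3 a2 b2 a1 b1 v -> small al (ashift a3 a2 a1 v) -> small al v.
Proof.
move=> al0 a30 e2 e1 Bb Hv S; pose c := b3 / a3.
pose u := - b2 + c * a2; pose t := - b1 + c * a1.
have lb : u * be + t = b3 * be ^+ 2 - b2 * be - b1.
  by rewrite /u /t /c e2 e1; field.
pose s n : R := (-1 * n%:R + - c) * ashift a3 a2 a1 v n.
have sE n : u * v n.+1 + t * v n = s n.
  have := Hv n; rewrite /aff => E; rewrite /s /u /t /ashift.
  apply/eqP; rewrite -subr_eq0; apply/eqP.
  transitivity ((a3 * n%:R + b3) * v n.+2 - ((a2 * n%:R + b2) * v n.+1 + (a1 * n%:R + b1) * v n)).
    by rewrite /c; field.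
  by rewrite E subrr.
have Ss : small al s by exact: small_affine.
have Ss1 : small al (fun n => s n.+1) by exact: (small_shift al0 Ss).
pose l := u * be + t; have l0 : l != 0 by rewrite /l lb.
apply: (@small_sum _ al al0 v (fun n => l^-1 * (1 * s n.+1 + - al * s n) +
   (- (u / a3) / l) * ashift a3 a2 a1 v n)).
  move=> n; rewrite -!sE /ashift e2 e1; move: l0; rewrite /l => l0.
  by field; rewrite a30 l0.
exact: (small_lin al0 _ _ (small_lin al0 _ _ Ss1 Ss) S).
Qed.

Lemma iter_ashift_sol a3 b3 a2 b2 a1 b1 k v : asol a3 b3 a2 b2 a1 b1 v ->
  asol a3 (b3 + 2 * a3 * k%:R) a2 (b2 + a2 * k%:R) a1 b1 (iter k (ashift a3 a2 a1) v).
Proof.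
move=> Hv; elim: k => [|k IH]; first by rewrite !mulr0 !addr0.
have := ashift_sol IH; rewrite -(natr1 k) /=.
have -> : b3 + 2 * a3 * k%:R + 2 * a3 = b3 + 2 * a3 * (k%:R + 1) by ring.
by have -> : b2 + a2 * k%:R + a2 = b2 + a2 * (k%:R + 1) by ring.
Qed.

(** The integral m may converge only after K applications of A(S). A small nonzero solution is
    pulled back level by level: some nonzero combination of two basic solutions has an image
    proportional to the small solution above, so the image is small, and by hypothesis so is its
    source. Hence minimality of v means smallness, which can be tested on A(S)^K v against m. *)
Lemma mini_ashift (al a3 b3 a2 b2 a1 b1 : R) K m : 0 < al ->
  (forall k n, aff a3 (b3 + 2 * a3 * k%:R) n != 0) ->
  (forall n, aff a1 b1 n != 0) ->
  (forall k, grows al (aff a3 (b3 + 2 * a3 * k%:R)) (aff a2 (b2 + a2 * k%:R)) (aff a1 b1)) ->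
  (forall k w, (k < K)%N -> asol a3 (b3 + 2 * a3 * k%:R) a2 (b2 + a2 * k%:R) a1 b1 w ->
     small al (ashift a3 a2 a1 w) -> small al w) ->
  asol a3 (b3 + 2 * a3 * K%:R) a2 (b2 + a2 * K%:R) a1 b1 m ->
  (exists n, m n != 0) -> small al m ->
  forall v, asol a3 b3 a2 b2 a1 b1 v ->
  amini a3 b3 a2 b2 a1 b1 v <->
    (v 0%N != 0 \/ v 1%N != 0) /\
    let u := iter K (ashift a3 a2 a1) v in u 1%N * m 0%N - u 0%N * m 1%N = 0.
Proof.
move=> al0 g3 g1 Hg Hs Hm m0 Sm v Hv.
have down k : (k <= K)%N -> exists m', [/\
    asol a3 (b3 + 2 * a3 * (K - k)%:R) a2 (b2 + a2 * (K - k)%:R) a1 b1 m',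
    (exists n, m' n != 0) & small al m'].
  elim: k => [|k IH] kK; first by exists m; rewrite subn0.
  have [m' [Hm' m'0 Sm']] := IH (ltnW kK).
  have E : (K - k = (K - k.+1).+1)%N by rewrite subnSK.
  move: Hm'; rewrite E; set j := (K - k.+1)%N => Hm'.
  have jK : (j < K)%N by rewrite /j ltn_subrL /=; exact: leq_ltn_trans kK.
  have step w : asol a3 (b3 + 2 * a3 * j%:R) a2 (b2 + a2 * j%:R) a1 b1 w ->
      asol a3 (b3 + 2 * a3 * j.+1%:R) a2 (b2 + a2 * j.+1%:R) a1 b1 (ashift a3 a2 a1 w).
    move=> /ashift_sol; rewrite -(natr1 j).
    have -> : b3 + 2 * a3 * j%:R + 2 * a3 = b3 + 2 * a3 * (j%:R + 1) by ring.
    by have -> : b2 + a2 * j%:R + a2 = b2 + a2 * (j%:R + 1) by ring.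
  have [e1 [E1 e10 e11]] := sol_ex (aff a2 (b2 + a2 * j%:R)) (aff a1 b1) (g3 j) 1 0.
  have [e2 [E2 e20 e21]] := sol_ex (aff a2 (b2 + a2 * j%:R)) (aff a1 b1) (g3 j) 0 1.
  pose x1 := cas (ashift a3 a2 a1 e1) m' 0; pose x2 := cas (ashift a3 a2 a1 e2) m' 0.
  have [p [q [pq E0]]] : exists p q : R, (p != 0 \/ q != 0) /\ p * x1 + q * x2 = 0.
    have [z|z] := eqVneq x2 0; last by exists x2, (- x1); split; [left|ring].
    by exists 0, 1; split; [right; rewrite oner_eq0|rewrite z; ring].
  pose w n := p * e1 n + q * e2 n.
  have Hw : asol a3 (b3 + 2 * a3 * j%:R) a2 (b2 + a2 * j%:R) a1 b1 w by exact: sol_lin.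
  exists w; split=> //.
    case: pq => h; [exists 0%N|exists 1%N].
      by rewrite /w e10 e20 mulr0 mulr1 addr0.
    by rewrite /w e11 e21 mulr0 mulr1 add0r.
  apply: (Hs j) => //.
  apply/(small_cas al0 (g3 j.+1) g1 (Hg j.+1) Hm' m'0 Sm' (step _ Hw)).
  by rewrite -E0 /x1 /x2 /cas /w /ashift; ring.
have [m' [Hm' m'0 Sm']] := down K (leqnn K).
move: Hm'; rewrite subnn !mulr0 !addr0 => Hm'.
have Hg0 := Hg 0%N; rewrite !mulr0 !addr0 in Hg0.
have g30 : forall n, aff a3 b3 n != 0 by move=> n; have := g3 0%N n; rewrite mulr0 addr0.
have HK := iter_ashift_sol K Hv.
have iff k : (k <= K)%N -> small al v <-> small al (iter k (ashift a3 a2 a1) v).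
  elim: k => // k IH kK; rewrite (IH (ltnW kK)) /=; split; first exact: small_ashift.
  by apply: (Hs k) => //; exact: iter_ashift_sol.
rewrite /amini (mini_small al0 g30 g1 Hg0 Hm' m'0 Sm' Hv) (iff K (leqnn K)).
rewrite (small_cas al0 (g3 K) g1 (Hg K) Hm m0 Sm HK) /cas /=.
exact: iff_refl.
Qed.

End Affine.
End AffineRecurrences.


Module HalfLineIntegrals.
Require Import Defs.
From mathcomp Require Import all_boot all_order all_algebra.
From mathcomp Require Import all_classical all_reals all_analysis.
From mathcomp Require Import measurable_realfun.
From mathcomp Require Import zify ring lra.
Set Implicit Arguments.
Unset Strict Implicit.
Unset Printing Implicit Defensive.
Import Order.TTheory GRing.Theory Num.Theory numFieldNormedType.Exports.
Local Open Scope classical_set_scope.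
Local Open Scope ring_scope.

(** * Integrals over the half-line *)

Section HalfLine.
Variable R : realType.
Implicit Types (f g h H K k : R -> R) (x y : R).
Local Notation mu := (@lebesgue_measure R).

Definition pos : set (measurableTypeR R) := `]0, +oo[%classic.

Lemma posE x : pos x = (0 < x) :> Prop.
Proof. by rewrite /pos /= in_itv /= andbT. Qed.

Lemma mpos : measurable pos. Proof. exact: measurable_itv. Qed.

Definition smooth f := forall y, 0 < y -> derivable f y 1.

Lemma derivable_continuous f x : derivable f x 1 -> {for x, continuous f}.
Proof. by move=> /derivable1_diffP/differentiable_continuous. Qed.

Lemma smooth_measurable f : smooth f -> measurable_fun pos f.
Proof.
move=> sf; apply: subspace_continuous_measurable_fun; first exact: mpos.
apply: continuous_in_subspaceT => x; rewrite inE posE => x0.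
exact/derivable_continuous/sf.
Qed.

Lemma is_derive_exp n x : is_derive x 1 (fun x : R => x ^+ n) (n%:R * x ^+ n.-1).
Proof.
elim: n => [|n IH].
  have -> : (fun x : R => x ^+ 0) = cst 1 by apply/funext => y; rewrite expr0.
  by rewrite mul0r; exact: is_derive_cst.
have -> : (fun x : R => x ^+ n.+1) = (fun x => x * x ^+ n).
  by apply/funext => y; rewrite exprS.
apply: is_derive_eq; rewrite /= -(natr1 n) /GRing.scale /=.
case: n {IH} => [|n]; first by rewrite !expr0; ring.
by rewrite -pred_Sn !exprS; ring.
Qed.

Lemma is_derive_derivable f x (d : R) : is_derive x 1 f d -> derivable f x 1.
Proof. by case. Qed.

Lemma is_derive_val f x (d : R) : is_derive x 1 f d -> 'D_1 f x = d.
Proof. by case. Qed.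

(** Integrability is assumed, so dominated convergence along [1 / (n + 1), n + 2] covers integrands
    of changing sign, with nothing required at 0 itself but the limit of K. *)
Lemma FTC_pos K k (l0 l1 : R) : (forall x, 0 < x -> is_derive x 1 K (k x)) ->
  smooth k -> mu.-integrable pos (EFin \o k) ->
  K x @[x --> 0^'+] --> l0 -> K x @[x --> +oo] --> l1 ->
  \int[mu]_(x in pos) k x = l1 - l0.
Proof.
move=> HK sk ik K0 K1.
pose a n : R := n.+1%:R^-1; pose b n : R := n.+2%:R.
have a0 n : 0 < a n by rewrite invr_gt0.
have ab n : a n < b n.
  apply: (@le_lt_trans _ _ 1); first by rewrite invf_le1 // ler1n.
  by rewrite ltr1n.
pose S n : set (measurableTypeR R) := `[a n, b n]%classic.
have Sp n : S n `<=` pos.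
  move=> x; rewrite /S /= in_itv /= posE => /andP[ax _].
  exact: lt_le_trans ax.
have E n : (\int[mu]_(x in S n) (k x)%:E = (K (b n))%:E - (K (a n))%:E)%E.
  have cK x : a n <= x -> {for x, continuous K}.
    move=> ax; have x0 : 0 < x by exact: lt_le_trans ax.
    exact: derivable_continuous (is_derive_derivable (HK x x0)).
  apply: continuous_FTC2 => //.
  - apply: continuous_in_subspaceT => x; rewrite inE => /Sp; rewrite posE => x0.
    exact/derivable_continuous/sk.
  - split=> [x||].
    + rewrite in_itv /= => /andP[ax _].
      exact: is_derive_derivable (HK x (lt_trans (a0 n) ax)).
    + exact/cvg_at_right_filter/cK.
    + apply/cvg_at_left_filter/cK; exact: ltW.
  - move=> x; rewrite in_itv /= => /andP[ax _].
    by rewrite derive1E; exact: is_derive_val (HK x (lt_trans (a0 n) ax)).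
have mS n : measurable (S n) by exact: measurable_itv.
have mk : measurable_fun pos (EFin \o k) by apply/measurable_EFinP; exact: smooth_measurable.
have mS' n : measurable_fun pos ((EFin \o k) \_ (S n)).
  apply: (proj1 (measurable_restrict (EFin \o k) (mS n) mpos)).
  by apply: measurable_funS mk; [exact: mpos|exact: subIsetl].
have cv : {ae mu, forall x, pos x ->
    ((EFin \o k) \_ (S n)) x @[n --> \oo] --> (EFin \o k) x}.
  apply: aeW => x px; apply: cvg_near_cst; rewrite posE in px.
  near=> n; rewrite /patch ifT // inE /S /= in_itv /=; apply/andP; split.
    rewrite /a -[leRHS]invrK lef_pV2 ?posrE ?invr_gt0 //.
    apply: (@le_trans _ _ n%:R); last by rewrite ler_nat.
    by near: n; exact: nbhs_infty_ger.
  apply: (@le_trans _ _ n%:R); last by rewrite /b ler_nat -addn2 leq_addr.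
  by near: n; exact: nbhs_infty_ger.
have dom : {ae mu, forall x n, pos x ->
    (`|((EFin \o k) \_ (S n)) x| <= (abse \o (EFin \o k)) x)%E}.
  apply: aeW => x n _; rewrite /patch; case: ifP => // _.
  by rewrite abse0 abse_ge0.
have [_ _ C] := dominated_convergence mpos mS' mk cv (integrable_abse ik) dom.
have C1 : (K (b n) - K (a n)) @[n --> \oo] --> \int[mu]_(x in pos) k x.
  have E' n : (\int[mu]_(x in pos) ((EFin \o k) \_ (S n)) x)%E = (K (b n) - K (a n))%:E.
    by rewrite -integral_mkcondr (setIidr (@Sp n)) EFinB -E.
  have fin : (\int[mu]_(x in pos) (EFin \o k) x)%E \is a fin_num.
    by apply: integrable_fin_num => //; exact: mpos.
  move: C; rewrite -{1}(fineK fin) => /fine_cvg; apply: cvg_trans.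
  rewrite (_ : (fun n => K (b n) - K (a n)) = fine \o
    (fun n => (\int[mu]_(x in pos) ((EFin \o k) \_ (S n)) x)%E)) //.
  by apply/funext => n /=; rewrite E'.
have C2 : (K (b n) - K (a n)) @[n --> \oo] --> l1 - l0.
  apply: cvgB.
    move/cvg_pinftyP : K1; apply; apply/cvgryPge => M; near=> n.
    apply: (@le_trans _ _ n%:R); last by rewrite /b ler_nat -addn2 leq_addr.
    by near: n; exact: nbhs_infty_ger.
  move/cvg_at_rightP : K0; apply; split=> //.
  exact: cvg_harmonic.
by rewrite -(cvg_lim _ C1) // (cvg_lim _ C2).
Unshelve. all: by end_near.
Qed.

(* [f |-> \int_(x > 0) f(x^D) d(x^D)]: the substitution y = x^D makes rational powers of y polynomial. *)
Section Power.
Variable D : nat.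
Hypothesis D0 : (0 < D)%N.

Definition wgt x : R := D%:R * x ^+ D.-1.
Definition IO f : R := \int[mu]_(x in pos) (f (x ^+ D) * wgt x).
Definition ig f := mu.-integrable pos (EFin \o (fun x => f (x ^+ D) * wgt x)).

Lemma wgt_gt0 x : 0 < x -> 0 < wgt x.
Proof. by move=> x0; rewrite mulr_gt0 ?ltr0n // exprn_gt0. Qed.

Lemma is_derive_pow f x (d : R) : 0 < x -> is_derive (x ^+ D) 1 f d ->
  is_derive x 1 (fun x => f (x ^+ D)) (d * wgt x).
Proof.
by move=> x0 Hf; exact: (@is_derive1_comp R f (fun x => x ^+ D) x _ _ Hf (is_derive_exp D x)).
Qed.

Lemma smooth_wgt f : smooth f -> smooth (fun x => f (x ^+ D) * wgt x).
Proof.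
move=> sf x x0; apply: derivableM; last first.
  apply: derivableM => //; exact: is_derive_derivable (is_derive_exp _ x).
have xD : 0 < x ^+ D by rewrite exprn_gt0.
have H : is_derive (x ^+ D) 1 f ('D_1 f (x ^+ D)) by split=> //; exact: sf.
exact: is_derive_derivable (is_derive_pow x0 H).
Qed.

Lemma pow_pinfty H (l : R) : H y @[y --> +oo] --> l -> H (x ^+ D) @[x --> +oo] --> l.
Proof.
move=> H1; apply/cvg_pinftyP => u uc; move/cvg_pinftyP : H1; apply.
move/cvgryPge : uc => uc; apply/cvgryPge => M.
have : \forall n \near \oo, `|M| + 1 <= u n by exact: uc.
apply: filterS => n un; have := ler_norm M => M0.
have u1 : 1 <= u n by have := normr_ge0 M; lra.
apply: (@le_trans _ _ (u n)); first lra.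
by rewrite -[leLHS]expr1 ler_weXn2l.
Qed.

Lemma IO_FTC H h (l0 l1 : R) : (forall y, 0 < y -> is_derive y 1 H (h y)) -> smooth h -> ig h ->
  H y @[y --> 0^'+] --> l0 -> H y @[y --> +oo] --> l1 -> IO h = l1 - l0.
Proof.
move=> HH sh ih H0 H1.
apply: (FTC_pos (K := fun x => H (x ^+ D))) => //.
- by move=> x x0; apply: is_derive_pow => //; apply: HH; rewrite exprn_gt0.
- exact: smooth_wgt.
- apply/cvg_at_rightP => u [u0 uc]; move/cvg_at_rightP : H0; apply; split.
    by move=> n; rewrite exprn_gt0.
  have c := derivable_continuous (is_derive_derivable (is_derive_exp D 0)).
  have := cvg_comp _ _ uc c.
  by rewrite expr0n gtn_eqF.
- exact: pow_pinfty.
Qed.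

Lemma ig_le f g : smooth f -> ig g -> (forall y, 0 < y -> `|f y| <= `|g y|) -> ig f.
Proof.
move=> sf Ig fg; apply: le_integrable Ig => //; first exact: mpos.
  by apply/measurable_EFinP; apply: smooth_measurable; exact: smooth_wgt.
move=> x /=; rewrite posE => x0; rewrite lee_fin !normrM ler_wpM2r // fg //.
by rewrite exprn_gt0.
Qed.

Lemma IO_lin (a b : R) f g : ig f -> ig g ->
  ig (fun y => a * f y + b * g y) /\ IO (fun y => a * f y + b * g y) = a * IO f + b * IO g.
Proof.
move=> If Ig.
have Ia := integrableZl mpos a If; have Ib := integrableZl mpos b Ig.
have E : (fun x => (a * f (x ^+ D) + b * g (x ^+ D)) * wgt x) =
  (fun x => a * (f (x ^+ D) * wgt x) + b * (g (x ^+ D) * wgt x)).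
  by apply/funext => x; ring.
split; first by rewrite /ig E; exact: (integrableD mpos Ia Ib).
by rewrite /IO E RintegralD ?RintegralZl //; exact: mpos.
Qed.

Lemma IO_gt0 f : smooth f -> ig f -> (forall y, 0 < y -> 0 < f y) -> 0 < IO f.
Proof.
move=> sf If f0.
have p x : 0 < x -> 0 < f (x ^+ D) * wgt x.
  by move=> x0; rewrite mulr_gt0 ?wgt_gt0 // f0 // exprn_gt0.
have IO0 : 0 <= IO f by apply: Rintegral_ge0 => x; rewrite posE => /p/ltW.
rewrite lt_neqAle IO0 andbT; apply/negP => /eqP E.
have fin : (\int[mu]_(x in pos) (f (x ^+ D) * wgt x)%:E)%E \is a fin_num.
  by apply: integrable_fin_num => //; exact: mpos.
have Z : (\int[mu]_(x in pos) `|(f (x ^+ D) * wgt x)%:E| = 0)%E.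
  transitivity (\int[mu]_(x in pos) (f (x ^+ D) * wgt x)%:E)%E.
    apply: eq_integral => x; rewrite inE posE => /p/ltW x0.
    by rewrite gee0_abs // lee_fin.
  by rewrite -(fineK fin); congr (_%:E); exact: esym E.
have mf := smooth_measurable (smooth_wgt sf).
have [/(_ Z)] := ae_eq_integral_abs mu mpos (proj2 (measurable_EFinP _ _) mf).
move=> [N [mN N0 sN]] _.
have : (mu pos <= mu N)%E.
  apply: le_measure; rewrite ?inE //; first exact: mpos.
  move=> x px; apply: sN => /= /(_ px) /eqP.
  rewrite eqe gt_eqF // p //; by rewrite posE in px.
by rewrite N0 lebesgue_measure_itv /= ltry.
Qed.

Lemma IO_le f g : ig f -> ig g -> (forall y, 0 < y -> f y <= g y) -> IO f <= IO g.
Proof.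
move=> If Ig fg; apply: le_Rintegral => //; first exact: mpos.
move=> x; rewrite posE => x0; rewrite ler_wpM2r ?fg ?exprn_gt0 //.
exact/ltW/wgt_gt0.
Qed.

Lemma IO_norm f g : ig f -> ig g -> (forall y, 0 < y -> `|f y| <= g y) -> `|IO f| <= IO g.
Proof.
move=> If Ig fg; rewrite ler_norml; apply/andP; split; last first.
  by apply: IO_le => // y y0; apply: le_trans (fg y y0); exact: ler_norm.
have [Im E] := IO_lin (-1) 0 Ig Ig.
have -> : - IO g = -1 * IO g + 0 * IO g by ring.
rewrite -E; apply: IO_le => // y /fg.
by rewrite ler_norml => /andP[H _]; apply: le_trans H; rewrite le_eqVlt; apply/orP; left; apply/eqP; ring.
Qed.

Definition decays (e : R) f := exists C : R, forall y, 0 < y -> `|f y| <= C * (1 + y) `^ (- e).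

Lemma is_derive_powR1 (k e : R) y : 0 < 1 + k * y ->
  is_derive y 1 (fun y => (1 + k * y) `^ e) (k * e * (1 + k * y) `^ (e - 1)).
Proof.
move=> y0.
have Hg : is_derive y 1 (fun y : R => 1 + k * y) k.
  by apply: is_derive_eq; rewrite /= /GRing.scale /=; ring.
have H := @is_derive1_comp R (fun y => y `^ e) (fun y => 1 + k * y) y _ _ (is_derive1_powR e y0) Hg.
by rewrite (_ : k * e * (1 + k * y) `^ (e - 1) = e * (1 + k * y) `^ (e - 1) * k) //; ring.
Qed.

Lemma powR_succ (e : R) y : 0 < y -> y `^ (e + 1) = y `^ e * y.
Proof. by move=> y0; rewrite powRD ?powRr1 ?(ltW y0) // (gt_eqF y0) implybT. Qed.

Lemma powR_decay (e : R) : 0 < e -> ((1 + y) `^ (- e)) @[y --> +oo] --> (0 : R).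
Proof.
move=> e0; apply/cvgrPdist_le => d d0.
have : \forall y \near +oo, d `^ (- e^-1) <= y by apply: nbhs_pinfty_ge; exact: num_real.
apply: filterS => y dy; rewrite sub0r normrN.
have y0 : 0 < y by apply: lt_le_trans dy; rewrite powR_gt0.
rewrite ger0_norm ?powR_ge0 // powRN invf_ple ?posrE ?powR_gt0 //; last lra.
have -> : d^-1 = (d `^ (- e^-1)) `^ e.
  by rewrite -powRrM mulNr mulVf ?gt_eqF // powR_inv1 // ltW.
apply: ge0_ler_powR; rewrite ?nnegrE ?powR_ge0 //; lra.
Qed.

(** In the variable x the majorant (1 + x^D)^(-e) D x^(D-1) has an explicit primitive, which tends
    to 0 at infinity because e > 1. *)
Lemma ig_decay f (e : R) : 1 < e -> smooth f -> decays e f -> ig f.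
Proof.
move=> e1 sf [C HC].
have De x : 0 <= x -> 0 < 1 + x ^+ D by move=> x0; rewrite ltr_wpDr // exprn_ge0.
suff Ig : ig (fun y => C * (1 + y) `^ (- e) + 0 * (1 + y) `^ (- e)).
  apply: (ig_le sf Ig) => y y0; rewrite mul0r addr0.
  exact: le_trans (HC y y0) (ler_norm _).
suff Ip : ig (fun y => (1 + y) `^ (- e)) by have [] := IO_lin C 0 Ip Ip.
pose k x := (1 + x ^+ D) `^ (- e) * wgt x.
pose K x := (1 - e)^-1 * (1 + x ^+ D) `^ (1 - e).
have HK x : 0 <= x -> is_derive x 1 K (k x).
  move=> x0.
  have Hg : is_derive (x ^+ D) 1 (fun y => (1 + 1 * y) `^ (1 - e))
     (1 * (1 - e) * (1 + 1 * x ^+ D) `^ (1 - e - 1)).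
    by apply: is_derive_powR1; rewrite mul1r De.
  have H2 := @is_derive1_comp R (fun y => (1 + 1 * y) `^ (1 - e)) (fun x => x ^+ D) x _ _
    Hg (is_derive_exp D x).
  have -> : K = (fun x => (1 - e)^-1 * ((fun y => (1 + 1 * y) `^ (1 - e)) \o (fun x => x ^+ D)) x).
    by apply/funext => z; rewrite /K /= mul1r.
  apply: is_derive_eq; rewrite /GRing.scale /= /k /wgt !mul1r.
  have -> : 1 - e - 1 = - e by ring.
  have e10 : 1 - e != 0 by rewrite lt_eqF // subr_lt0.
  by rewrite -[(1 - e) * _ * _]mulrA mulKf.
have ck : {within `[0, +oo[, continuous k}.
  apply: continuous_in_subspaceT => x; rewrite inE /= in_itv /= andbT => x0.
  apply: derivable_continuous; apply: derivableM.
    have Hg : is_derive (x ^+ D) 1 (fun y => (1 + 1 * y) `^ (- e))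
       (1 * (- e) * (1 + 1 * x ^+ D) `^ (- e - 1)).
      by apply: is_derive_powR1; rewrite mul1r De.
    rewrite (_ : (fun z : R => (1 + z ^+ D) `^ (- e)) =
      (fun y : R => (1 + 1 * y) `^ (- e)) \o (fun x => x ^+ D)); last first.
      by apply/funext => z /=; rewrite mul1r.
    exact: is_derive_derivable (@is_derive1_comp R (fun y : R => (1 + 1 * y) `^ (- e))
      (fun x => x ^+ D) x _ _ Hg (is_derive_exp D x)).
  by apply: derivableM => //; exact: is_derive_derivable (is_derive_exp _ x).
have k0 x : 0 <= x -> 0 <= k x.
  by move=> x0; rewrite /k /wgt !mulr_ge0 ?powR_ge0 // exprn_ge0.
have Kl : K x @[x --> +oo] --> (0 : R).
  have e2 : 0 < e - 1 by lra.
  have H := pow_pinfty (powR_decay e2).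
  have -> : K = (fun x => (1 - e)^-1 * (1 + x ^+ D) `^ (- (e - 1))).
    by apply/funext => x; rewrite /K opprB.
  rewrite -[X in _ --> X](mulr0 (1 - e)^-1).
  by apply: cvgM H; exact: cvg_cst.
have cK x : 0 <= x -> {for x, continuous K}.
  by move=> x0; exact: derivable_continuous (is_derive_derivable (HK x x0)).
have E : (\int[mu]_(x in `[0%R, +oo[) (k x)%:E = 0%:E - (K 0%R)%:E)%E.
  apply: ge0_continuous_FTC2y => //.
  - by move=> x x0; exact: is_derive_derivable (HK x (ltW x0)).
  - exact/cvg_at_right_filter/cK.
  - move=> x; rewrite in_itv /= andbT => x0.
    by rewrite derive1E; exact: is_derive_val (HK x (ltW x0)).
have mk : measurable_fun pos (EFin \o k).
  apply/measurable_EFinP; apply: (smooth_measurable (f := k)) => x x0.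
  have -> : k = (fun x => (fun y => (1 + 1 * y) `^ (- e)) (x ^+ D) * wgt x).
    by apply/funext => z; rewrite /k mul1r.
  apply: (@smooth_wgt (fun y => (1 + 1 * y) `^ (- e))) x0 => y y0.
  apply: is_derive_derivable; apply: is_derive_powR1; lra.
apply/integrableP; split=> //.
have -> : (\int[mu]_(x in pos) `|(EFin \o k) x| = \int[mu]_(x in pos) (k x)%:E)%E.
  apply: eq_integral => x; rewrite inE posE => x0.
  by rewrite /= ger0_norm // k0 // ltW.
by rewrite /pos integral_itv_obnd_cbnd // E -EFinB ltry.
Qed.

End Power.
End HalfLine.
End HalfLineIntegrals.


Module DecayAndSmoothness.
Require Import Defs.
Import Recursive LinearRecurrences SubdominantGrowth Oscillation OscillationLowDegree AffineRecurrences HalfLineIntegrals.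
From mathcomp Require Import all_boot all_order all_algebra.
From mathcomp Require Import all_classical all_reals all_analysis.
From mathcomp Require Import measurable_realfun.
From mathcomp Require Import zify ring lra.
Set Implicit Arguments.
Unset Strict Implicit.
Unset Printing Implicit Defensive.
Import Order.TTheory GRing.Theory Num.Theory numFieldNormedType.Exports.
Local Open Scope classical_set_scope.
Local Open Scope ring_scope.

(** * Moments solving an affine recurrence *)

Section Moments.
Variable R : realType.
Implicit Types (f g h H x T : R -> R) (y : R).

Lemma lim0_bound H (C : R) : (forall y, 0 < y -> y <= 1 -> `|H y| <= C * y) ->
  H y @[y --> 0^'+] --> (0 : R).
Proof.
move=> HC; apply/cvgrPdist_le => d d0.
have C0 : 0 <= C by have := HC 1 ltr01 (lexx _); rewrite mulr1; apply: le_trans.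
have C1 : 0 < C + 1 by lra.
have D0 : 0 < d / (C + 1) by exact: divr_gt0.
near=> y; rewrite sub0r normrN.
have y0 : 0 < y by near: y; exact: nbhs_right_gt.
have y1 : y <= 1 by near: y; exact: nbhs_right_ltW.
have yd : y <= d / (C + 1) by near: y; exact: nbhs_right_ltW.
apply: le_trans (HC y y0 y1) _; apply: (@le_trans _ _ ((C + 1) * y)).
  by rewrite ler_wpM2r ?(ltW y0) // lerDl.
by rewrite mulrC -ler_pdivlMr.
Unshelve. all: by end_near.
Qed.

Lemma lim1_decay H (e : R) : 0 < e -> decays e H -> H y @[y --> +oo] --> (0 : R).
Proof.
move=> e0 [C HC].
apply/cvgrPdist_le => d d0.
have C1 : 0 < `|C| + 1 by have := normr_ge0 C; lra.
have /cvgrPdist_le /(_ _ (divr_gt0 d0 C1)) P := powR_decay e0.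
have Q : \forall y \near +oo, (1 : R) <= y by apply: nbhs_pinfty_ge; exact: num_real.
near=> y; rewrite sub0r normrN.
have y1 : 1 <= y by near: y.
have : `|0 - (1 + y) `^ (- e)| <= d / (`|C| + 1) by near: y.
rewrite sub0r normrN ger0_norm ?powR_ge0 // ler_pdivlMr // => P1.
apply: le_trans (HC y _) _; first lra.
apply: le_trans P1; rewrite mulrC ler_wpM2l ?powR_ge0 //.
by have := ler_norm C; lra.
Unshelve. all: by end_near.
Qed.

Lemma smooth_lin (a b : R) f g : smooth f -> smooth g ->
  smooth (fun y => a * f y + b * g y).
Proof.
move=> sf sg y y0; apply: derivableD.
  by apply: derivableM; [exact: derivable_cst|exact: sf].
by apply: derivableM; [exact: derivable_cst|exact: sg].
Qed.

Arguments smooth_lin : clear implicits.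

(** For an integer N >= |M|, exp (c y) = exp (c y / N)^N >= (k (1 + y))^N with k = min (1, c /
    N). *)
Lemma exp_decay (c M : R) : 0 < c -> exists C : R, forall y, 0 < y ->
  expR (- (c * y)) <= C * (1 + y) `^ M.
Proof.
move=> c0; pose N := (Num.truncn `|M|).+1.
have MN : - M <= N%:R.
  apply: le_trans (ler_norm _) _; rewrite normrN.
  exact: ltW (truncnS_gt _).
pose k := Num.min 1 (c / N%:R).
have N0 : 0 < N%:R :> R by rewrite ltr0n.
have k0 : 0 < k by rewrite lt_min ltr01 divr_gt0.
have k1 : k <= 1 by rewrite ge_min lexx.
have kc : k <= c / N%:R by rewrite ge_min lexx orbT.
exists (k ^+ N)^-1 => y y0.
have y1 : 0 < 1 + y by lra.
have A : k * (1 + y) <= expR (c * y / N%:R).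
  apply: le_trans (expR_ge1Dx _); rewrite mulrDr mulr1 lerD //.
  by rewrite mulrAC ler_wpM2r // ltW.
have B : (k * (1 + y)) ^+ N <= expR (c * y).
  have -> : expR (c * y) = expR (c * y / N%:R) ^+ N.
    by rewrite -expRM_natr divfK // gt_eqF.
  by rewrite ler_pXn2r // ?nnegrE ?expR_ge0 // mulr_ge0 // ltW.
rewrite expRN -[leRHS]invrK invfM invrK lef_pV2 ?posrE ?expR_gt0 //; last first.
  by rewrite mulr_gt0 ?exprn_gt0 // invr_gt0 powR_gt0.
apply: le_trans B; rewrite exprMn ler_pM2l ?exprn_gt0 // -powRN -powR_mulrn ?(ltW y1) //.
by apply: ler_powR => //; lra.
Qed.

Section Weighted.
Variable D : nat.
Hypothesis D0 : (0 < D)%N.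
Variables (a3 b3 a2 b2 a1 b1 : R).
Variables (x T T1 rho tau : R -> R) (x' : R -> R) (e0 q k eps Cr : R).
Hypothesis e01 : 1 <= e0.
Hypothesis eps0 : 0 < eps.
Hypothesis k0 : k != 0.
Hypothesis Hx : forall y, 0 < y -> is_derive y 1 x (x' y).
Hypothesis HT : forall y, 0 < y -> is_derive y 1 T (tau y * T1 y).
Hypothesis sT1 : smooth T1.
Hypothesis ET : forall y, 0 < y -> T y = rho y * T1 y.
Hypothesis Hrho : forall y, 0 < y -> `|rho y| <= Cr * (1 + y).
Hypothesis x0 : forall y, 0 < y -> 0 < x y.
Hypothesis T10 : forall y, 0 < y -> 0 < T1 y.
Hypothesis HB : forall n, exists C : R, forall y, 0 < y ->
  x y ^+ n * T1 y <= C * (1 + y) `^ (q - e0 - 1 - eps).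
Hypothesis c1 : forall y, 0 < y ->
  x' y * (y / (1 + y)) * rho y = x y * (a3 * x y ^+ 2 - a2 * x y - a1) * k.
Hypothesis c2 : forall y, 0 < y ->
  (y / (1 + y)) * (rho y * (e0 / y - q / (1 + y)) + tau y) =
  (b3 * x y ^+ 2 - b2 * x y - b1) * k.

(** Laplace's method. With Psi = y^e0 (1 + y)^(-q) T, the derivative of x^n Psi is k (g3 n x^2 - g2
    n x - g1 n) x^n times the weight: [c1] matches the terms in n and [c2] the constant ones.
    Integration yields the recurrence for the moments, because the boundary terms vanish, at 0 by e0
    >= 1 and at infinity by eps > 0. *)
Definition weight y := y `^ (e0 - 1) * (1 + y) `^ (1 - q) * T1 y.
Definition moment n := IO D (fun y => x y ^+ n * weight y).

Let Psi y := y `^ e0 * (1 + y) `^ (- q) * T y.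

Let PsiE y : 0 < y -> Psi y = weight y * (y / (1 + y)) * rho y.
Proof.
move=> y0; have y1 : 0 < 1 + y by lra.
rewrite /Psi /weight ET //.
have -> : y `^ e0 = y `^ (e0 - 1) * y.
  by rewrite -powR_succ // subrK.
have -> : (1 + y) `^ (1 - q) = (1 + y) `^ (- q) * (1 + y).
  by rewrite -powR_succ // [- q + 1]addrC.
by field; rewrite gt_eqF.
Qed.

Let dPsi y : 0 < y -> is_derive y 1 Psi ((b3 * x y ^+ 2 - b2 * x y - b1) * k * weight y).
Proof.
move=> y0; have y1 : 0 < 1 + 1 * y by lra.
have D1 := is_derive1_powR e0 y0; have D2 := is_derive_powR1 (- q) y1.
have -> : Psi = (fun y => y `^ e0 * (1 + 1 * y) `^ (- q) * T y).
  by apply/funext => z; rewrite /Psi mul1r.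
have D3 := HT y0; apply: is_derive_eq; rewrite /= /GRing.scale /= -c2 //.
rewrite !mul1r in y1 *; rewrite ET // /weight.
have -> : y `^ e0 = y `^ (e0 - 1) * y.
  by rewrite -powR_succ // subrK.
have E1 : (1 + y) `^ (1 - q) = (1 + y) `^ (- q) * (1 + y).
  by rewrite -powR_succ // [- q + 1]addrC.
have E2 : (1 + y) `^ (- q) = (1 + y) `^ (- q - 1) * (1 + y).
  by rewrite -powR_succ // subrK.
rewrite E1 E2; field; rewrite !gt_eqF //.
Qed.

Let sweight : smooth weight.
Proof.
move=> y y0; have y1 : 0 < 1 + 1 * y by lra.
have -> : weight = (fun y => y `^ (e0 - 1) * (1 + 1 * y) `^ (1 - q) * T1 y).
  by apply/funext => z; rewrite /weight mul1r.
apply: derivableM; last exact: sT1.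
apply: derivableM; first exact: is_derive_derivable (is_derive1_powR _ y0).
exact: is_derive_derivable (is_derive_powR1 _ y1).
Qed.

Let sxn n : smooth (fun y => x y ^+ n).
Proof.
move=> y y0; have := @is_derive1_comp R (fun z => z ^+ n) x y _ _ (is_derive_exp n (x y)) (Hx y0).
exact: is_derive_derivable.
Qed.

Lemma weight_gt0 y : 0 < y -> 0 < weight y.
Proof. by move=> y0; rewrite /weight !mulr_gt0 ?powR_gt0 ?T10 //; lra. Qed.

Let weight_bound n : exists C : R, forall y, 0 < y ->
  x y ^+ n * weight y <= C * (1 + y) `^ (- (1 + eps)) /\ 0 <= C.
Proof.
have [C HC] := HB n; exists `|C| => y y0; split=> //.
have y1 : 0 < 1 + y by lra.
have e1 := e01.
have -> : x y ^+ n * weight y = y `^ (e0 - 1) * (1 + y) `^ (1 - q) * (x y ^+ n * T1 y).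
  by rewrite /weight; ring.
have P1 : y `^ (e0 - 1) <= (1 + y) `^ (e0 - 1).
  by apply: ge0_ler_powR; rewrite ?nnegrE; lra.
apply: (@le_trans _ _ ((1 + y) `^ (e0 - 1) * (1 + y) `^ (1 - q) *
    (`|C| * (1 + y) `^ (q - e0 - 1 - eps)))).
  apply: ler_pM.
  - by rewrite mulr_ge0 ?powR_ge0.
  - by rewrite mulr_ge0 ?exprn_ge0 // ltW // ?x0 ?T10.
  - by rewrite ler_wpM2r ?powR_ge0.
  - apply: le_trans (HC y y0) _; rewrite ler_wpM2r ?powR_ge0 //; exact: ler_norm.
rewrite mulrCA -!powRD ?(gt_eqF y1) ?implybT //.
by rewrite (_ : e0 - 1 + (1 - q) + (q - e0 - 1 - eps) = - (1 + eps)) //; ring.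
Qed.

Lemma ig_weight n : ig D (fun y => x y ^+ n * weight y).
Proof.
have [C HC] := weight_bound n.
apply: (@ig_decay _ D D0 _ (1 + eps)); first by have := eps0; lra.
  by move=> y y0; apply: derivableM; [exact: sxn|exact: sweight].
exists C => y y0; have [H _] := HC y y0; rewrite ger0_norm //.
by rewrite mulr_ge0 ?exprn_ge0 // ltW // ?x0 ?weight_gt0.
Qed.

Lemma moment_gt0 n : 0 < moment n.
Proof.
apply: (IO_gt0 D0) (ig_weight n) _ => y y0.
  by apply: derivableM; [exact: sxn|exact: sweight].
by rewrite mulr_gt0 ?exprn_gt0 ?x0 ?weight_gt0.
Qed.

Lemma moment_sol : asol a3 b3 a2 b2 a1 b1 moment.
Proof.
move=> n; pose f j y : R := x y ^+ j * weight y.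
have [I1 E1] := IO_lin (aff a3 b3 n) (- aff a2 b2 n) (ig_weight n.+2) (ig_weight n.+1).
have [I2 E2] := IO_lin 1 (- aff a1 b1 n) I1 (ig_weight n).
have [I3 E3] := IO_lin k 0 I2 I2.
have Z : IO D (fun y => k * (1 * (aff a3 b3 n * (x y ^+ n.+2 * weight y) +
    - aff a2 b2 n * (x y ^+ n.+1 * weight y)) + - aff a1 b1 n * (x y ^+ n * weight y)) +
    0 * (1 * (aff a3 b3 n * (x y ^+ n.+2 * weight y) +
    - aff a2 b2 n * (x y ^+ n.+1 * weight y)) + - aff a1 b1 n * (x y ^+ n * weight y))) = 0 - 0.
  have [C HC] := weight_bound n.
  have bd y : 0 < y -> `|x y ^+ n * Psi y| <= C * `|Cr| * (1 + y) `^ (- eps) /\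
      `|x y ^+ n * Psi y| <= C * `|Cr| * y.
    move=> y0; have [H1 C0] := HC y y0; have y1 : 0 < 1 + y by lra.
    have xn : 0 <= x y ^+ n by rewrite exprn_ge0 // ltW // x0.
    have w0 := ltW (weight_gt0 y0).
    have H2 : `|x y ^+ n * Psi y| <= C * `|Cr| * (y * (1 + y) `^ (- (1 + eps))).
      rewrite PsiE //.
      have -> : x y ^+ n * (weight y * (y / (1 + y)) * rho y) =
        x y ^+ n * weight y * (y / (1 + y) * rho y) by ring.
      rewrite [leRHS](_ : _ = C * (1 + y) `^ (- (1 + eps)) * (y * `|Cr|)); last by ring.
      rewrite normrM; apply: ler_pM => //; first by rewrite ger0_norm // mulr_ge0.
      rewrite !normrM normfV (gtr0_norm y0) (gtr0_norm y1) -mulrA ler_pM2l //.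
      rewrite mulrC ler_pdivrMr //.
      apply: le_trans (Hrho y0) _; rewrite ler_wpM2r ?(ltW y1) //; exact: ler_norm.
    split; apply: le_trans H2 _; rewrite ler_wpM2l ?mulr_ge0 //.
      rewrite opprD powRD; last by rewrite (gt_eqF y1) implybT.
      rewrite powR_inv1 ?(ltW y1) // mulrA ler_piMl ?powR_ge0 //.
      by rewrite ler_pdivrMr //; lra.
    rewrite ler_piMr ?(ltW y0) // powRN invf_le1 ?powR_gt0 //.
    have e1 := eps0; rewrite -[leLHS](powRr0 (1 + y)).
    by apply: ler_powR; lra.
  apply: (@IO_FTC _ D D0 (fun y => x y ^+ n * Psi y)).
  - move=> y y0; have Dx := @is_derive1_comp R (fun z => z ^+ n) x y _ _
      (is_derive_exp n (x y)) (Hx y0).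
    have Dn : is_derive y 1 (fun y => x y ^+ n) (n%:R * x y ^+ n.-1 * x' y) by exact: Dx.
    have DP := dPsi y0; apply: is_derive_eq; rewrite /= /GRing.scale /= PsiE // mul0r addr0.
    have E : n%:R * x y ^+ n.-1 * x' y * (weight y * (y / (1 + y)) * rho y) =
       n%:R * x y ^+ n * (a3 * x y ^+ 2 - a2 * x y - a1) * k * weight y.
      transitivity (n%:R * x y ^+ n.-1 * (x' y * (y / (1 + y)) * rho y) * weight y); first by ring.
      rewrite c1 //; have -> : n%:R * x y ^+ n = n%:R * (x y ^+ n.-1 * x y).
        by case: (n) => [|j]; [rewrite !mul0r|rewrite exprSr].
      by ring.
    rewrite [weight y * (y / (1 + y)) * rho y * _]mulrC E /aff !exprS; ring.
  - have s3 j : smooth (fun y => x y ^+ j * weight y).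
      by move=> y y0; apply: derivableM; [exact: sxn|exact: sweight].
    have S1 := smooth_lin (aff a3 b3 n) (- aff a2 b2 n) _ _ (s3 n.+2) (s3 n.+1).
    have S2 := smooth_lin 1 (- aff a1 b1 n) _ _ S1 (s3 n).
    exact: (smooth_lin k 0 _ _ S2 S2).
  - exact: I3.
  - by apply: (@lim0_bound _ (C * `|Cr|)) => y y0 _; have [] := bd y y0.
  - by apply: (@lim1_decay _ eps eps0); exists (C * `|Cr|) => y /bd[].
move: Z; rewrite E3 E2 E1 mul0r addr0 subr0 => /eqP.
rewrite mulf_eq0 (negbTE k0) /= => /eqP Z; rewrite /moment; lra.
Qed.

Lemma moment_le (al : R) n : (forall y, 0 < y -> x y <= al) ->
  moment n <= al ^+ n * moment 0 /\ moment n.+1 <= al * moment n.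
Proof.
move=> xa; split.
  have [I E] := IO_lin (al ^+ n) 0 (ig_weight 0) (ig_weight 0).
  rewrite /moment -[leRHS]addr0 -(mul0r (IO D (fun y => x y ^+ 0 * weight y))) -E.
  apply: IO_le => //; first exact: ig_weight.
  move=> y y0; rewrite mul0r addr0 expr0 mul1r ler_wpM2r ?(ltW (weight_gt0 y0)) //.
  by apply: lerXn2r; rewrite ?nnegrE ?(ltW (x0 y0)) ?xa // (le_trans (ltW (x0 y0))) // xa.
have [I E] := IO_lin al 0 (ig_weight n) (ig_weight n).
rewrite /moment -[leRHS]addr0 -(mul0r (IO D (fun y => x y ^+ n * weight y))) -E.
apply: IO_le => //; first exact: ig_weight.
move=> y y0; rewrite mul0r addr0 exprS -mulrA ler_wpM2r ?xa //.
by rewrite mulr_ge0 ?exprn_ge0 // ltW // ?x0 ?weight_gt0.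
Qed.

(** Cauchy-Schwarz, obtained by integrating x^n (x - c)^2 against the weight with c the ratio of
    consecutive moments. *)
Lemma moment_logconvex n : moment n.+1 ^+ 2 <= moment n * moment n.+2.
Proof.
have [m0 m1 m2] := And3 (moment_gt0 n) (moment_gt0 n.+1) (moment_gt0 n.+2).
pose c := moment n.+1 / moment n.
have [I1 E1] := IO_lin 1 (- (2 * c)) (ig_weight n.+2) (ig_weight n.+1).
have [I2 E2] := IO_lin 1 (c ^+ 2) I1 (ig_weight n).
have [I0 E0] := IO_lin 0 0 (ig_weight n) (ig_weight n).
have : IO D (fun y => 0 * (x y ^+ n * weight y) + 0 * (x y ^+ n * weight y)) <=
   IO D (fun y => 1 * (1 * (x y ^+ n.+2 * weight y) + - (2 * c) * (x y ^+ n.+1 * weight y)) +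
      c ^+ 2 * (x y ^+ n * weight y)).
  apply: IO_le => // y y0; rewrite !mul0r addr0.
  have -> : 1 * (1 * (x y ^+ n.+2 * weight y) + - (2 * c) * (x y ^+ n.+1 * weight y)) +
      c ^+ 2 * (x y ^+ n * weight y) = x y ^+ n * weight y * (x y - c) ^+ 2.
    by rewrite !exprS expr0; ring.
  by rewrite mulr_ge0 ?sqr_ge0 // mulr_ge0 ?exprn_ge0 // ltW // ?x0 ?weight_gt0.
rewrite E0 E2 E1 -/(moment n) -/(moment n.+1) -/(moment n.+2) !mul0r addr0.
have -> : 1 * (1 * moment n.+2 + - (2 * c) * moment n.+1) + c ^+ 2 * moment n =
  moment n.+2 - moment n.+1 ^+ 2 / moment n by rewrite /c; field; rewrite gt_eqF.
by rewrite subr_ge0 ler_pdivrMr // mulrC.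
Qed.

End Weighted.
End Moments.
End DecayAndSmoothness.


Module Fibres.
From mathcomp Require Import all_boot all_order all_algebra.
From mathcomp Require Import complex.
From mathcomp Require mpoly.
Import -(notations) mpoly.
From mathcomp Require Import all_classical all_reals all_analysis.
From mathcomp Require Import measurable_realfun.
From mathcomp Require Import zify ring lra.
Require Import Defs.
Import LinearRecurrences SubdominantGrowth Oscillation OscillationLowDegree AffineRecurrences HalfLineIntegrals DecayAndSmoothness.
Set Implicit Arguments.
Unset Strict Implicit.
Unset Printing Implicit Defensive.
Import Order.TTheory GRing.Theory Num.Theory numFieldNormedType.Exports.
Local Open Scope classical_set_scope.
Local Open Scope ring_scope.

(** * Iterated integrals *)

Section Iterated.
Variable R : realType.
Local Notation mu := (@lebesgue_measure R).

Lemma mpol_evalE (C : countType) (K : comNzRingType) n (val : C -> K) (P : mpol C)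
    (x : n.-tuple K) :
  mpol_eval val P x = \sum_(t <- P) val t.1 * \prod_(i < n) tnth x i ^+ nth 0%N t.2 i.
Proof.
rewrite /mpol_eval /mpoly_of; elim: P => [|t P IH].
  by rewrite !big_nil mpoly.meval0.
rewrite !big_cons mpoly.mevalD IH mpoly.mevalZ mpoly.mevalX; congr (_ * _ + _).
by apply: eq_bigr => i _; rewrite /= mpoly.multinomE tnth_mktuple.
Qed.

Lemma mpoly_of_neq0 (C : countType) (K : comNzRingType) n (val : C -> K) (P : mpol C)
    (x : n.-tuple K) : mpol_eval val P x != 0 -> mpoly_of n val P != 0.
Proof. by rewrite /mpol_eval; apply: contraNneq => ->; rewrite mpoly.meval0. Qed.

Lemma lebesgue0 (F : euclid R 0 -> \bar R) :
  (\int[lebesgue_n R 0]_x F x = F [tuple])%E.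
Proof.
rewrite /= (_ : F = cst (F [tuple])); last by apply/funext => x; rewrite (tuple0 x).
by rewrite integral_dirac // diracT mul1e.
Qed.

Lemma measurable_tcons_comp n (F : euclid R n.+1 -> \bar R) (a : R) :
  measurable_fun setT F -> measurable_fun setT (fun t : euclid R n => F (tcons (a, t))).
Proof.
move=> mF; apply: measurableT_comp mF _.
exact: (measurableT_comp (@measurable_tcons R n) (measurable_pair1 a)).
Qed.

Lemma lebesgue_tonelli n (F : euclid R n.+1 -> \bar R) :
  measurable_fun setT F -> (forall x, 0 <= F x)%E ->
  (\int[lebesgue_n R n.+1]_x F x = \int[mu]_a \int[lebesgue_n R n]_t F (tcons (a, t)))%E.
Proof.
move=> mF F0; transitivity (\int[pushforward (mu \x lebesgue_n R n)%E (@tcons R n)]_x F x)%E.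
  by [].
rewrite ge0_integral_pushforward //; last exact: measurable_tcons.
rewrite preimage_setT fubini_tonelli1 //; last by move=> x; exact: F0.
by apply: measurableT_comp mF _; exact: measurable_tcons.
Qed.

Lemma measurable_inner n (F : euclid R n.+1 -> \bar R) :
  measurable_fun setT F -> (forall x, 0 <= F x)%E ->
  measurable_fun setT (fun a => \int[lebesgue_n R n]_t F (tcons (a, t)))%E.
Proof.
move=> mF F0.
apply: (@measurable_fun_fubini_tonelli_F _ _ _ _ _ (lebesgue_n R n) (F \o @tcons R n)).
  by apply: measurableT_comp mF _; exact: measurable_tcons.
by move=> x; exact: F0.
Qed.

Lemma lebesgue1 (F : euclid R 1 -> \bar R) : measurable_fun setT F ->
  (\int[lebesgue_n R 1]_x F x = \int[mu]_a F [tuple of [:: a]])%E.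
Proof.
move=> mF.
have P G : measurable_fun setT G -> (forall x, 0 <= G x)%E ->
    (\int[lebesgue_n R 1]_x G x = \int[mu]_a G [tuple of [:: a]])%E.
  move=> mG G0; rewrite lebesgue_tonelli //; apply: eq_integral => a _.
  by rewrite lebesgue0; congr G; apply: val_inj.
have Ep := P _ (measurable_funepos mF) (funepos_ge0 F).
have En := P _ (measurable_funeneg mF) (funeneg_ge0 F).
transitivity (\int[lebesgue_n R 1]_x F^\+ x - \int[lebesgue_n R 1]_x F^\- x)%E.
  exact: integralE.
rewrite Ep En; apply: esym; apply: etrans (integralE _ _ _) _.
congr (_ - _)%E.
all: by apply: eq_integral => a _; rewrite ?funepos.unlock ?funeneg.unlock.
Qed.

Lemma lebesgue_fubini n (F : euclid R n.+1 -> \bar R) :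
  measurable_fun setT F ->
  (\int[mu]_a \int[lebesgue_n R n]_t `|F (tcons (a, t))| < +oo)%E ->
  (lebesgue_n R n.+1).-integrable setT F /\
  (\int[lebesgue_n R n.+1]_x F x = \int[mu]_a \int[lebesgue_n R n]_t F (tcons (a, t)))%E.
Proof.
move=> mF fin.
have mFc : measurable_fun setT (F \o (@tcons R n)).
  by apply: measurableT_comp mF _; exact: measurable_tcons.
have I : (mu \x lebesgue_n R n)%E.-integrable setT (F \o (@tcons R n)).
  by apply/integrable12ltyP.
split.
  apply/integrableP; split=> //.
  rewrite lebesgue_tonelli //.
  by apply: measurableT_comp mF; exact: abse_measurable.
transitivity (\int[pushforward (mu \x lebesgue_n R n)%E (@tcons R n)]_x F x)%E.
  by [].
rewrite integral_pushforward //; last exact: measurable_tcons.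
by rewrite preimage_setT -integral12_prod_meas1.
Qed.

Lemma integral_power (r : nat) (t : R) : 0 < t ->
  (\int[mu]_(x in `]0%R, t[) (x ^+ r)%:E = (t ^+ r.+1 / r.+1%:R)%:E)%E.
Proof.
move=> t0.
rewrite integral_itv_obnd_cbnd; last first.
  by apply/measurable_EFinP; apply: measurable_funTS; exact: exprn_measurable.
rewrite integral_itv_bndo_bndc; last first.
  by apply/measurable_EFinP; apply: measurable_funTS; exact: exprn_measurable.
have DK (x : R) : is_derive x 1 (fun x : R => r.+1%:R^-1 * x ^+ r.+1) (x ^+ r).
  have H := is_derive_exp r.+1 x.
  apply: is_derive_eq; rewrite /GRing.scale /= mulrA mulVf ?mul1r ?pnatr_eq0 //.
rewrite (@continuous_FTC2 _ _ (fun x : R => r.+1%:R^-1 * x ^+ r.+1)) //.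
- by rewrite expr0n mulr0 sube0 mulrC.
- by apply: continuous_subspaceT => x; exact: exprn_continuous.
- have cK (x : R) : {for x, continuous (fun x : R => r.+1%:R^-1 * x ^+ r.+1)}.
    exact: derivable_continuous (is_derive_derivable (DK x)).
  split=> [x _||]; first exact: is_derive_derivable (DK x).
    exact/cvg_at_right_filter/cK.
  exact/cvg_at_left_filter/cK.
- by move=> x _; rewrite derive1E; exact: is_derive_val (DK x).
Qed.

Lemma in_pos (a : R) : (a \in @pos R) = (0 < a).
Proof. by apply/idP/idP; rewrite inE posE. Qed.

Section Fiber.
Variables (D r : nat).
Hypothesis D0 : (0 < D)%N.

(** For y = xi^D the fibre over xi is 0 < tau < (1 + y)^(-1/D). Integrating tau^r over it gives (1 +
    y)^(-(r+1)/D) / (r + 1), a fractional power obtained from polynomial data. *)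
Definition infib (xi tau : R) := [&& 0 < xi, 0 < tau & tau ^+ D * (1 + xi ^+ D) < 1].
Definition tmax (xi : R) := (1 + xi ^+ D) `^ (- D%:R^-1).
Definition fibw (xi : R) := (1 + xi ^+ D) `^ (- (r.+1%:R / D%:R)).

Lemma infibE xi tau : 0 < xi -> infib xi tau = (tau \in `]0, tmax xi[).
Proof.
move=> x0; have y0 : 0 < 1 + xi ^+ D by rewrite addr_gt0 // exprn_gt0.
rewrite /infib x0 in_itv /=; case: ltP => //= t0.
rewrite -ltr_pdivlMr // div1r.
have -> : (1 + xi ^+ D)^-1 = tmax xi ^+ D.
  rewrite /tmax -powR_mulrn ?powR_ge0 // -powRrM mulNr mulVf ?pnatr_eq0 ?gt_eqF //.
  by rewrite powR_inv1 // ltW.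
by rewrite ltr_pXn2r // ?nnegrE ?powR_ge0 // ltW.
Qed.

Lemma tmaxX xi : 0 < xi -> tmax xi ^+ r.+1 = fibw xi.
Proof.
move=> x0; rewrite /tmax /fibw -powR_mulrn ?powR_ge0 // -powRrM mulNr; congr (_ `^ (- _)).
by rewrite mulrC.
Qed.

Lemma fib_integral xi (c : R) :
  (\int[mu]_tau (if infib xi tau then c * tau ^+ r else 0)%:E =
   (if 0 < xi then c * fibw xi / r.+1%:R else 0)%:E)%E.
Proof.
case: ifPn => x0; last first.
  rewrite integral0_eq // => t _; rewrite /infib (negbTE x0) //.
transitivity (\int[mu]_tau (((fun t => c%:E * (t ^+ r)%:E) \_ `]0%R, tmax xi[) tau))%E.
  apply: eq_integral => t _; rewrite patchE infibE // mem_setE.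
  by case: ifP.
rewrite -integral_mkcond.
have t0 : 0 < tmax xi by rewrite powR_gt0 // addr_gt0 // exprn_gt0.
have mr : measurable_fun `]0%R, tmax xi[ (fun t : R => (t ^+ r)%:E).
  by apply/measurable_EFinP; apply: measurable_funTS; exact: exprn_measurable.
have E := integral_power r t0.
rewrite integralZl //; last first.
  apply/integrableP; split=> //.
  rewrite (_ : (\int[mu]_(t in _) _)%E = (\int[mu]_(t in `]0%R, tmax xi[) (t ^+ r)%:E)%E); last first.
    apply: eq_integral => t; rewrite inE /= in_itv /= => /andP[t1 _].
    by rewrite ger0_norm // exprn_ge0 // ltW.
  by rewrite E ltry.
by rewrite E -EFinM tmaxX // mulrA.
Qed.

Lemma measurable_infib n (i j : 'I_n) :
  measurable_fun setT (fun x : euclid R n => infib (tnth x i) (tnth x j)).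
Proof.
have mi k : measurable_fun setT (fun x : euclid R n => tnth x k : R) by exact: measurable_tnth.
have mX k : measurable_fun setT (fun x : euclid R n => tnth x k ^+ D : R).
  by apply: measurable_funX; exact: mi.
apply: measurable_and; first by apply: measurable_fun_ltr => //; exact: measurable_cst.
apply: measurable_and; first by apply: measurable_fun_ltr => //; exact: measurable_cst.
apply: measurable_fun_ltr; last exact: measurable_cst.
apply: measurable_funM => //; apply: measurable_funD => //; exact: measurable_cst.
Qed.

Lemma fiber2 (phi : R -> R) : measurable_fun setT phi ->
  mu.-integrable (@pos R) (fun xi => (phi xi * fibw xi)%:E) ->
  (lebesgue_n R 2).-integrable setT (fun x : euclid R 2 =>
    (if infib (tnth x 0) (tnth x 1) then phi (tnth x 0) * tnth x 1 ^+ r else 0)%:E) /\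
  (\int[lebesgue_n R 2]_x
    (if infib (tnth x 0) (tnth x 1) then phi (tnth x 0) * tnth x 1 ^+ r else 0)%:E =
   ((\int[mu]_(xi in @pos R) (phi xi * fibw xi)) / r.+1%:R)%:E)%E.
Proof.
move=> mphi Iphi.
set F := (fun x : euclid R 2 => _%:E).
have mF : measurable_fun setT F.
  apply/measurable_EFinP; apply: measurable_fun_ifT; first exact: measurable_infib.
    apply: measurable_funM.
      by apply: measurableT_comp mphi _; exact: measurable_tnth.
    by apply: measurable_funX; exact: measurable_tnth.
  exact: measurable_cst.
have E a : (\int[lebesgue_n R 1]_t F (tcons (a, t)) =
    (((fun xi => (phi xi * fibw xi / r.+1%:R)%:E) \_ (@pos R)) a))%E.
  rewrite lebesgue1; last exact: measurable_tcons_comp.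
  rewrite (fib_integral a (phi a)) patchE.
  by rewrite in_pos; case: ifPn.
have Ea a : (\int[lebesgue_n R 1]_t `|F (tcons (a, t))| =
    (((fun xi => (`|phi xi * fibw xi| / r.+1%:R)%:E) \_ (@pos R)) a))%E.
  rewrite lebesgue1; last first.
    by apply: measurableT_comp (measurable_tcons_comp _ mF); exact: abse_measurable.
  transitivity (\int[mu]_t (if infib a t then `|phi a| * t ^+ r else 0)%:E)%E.
    apply: eq_integral => t _; rewrite /F /tcons !(tnth_nth 0) /=.
    case: ifPn => [/and3P[_ t0 _]|_]; last by rewrite normr0.
    by rewrite normrM [`|t ^+ r|]ger0_norm // exprn_ge0 // ltW.
  rewrite fib_integral patchE normrM [`|fibw a|]ger0_norm ?powR_ge0 //.
  by rewrite in_pos; case: ifPn.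
have I1 : mu.-integrable (@pos R) (fun xi => (phi xi * fibw xi / r.+1%:R)%:E).
  have := integrableZl (@mpos R) (r.+1%:R^-1) Iphi; apply: eq_integrable => //.
    exact: mpos.
  by move=> x _; rewrite /= -EFinM mulrC.
have [If Ef] : (lebesgue_n R 2).-integrable setT F /\
    (\int[lebesgue_n R 2]_x F x = \int[mu]_a \int[lebesgue_n R 1]_t F (tcons (a, t)))%E.
  apply: lebesgue_fubini => //.
  under eq_integral do rewrite Ea.
  rewrite -integral_mkcond; move/integrableP : I1 => [_]; apply: le_lt_trans.
  rewrite le_eqVlt; apply/orP; left; apply/eqP; apply: eq_integral => x _.
  by rewrite abse_EFin; congr (_%:E); rewrite [RHS]normrM normfV [`|r.+1%:R|]ger0_norm.
split=> //; rewrite Ef; under eq_integral do rewrite E.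
rewrite -integral_mkcond.
transitivity (\int[mu]_(xi in @pos R) ((r.+1%:R^-1)%:E * (phi xi * fibw xi)%:E))%E.
  by apply: eq_integral => x _; rewrite -EFinM mulrC.
rewrite integralZl //; last exact: mpos.
rewrite mulrC EFinM; congr (_ * _)%E.
by rewrite /Rintegral fineK //; apply: integrable_fin_num => //; exact: mpos.
Qed.

Section Triple.
Variables (w H : R -> R) (Psi : R -> R -> R) (C c : R).
Hypothesis mw : measurable_fun setT w.
Hypothesis mH : measurable_fun setT H.
Hypothesis mPsi : measurable_fun setT (fun z : R * R => Psi z.1 z.2).
Hypothesis PsiI : forall W, W != 0 -> mu.-integrable (@pos R) (fun u => (Psi W u)%:E).
Hypothesis PsiE : forall W, W != 0 -> \int[mu]_(u in @pos R) Psi W u = c * W.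
Hypothesis PsiC : forall W, W != 0 ->
  (\int[mu]_(u in @pos R) `|Psi W u|%:E <= (C * `|W|)%:E)%E.
Hypothesis IwH : mu.-integrable (@pos R) (fun xi => (w xi * H xi * fibw xi)%:E).

Let G (xi tau u : R) : R :=
  if infib xi tau && ((0 < u) && (w xi * tau ^+ r != 0)) then
    Psi (w xi * tau ^+ r) u * H xi else 0.
Let F (x : euclid R 3) : \bar R := (G (tnth x 0) (tnth x 1) (tnth x (Ordinal (isT : 2 < 3)%N)))%:E.

Let mF : measurable_fun setT F.
Proof.
have mi k : measurable_fun setT (fun x : euclid R 3 => tnth x k : R) by exact: measurable_tnth.
have mW : measurable_fun setT (fun x : euclid R 3 => w (tnth x 0) * tnth x 1 ^+ r).
  apply: measurable_funM; first exact: (measurableT_comp mw (mi _)).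
  by apply: measurable_funX; exact: mi.
apply/measurable_EFinP; apply: measurable_fun_ifT.
- apply: measurable_and; first exact: measurable_infib.
  apply: measurable_and; first by apply: measurable_fun_ltr => //; exact: measurable_cst.
  apply: measurable_neg; apply: measurable_fun_eqr => //; exact: measurable_cst.
- apply: measurable_funM; last exact: (measurableT_comp mH (mi _)).
  exact: (measurableT_comp mPsi (measurable_fun_pair mW (mi (Ordinal (isT : 2 < 3)%N)))).
- exact: measurable_cst.
Qed.

Let Gu xi tau : (\int[mu]_u (G xi tau u)%:E =
  (if infib xi tau then (c * (w xi * H xi)) * tau ^+ r else 0)%:E)%E.
Proof.
case: (boolP (infib xi tau)) => it; last first.
  by rewrite integral0_eq // => u _; rewrite /G (negbTE it).
have [W0|W0] := eqVneq (w xi * tau ^+ r) 0.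
  have -> : c * (w xi * H xi) * tau ^+ r = c * (w xi * tau ^+ r) * H xi by ring.
  by rewrite W0 mulr0 mul0r integral0_eq // => u _; rewrite /G W0 eqxx /= !andbF.
transitivity (\int[mu]_(u in @pos R) ((H xi)%:E * (Psi (w xi * tau ^+ r) u)%:E))%E.
  rewrite [RHS]integral_mkcond; apply: eq_integral => u _; rewrite patchE in_pos /G it W0 /= andbT.
  by case: ifP => // _; rewrite -EFinM mulrC.
rewrite integralZl //; last 2 first.
- exact: mpos.
- exact: PsiI.
rewrite -[X in (_ * X)%E]fineK; last by apply: integrable_fin_num; [exact: mpos|exact: PsiI].
rewrite -EFinM -[fine _]/(Rintegral mu (@pos R) (Psi (w xi * tau ^+ r))) PsiE //.
by congr (_%:E); ring.
Qed.

Let Gua xi tau : (\int[mu]_u `|(G xi tau u)%:E| <=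
  (if infib xi tau then (C * `|w xi * H xi|) * tau ^+ r else 0)%:E)%E.
Proof.
case: (boolP (infib xi tau)) => it; last first.
  by rewrite integral0_eq // => u _; rewrite /G (negbTE it) /= normr0.
have t0 : 0 <= tau ^+ r by move: it => /and3P[_ /ltW t0 _]; rewrite exprn_ge0.
have [W0|W0] := eqVneq (w xi * tau ^+ r) 0.
  have -> : C * `|w xi * H xi| * tau ^+ r = C * `|w xi * tau ^+ r| * `|H xi|.
    by rewrite !normrM (ger0_norm t0); ring.
  rewrite W0 normr0 mulr0 mul0r integral0_eq // => u _.
  by rewrite /G W0 eqxx /= !andbF normr0.
rewrite (_ : (\int[mu]_u _)%E =
    (\int[mu]_(u in @pos R) (`|H xi|%:E * `|Psi (w xi * tau ^+ r) u|%:E))%E); last first.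
  rewrite [RHS]integral_mkcond; apply: eq_integral => u _.
  rewrite patchE in_pos /G it W0 /= andbT.
  by case: ifP => [_|_]; [rewrite -EFinM mulrC normrM|rewrite normr0].
have mP : measurable_fun (@pos R) (fun u => `|Psi (w xi * tau ^+ r) u|%:E).
  have /integrableP[mP _] := PsiI W0.
  by have := measurableT_comp (@abse_measurable R setT) mP.
rewrite ge0_integralZl_EFin //; last exact: mpos.
apply: le_trans (lee_wpmul2l _ (PsiC W0)) _; first by rewrite lee_fin.
by rewrite -EFinM lee_fin !normrM (ger0_norm t0) le_eqVlt; apply/orP; left; apply/eqP; ring.
Qed.

Let Fa a : (\int[lebesgue_n R 2]_t `|F (tcons (a, t))| <=
  (((fun xi => (C * `|w xi * H xi * fibw xi| / r.+1%:R)%:E) \_ (@pos R)) a))%E.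
Proof.
have mFa := measurable_tcons_comp a mF.
have mFn : measurable_fun setT (fun t : euclid R 2 => `|F (tcons (a, t))|%E).
  by apply: measurableT_comp mFa; exact: abse_measurable.
rewrite lebesgue_tonelli //.
apply: (@le_trans _ _ (\int[mu]_t (if infib a t then C * `|w a * H a| * t ^+ r else 0)%:E)%E).
  have mr : measurable_fun setT (fun t : R => t ^+ r) by exact: exprn_measurable.
  apply: ge0_le_integral => //.
  - by move=> t _; exact: integral_ge0.
  - exact: (@measurable_inner 1 (fun t => `|F (tcons (a, t))|%E) mFn).
  - apply/measurable_EFinP; apply: measurable_fun_ifT.
    + apply: measurable_and; first exact: measurable_cst.
      apply: measurable_and; first by apply: measurable_fun_ltr => //; exact: measurable_cst.
      apply: measurable_fun_ltr; last exact: measurable_cst.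
      by apply: measurable_funM; [exact: exprn_measurable|exact: measurable_cst].
    + by apply: measurable_funM => //; exact: measurable_cst.
    + exact: measurable_cst.
  - move=> t _; rewrite lebesgue1; last exact: (measurable_tcons_comp t mFn).
    exact: Gua.
rewrite fib_integral patchE in_pos [`|_ * fibw a|]normrM [`|fibw a|]ger0_norm ?powR_ge0 //.
by case: ifP => // _; rewrite !mulrA.
Qed.

(** Integration over u replaces Psi W u by c W, where W = w(xi) tau^r; the other two variables are
    treated as in the plane. The linear bound C |W| on the absolute integrals supplies Fubini's
    hypothesis. Points with W = 0 lie outside the region, in agreement with c W = 0. *)
Lemma fiber3 : (lebesgue_n R 3).-integrable setT F /\
  (\int[lebesgue_n R 3]_x F x =
   (c * (\int[mu]_(xi in @pos R) (w xi * H xi * fibw xi)) / r.+1%:R)%:E)%E.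
Proof.
have fin a : (\int[lebesgue_n R 2]_t `|F (tcons (a, t))| < +oo)%E.
  by apply: le_lt_trans (Fa a) _; rewrite patchE; case: ifP => _; rewrite ltry.
have E a : (\int[lebesgue_n R 2]_t F (tcons (a, t)) =
  (((fun xi => (c * (w xi * H xi * fibw xi) / r.+1%:R)%:E) \_ (@pos R)) a))%E.
  have mFa := measurable_tcons_comp a mF.
  have [|_ ->] := lebesgue_fubini mFa.
    have := fin a; rewrite lebesgue_tonelli //.
    by apply: measurableT_comp mFa; exact: abse_measurable.
  rewrite patchE in_pos.
  transitivity (\int[mu]_t (if infib a t then c * (w a * H a) * t ^+ r else 0)%:E)%E.
    apply: eq_integral => t _; rewrite lebesgue1; last exact: (measurable_tcons_comp t mFa).
    exact: Gu.
  by rewrite fib_integral; case: ifP => // _; rewrite !mulrA.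
have Iz k : mu.-integrable (@pos R) (fun xi => (k * (w xi * H xi * fibw xi) / r.+1%:R)%:E).
  have := integrableZl (@mpos R) (k / r.+1%:R) IwH; apply: eq_integrable => //.
    exact: mpos.
  by move=> x _; rewrite /= -EFinM mulrAC.
have [IF EF] : (lebesgue_n R 3).-integrable setT F /\
    (\int[lebesgue_n R 3]_x F x = \int[mu]_a \int[lebesgue_n R 2]_t F (tcons (a, t)))%E.
  apply: lebesgue_fubini => //.
  have IC : mu.-integrable (@pos R) (fun xi => (C * `|w xi * H xi * fibw xi| / r.+1%:R)%:E).
    have := integrableZl (@mpos R) (C / r.+1%:R) (integrable_abse IwH); apply: eq_integrable => //.
      exact: mpos.
    by move=> x _; rewrite /= -EFinM mulrAC.
  have F0 a : setT a -> (0 <= \int[lebesgue_n R 2]_t `|F (tcons (a, t))|)%E.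
    by move=> _; exact: integral_ge0.
  have mI : measurable_fun setT (fun a => \int[lebesgue_n R 2]_t `|F (tcons (a, t))|)%E.
    apply: (@measurable_inner 2 (fun x => `|F x|%E)) => //.
    by apply: measurableT_comp mF; exact: abse_measurable.
  apply: (@le_lt_trans _ _ (\int[mu]_a
      (((fun xi => (C * `|w xi * H xi * fibw xi| / r.+1%:R)%:E) \_ (@pos R)) a))%E).
    apply: ge0_le_integral => //.
    by have /integrableP[m _] := IC; apply: (proj1 (measurable_restrictT (fun xi => (C * `|w xi * H xi * fibw xi| / r.+1%:R)%:E) (@mpos R))); exact: m.
  rewrite -integral_mkcond.
  have fi := integrable_fin_num (@mpos R) IC.
  by rewrite -(fineK fi) ltry.
split=> //; rewrite EF; under eq_integral do rewrite E.
rewrite -integral_mkcond.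
transitivity (\int[mu]_(xi in @pos R) ((c / r.+1%:R)%:E * (w xi * H xi * fibw xi)%:E))%E.
  by apply: eq_integral => x _; rewrite -EFinM mulrAC.
rewrite integralZl //; last exact: mpos.
rewrite [c * _ / _]mulrAC [RHS]EFinM; congr (_ * _)%E.
by rewrite /Rintegral fineK //; apply: integrable_fin_num => //; exact: mpos.
Qed.

End Triple.
End Fiber.
End Iterated.
End Fibres.


Module Fibres3.
From mathcomp Require Import all_boot all_order all_algebra.
From mathcomp Require Import complex.
From mathcomp Require mpoly.
Import -(notations) mpoly.
From mathcomp Require Import all_classical all_reals all_analysis.
From mathcomp Require Import measurable_realfun.
From mathcomp Require Import zify ring lra.
Require Import Defs.
Import LinearRecurrences SubdominantGrowth Oscillation OscillationLowDegree AffineRecurrences HalfLineIntegrals DecayAndSmoothness Fibres.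
Set Implicit Arguments.
Unset Strict Implicit.
Unset Printing Implicit Defensive.
Import Order.TTheory GRing.Theory Num.Theory numFieldNormedType.Exports.
Local Open Scope classical_set_scope.
Local Open Scope ring_scope.

(** * The integral of exp(- (u / W)^(1/3)) *)

Section Cube.
Variable R : realType.
Local Notation mu := (@lebesgue_measure R).

Definition cbrt (W u : R) : R := (u / `|W|) `^ (3%:R^-1).

Section CubeFTC.
Variables (W : R) (psi K : R -> R) (C0 C : R).
Hypothesis C0' : 0 <= C.
Hypothesis HC6 : forall y : R, 0 < y -> expR (- (2^-1 * y)) <= C * (1 + y) `^ (- 6%:R).
Hypothesis W0 : W != 0.
Hypothesis spsi : smooth psi.
Hypothesis psib : forall s, 0 < s -> `|psi s| <= expR (- (2^-1 * s)).
Hypothesis HK : forall s : R, is_derive s 1 K (3 * s ^+ 2 * psi s).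
Hypothesis Kb : forall s, 0 < s -> `|K s| <= C0 * (1 + s) ^+ 2 * expR (- (2^-1 * s)).

Let s := cbrt W.
Let V0 : 0 < `|W|. Proof. by rewrite normr_gt0. Qed.

Let s_gt0 (u : R) : 0 < u -> 0 < s u.
Proof. by move=> u0; rewrite powR_gt0 // divr_gt0 // V0. Qed.

Let s3 (u : R) : 0 < u -> s u ^+ 3 = u / `|W|.
Proof.
move=> u0; have v0 : 0 < u / `|W| by rewrite divr_gt0 // V0.
by rewrite /s /cbrt -powR_mulrn ?powR_ge0 // -powRrM mulVf ?powRr1 ?(ltW v0) // pnatr_eq0.
Qed.

Let Hs (u : R) : 0 < u -> is_derive u 1 s ((3 * s u ^+ 2 * `|W|)^-1).
Proof.
move=> u0; have v0 : 0 < u / `|W| by rewrite divr_gt0 // V0.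
have Hg : is_derive u 1 (fun u : R => u / `|W|) (`|W|^-1).
  by apply: is_derive_eq; rewrite /GRing.scale /=; ring.
have H := @is_derive1_comp R (fun v => v `^ (3%:R^-1)) (fun u => u / `|W|) u _ _
  (is_derive1_powR (3%:R^-1) v0) Hg.
have E : s u = s u ^+ 3 * (u / `|W|) `^ (3%:R^-1 - 1).
  rewrite s3 // mulrC -powR_succ // subrK //.
rewrite (_ : (3 * s u ^+ 2 * `|W|)^-1 = 3%:R^-1 * (u / `|W|) `^ (3%:R^-1 - 1) * `|W|^-1) //.
have su := s_gt0 u0.
have -> : (u / `|W|) `^ (3%:R^-1 - 1) = (s u ^+ 2)^-1.
  apply: (mulfI (x := s u ^+ 3)); first by rewrite gt_eqF // exprn_gt0.
  by rewrite -E; field; rewrite gt_eqF.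
by field; rewrite !gt_eqF.
Qed.

Let k0 : 0 < `|W|^-1 :> R. Proof. by rewrite invr_gt0 V0. Qed.
Let y1 (u : R) : 0 <= u -> 0 < 1 + `|W|^-1 * u.
Proof. by move=> u0; rewrite ltr_wpDr // mulr_ge0 // ltW. Qed.

Let cub (u : R) : 0 < u -> 1 + `|W|^-1 * u <= (1 + s u) ^+ 3.
Proof.
move=> u0; rewrite mulrC -s3 //; have su := s_gt0 u0.
have -> : (1 + s u) ^+ 3 = 1 + s u ^+ 3 + (3 * s u + 3 * s u ^+ 2) by rewrite !exprS expr0; ring.
by rewrite lerDl addr_ge0 // mulr_ge0 // ?exprn_ge0 // ltW.
Qed.

(** The exponent 6 in [HC6] is chosen because 1 + u/|W| <= (1 + s)^3: the decay (1 + s)^(-6) becomes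
    the majorant (1 + u/|W|)^(-2), whose integral over u is |W|. This keeps the bounds linear in
    |W|. *)
Let expb (u : R) : 0 < u ->
  expR (- (2^-1 * s u)) <= C * (1 + `|W|^-1 * u) `^ (-2) /\
  (1 + s u) ^+ 2 * expR (- (2^-1 * s u)) <= C * (1 + `|W|^-1 * u) `^ (-1).
Proof.
move=> u0.
have su := s_gt0 u0; have S1 : 1 <= 1 + s u by rewrite lerDl ltW.
have S0 : 0 < 1 + s u by lra.
have B : expR (- (2^-1 * s u)) <= C * ((1 + s u) ^+ 6)^-1.
  by apply: le_trans (HC6 su) _; rewrite powRN powR_mulrn ?(ltW S0).
have Y0 := y1 (ltW u0); have c := cub u0.
have -> : (1 + `|W|^-1 * u) `^ (-2) = ((1 + `|W|^-1 * u) ^+ 2)^-1.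
  by rewrite powRN powR_mulrn // ltW.
rewrite powR_inv1 ?(ltW Y0) //; split.
  apply: le_trans B _; rewrite ler_wpM2l // lef_pV2 ?posrE ?exprn_gt0 //.
  rewrite (_ : 6%N = (3 * 2)%N) // exprM lerXn2r ?nnegrE ?exprn_ge0 ?(ltW S0) ?(ltW Y0) //.
apply: (@le_trans _ _ ((1 + s u) ^+ 2 * (C * ((1 + s u) ^+ 6)^-1))).
  by rewrite ler_wpM2l // exprn_ge0 // ltW.
rewrite [leLHS](_ : _ = C * ((1 + s u) ^+ 4)^-1); last first.
  by move: (1 + s u) S0 => z z0; field; rewrite gt_eqF.
rewrite ler_wpM2l // lef_pV2 ?posrE ?exprn_gt0 //.
apply: le_trans c _; rewrite [leRHS]exprS ler_peMl // exprn_ge0 // ltW.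
all: by [].
Qed.

Let spsis : smooth (fun u => psi (s u)).
Proof.
move=> u u0; have Hp : is_derive (s u) 1 psi ('D_1 psi (s u)).
  by split=> //; apply: spsi; exact: s_gt0.
exact: is_derive_derivable (@is_derive1_comp R psi s u _ _ Hp (Hs u0)).
Qed.

Let g u := (1 + `|W|^-1 * u) `^ (-2).
Let Gf u := - `|W| * (1 + `|W|^-1 * u) `^ (-1).

Let HG (u : R) : 0 <= u -> is_derive u 1 Gf (g u).
Proof.
move=> u0; have H := is_derive_powR1 (-1) (y1 u0).
apply: is_derive_eq; rewrite /GRing.scale /= /g.
have -> : -1 - 1 = -2 :> R by ring.
by field; rewrite gt_eqF // V0.
Qed.

Let ig_g : mu.-integrable (@pos R) (EFin \o g) /\ (\int[mu]_(u in @pos R) (g u)%:E = `|W|%:E)%E.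
Proof.
have cg : {within `[0, +oo[, continuous g}.
  apply: continuous_in_subspaceT => u; rewrite inE /= in_itv /= andbT => u0.
  exact: derivable_continuous (is_derive_derivable (is_derive_powR1 (-2) (y1 u0))).
have Gl : Gf u @[u --> +oo] --> (0 : R).
  apply/cvgrPdist_le => e e0.
  have P : \forall u \near +oo, (`|W| ^+ 2 / e : R) <= u by apply: nbhs_pinfty_ge; exact: num_real.
  have Q : \forall u \near +oo, (1 : R) <= u by apply: nbhs_pinfty_ge; exact: num_real.
  near=> u; have u1 : 1 <= u by near: u. have u2 : `|W| ^+ 2 / e <= u by near: u.
  have u0 : 0 <= u by lra.
  rewrite /Gf sub0r normrN mulNr normrN powR_inv1 ?(ltW (y1 u0)) //.
  rewrite ger0_norm; last by rewrite mulr_ge0 // invr_ge0 ltW // y1.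
  rewrite ler_pdivrMr ?y1 //.
  have h : `|W| ^+ 2 <= u * e by rewrite -ler_pdivrMr.
  have {}h : `|W| <= e * (`|W|^-1 * u).
    rewrite (_ : e * (`|W|^-1 * u) = (u * e) / `|W|); last by ring.
    by rewrite ler_pdivlMr // -expr2.
  by rewrite mulrDr mulr1; apply: le_trans h _; rewrite lerDr ltW.
have cG (u : R) : 0 <= u -> {for u, continuous Gf}.
  by move=> u0; exact: derivable_continuous (is_derive_derivable (HG u0)).
have E : (\int[mu]_(u in `[0%R, +oo[) (g u)%:E = 0%:E - (Gf 0%R)%:E)%E.
  apply: ge0_continuous_FTC2y => //.
  - by move=> u u0; exact: powR_ge0.
  - by move=> u u0; exact: is_derive_derivable (HG (ltW u0)).
  - exact/cvg_at_right_filter/cG.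
  - move=> u; rewrite in_itv /= andbT => u0.
    by rewrite derive1E; exact: is_derive_val (HG (ltW u0)).
have mg : measurable_fun (@pos R) (EFin \o g).
  apply/measurable_EFinP; apply: smooth_measurable => u u0.
  exact: is_derive_derivable (is_derive_powR1 (-2) (y1 (ltW u0))).
have E2 : (\int[mu]_(u in @pos R) (g u)%:E = `|W|%:E)%E.
  rewrite /pos integral_itv_obnd_cbnd // E -EFinB /Gf mulr0 addr0 powR1 mulr1.
  by rewrite sub0r opprK.
split=> //; apply/integrableP; split=> //.
have -> : (\int[mu]_(u in @pos R) `|(EFin \o g) u| = \int[mu]_(u in @pos R) (g u)%:E)%E.
  by apply: eq_integral => u _; rewrite /= ger0_norm // powR_ge0.
by rewrite E2 ltry.
Unshelve. all: by end_near.
Qed.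

Lemma cube_integrable : mu.-integrable (@pos R) (fun u => (psi (cbrt W u))%:E).
Proof.
have [Ig _] := ig_g.
apply: le_integrable (integrableZl (@mpos R) C Ig) => //; first exact: mpos.
  by apply/measurable_EFinP; exact: (smooth_measurable spsis).
move=> u /=; rewrite posE => u0; rewrite lee_fin.
apply: le_trans (psib (s_gt0 u0)) _; have [H _] := expb u0.
exact: le_trans H (ler_norm _).
Qed.

Lemma cube_bound : (\int[mu]_(u in @pos R) `|psi (cbrt W u)|%:E <= (C * `|W|)%:E)%E.
Proof.
have [Ig E] := ig_g.
rewrite EFinM -E -ge0_integralZl_EFin //; last 3 first.
- exact: mpos.
- by move=> u _; rewrite lee_fin powR_ge0.
- by have /integrableP[] := Ig.
apply: ge0_le_integral => //.
- exact: mpos.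
- have /integrableP[m _] := cube_integrable.
  by have := measurableT_comp (@abse_measurable R setT) m.
- by have /integrableP[] := integrableZl (@mpos R) C Ig.
- move=> u; rewrite posE => u0; rewrite -EFinM lee_fin.
  by apply: le_trans (psib (s_gt0 u0)) _; have [] := expb u0.
Qed.

(** The substitution u = |W| s^3 turns psi(s) du into |W| 3 s^2 psi(s) ds, with primitive |W|
    K(s). *)
Lemma cube_integral : \int[mu]_(u in @pos R) psi (cbrt W u) = - K 0 * `|W|.
Proof.
have -> : - K 0 * `|W| = 0 - `|W| * K 0 by ring.
apply: (@FTC_pos R (fun u => `|W| * K (s u)) (fun u => psi (s u)) (`|W| * K 0) 0).
- move=> u u0; have su := s_gt0 u0.
  have H := @is_derive1_comp R K s u _ _ (HK (s u)) (Hs u0).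
  have H' : is_derive u 1 (fun u => K (s u)) (3 * s u ^+ 2 * psi (s u) * (3 * s u ^+ 2 * `|W|)^-1) by exact: H.
  apply: is_derive_eq; rewrite /GRing.scale /=.
  by field; rewrite !gt_eqF // V0.
- exact: spsis.
- exact: cube_integrable.
- apply: cvgM; first exact: cvg_cst.
  have sl : s u @[u --> 0^'+] --> (0 : R).
    apply/cvgrPdist_le => e e0.
    have d0 : 0 < `|W| * e ^+ 3 by rewrite mulr_gt0 ?exprn_gt0 // V0.
    near=> u; have u0 : 0 < u by near: u; exact: nbhs_right_gt.
    have ue : u <= `|W| * e ^+ 3 by near: u; exact: nbhs_right_ltW.
    have su := s_gt0 u0; rewrite sub0r normrN ger0_norm ?(ltW su) //.
    rewrite -(ler_pXn2r (n := 3)) ?nnegrE ?(ltW su) ?(ltW e0) // s3 //.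
    by rewrite ler_pdivrMr ?V0 // mulrC.
  have cK : {for 0, continuous K} by exact: derivable_continuous (is_derive_derivable (HK 0)).
  exact: (cvg_comp _ _ sl cK).
- apply/cvgrPdist_le => e e0.
  have P : \forall u \near +oo, (`|C0| * C * `|W| ^+ 2 / e : R) <= u by apply: nbhs_pinfty_ge; exact: num_real.
  have Q : \forall u \near +oo, (1 : R) <= u by apply: nbhs_pinfty_ge; exact: num_real.
  near=> u; have u1 : 1 <= u by near: u. have u2 : `|C0| * C * `|W| ^+ 2 / e <= u by near: u.
  have u0 : 0 < u by lra.
  have [_ H] := expb u0; have su := s_gt0 u0; have Y0 := y1 (ltW u0).
  rewrite sub0r normrN normrM normr_id.
  apply: (@le_trans _ _ (`|W| * (`|C0| * (C * (1 + `|W|^-1 * u) `^ (-1))))).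
    rewrite ler_wpM2l //; apply: le_trans (Kb su) _; rewrite -mulrA.
    apply: (@le_trans _ _ (`|C0| * ((1 + s u) ^+ 2 * expR (- (2^-1 * s u))))).
      by rewrite ler_wpM2r ?ler_norm // mulr_ge0 ?expR_ge0 // exprn_ge0 // ltW // addr_gt0.
    by rewrite ler_wpM2l.
  rewrite powR_inv1 ?(ltW Y0) // !mulrA ler_pdivrMr //.
  have : `|C0| * C * `|W| ^+ 2 <= e * u by rewrite mulrC -ler_pdivrMl // mulrC.
  have V := V0 => h.
  have : `|W| * `|C0| * C <= e * (`|W|^-1 * u).
    rewrite (_ : e * (`|W|^-1 * u) = (e * u) / `|W|); last by ring.
    rewrite ler_pdivlMr //; move: h; rewrite expr2 => h.
    by apply: le_trans h; rewrite le_eqVlt; apply/orP; left; apply/eqP; ring.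
  by move=> h'; rewrite mulrDr mulr1; apply: le_trans h' _; rewrite lerDr ltW.
Unshelve. all: by end_near.
Qed.

End CubeFTC.

Lemma quad_bound1 (s : R) : 0 < s -> `|3 / 2 * s ^+ 2 - 3 * s - 6| <= 6 * (1 + s) ^+ 2.
Proof.
have S : (1 + s) ^+ 2 = 1 + 2 * s + s ^+ 2 by ring.
by move=> s0; rewrite ler_norml S; have := sqr_ge0 s; move=> h; apply/andP; split; lra.
Qed.

Lemma quad_bound2 (z s : R) : 0 <= z -> z <= 1 -> 0 < s ->
  `|- (3 * z * s ^+ 2) - 6 * z * s| <= 6 * (1 + s) ^+ 2.
Proof.
move=> z0 z1 s0.
have P : 0 <= z * s ^+ 2 <= s ^+ 2 by rewrite mulr_ge0 ?sqr_ge0 // ler_piMl // sqr_ge0.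
have Q : 0 <= z * s <= s by rewrite mulr_ge0 ?(ltW s0) // ler_piMl // ltW.
have S : (1 + s) ^+ 2 = 1 + 2 * s + s ^+ 2 by ring.
rewrite ler_norml; move: P Q; rewrite S => /andP[P1 P2] /andP[Q1 Q2]; apply/andP; split; lra.
Qed.

Lemma quad_bound3 (s : R) : 0 < s -> 0 <= 3 * s ^+ 2 + 6 * s + 6 <= 6 * (1 + s) ^+ 2.
Proof.
have S : (1 + s) ^+ 2 = 1 + 2 * s + s ^+ 2 by ring.
by move=> s0; rewrite S; have := sqr_ge0 s; move=> h; apply/andP; split; lra.
Qed.

Section Psi.
Variable h : R.
Hypothesis h2 : h ^+ 2 = 3 / 4.
Hypothesis h0 : 0 <= h /\ h <= 1.

(** [psi_re] and [psi_im] are the real and imaginary parts of exp (- f) with f^3 = u / W, where f =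
    s if W > 0 and f = e^(i pi/3) s if W < 0; [h] is sqrt 3 / 2. *)
Definition psi_re (W u : R) : R := let s := cbrt W u in
  if 0 < W then expR (- s) else expR (- (2^-1 * s)) * cos (h * s).
Definition psi_im (W u : R) : R := let s := cbrt W u in
  if 0 < W then 0 else - (expR (- (2^-1 * s)) * sin (h * s)).


(** A primitive of 3 s^2 e^(-z s) is - e^(-z s) (3 s^2 / z + 6 s / z^2 + 6 / z^3). [K1] is the case
    z = 1; [K2] and [K3] are the real and imaginary parts for z = 1/2 + i h, where 1/z = 1/2 - i h,
    1/z^2 = - 1/2 - i h and 1/z^3 = -1. *)
Let K1 (s : R) := - (3 * s ^+ 2 + 6 * s + 6) * expR (- s).
Let Ar (s : R) := 3 / 2 * s ^+ 2 - 3 * s - 6.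
Let Br (s : R) := - (3 * h * s ^+ 2) - 6 * h * s.
Let K2 (s : R) := - (expR (- (2^-1 * s)) * (Ar s * cos (h * s) + Br s * sin (h * s))).
Let K3 (s : R) := - (expR (- (2^-1 * s)) * (Br s * cos (h * s) - Ar s * sin (h * s))).

Let Hexp (c s : R) : is_derive s 1 (fun s => expR (- (c * s))) (- c * expR (- (c * s))).
Proof.
have Hg : is_derive s 1 (fun s : R => - (c * s)) (- c).
  by apply: is_derive_eq; rewrite /GRing.scale /=; ring.
have H := @is_derive1_comp R expR (fun s => - (c * s)) s _ _ (is_derive_expR _) Hg.
by rewrite mulrC.
Qed.

Let Hcos (c s : R) : is_derive s 1 (fun s => cos (c * s)) (- (c * sin (c * s))).
Proof.
have Hg : is_derive s 1 (fun s : R => c * s) c by apply: is_derive_eq; rewrite /GRing.scale /=; ring.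
have H := @is_derive1_comp R cos (fun s => c * s) s _ _ (is_derive_cos _) Hg.
by rewrite (_ : - (c * sin (c * s)) = - sin (c * s) * c) //; ring.
Qed.

Let Hsin (c s : R) : is_derive s 1 (fun s => sin (c * s)) (c * cos (c * s)).
Proof.
have Hg : is_derive s 1 (fun s : R => c * s) c by apply: is_derive_eq; rewrite /GRing.scale /=; ring.
have H := @is_derive1_comp R sin (fun s => c * s) s _ _ (is_derive_sin _) Hg.
by rewrite mulrC.
Qed.

Let HX (a b c s : R) : is_derive s 1 (fun s => a * s ^+ 2 + b * s + c) (2 * a * s + b).
Proof.
have H := is_derive_exp 2 s; apply: is_derive_eq; rewrite /GRing.scale /=; ring.
Qed.

Let HA (s : R) : is_derive s 1 Ar (3 * s - 3).
Proof.
have H := HX (3 / 2) (- 3) (- 6) s.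
rewrite (_ : Ar = fun s => 3 / 2 * s ^+ 2 + - 3 * s + - 6); last by apply/funext => x; rewrite /Ar; ring.
by rewrite (_ : 3 * s - 3 = 2 * (3 / 2) * s + - 3) //; field.
Qed.

Let HB (s : R) : is_derive s 1 Br (- (6 * h * s) - 6 * h).
Proof.
have H := HX (- (3 * h)) (- (6 * h)) 0 s.
rewrite (_ : Br = fun s => - (3 * h) * s ^+ 2 + - (6 * h) * s + 0); last by apply/funext => x; rewrite /Br; ring.
by rewrite (_ : - (6 * h * s) - 6 * h = 2 * - (3 * h) * s + - (6 * h)) //; ring.
Qed.

Let HK1 (s : R) : is_derive s 1 K1 (3 * s ^+ 2 * expR (- s)).
Proof.
have H := HX 3 6 6 s; have H2 := Hexp 1 s.
rewrite (_ : K1 = fun s => - (3 * s ^+ 2 + 6 * s + 6) * expR (- (1 * s))); last first.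
  by apply/funext => x; rewrite /K1 mul1r.
by apply: is_derive_eq; rewrite /GRing.scale /= !mul1r; ring.
Qed.

Let HK2 (s : R) : is_derive s 1 K2 (3 * s ^+ 2 * (expR (- (2^-1 * s)) * cos (h * s))).
Proof.
have H1 := HA s; have H2 := HB s; have H3 := Hexp 2^-1 s; have H4 := Hcos h s; have H5 := Hsin h s.
apply: is_derive_eq; rewrite /GRing.scale /= /Ar /Br.
have E : h * h = 3 / 4 by rewrite -expr2.
move: (expR _) (cos _) (sin _) E => e c d; move: h => z E.
have E1 k : k * (z * z) = k * (3 / 4) by rewrite E.
have {}E1 := E1 (e * (- 3 * s ^+ 2 - 6 * s) * c).
have E2 : e * (- 3 * s ^+ 2 - 6 * s) * c * (z * z) =
  z * (e * (- 3 * s ^+ 2 - 6 * s)) * (z * c) by ring.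
by lra.
Qed.

Let HK3 (s : R) : is_derive s 1 K3 (3 * s ^+ 2 * (- (expR (- (2^-1 * s)) * sin (h * s)))).
Proof.
have H1 := HA s; have H2 := HB s; have H3 := Hexp 2^-1 s; have H4 := Hcos h s; have H5 := Hsin h s.
apply: is_derive_eq; rewrite /GRing.scale /= /Ar /Br.
have E : h * h = 3 / 4 by rewrite -expr2.
move: (expR _) (cos _) (sin _) E => e c d; move: h => z E.
have {}E : e * (- 3 * s ^+ 2 - 6 * s) * d * (z * z) = e * (- 3 * s ^+ 2 - 6 * s) * d * (3 / 4) by rewrite E.
by lra.
Qed.

Let trig (a b x : R) : `|a * cos x + b * sin x| <= `|a| + `|b|.
Proof.
apply: le_trans (ler_normD _ _) _; rewrite !normrM lerD //.
  by rewrite ler_piMr // ler_norml cos_geN1 cos_le1.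
by rewrite ler_piMr // ler_norml sin_geN1 sin_le1.
Qed.

Let Kbd (s : R) : 0 < s -> `|Ar s| + `|Br s| <= 18 * (1 + s) ^+ 2.
Proof.
move=> s0; have [h1 h3] := h0.
have A : `|Ar s| <= 6 * (1 + s) ^+ 2 by exact: quad_bound1.
have B : `|Br s| <= 6 * (1 + s) ^+ 2 by exact: quad_bound2.
by have := sqr_ge0 (1 + s); lra.
Qed.

Let ebnd (s : R) : 0 < s -> expR (- s) <= expR (- (2^-1 * s)).
Proof. by move=> s0; rewrite ler_expR lerN2 ler_piMl ?(ltW s0) // invf_le1 // ler1n. Qed.

Let sprod (f g : R -> R) (f' g' : R -> R) : (forall s : R, is_derive s 1 f (f' s)) ->
  (forall s : R, is_derive s 1 g (g' s)) -> smooth (fun s => f s * g s).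
Proof.
by move=> Hf Hg s _; apply: derivableM; [exact: is_derive_derivable (Hf s)|exact: is_derive_derivable (Hg s)].
Qed.

Lemma psi_facts (C : R) (C0 : 0 <= C)
    (HC : forall y : R, 0 < y -> expR (- (2^-1 * y)) <= C * (1 + y) `^ (- 6%:R)) (W : R) : W != 0 ->
  [/\ mu.-integrable (@pos R) (fun u => (psi_re W u)%:E),
      mu.-integrable (@pos R) (fun u => (psi_im W u)%:E),
      \int[mu]_(u in @pos R) psi_re W u = 6 * W,
      \int[mu]_(u in @pos R) psi_im W u = 0 * W &
      (\int[mu]_(u in @pos R) `|psi_re W u|%:E <= (C * `|W|)%:E)%E /\
      (\int[mu]_(u in @pos R) `|psi_im W u|%:E <= (C * `|W|)%:E)%E].
Proof.
move=> W0.
have cs1 (c s : R) : `|expR (- (2^-1 * s)) * cos c| <= expR (- (2^-1 * s)).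
  by rewrite normrM ger0_norm ?expR_ge0 // ler_piMr ?expR_ge0 // ler_norml cos_geN1 cos_le1.
have cs2 (c s : R) : `|- (expR (- (2^-1 * s)) * sin c)| <= expR (- (2^-1 * s)).
  by rewrite normrN normrM ger0_norm ?expR_ge0 // ler_piMr ?expR_ge0 // ler_norml sin_geN1 sin_le1.
have [Wp|Wn] := ltP 0 W.
  have s1 : smooth (fun s : R => expR (- s)).
    by move=> s _; have := is_derive_derivable (Hexp 1 s); rewrite (_ : (fun s0 : R => expR (- (1 * s0))) = fun s => expR (- s)) //; apply/funext => x; rewrite mul1r.
  have b1 (s : R) : 0 < s -> `|expR (- s)| <= expR (- (2^-1 * s)).
    by move=> s0; rewrite ger0_norm ?expR_ge0 // ebnd.
  have k1 (s : R) : 0 < s -> `|K1 s| <= 6 * (1 + s) ^+ 2 * expR (- (2^-1 * s)).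
    move=> s0; rewrite /K1 normrM normrN [`|expR _|]ger0_norm ?expR_ge0 //.
    have /andP[q1 q2] := quad_bound3 s0.
    by apply: ler_pM; rewrite ?expR_ge0 ?ebnd // ger0_norm.
  have E1 : psi_re W = fun u => expR (- cbrt W u) by apply/funext => u; rewrite /psi_re Wp.
  have E2 : psi_im W = fun u => 0 by apply/funext => u; rewrite /psi_im Wp.
  rewrite E1 E2; split.
  - exact: (cube_integrable C0 HC W0 s1 b1).
  - exact: integrable0.
  - rewrite (cube_integral C0 HC W0 s1 b1 HK1 k1) /K1 gtr0_norm // oppr0 expR0 expr0n /=; ring.
  - by rewrite mul0r /Rintegral integral0_eq.
  - split; first exact: (cube_bound C0 HC W0 s1 b1).
    rewrite integral0_eq; last by move=> u _; rewrite normr0.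
    by rewrite lee_fin mulr_ge0.
have {}Wn : W < 0 by rewrite lt_neqAle W0.
have Wf : (0 < W) = false by rewrite ltNge (ltW Wn).
have s2 : smooth (fun s : R => expR (- (2^-1 * s)) * cos (h * s)).
  exact: (sprod (Hexp 2^-1) (Hcos h)).
have s3 : smooth (fun s : R => - (expR (- (2^-1 * s)) * sin (h * s))).
  by move=> s s0; apply: derivableN; exact: (sprod (Hexp 2^-1) (Hsin h) s0).
have b2 (s : R) : 0 < s -> `|expR (- (2^-1 * s)) * cos (h * s)| <= expR (- (2^-1 * s)) by [].
have b3 (s : R) : 0 < s -> `|- (expR (- (2^-1 * s)) * sin (h * s))| <= expR (- (2^-1 * s)) by [].
have kk (x s : R) : 0 < s -> `|x| <= `|Ar s| + `|Br s| ->
    `|- (expR (- (2^-1 * s)) * x)| <= 18 * (1 + s) ^+ 2 * expR (- (2^-1 * s)).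
  move=> s0 xb; rewrite normrN normrM ger0_norm ?expR_ge0 // mulrC ler_wpM2r ?expR_ge0 //.
  exact: le_trans xb (Kbd s0).
have k2 (s : R) : 0 < s -> `|K2 s| <= 18 * (1 + s) ^+ 2 * expR (- (2^-1 * s)).
  by move=> s0; apply: kk => //; exact: trig.
have k3 (s : R) : 0 < s -> `|K3 s| <= 18 * (1 + s) ^+ 2 * expR (- (2^-1 * s)).
  move=> s0; apply: kk => //; have := trig (Br s) (- Ar s) (h * s).
  by rewrite mulNr normrN [`|Br s| + _]addrC.
have E1 : psi_re W = fun u => (fun s => expR (- (2^-1 * s)) * cos (h * s)) (cbrt W u).
  by apply/funext => u; rewrite /psi_re Wf.
have E2 : psi_im W = fun u => (fun s => - (expR (- (2^-1 * s)) * sin (h * s))) (cbrt W u).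
  by apply/funext => u; rewrite /psi_im Wf.
rewrite E1 E2; split.
- exact: (cube_integrable C0 HC W0 s2 b2).
- exact: (cube_integrable C0 HC W0 s3 b3).
- rewrite (cube_integral C0 HC W0 s2 b2 HK2 k2) /K2 /Ar /Br ltr0_norm // !mulr0 oppr0 expR0 cos0 sin0 expr0n /=; ring.
- rewrite (cube_integral C0 HC W0 s3 b3 HK3 k3) /K3 /Ar /Br ltr0_norm // !mulr0 oppr0 expR0 cos0 sin0 expr0n /=; ring.
- by split; [exact: (cube_bound C0 HC W0 s2 b2)|exact: (cube_bound C0 HC W0 s3 b3)].
Qed.

End Psi.
End Cube.
End Fibres3.


Module Descriptors.
From mathcomp Require Import all_boot all_order all_algebra.
From mathcomp Require Import complex.
From mathcomp Require mpoly.
Import -(notations) mpoly.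
From mathcomp Require Import all_classical all_reals all_analysis.
From mathcomp Require Import measurable_realfun.
From mathcomp Require Import zify ring lra.
Require Import Defs.
Import Recursive LinearRecurrences SubdominantGrowth Oscillation OscillationLowDegree AffineRecurrences HalfLineIntegrals DecayAndSmoothness Fibres.
Set Implicit Arguments.
Unset Strict Implicit.
Unset Printing Implicit Defensive.
Import Order.TTheory GRing.Theory Num.Theory numFieldNormedType.Exports.
Local Open Scope classical_set_scope.
Local Open Scope ring_scope.
Local Open Scope complex_scope.

(** * Explicit descriptions of integrals *)

Section Descriptors.
Variable R : realType.
Local Notation mu := (@lebesgue_measure R).

(* The real number (u + w sqrt d) / t. *)
Definition quadp (u w d : int) (t : nat) : {poly rat} :=
  Poly [:: ratz (u * u + (- (w * w * d))) (t * t)%N; ratz (- (2 * u)) t; 1].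
(** The conjugate root lies on the other side of u / t, so the interval from u / t to (u + w (d +
    1)) / t isolates the wanted root, in view of sqrt d <= d + 1. *)
Definition rquad (u w d : int) (t : nat) : ralg :=
  (quadp u w d t,
   (ratz (if (0 <= w)%R then u else u + w * (d + 1)) t,
    ratz (if (0 <= w)%R then u + w * (d + 1) else u) t)).
Definition cal (a : ralg) : calg := (a.1, (a.2, (0, 0))).

Lemma ratr_ratz (z : int) (d : nat) : ratr (ratz z d) = z%:~R / d%:~R :> R.
Proof. by rewrite /ratz fmorph_div /= !ratr_int. Qed.

Lemma ratr_ratzC (z : int) (d : nat) : ratr (ratz z d) = (z%:~R / d%:~R)%:C :> R[i].
Proof. by rewrite /ratz fmorph_div /= !ratr_int rmorphM /= fmorphV !rmorph_int. Qed.

Lemma quadp_neq0 u w d t : quadp u w d t != 0.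
Proof.
apply: contra_neq (@oner_neq0 rat) => E.
by have := congr1 (fun p : {poly rat} => p`_2) E; rewrite /quadp coef_Poly coef0.
Qed.

Lemma horner_quad (K : comNzRingType) (f : {rmorphism rat -> K}) u w d t (x : K) :
  (map_poly f (quadp u w d t)).[x] =
  f (ratz (u * u + (- (w * w * d))) (t * t)%N) + f (ratz (- (2 * u)) t) * x + x ^+ 2.
Proof.
have s3 : (size (map_poly f (quadp u w d t)) <= 3)%N.
  by apply: leq_trans (size_poly _ _) _; rewrite /quadp; apply: leq_trans (size_Poly _) _.
rewrite (horner_coef_wide _ s3) !big_ord_recl big_ord0 !coef_map /quadp !coef_Poly /=.
by rewrite rmorph1 /bump /= mul1r addr0 expr0 mulr1 expr1 addrA.
Qed.

Lemma rquadP (u w d : int) (t : nat) : (0 < t)%N -> 0 <= d ->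
  ralg_ok R (rquad u w d t) /\
  ralg_val R (rquad u w d t) = (u%:~R + w%:~R * Num.sqrt d%:~R) / t%:~R.
Proof.
move=> t0 d0; set x := (_ / _).
have t0' : 0 < t%:~R :> R by rewrite ltr0z.
have d0' : 0 <= d%:~R :> R by rewrite ler0z.
pose S := Num.sqrt (d%:~R : R).
have S0 : 0 <= S by exact: sqrtr_ge0.
have S2 : S ^+ 2 = d%:~R by rewrite sqr_sqrtr.
have Sd : S <= d%:~R + 1 by rewrite -S2; nra.
have tt : ((t * t)%N : int)%:~R = t%:~R * t%:~R :> R by rewrite PoszM rmorphM.
have E y : (map_poly ratr (rquad u w d t).1).[y] =
    (y - x) * (y - (u%:~R - w%:~R * S) / t%:~R) :> R.
  rewrite horner_quad /= !ratr_ratz tt /x -/S !rmorphD !rmorphN !rmorphM /= -S2.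
  by field; rewrite gt_eqF.
have lo : ratr (rquad u w d t).2.1 = (if (0 <= w)%R then u%:~R else u%:~R + w%:~R * (d%:~R + 1)) / t%:~R :> R.
  by rewrite /= ratr_ratz; case: ifP => _ //; rewrite rmorphD rmorphM rmorphD.
have hi : ratr (rquad u w d t).2.2 = (if (0 <= w)%R then u%:~R + w%:~R * (d%:~R + 1) else u%:~R) / t%:~R :> R.
  by rewrite /= ratr_ratz; case: ifP => _ //; rewrite rmorphD rmorphM rmorphD.
have P : is_ralg (rquad u w d t) x.
  split; [exact: quadp_neq0|by rewrite /root E subrr mul0r|].
  rewrite lo hi /x; case: ifP => w0.
    have w0' : 0 <= w%:~R :> R by rewrite ler0z.
    by rewrite !ler_pM2r ?invr_gt0 // lerDl mulr_ge0 //= lerD2l ler_wpM2l.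
  have w0' : w%:~R <= 0 :> R by rewrite lerz0 leNgt; apply/negP => /ltW; rewrite w0.
  by rewrite !ler_pM2r ?invr_gt0 // lerD2l gerDl mulr_le0_ge0 // andbT ler_wnM2l.
have U y : is_ralg (rquad u w d t) y -> y = x.
  case=> _; rewrite /root E mulf_eq0 subr_eq0 => /orP[/eqP//|]; rewrite subr_eq0 => /eqP ->.
  rewrite lo hi /x -/S; case: ifP => w0.
    have w0' : 0 <= w%:~R :> R by rewrite ler0z.
    rewrite !ler_pM2r ?invr_gt0 // => /andP[H _].
    have wS : 0 <= w%:~R * S by exact: mulr_ge0.
    have -> : w%:~R * S = 0 by lra.
    by rewrite subr0 addr0.
  have w0' : w%:~R <= 0 :> R by rewrite lerz0 leNgt; apply/negP => /ltW; rewrite w0.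
  rewrite !ler_pM2r ?invr_gt0 // => /andP[_ H].
  have wS : w%:~R * S <= 0 by exact: mulr_le0_ge0.
  have -> : w%:~R * S = 0 by lra.
  by rewrite subr0 addr0.
split; first by exists x; split=> // y /U.
by apply: U; apply: (@xgetPex _ 0 [set x | is_ralg (rquad u w d t) x]); exists x.
Qed.

Lemma calP (a : ralg) : ralg_ok R a ->
  calg_ok R (cal a) /\ calg_val R (cal a) = (ralg_val R a)%:C.
Proof.
move=> [x [Px Ux]].
have va : ralg_val R a = x.
  by apply: esym; apply: Ux; apply: (@xgetPex _ 0 [set x | is_ralg a x]); exists x.
have RC (y : R) : (map_poly ratr a.1).[y%:C] = ((map_poly ratr a.1).[y])%:C :> R[i].
  rewrite -horner_map /= -map_poly_comp; congr (_.[_]).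
  by apply: eq_map_poly => q /=; rewrite fmorph_rat.
have Q : is_calg (cal a) x%:C.
  case: Px => a0 rx /andP[l h]; split=> //=.
  - by rewrite /root RC (rootP rx).
  - by apply/andP.
  - by rewrite rmorph0 lexx.
have U z : is_calg (cal a) z -> z = x%:C.
  case: z => zr zi [a0 rz /= lh]; rewrite rmorph0 => /andP[i1 i2].
  have zi0 : zi = 0 by apply/eqP; rewrite eq_le i1 i2.
  rewrite zi0 in rz *; rewrite -/(zr%:C) in rz *; congr (_%:C); apply: esym; apply: Ux.
  split=> //; move: rz; rewrite /root RC.
  by rewrite -(rmorph0 (real_complex R)) (inj_eq (@complexI R)).
split; first by exists x%:C; split=> // z /U.
by rewrite va; apply: U; apply: (@xgetPex _ 0 [set z | is_calg (cal a) z]); exists x%:C.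
Qed.

(* sqrt m, with nonnegative real and imaginary parts *)
Definition csqrtd (m : int) : calg :=
  (Poly [:: ratz (- m) 1; 0; 1], ((0, ratz (m * m + 1) 1), (0, ratz (m * m + 1) 1))).
Definition csqrtz (m : int) : R[i] :=
  if (0 <= m)%R then (Num.sqrt m%:~R)%:C else 0 +i* Num.sqrt (- m%:~R).

Lemma csqrtdP (m : int) : calg_ok R (csqrtd m) /\ calg_val R (csqrtd m) = csqrtz m.
Proof.
have E z : (map_poly ratr (csqrtd m).1).[z] = z ^+ 2 - (m%:~R)%:C :> R[i].
  have s3 : (size (map_poly ratr (csqrtd m).1 : {poly R[i]}) <= 3)%N.
    by apply: leq_trans (size_poly _ _) _; apply: leq_trans (size_Poly _) _.
  rewrite (horner_coef_wide _ s3) !big_ord_recl big_ord0 !coef_map !coef_Poly /=.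
  rewrite rmorph1 rmorph0 /bump /= ratr_ratzC divr1 rmorphN rmorphN /= mul0r mul1r expr0 mulr1 add0r addr0.
  by rewrite addrC.
have nz : (csqrtd m).1 != 0.
  apply: contra_neq (@oner_neq0 rat) => H.
  by have := congr1 (fun p : {poly rat} => p`_2) H; rewrite coef_Poly coef0.
have bd (r : R) : 0 <= r -> r ^+ 2 <= `|m%:~R| -> r <= ratr (ratz (m * m + 1) 1).
  move=> r0 rm; rewrite ratr_ratz divr1 rmorphD rmorphM /=.
  have : (m%:~R : R) * m%:~R = `|m%:~R| ^+ 2 by rewrite -normrX ger0_norm ?sqr_ge0 // expr2.
  move=> ->; move: rm; move: (`|m%:~R|) (normr_ge0 (m%:~R : R)) => M M0 rm.
  rewrite -(ler_pXn2r (n := 2)) ?nnegrE //; last by rewrite addr_ge0 // sqr_ge0.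
  apply: le_trans rm _; rewrite (_ : (M ^+ 2 + 1) ^+ 2 = (M ^+ 2) ^+ 2 + 2 * M ^+ 2 + 1); last by ring.
  by have := sqr_ge0 M; have := sqr_ge0 (M ^+ 2); have := sqr_ge0 (M - 1); rewrite [(M - 1) ^+ 2](_ : _ = M ^+ 2 - 2 * M + 1); [lra|ring].
have S2 : csqrtz m ^+ 2 = (m%:~R)%:C.
  rewrite /csqrtz; case: ifP => m0.
    by rewrite -rmorphXn /= sqr_sqrtr // ler0z.
  have m0' : 0 <= - m%:~R :> R by rewrite oppr_ge0 lerz0 leNgt; apply/negP => /ltW; rewrite m0.
  rewrite expr2; apply/eqP; rewrite eq_complex /=; apply/andP; split; apply/eqP.
    by rewrite mul0r -expr2 sqr_sqrtr //; ring.
  by ring.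
have P : is_calg (csqrtd m) (csqrtz m).
  split=> //; first by rewrite /root E S2 subrr.
  - rewrite /csqrtz /= rmorph0; case: ifP => m0 /=.
      by rewrite sqrtr_ge0 bd ?sqrtr_ge0 // sqr_sqrtr ?ler0z // ler_norm.
    by rewrite lexx bd // expr0n /= normr_ge0.
  - rewrite /csqrtz /= rmorph0; case: ifP => m0 /=.
      by rewrite lexx bd // expr0n /= normr_ge0.
    have m0' : 0 <= - m%:~R :> R by rewrite oppr_ge0 lerz0 leNgt; apply/negP => /ltW; rewrite m0.
    by rewrite sqrtr_ge0 bd ?sqrtr_ge0 // sqr_sqrtr // -[X in _ <= X]normrN ler_norm.
have U z : is_calg (csqrtd m) z -> z = csqrtz m.
  case=> _ rz; rewrite /= rmorph0 => /andP[r0 _] /andP[i0 _].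
  move: rz; rewrite /root E -S2 subr_sqr mulf_eq0 subr_eq0 => /orP[/eqP//|].
  rewrite addr_eq0 => /eqP ze.
  have [c0 c1] : 0 <= complex.Re (csqrtz m) /\ 0 <= complex.Im (csqrtz m).
    by rewrite /csqrtz; case: ifP => _ /=; rewrite ?sqrtr_ge0 ?lexx.
  move: r0 i0; rewrite ze; case: (csqrtz m) c0 c1 => cr ci /= c0 c1 r0 i0.
  have -> : cr = 0 by lra.
  have -> : ci = 0 by lra.
  by apply/eqP; rewrite eq_complex /= !oppr0 eqxx.
split; first by exists (csqrtz m); split=> // z /U.
by apply: U; apply: (@xgetPex _ 0 [set z | is_calg (csqrtd m) z]); exists (csqrtz m).
Qed.

Lemma intdP (c : int) : ralg_ok R (rquad c 0 0 1) /\ ralg_val R (rquad c 0 0 1) = c%:~R.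
Proof.
have [A ->] := @rquadP c 0 0 1 isT isT; split=> //.
by rewrite mul0r addr0 divr1.
Qed.

Definition cint (c : int) : calg := cal (rquad c 0 0 1).

Lemma cintP (c : int) : calg_ok R (cint c) /\ calg_val R (cint c) = (c%:~R)%:C.
Proof. by have [A B] := intdP c; have [C ->] := calP A; rewrite B. Qed.

(** * Two-dimensional exponential periods *)

Definition dom2 (D : nat) : seq (bool * mpol ralg) :=
  [:: (true, [:: (rquad 1 0 0 1, [:: 1%N])]); (true, [:: (rquad 1 0 0 1, [:: 0%N; 1%N])]);
      (true, [:: (rquad 1 0 0 1, [::]); (rquad (-1) 0 0 1, [:: 0%N; D]);
                 (rquad (-1) 0 0 1, [:: D; D])])].

(** The equations of f and g are linear in the last variable, so no branch has to be chosen: [[::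
    [::]]], one empty conjunction, always holds. With y = xi^D they describe f = - (c0 + c1 y + c2
    y^2) / (d0 + d1 y) and g = (q0 + q1 y + q2 y^2) xi^P tau^r. *)
Definition enc2f (D : nat) (d0 d1 : int) (c0 c1 c2 : calg) : algfun :=
  ([:: (cint d0, [:: 0; 0; 1]%N); (cint d1, [:: D; 0; 1]%N); (c0, [::]); (c1, [:: D]);
       (c2, [:: D + D]%N)], [:: [::]]).
Definition enc2g (D P r : nat) (q0 q1 q2 : int) : algfun :=
  ([:: (cint 1, [:: 0; 0; 1]%N); (cint (- q0), [:: P; r]); (cint (- q1), [:: P + D; r]%N);
       (cint (- q2), [:: P + (D + D); r]%N)], [:: [::]]).
Definition enc2 (D P r : nat) (d0 d1 : int) (c0 c1 c2 : calg) (q0 q1 q2 : int) : exp_period :=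
  (2, enc2f D d0 d1 c0 c1 c2, enc2g D P r q0 q1 q2, [:: dom2 D]).

End Descriptors.
End Descriptors.


(** * Correctness of the two-dimensional exponential periods *)

Module ExponentialPeriods.
From mathcomp Require Import all_boot all_order all_algebra.
From mathcomp Require Import complex.
From mathcomp Require mpoly.
Import -(notations) mpoly.
From mathcomp Require Import all_classical all_reals all_analysis.
From mathcomp Require Import measurable_realfun.
From mathcomp Require Import zify ring lra.
Require Import Defs.
Import Recursive LinearRecurrences SubdominantGrowth Oscillation OscillationLowDegree AffineRecurrences HalfLineIntegrals DecayAndSmoothness Fibres Fibres3 Descriptors.
Set Implicit Arguments.
Unset Strict Implicit.
Unset Printing Implicit Defensive.
Import Order.TTheory GRing.Theory Num.Theory numFieldNormedType.Exports.
Local Open Scope classical_set_scope.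
Local Open Scope ring_scope.
Local Open Scope complex_scope.

Section Enc2.
Variable R : realType.
Local Notation mu := (@lebesgue_measure R).

Lemma algfun_valE n (f : algfun) (x : n.-tuple R) (y : R[i]) :
  algfun_at f x y -> (forall y', algfun_at f x y' -> y' = y) -> algfun_val f x = y.
Proof.
by move=> fy U; apply: U; apply: (@xgetPex _ 0 [set y | algfun_at f x y]); exists y.
Qed.

Lemma exprD_powR (D P : nat) (e0 xi : R) : (0 < D)%N -> 0 < xi -> e0 * D%:R = P%:R + 1 ->
  xi ^+ P = (xi ^+ D) `^ (e0 - 1) * xi ^+ D.-1.
Proof.
move=> D0 x0 E; rewrite -!powR_mulrn ?(ltW x0) // -powRrM -powRD; last first.
  by rewrite (gt_eqF x0) implybT.
congr (_ `^ _); rewrite -subn1 natrB // mulrBr mulr1 [D%:R * e0]mulrC E; ring.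
Qed.

(** D is a common denominator of e0 and s: with y = xi^D one has y^(e0-1) dy = D xi^P dxi, and (1 +
    y)^(-s) is the fibre integral for r = s D - 1. *)
Lemma fibw_IO (D P r : nat) (e0 s : R) (f : R -> R) : (0 < D)%N ->
  e0 * D%:R = P%:R + 1 -> s * D%:R = r.+1%:R ->
  smooth f -> ig D (fun y => f y * (y `^ (e0 - 1) * (1 + y) `^ (- s))) ->
  [/\ measurable_fun setT (fun xi : R => if 0 < xi then f (xi ^+ D) * xi ^+ P else 0),
    mu.-integrable (@pos R)
      (fun xi : R => ((if 0 < xi then f (xi ^+ D) * xi ^+ P else 0) * fibw D r xi)%:E) &
    \int[mu]_(xi in @pos R) ((if 0 < xi then f (xi ^+ D) * xi ^+ P else 0) * fibw D r xi) =
      D%:R^-1 * IO D (fun y => f y * (y `^ (e0 - 1) * (1 + y) `^ (- s)))].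
Proof.
move=> D0 e0E sE sf If.
have Dn : D%:R != 0 :> R by rewrite pnatr_eq0 -lt0n.
have E xi : 0 < xi -> (if 0 < xi then f (xi ^+ D) * xi ^+ P else 0) * fibw D r xi =
    D%:R^-1 * (f (xi ^+ D) * ((xi ^+ D) `^ (e0 - 1) * (1 + xi ^+ D) `^ (- s)) * wgt D xi).
  move=> x0; rewrite x0 (exprD_powR D0 x0 e0E) /fibw /wgt.
  have -> : r.+1%:R / D%:R = s by rewrite -sE mulfK.
  by rewrite mulrC; field.
have I : mu.-integrable (@pos R)
    (fun xi : R => ((if 0 < xi then f (xi ^+ D) * xi ^+ P else 0) * fibw D r xi)%:E).
  have := integrableZl (@mpos R) (D%:R^-1) If; apply: eq_integrable; first exact: mpos.
  by move=> x; rewrite in_pos => x0; rewrite /= -EFinM E.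
split=> //.
  pose G : measurableTypeR R -> R := fun xi : R => f (xi ^+ D) * xi ^+ P.
  rewrite (_ : (fun xi : R => _) = (fun xi => f (xi ^+ D) * xi ^+ P) \_ (@pos R)); last first.
    by apply/funext => xi; rewrite patchE in_pos.
  apply: (proj1 (measurable_restrictT G (@mpos R))); apply: smooth_measurable => x x0; apply: derivableM; last exact: exprn_derivable.
  have fd : is_derive (x ^+ D) 1 f ('D_1 f (x ^+ D)) by split=> //; apply: sf; rewrite exprn_gt0.
  exact: is_derive_derivable (is_derive_pow x0 fd).
rewrite /IO -RintegralZl //; last exact: mpos.
by apply: eq_Rintegral => x; rewrite in_pos => /E.
Qed.

Lemma dom2P (D : nat) (a b : R) (p : size [:: a; b] == 2) :
  all (fun t => if t.1 then 0 < mpol_eval (@ralg_val R) t.2 (Tuple p)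
       else 0 <= mpol_eval (@ralg_val R) t.2 (Tuple p)) (dom2 D) = infib D a b.
Proof.
have [_ E1] := intdP R 1; have [_ E2] := intdP R (-1).
rewrite /= !mpol_evalE !big_cons !big_nil !big_ord_recl !big_ord0 !(tnth_nth 0) /= E1 E2 /infib andbT.
congr [&& _, _ & _]; try by rewrite !expr0 !expr1 ?mul1r ?mulr1 ?addr0.
rewrite -[RHS]subr_gt0; congr (0 < _); rewrite rmorphN1 rmorph1 !expr0; ring.
Qed.

Section Data.
Variables (D P r : nat) (d0 d1 : int) (c0 c1 c2 : calg) (q0 q1 q2 : int).
Variables (z0 z1 z2 : R[i]).
Hypothesis D0 : (0 < D)%N.
Hypothesis ok0 : calg_ok R c0 /\ calg_val R c0 = z0.
Hypothesis ok1 : calg_ok R c1 /\ calg_val R c1 = z1.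
Hypothesis ok2 : calg_ok R c2 /\ calg_val R c2 = z2.
Hypothesis dn0 : forall y : R, 0 < y -> d0%:~R + d1%:~R * y != 0.

Definition phi2 (y : R) : R[i] :=
  - (z0 + z1 * y%:C + z2 * (y ^+ 2)%:C) / (d0%:~R + d1%:~R * y)%:C.
Definition quad2 (y : R) : R := q0%:~R + q1%:~R * y + q2%:~R * y ^+ 2.

Let evf (a b : R) (p : size [:: a; b] == 2) (y : R[i]) :
  mpol_eval (@calg_val R) (enc2f D d0 d1 c0 c1 c2).1
    [tuple of rcons (map (fun t => t%:C) (Tuple p)) y] =
  (d0%:~R + d1%:~R * a ^+ D)%:C * y + (z0 + z1 * (a ^+ D)%:C + z2 * ((a ^+ D) ^+ 2)%:C).
Proof.
have [[_ E0] [_ E1] [_ E2]] := And3 ok0 ok1 ok2.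
have [_ F0] := cintP R d0; have [_ F1] := cintP R d1.
rewrite mpol_evalE !big_cons big_nil !big_ord_recl !big_ord0 !(tnth_nth 0) /= E0 E1 E2 F0 F1.
by rewrite !rmorphD !rmorphM !rmorphXn /= exprD !expr0 expr1; ring.
Qed.

Let evg (a b : R) (p : size [:: a; b] == 2) (y : R[i]) :
  mpol_eval (@calg_val R) (enc2g D P r q0 q1 q2).1
    [tuple of rcons (map (fun t => t%:C) (Tuple p)) y] =
  y - (quad2 (a ^+ D) * a ^+ P * b ^+ r)%:C.
Proof.
have [_ F] := cintP R 1; have [_ F0] := cintP R (- q0).
have [_ F1] := cintP R (- q1); have [_ F2] := cintP R (- q2).
rewrite mpol_evalE !big_cons big_nil !big_ord_recl !big_ord0 !(tnth_nth 0) /= F F0 F1 F2.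
rewrite /quad2 !rmorphM !rmorphD !rmorphM !rmorphXn /= !rmorphN !exprD !expr0 expr1 !rmorph1; ring.
Qed.

Let trueset n (x : n.-tuple R) : semialg_set (@ralg_val R) [:: [::]] x.
Proof. by []. Qed.

Let atf (a b : R) (p : size [:: a; b] == 2) y : 0 < a ->
  algfun_at (enc2f D d0 d1 c0 c1 c2) (Tuple p) y <-> y = phi2 (a ^+ D).
Proof.
move=> a0; have dn := dn0 (exprn_gt0 D a0); rewrite /algfun_at evf.
have dnC : (d0%:~R + d1%:~R * a ^+ D)%:C != 0 :> R[i].
  by rewrite -(rmorph0 (real_complex R)) (inj_eq (@complexI R)).
split=> [[E _]|->]; last first.
  by split=> //; rewrite /phi2 mulrC mulfVK // addNr.
apply: (mulIf dnC); rewrite /phi2 mulfVK //; apply/eqP.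
by rewrite -addr_eq0 mulrC E.
Qed.

Let atg (a b : R) (p : size [:: a; b] == 2) y :
  algfun_at (enc2g D P r q0 q1 q2) (Tuple p) y <-> y = (quad2 (a ^+ D) * a ^+ P * b ^+ r)%:C.
Proof.
rewrite /algfun_at evg; split=> [[E _]|->]; last by split=> //; rewrite subrr.
by apply/eqP; rewrite -subr_eq0 E.
Qed.

Let dom := @semialg_set R _ (@ralg_val R) 2 [:: dom2 D].

Let domE (x : 2.-tuple R) : dom x = infib D (tnth x 0) (tnth x 1) :> Prop.
Proof.
case: x => [[|a [|b []]] p] //.
by rewrite /dom /semialg_set /= orbF; have := dom2P D p; rewrite /= => ->; rewrite !(tnth_nth 0).
Qed.

Let mdom : measurable (dom : set (euclid R 2)).
Proof.
have -> : dom = (fun x : euclid R 2 => infib D (tnth x 0) (tnth x 1)) @^-1` [set true].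
  by apply/seteqP; split=> x; rewrite /preimage /= domE.
rewrite -[X in measurable X]setTI; exact: measurable_infib.
Qed.

Variables (Er Ei : R -> R) (e0 s : R).
Hypothesis HE : forall y, 0 < y -> cexp (- phi2 y) = Er y +i* Ei y.
Hypothesis e0E : e0 * D%:R = P%:R + 1.
Hypothesis sE : s * D%:R = r.+1%:R.

Let part (E : R -> R) (F : euclid R 2 -> R) : smooth E ->
  (forall x : 2.-tuple R, dom x -> F x = E (tnth x 0 ^+ D) *
     (quad2 (tnth x 0 ^+ D) * tnth x 0 ^+ P * tnth x 1 ^+ r)) ->
  ig D (fun y => E y * quad2 y * (y `^ (e0 - 1) * (1 + y) `^ (- s))) ->
  abs_cvg dom F /\ rint dom F =
   D%:R^-1 * IO D (fun y => E y * quad2 y * (y `^ (e0 - 1) * (1 + y) `^ (- s))) / r.+1%:R.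
Proof.
move=> sE' HF I.
have sf : smooth (fun y => E y * quad2 y).
  move=> y y0; apply: derivableM; first exact: sE'.
  by apply: derivableD; [apply: derivableD|].
have [m1 i1 v1] := fibw_IO D0 e0E sE sf I.
have [i2 v2] := fiber2 D0 m1 i1.
have EF : (EFin \o F) \_ dom = (fun x : euclid R 2 => (if infib D (tnth x 0) (tnth x 1) then
   (if 0 < tnth x 0 then E (tnth x 0 ^+ D) * quad2 (tnth x 0 ^+ D) * tnth x 0 ^+ P else 0) *
    tnth x 1 ^+ r else 0)%:E).
  apply/funext => x; rewrite patchE.
  have dE : (x \in dom) = infib D (tnth x 0) (tnth x 1).
    by apply/idP/idP; rewrite inE domE.
  rewrite dE; case: ifPn => // ix; rewrite /= HF ?domE //.
  by move: ix => /and3P[-> _ _]; rewrite !mulrA.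
split; first by rewrite /abs_cvg (integrable_mkcond _ mdom) EF.
by rewrite /rint /Rintegral integral_mkcond EF v2 v1.
Qed.

Lemma enc2P : smooth Er -> smooth Ei ->
  ig D (fun y => Er y * quad2 y * (y `^ (e0 - 1) * (1 + y) `^ (- s))) ->
  ig D (fun y => Ei y * quad2 y * (y `^ (e0 - 1) * (1 + y) `^ (- s))) ->
  exp_period_ok R (enc2 D P r d0 d1 c0 c1 c2 q0 q1 q2) /\
  (exp_period_val R (enc2 D P r d0 d1 c0 c1 c2 q0 q1 q2) = 0 <->
   IO D (fun y => Er y * quad2 y * (y `^ (e0 - 1) * (1 + y) `^ (- s))) = 0 /\
   IO D (fun y => Ei y * quad2 y * (y `^ (e0 - 1) * (1 + y) `^ (- s))) = 0).
Proof.
move=> sr si ir ii.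
have vE (x : 2.-tuple R) : dom x ->
  exp_integrand (enc2f D d0 d1 c0 c1 c2) (enc2g D P r q0 q1 q2) x =
  (Er (tnth x 0 ^+ D) +i* Ei (tnth x 0 ^+ D)) *
  (quad2 (tnth x 0 ^+ D) * tnth x 0 ^+ P * tnth x 1 ^+ r)%:C.
  case: x => [[|a [|b []]] p] //; rewrite domE !(tnth_nth 0) /= => /and3P[a0 _ _].
  rewrite /exp_integrand (@algfun_valE _ _ _ (phi2 (a ^+ D))); last 2 first.
  - exact/atf.
  - by move=> y /atf; apply.
  rewrite (@algfun_valE _ (enc2g _ _ _ _ _ _) _ (quad2 (a ^+ D) * a ^+ P * b ^+ r)%:C); last 2 first.
  - exact/atg.
  - by move=> y /atg.
  by rewrite HE // exprn_gt0.
have h1 (x : 2.-tuple R) : dom x ->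
    complex.Re (exp_integrand (enc2f D d0 d1 c0 c1 c2) (enc2g D P r q0 q1 q2) x) =
    Er (tnth x 0 ^+ D) * (quad2 (tnth x 0 ^+ D) * tnth x 0 ^+ P * tnth x 1 ^+ r).
  by move=> dx; rewrite vE //=; ring.
have [A1 B1] := part sr h1 ir.
have h2 (x : 2.-tuple R) : dom x ->
    complex.Im (exp_integrand (enc2f D d0 d1 c0 c1 c2) (enc2g D P r q0 q1 q2) x) =
    Ei (tnth x 0 ^+ D) * (quad2 (tnth x 0 ^+ D) * tnth x 0 ^+ P * tnth x 1 ^+ r).
  by move=> dx; rewrite vE //=; ring.
have [A2 B2] := part si h2 ii.
have one : size [:: 1 : R; 1] == 2 by [].
split.
  have oki (k : int) : calg_ok R (cint k) by have [] := cintP R k.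
  split.
  - have ok (k : int) : ralg_ok R (rquad k 0 0 1) by have [] := intdP R k.
    move=> c; rewrite inE => /eqP -> t; rewrite !inE => /or3P[] /eqP -> u;
    by rewrite !inE; do ?[case/orP]; move=> /eqP -> //=; apply: ok.
  - split.
    + move=> t; rewrite !inE; do ?[case/orP]; move=> /eqP -> /=; first [exact: oki | by case: ok0 | by case: ok1 | by case: ok2].
    + by move=> c; rewrite inE => /eqP -> t; rewrite in_nil.
    + have dn := dn0 ltr01; rewrite mulr1 in dn.
      have dnC : (d0%:~R + d1%:~R : R)%:C != 0 :> R[i].
        by rewrite -(rmorph0 (real_complex R)) (inj_eq (@complexI R)).
      pose y := (1 - (z0 + z1 + z2)) / (d0%:~R + d1%:~R : R)%:C.
      apply: (@mpoly_of_neq0 _ _ _ _ _ [tuple of rcons (map (fun t => t%:C) (Tuple one)) y]).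
      rewrite evf !expr1n !rmorph1 !mulr1 mulrC divfK // subrK oner_neq0 //.
    + case=> [[|a [|b []]] p] //; rewrite -/dom domE !(tnth_nth 0) /= => /and3P[a0 _ _].
      by exists (phi2 (a ^+ D)); split; [exact/atf|move=> y /atf ->].
  - split.
    + move=> t; rewrite !inE; do ?[case/orP]; move=> /eqP -> /=; exact: oki.
    + by move=> c; rewrite inE => /eqP -> t; rewrite in_nil.
    + apply: (@mpoly_of_neq0 _ _ _ _ _ [tuple of rcons (map (fun t => t%:C) (Tuple one)) (1 + (quad2 1)%:C)]).
      by rewrite evg !expr1n !mulr1 addrK oner_neq0.
    + case=> [[|a [|b []]] p] // _.
      by exists (quad2 (a ^+ D) * a ^+ P * b ^+ r)%:C; split; [exact/atg|move=> y /atg ->].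
  - by split.
have -> : exp_period_val R (enc2 D P r d0 d1 c0 c1 c2 q0 q1 q2) =
  rint dom (fun x : 2.-tuple R => complex.Re (exp_integrand (enc2f D d0 d1 c0 c1 c2) (enc2g D P r q0 q1 q2) x)) +i*
  rint dom (fun x : 2.-tuple R => complex.Im (exp_integrand (enc2f D d0 d1 c0 c1 c2) (enc2g D P r q0 q1 q2) x)) by [].
rewrite B1 B2.
have rn : r.+1%:R != 0 :> R by rewrite pnatr_eq0.
have Dn : D%:R != 0 :> R by rewrite pnatr_eq0 -lt0n.
have Z (x : R) : D%:R^-1 * x / r.+1%:R = 0 -> x = 0.
  by move/eqP; rewrite !mulf_eq0 !invr_eq0 (negbTE rn) (negbTE Dn) orbF /= => /eqP.
split=> [/eqP|[-> ->]]; last by rewrite mulr0 mul0r.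
by rewrite eq_complex /= => /andP[/eqP/Z -> /eqP/Z ->].
Qed.

End Data.
End Enc2.
End ExponentialPeriods.


Module PeriodLike.
From mathcomp Require Import all_boot all_order all_algebra.
From mathcomp Require Import complex.
From mathcomp Require mpoly.
Import -(notations) mpoly.
From mathcomp Require Import all_classical all_reals all_analysis.
From mathcomp Require Import measurable_realfun.
From mathcomp Require Import zify ring lra.
Require Import Defs.
Import Recursive LinearRecurrences SubdominantGrowth Oscillation OscillationLowDegree AffineRecurrences HalfLineIntegrals DecayAndSmoothness Fibres Fibres3 Descriptors ExponentialPeriods.
Set Implicit Arguments.
Unset Strict Implicit.
Unset Printing Implicit Defensive.
Import Order.TTheory GRing.Theory Num.Theory numFieldNormedType.Exports.
Local Open Scope classical_set_scope.
Local Open Scope ring_scope.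
Local Open Scope complex_scope.

(** * Three-dimensional period-like integrals *)

Section Enc1.
Variable R : realType.
Local Notation mu := (@lebesgue_measure R).
Local Notation h3 := (Num.sqrt 3 / 2 : R).

Lemma cpow_real (x a : R) : 0 < x -> cpow x%:C a%:C = (x `^ a)%:C.
Proof.
move=> x0; rewrite /cpow; have -> : (x%:C == 0 :> R[i]) = false.
  by rewrite -(rmorph0 (real_complex R)) (inj_eq (@complexI R)) gt_eqF.
have cm : cmod x%:C = x by rewrite /cmod /= expr0n /= addr0 sqrtr_sqr gtr0_norm.
have ca : carg x%:C = 0 by rewrite /carg cm /= lexx divff ?gt_eqF // acos1.
rewrite cm ca /cexp /= !mulr0 !mul0r subr0 addr0 cos0 sin0 /powR gt_eqF //.
by rewrite -[1 +i* 0]/(1 : R[i]) mulr1.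
Qed.

Lemma cexp_cube (W u : R) : 
  cexp (- (if 0 < W then (cbrt W u)%:C else (2^-1 * cbrt W u) +i* (h3 * cbrt W u))) =
  psi_re h3 W u +i* psi_im h3 W u.
Proof.
rewrite /psi_re /psi_im /cexp; case: ifP => _; apply/eqP; rewrite eq_complex /=.
  by rewrite oppr0 cos0 sin0; apply/andP; split; apply/eqP; ring.
by rewrite cosN sinN; apply/andP; split; apply/eqP; ring.
Qed.

(** Exactly one cube root of u / W has positive real and nonnegative imaginary part: the real one if
    W > 0, that of argument pi/3 if W < 0. These inequalities are the branch condition of
    [enc1f]. *)
Lemma cube_root (W u : R) (y : R[i]) : W != 0 -> 0 < u ->
  (W%:C * y ^+ 3 - u%:C = 0 /\ 0 < complex.Re y /\ 0 <= complex.Im y) <->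
  y = (if 0 < W then (cbrt W u)%:C else (2^-1 * cbrt W u) +i* (h3 * cbrt W u)).
Proof.
move=> W0 u0; set s := cbrt W u.
have V0 : 0 < `|W| by rewrite normr_gt0.
have s0 : 0 < s by rewrite powR_gt0 // divr_gt0.
have s3 : s ^+ 3 * `|W| = u.
  have v0 : 0 < u / `|W| by rewrite divr_gt0.
  rewrite /s /cbrt -powR_mulrn ?powR_ge0 // -powRrM mulVf ?powRr1 ?(ltW v0) ?pnatr_eq0 //.
  by rewrite divfK ?gt_eqF.
have hh : h3 ^+ 2 = 3 / 4 by rewrite expr_div_n sqr_sqrtr //; field.
have h0 : 0 < h3 by rewrite divr_gt0 // sqrtr_gt0.
move: (h3) hh h0 => h hh h0.
case: y => a b.
have cub : W%:C * (a +i* b) ^+ 3 - u%:C =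
    (W * (a ^+ 3 - 3 * a * b ^+ 2) - u) +i* (W * (b * (3 * a ^+ 2 - b ^+ 2))).
  by apply/eqP; rewrite eq_complex !exprS !expr0 /=; apply/andP; split; apply/eqP; ring.
rewrite cub; split=> [[/eqP] |].
  rewrite eq_complex /= => /andP[/eqP E1 /eqP E2] [a0 b0].
  move: E2 => /eqP; rewrite !mulf_eq0 (negbTE W0) /= => /orP[/eqP bz|/eqP bz].
    have aW : W * a ^+ 3 = u by rewrite bz in E1; move: E1; rewrite expr0n /= mulr0 subr0 => /eqP; rewrite subr_eq0 => /eqP.
    have Wp : 0 < W by rewrite -(pmulr_lgt0 _ (exprn_gt0 3 a0)) aW.
    rewrite Wp bz; suff -> : a = s by [].
    apply/eqP; rewrite -(eqrXn2 (n := 3)) ?(ltW a0) ?(ltW s0) //; apply/eqP.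
    by apply: (mulfI W0); rewrite aW -s3 gtr0_norm // mulrC.
  have bz2 : b ^+ 2 = 3 * a ^+ 2 by lra.
  have aW : - W * (2 * a) ^+ 3 = u.
    move: E1; rewrite bz2 => E1; have -> : u = W * (a ^+ 3 - 3 * a * (3 * a ^+ 2)) by lra.
    by rewrite !exprS expr0; ring.
  have Wn : 0 < - W by rewrite -(pmulr_lgt0 _ (exprn_gt0 3 (mulr_gt0 (ltr0Sn _ 1) a0))) aW.
  have -> : (0 < W) = false by rewrite ltNge -oppr_ge0 (ltW Wn).
  have as2 : 2 * a = s.
    apply/eqP; rewrite -(eqrXn2 (n := 3)) ?(ltW s0) ?mulr_ge0 ?(ltW a0) //; apply/eqP.
    apply: (mulfI (x := - W)); first by rewrite oppr_eq0.
    by rewrite aW -s3 ltr0_norm -?oppr_gt0 // mulrC.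
  have bh : b = h * s.
    apply/eqP; rewrite -(eqrXn2 (n := 2)) ?b0 ?mulr_ge0 ?(ltW s0) ?(ltW h0) //; apply/eqP.
    by rewrite bz2 exprMn hh -as2 exprMn; field.
  by rewrite bh -as2; congr (_ +i* _); field.
case: ifP => Wp [-> ->].
  rewrite gtr0_norm // in s3; split; last by split.
  by apply/eqP; rewrite eq_complex /= -s3; apply/andP; split; apply/eqP; ring.
have Wn : W < 0 by rewrite lt_neqAle W0 /= leNgt Wp.
rewrite ltr0_norm // in s3; split; last by rewrite mulr_gt0 ?invr_gt0 // mulr_ge0 // ltW.
have E2 : (h * s) ^+ 2 = 3 / 4 * s ^+ 2 by rewrite exprMn hh.
apply/eqP; rewrite eq_complex /= E2 -s3; apply/andP; split; apply/eqP.
  by rewrite !exprS expr0; field.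
by rewrite !exprS expr0; field.
Qed.

Lemma measurable_cbrt d (T : measurableType d) (f g : T -> R) :
  measurable_fun setT f -> measurable_fun setT g -> measurable_fun setT (fun x => cbrt (f x) (g x)).
Proof.
move=> mf mg; rewrite /cbrt.
have -> : (fun x => (g x / `|f x|) `^ 3^-1) = (fun x => (g x * `|f x| `^ (-1)) `^ 3^-1).
  by apply/funext => x; rewrite powR_inv1.
apply: (measurableT_comp (measurable_powR _)); apply: measurable_funM => //.
by apply: (measurableT_comp (measurable_powR _)); exact: (measurableT_comp (@normr_measurable R setT)).
Qed.

Lemma measurable_psi : measurable_fun setT (fun z : R * R => psi_re h3 z.1 z.2) /\
  measurable_fun setT (fun z : R * R => psi_im h3 z.1 z.2).
Proof.
have mc : measurable_fun setT (fun z : R * R => cbrt z.1 z.2).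
  by apply: measurable_cbrt; [exact: measurable_fst|exact: measurable_snd].
have mk (k : R) : measurable_fun setT (fun z : R * R => k * cbrt z.1 z.2).
  by apply: measurable_funM => //; exact: measurable_cst.
have me (k : R) : measurable_fun setT (fun z : R * R => expR (- (k * cbrt z.1 z.2))).
  apply: (measurableT_comp (@measurable_expR R)).
  exact: (measurableT_comp (@oppr_measurable R setT) (mk k)).
have ms : measurable_fun setT (fun z : R * R => 0 < z.1).
  by apply: measurable_fun_ltr; [exact: measurable_cst|exact: measurable_fst].
have cos_m : measurable_fun setT (@cos R) by apply: continuous_measurable_fun; exact: continuous_cos.
have sin_m : measurable_fun setT (@sin R) by apply: continuous_measurable_fun; exact: continuous_sin.
split; apply: measurable_fun_ifT => //.
- by have := me 1; under eq_fun do rewrite mul1r.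
- by apply: measurable_funM => //; exact: (measurableT_comp cos_m (mk _)).
- apply: (measurableT_comp (@oppr_measurable R setT)).
  by apply: measurable_funM => //; exact: (measurableT_comp sin_m (mk _)).
Qed.

Definition dom3 (D P r : nat) (a0 a1 : ralg) : seq (bool * mpol ralg) :=
  dom2 D ++ [:: (true, [:: (rquad 1 0 0 1, [:: 0; 0; 1]%N)]);
                (true, [:: (a0, [:: P; r]); (a1, [:: P + D; r]%N)])].
Definition enc1f (D P r : nat) (a0 a1 : ralg) : algfun :=
  ([:: (cal a0, [:: P; r; 0; 3]%N); (cal a1, [:: P + D; r; 0; 3]%N); (cint (-1), [:: 0; 0; 1]%N)],
   [:: [:: (true, [:: (rquad 1 0 0 1, [:: 0; 0; 0; 1]%N)]);
           (false, [:: (rquad 1 0 0 1, [:: 0; 0; 0; 0; 1]%N)])]]).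
Definition enc1h (D : nat) (mk : ralg) : algfun :=
  ([:: (cint 1, [:: 0; 0; 0; 1]%N); (cint (-1), [::]); (cal mk, [:: D])], [:: [::]]).
(** [n0], [n1] are meant to describe the opposites of [a0], [a1], and [mk] that of the slope ka. The
    two conjunctions of the domain are then W > 0 and - W > 0, with union W != 0. *)
Definition enc1 (D P r : nat) (a0 a1 n0 n1 mk ex : ralg) : period_like :=
  (3, enc1f D P r a0 a1, [:: (enc1h D mk, cal ex)], [:: dom3 D P r a0 a1; dom3 D P r n0 n1]).

Section Data.
Variables (D P r : nat) (a0 a1 n0 n1 mk ex : ralg) (w0 w1 ka e e0 s : R).
Hypothesis D0 : (0 < D)%N.
Hypothesis ok0 : ralg_ok R a0 /\ ralg_val R a0 = w0.
Hypothesis ok1 : ralg_ok R a1 /\ ralg_val R a1 = w1.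
Hypothesis okn0 : ralg_ok R n0 /\ ralg_val R n0 = - w0.
Hypothesis okn1 : ralg_ok R n1 /\ ralg_val R n1 = - w1.
Hypothesis okm : ralg_ok R mk /\ ralg_val R mk = - ka.
Hypothesis oke : ralg_ok R ex /\ ralg_val R ex = e.
Hypothesis ka0 : 0 <= ka.
Hypothesis e0E : e0 * D%:R = P%:R + 1.
Hypothesis sE : s * D%:R = r.+1%:R.

Let w (y : R) := w0 + w1 * y.
Let wf (xi : R) := if 0 < xi then w (xi ^+ D) * xi ^+ P else 0.
Let Hf (xi : R) := if 0 < xi then (1 + ka * xi ^+ D) `^ e else 0.
Let i2 : 'I_3 := Ordinal (isT : (2 < 3)%N).

Let evW (a b c : R) (p : size [:: a; b; c] == 3) (x0 x1 : ralg) :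
  mpol_eval (@ralg_val R) [:: (x0, [:: P; r]); (x1, [:: P + D; r]%N)] (Tuple p) =
  (ralg_val R x0 + ralg_val R x1 * a ^+ D) * a ^+ P * b ^+ r.
Proof.
rewrite mpol_evalE !big_cons big_nil !big_ord_recl !big_ord0 !(tnth_nth 0) /=.
by rewrite exprD !expr0; ring.
Qed.

Let evd (a b c : R) (p : size [:: a; b; c] == 3) (x0 x1 : ralg) :
  all (fun t => if t.1 then 0 < mpol_eval (@ralg_val R) t.2 (Tuple p)
       else 0 <= mpol_eval (@ralg_val R) t.2 (Tuple p)) (dom3 D P r x0 x1) =
  infib D a b && ((0 < c) && (0 < (ralg_val R x0 + ralg_val R x1 * a ^+ D) * a ^+ P * b ^+ r)).
Proof.
have [_ E1] := intdP R 1; have [_ E2] := intdP R (-1).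
rewrite /dom3 all_cat [X in _ && X]/= evW andbT; congr (_ && (_ && _)).
  rewrite /= !mpol_evalE !big_cons !big_nil !big_ord_recl !big_ord0 !(tnth_nth 0) /= E1 E2 /infib andbT.
  congr [&& _, _ & _]; try by rewrite !expr0 !expr1 ?mul1r ?mulr1 ?addr0.
  rewrite -[RHS]subr_gt0; congr (0 < _); rewrite rmorphN1 rmorph1 !expr0; ring.
rewrite mpol_evalE big_cons big_nil !big_ord_recl big_ord0 !(tnth_nth 0) /= E1.
by rewrite !expr0 expr1 !mul1r !mulr1 addr0.
Qed.

Let dom := @semialg_set R _ (@ralg_val R) 3 [:: dom3 D P r a0 a1; dom3 D P r n0 n1].

Let domE (x : 3.-tuple R) : dom x = infib D (tnth x 0) (tnth x 1) &&
  ((0 < tnth x i2) && (wf (tnth x 0) * tnth x 1 ^+ r != 0)) :> Prop.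
Proof.
case: x => [[|a [|b [|c []]]] p] //.
pose FF := fun t : bool * mpol ralg => if t.1 then 0 < mpol_eval (@ralg_val R) t.2 (Tuple p)
       else 0 <= mpol_eval (@ralg_val R) t.2 (Tuple p).
have -> : dom (Tuple p) = (all FF (dom3 D P r a0 a1) || (all FF (dom3 D P r n0 n1) || false)) :> Prop by [].
rewrite orbF !evd !(tnth_nth 0) /=.
have [[_ ->] [_ ->]] := (ok0, ok1); have [[_ ->] [_ ->]] := (okn0, okn1).
case: (boolP (infib D a b)) => //= /and3P[ap _ _]; case: (0 < c) => //=.
rewrite /wf ap /w; set z := _ * b ^+ r.
have -> : (- w0 + - w1 * a ^+ D) * a ^+ P * b ^+ r = - z by rewrite /z; ring.
by rewrite oppr_gt0 neq_lt orbC.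
Qed.

Let mdom : measurable (dom : set (euclid R 3)).
Proof.
have mt k : measurable_fun setT (fun x : euclid R 3 => tnth x k : R) by exact: measurable_tnth.
have -> : dom = (fun x : euclid R 3 => infib D (tnth x 0) (tnth x 1) && ((0 < tnth x i2) &&
   ((w0 + w1 * tnth x 0 ^+ D) * tnth x 0 ^+ P * tnth x 1 ^+ r != 0))) @^-1` [set true].
  apply/seteqP; split=> x; rewrite /preimage /= domE /wf;
  by case: (boolP (infib D (tnth x 0) (tnth x 1))) => //= /and3P[-> _ _].
have mX k m : measurable_fun setT (fun x : euclid R 3 => tnth x k ^+ m : R).
  by apply: measurable_funX; exact: mt.
rewrite -[X in measurable X]setTI; apply: (_ : measurable_fun setT _) => //.
apply: measurable_and; first exact: measurable_infib.
apply: measurable_and; first by apply: measurable_fun_ltr => //; exact: measurable_cst.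
apply: measurable_neg; apply: measurable_fun_eqr; last exact: measurable_cst.
do 2![apply: measurable_funM => //]; apply: measurable_funD; first exact: measurable_cst.
by apply: measurable_funM => //; exact: measurable_cst.
Qed.

Let f0 (y : R) := w y * (1 + ka * y) `^ e.
Let pw (y : R) : R := y `^ (e0 - 1) * (1 + y) `^ (- s).

Let ka1 (y : R) : 0 < y -> 0 < 1 + ka * y.
Proof. by move=> y0; rewrite ltr_wpDr // mulr_ge0 // ltW. Qed.

Let sh : smooth (fun y => (1 + ka * y) `^ e).
Proof. by move=> y y0; exact: is_derive_derivable (is_derive_powR1 e (ka1 y0)). Qed.

Let sw : smooth w.
Proof. by move=> y _; apply: derivableD. Qed.

Let sf0 : smooth f0.
Proof. by move=> y y0; apply: derivableM; [exact: sw|exact: sh]. Qed.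

Let mif (g : R -> R) (m : nat) : smooth g ->
  measurable_fun setT (fun xi : R => if 0 < xi then g (xi ^+ D) * xi ^+ m else 0).
Proof.
move=> sg; rewrite (_ : (fun xi : R => _) = (fun xi => g (xi ^+ D) * xi ^+ m) \_ (@pos R)); last first.
  by apply/funext => xi; rewrite patchE in_pos.
pose G : measurableTypeR R -> R := fun xi : R => g (xi ^+ D) * xi ^+ m.
apply: (proj1 (measurable_restrictT G (@mpos R))).
apply: smooth_measurable => x x0; apply: derivableM; last exact: exprn_derivable.
have fd : is_derive (x ^+ D) 1 g ('D_1 g (x ^+ D)) by split=> //; apply: sg; rewrite exprn_gt0.
exact: is_derive_derivable (is_derive_pow x0 fd).
Qed.

Hypothesis I0 : ig D (fun y => f0 y * pw y).

Let part (Psi : R -> R -> R) (C c : R) (F : euclid R 3 -> R) :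
  measurable_fun setT (fun z : R * R => Psi z.1 z.2) ->
  (forall W, W != 0 -> mu.-integrable (@pos R) (fun u => (Psi W u)%:E)) ->
  (forall W, W != 0 -> \int[mu]_(u in @pos R) Psi W u = c * W) ->
  (forall W, W != 0 -> (\int[mu]_(u in @pos R) `|Psi W u|%:E <= (C * `|W|)%:E)%E) ->
  (forall x : 3.-tuple R, dom x -> F x = Psi (wf (tnth x 0) * tnth x 1 ^+ r) (tnth x i2) * Hf (tnth x 0)) ->
  abs_cvg dom F /\ rint dom F = c * (D%:R^-1 * IO D (fun y => f0 y * pw y)) / r.+1%:R.
Proof.
move=> mP PI PE PC HF.
have [_ i1 v1] := fibw_IO D0 e0E sE sf0 I0.
have mw : measurable_fun setT wf by exact: mif.
have mH : measurable_fun setT Hf.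
  by have := mif 0 sh; under eq_fun do rewrite expr0 mulr1.
have wE xi : wf xi * Hf xi = if 0 < xi then f0 (xi ^+ D) * xi ^+ P else 0.
  by rewrite /wf /Hf /f0; case: ifP => _; [ring|rewrite mul0r].
have i1' : mu.-integrable (@pos R) (fun xi => (wf xi * Hf xi * fibw D r xi)%:E).
  by under eq_fun do rewrite wE.
have [i2' v2] := fiber3 D0 mw mH mP PI PE PC i1'.
have EF : (EFin \o F) \_ dom = (fun x : euclid R 3 =>
   (if infib D (tnth x 0) (tnth x 1) && ((0 < tnth x i2) && (wf (tnth x 0) * tnth x 1 ^+ r != 0)) then
   Psi (wf (tnth x 0) * tnth x 1 ^+ r) (tnth x i2) * Hf (tnth x 0) else 0)%:E).
  apply/funext => x; rewrite patchE.
  have dE : (x \in dom) = infib D (tnth x 0) (tnth x 1) && ((0 < tnth x i2) && (wf (tnth x 0) * tnth x 1 ^+ r != 0)).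
    by apply/idP/idP; rewrite inE domE.
  by rewrite dE; case: ifPn => // ix; rewrite /= HF ?domE.
split; first by rewrite /abs_cvg (integrable_mkcond _ mdom) EF.
rewrite /rint /Rintegral integral_mkcond EF v2; congr (c * _ / _); rewrite -v1.
by apply: eq_Rintegral => x _; rewrite wE.
Qed.

Let root3 (W u : R) : R[i] :=
  if 0 < W then (cbrt W u)%:C else (2^-1 * cbrt W u) +i* (h3 * cbrt W u).

Let atf (a b c : R) (p : size [:: a; b; c] == 3) y :
  let W := w (a ^+ D) * a ^+ P * b ^+ r in W != 0 -> 0 < c ->
  algfun_at (enc1f D P r a0 a1) (Tuple p) y <-> y = root3 W c.
Proof.
move=> W W0 c0; have [[k_0 v0] [k_1 v1]] := (ok0, ok1).
have [_ E0] := calP k_0; have [_ E1] := calP k_1; have [_ E2] := cintP R (-1).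
have [_ E3] := intdP R 1.
rewrite -(cube_root y W0 c0) /algfun_at.
have -> : mpol_eval (@calg_val R) (enc1f D P r a0 a1).1
    [tuple of rcons (map (fun t => t%:C) (Tuple p)) y] = W%:C * y ^+ 3 - c%:C.
  rewrite mpol_evalE !big_cons big_nil !big_ord_recl !big_ord0 !(tnth_nth 0) /= E0 E1 E2 v0 v1.
  by rewrite /W /w !rmorphM !rmorphD !rmorphM !rmorphXn /= exprD !expr0 rmorphN1; ring.
have -> : semialg_set (@ralg_val R) (enc1f D P r a0 a1).2
    [tuple of rcons (rcons (Tuple p) (complex.Re y)) (complex.Im y)] =
   ((0 < complex.Re y) && (0 <= complex.Im y)) :> Prop.
  rewrite /semialg_set /= !mpol_evalE !big_cons !big_nil !big_ord_recl !big_ord0 !(tnth_nth 0) /= E3.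
  by rewrite !expr0 !expr1 !mul1r !mulr1 !addr0 andbT orbF.
by split=> [[E /andP[]]|[E [h1 h2]]]; split=> //; apply/andP.
Qed.

Let ath (a b c : R) (p : size [:: a; b; c] == 3) y :
  algfun_at (enc1h D mk) (Tuple p) y <-> y = (1 + ka * a ^+ D)%:C.
Proof.
have [k_m vm] := okm; have [_ E0] := calP k_m; have [_ E1] := cintP R 1; have [_ E2] := cintP R (-1).
have E : mpol_eval (@calg_val R) (enc1h D mk).1
    [tuple of rcons (map (fun t => t%:C) (Tuple p)) y] = y - (1 + ka * a ^+ D)%:C.
  rewrite mpol_evalE !big_cons big_nil !big_ord_recl !big_ord0 !(tnth_nth 0) /= E0 E1 E2 vm.
  by rewrite !rmorphD !rmorphN !rmorphM !rmorphXn /= !expr0 expr1 !rmorph1; ring.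
rewrite /algfun_at E; split=> [[/eqP]|->]; last by split=> //; rewrite subrr.
by rewrite subr_eq0 => /eqP.
Qed.

(** Over u the exponential integrates to 6 W, with imaginary part 0 for either sign of W, so the
    value is a positive multiple of the half-line integral. *)
Lemma enc1P : period_like_ok R (enc1 D P r a0 a1 n0 n1 mk ex) /\
  (period_like_val R (enc1 D P r a0 a1 n0 n1 mk ex) = 0 <->
   IO D (fun y => (w0 + w1 * y) * (1 + ka * y) `^ e * (y `^ (e0 - 1) * (1 + y) `^ (- s))) = 0).
Proof.
have [k_e ve] := oke; have [k_ce vce] := calP k_e.
have vE (x : 3.-tuple R) : dom x ->
  like_integrand (enc1f D P r a0 a1) [:: (enc1h D mk, cal ex)] x =
  (psi_re h3 (wf (tnth x 0) * tnth x 1 ^+ r) (tnth x i2) +i* psi_im h3 (wf (tnth x 0) * tnth x 1 ^+ r) (tnth x i2)) *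
  (Hf (tnth x 0))%:C.
  case: x => [[|a [|b [|c []]]] p] //; rewrite domE !(tnth_nth 0) /= => /andP[/and3P[ap _ _] /andP[cp W0]].
  rewrite /wf /Hf ap in W0 *.
  rewrite /like_integrand big_cons big_nil addr0.
  rewrite (@algfun_valE _ _ _ _ (root3 (w (a ^+ D) * a ^+ P * b ^+ r) c)); last 2 first.
  - exact/atf.
  - by move=> y /(atf _ _ W0 cp).
  rewrite (@algfun_valE _ _ (enc1h D mk) _ (1 + ka * a ^+ D)%:C); last 2 first.
  - exact/ath.
  - by move=> y /ath.
  by rewrite cexp_cube vce ve cpow_real // ka1 // exprn_gt0.
have h0 : 0 < 2^-1 :> R by rewrite invr_gt0.
have [C' HC'] := exp_decay (- 6%:R) h0.
have HC (y : R) : 0 < y -> expR (- (2^-1 * y)) <= `|C'| * (1 + y) `^ (- 6%:R).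
  by move=> y0; apply: le_trans (HC' y y0) _; rewrite ler_wpM2r ?powR_ge0 // ler_norm.
have hh : h3 ^+ 2 = 3 / 4 by rewrite expr_div_n sqr_sqrtr //; field.
have hb : 0 <= h3 /\ h3 <= 1.
  have p0 : 0 <= h3 by rewrite divr_ge0 ?sqrtr_ge0.
  split=> //; rewrite -(ler_pXn2r (n := 2)) ?nnegrE // hh expr1n; lra.
have facts W W0 := @psi_facts R h3 hh hb `|C'| (normr_ge0 _) HC W W0.
have [m1 m2] := measurable_psi.
have [A1 B1] := @part (psi_re h3) `|C'| 6 (fun x => complex.Re (like_integrand (enc1f D P r a0 a1) [:: (enc1h D mk, cal ex)] x)) m1
  (fun W W0 => let: And5 q _ _ _ _ := facts W W0 in q)
  (fun W W0 => let: And5 _ _ q _ _ := facts W W0 in q)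
  (fun W W0 => let: And5 _ _ _ _ (conj q _) := facts W W0 in q)
  (fun x dx => etrans (congr1 (@complex.Re R) (vE x dx)) (ltac:(by rewrite /= mulr0 subr0))).
have [A2 B2] := @part (psi_im h3) `|C'| 0 (fun x => complex.Im (like_integrand (enc1f D P r a0 a1) [:: (enc1h D mk, cal ex)] x)) m2
  (fun W W0 => let: And5 _ q _ _ _ := facts W W0 in q)
  (fun W W0 => let: And5 _ _ _ q _ := facts W W0 in q)
  (fun W W0 => let: And5 _ _ _ _ (conj _ q) := facts W W0 in q)
  (fun x dx => etrans (congr1 (@complex.Im R) (vE x dx)) (ltac:(by rewrite /= mulr0 add0r))).
have oki (k : int) : calg_ok R (cint k) by have [] := cintP R k.
have ok (k : int) : ralg_ok R (rquad k 0 0 1) by have [] := intdP R k.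
have one : size [:: 1 : R; 1; 1] == 3 by [].
have [[k_0 v0] [k_1 v1]] := (ok0, ok1); have [[k_n0 _] [k_n1 _]] := (okn0, okn1); have [k_m vm] := okm.
have [k_c0 _] := calP k_0; have [k_c1 _] := calP k_1; have [k_cm _] := calP k_m.
split.
  split.
  - move=> c; rewrite !inE => /orP[] /eqP -> t; rewrite /dom3 mem_cat !inE; do ?[case/orP];
    move=> /eqP -> u; rewrite !inE; do ?[case/orP]; move=> /eqP -> //=; exact: ok.
  - split.
    + by move=> t; rewrite !inE; do ?[case/orP]; move=> /eqP -> /=.
    + move=> c; rewrite inE => /eqP -> t; rewrite !inE => /orP[] /eqP -> u; rewrite inE => /eqP -> /=; exact: ok.
    + apply: (@mpoly_of_neq0 _ _ _ _ _ [tuple of rcons (map (fun t => t%:C) (Tuple one)) 0]).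
      have [_ E2] := cintP R (-1).
      rewrite mpol_evalE !big_cons big_nil !big_ord_recl !big_ord0 !(tnth_nth 0) /= E2.
      have -> : ((-1)%:~R : R)%:C = -1 :> R[i] by exact: (rmorphN1 (real_complex R)).
      rewrite (rmorph1 (real_complex R)) !expr1n.
      by rewrite [X in X != 0](_ : _ = -1) ?oppr_eq0 ?oner_neq0 //; ring.
    + case=> [[|a [|b [|c []]]] p] //; rewrite -/dom domE !(tnth_nth 0) /= => /andP[/and3P[ap _ _] /andP[cp W0]].
      rewrite /wf ap in W0.
      by exists (root3 (w (a ^+ D) * a ^+ P * b ^+ r) c); split; [exact/atf|move=> y /(atf _ _ W0 cp) ->].
  - move=> t; rewrite inE => /eqP ->; split=> //; split.
    + by move=> u; rewrite !inE; do ?[case/orP]; move=> /eqP -> /=.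
    + by move=> c; rewrite inE => /eqP -> u; rewrite in_nil.
    + apply: (@mpoly_of_neq0 _ _ _ _ _ [tuple of rcons (map (fun t => t%:C) (Tuple one)) (2 + ka)%:C]).
      have [_ E0] := calP k_m; have [_ E1] := cintP R 1; have [_ E2] := cintP R (-1).
      rewrite mpol_evalE !big_cons big_nil !big_ord_recl !big_ord0 !(tnth_nth 0) /= E0 E1 E2 vm.
      rewrite -(rmorph0 (real_complex R)) (_ : _ + _ = 1%:C) ?(inj_eq (@complexI R)) ?oner_neq0 //.
      rewrite !expr1n !expr0 !expr1 !rmorphD !rmorphN !rmorph1; ring.
    + case=> [[|a [|b [|c []]]] p] // _.
      by exists (1 + ka * a ^+ D)%:C; split; [exact/ath|move=> y /ath ->].
  - by split.
have -> : period_like_val R (enc1 D P r a0 a1 n0 n1 mk ex) =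
  rint dom (fun x => complex.Re (like_integrand (enc1f D P r a0 a1) [:: (enc1h D mk, cal ex)] x)) +i*
  rint dom (fun x => complex.Im (like_integrand (enc1f D P r a0 a1) [:: (enc1h D mk, cal ex)] x)) by [].
rewrite B1 B2.
have rn : r.+1%:R != 0 :> R by rewrite pnatr_eq0.
have Dn : D%:R != 0 :> R by rewrite pnatr_eq0 -lt0n.
have s6 : 6%:R != 0 :> R by rewrite pnatr_eq0.
split=> [/eqP|]; last by move=> ->; rewrite !mulr0 !mul0r.
rewrite eq_complex /= => /andP[/eqP H _]; apply/eqP; move/eqP: H.
by rewrite !mulf_eq0 !invr_eq0 (negbTE rn) (negbTE Dn) (negbTE s6) orbF /=.
Qed.

End Data.
End Enc1.
End PeriodLike.


Module MomentSolutions.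
From mathcomp Require Import all_boot all_order all_algebra.
From mathcomp Require Import complex.
From mathcomp Require mpoly.
Import -(notations) mpoly.
From mathcomp Require Import all_classical all_reals all_analysis.
From mathcomp Require Import measurable_realfun.
From mathcomp Require Import zify ring lra.
Require Import Defs.
Import Recursive LinearRecurrences SubdominantGrowth Oscillation OscillationLowDegree AffineRecurrences HalfLineIntegrals DecayAndSmoothness Fibres.
Set Implicit Arguments.
Unset Strict Implicit.
Unset Printing Implicit Defensive.
Import Order.TTheory GRing.Theory Num.Theory numFieldNormedType.Exports.
Local Open Scope classical_set_scope.
Local Open Scope ring_scope.

(** * The minimal solutions as moments *)

Section Classes.
Variable R : realType.
Variable D : nat.
Hypothesis D0 : (0 < D)%N.
Implicit Types (X Y : R).

(** If X, Y are the initial values of v, the integral is the Casoratian that tests v against m. *)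
Definition represents (m : nat -> R) (F : R -> R -> R -> R) :=
  forall X Y : R, ig D (F X Y) /\ IO D (F X Y) = Y * m 0%N - X * m 1%N.

Lemma ig_eq (f g : R -> R) : (forall y, 0 < y -> f y = g y) -> ig D f -> ig D g.
Proof.
move=> fg; apply: eq_integrable; first exact: mpos.
by move=> x; rewrite in_pos => x0; rewrite /= fg // exprn_gt0.
Qed.

Lemma IO_eq (f g : R -> R) : (forall y, 0 < y -> f y = g y) -> IO D f = IO D g.
Proof.
by move=> fg; apply: eq_Rintegral => x; rewrite in_pos => x0; rewrite fg // exprn_gt0.
Qed.

Lemma fold_derive (al y : R) : 0 < y ->
  is_derive y 1 (fun y => al * y / (1 + y)) (al / (1 + y) ^+ 2).
Proof.
move=> y0; have y1 : 1 + y != 0 by rewrite gt_eqF // addr_gt0.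
have H : is_derive y 1 (fun y : R => 1 + y) 1 by apply: is_derive_eq; rewrite /GRing.scale /=; ring.
have HV := @is_deriveV R (fun y : R => 1 + y) y 1 1 y1 H.
have HM : is_derive y 1 (fun y : R => al * y) al by apply: is_derive_eq; rewrite /GRing.scale /=; ring.
apply: is_derive_eq; rewrite /GRing.scale /=; by field.
Qed.

Lemma fold_bound (al y : R) : 0 < al -> 0 < y -> 0 < al * y / (1 + y) <= al.
Proof.
move=> a0 y0; have y1 : 0 < 1 + y by rewrite addr_gt0.
rewrite divr_gt0 ?mulr_gt0 //= ler_pdivrMr // mulrDr mulr1 lerDr ltW //.
Qed.

Lemma exp_derive (g : R -> R) (d y : R) : is_derive y 1 g d ->
  is_derive y 1 (fun y => expR (g y)) (d * expR (g y)).
Proof.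
move=> H; have := @is_derive1_comp R expR g y _ _ (is_derive_expR _) H.
by rewrite mulrC.
Qed.

Section Distinct.
Variables (a3 b3 a2 b2 a1 b1 al be ea eb e0 q : R).
Hypothesis a3n0 : a3 != 0.
Hypothesis al0 : 0 < al.
Hypothesis ben0 : be != 0.
Hypothesis bel : be - al != 0.
Hypothesis a2E : a2 = a3 * (al + be).
Hypothesis a1E : a1 = - a3 * al * be.
Hypothesis ka0 : 0 < 1 - al / be.
Hypothesis b1E : b1 = e0 * a1.
Hypothesis b3E : b3 = q * a3.
Hypothesis e01 : 1 <= e0.
Hypothesis ea0 : 0 < ea.
Hypothesis ebE : eb * be * (a3 * (be - al)) = b3 * be ^+ 2 - b2 * be - b1.
Hypothesis sumE : e0 + ea + eb = q.

Let ka := 1 - al / be.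
Let ka1 (y : R) : 0 < y -> 0 < 1 + ka * y.
Proof. by move=> y0; rewrite addr_gt0 // mulr_gt0. Qed.
Let x (y : R) := al * y / (1 + y).
Let rho (y : R) := 1 + ka * y.

(** In the variable x = al y / (1 + y) this is, up to a constant, Euler's hypergeometric integral of
    x^(n+e0-1) (al - x)^(ea-1) (1 - x/be)^(eb-1) over 0 < x < al. The factor 1 - x/be equals (1 + ka
    y) / (1 + y). Convergence asks nothing of eb. *)
Lemma moments_distinct : exists m : nat -> R,
  [/\ asol a3 b3 a2 b2 a1 b1 m, forall n, 0 < m n,
     forall n, m n <= al ^+ n * m 0%N /\ m n.+1 <= al * m n &
     represents m (fun X Y y => (Y + (Y - X * al) * y) * (1 + (1 - al / be) * y) `^ (eb - 1) *
       (y `^ (e0 - 1) * (1 + y) `^ (- q)))].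
Proof.
have a1n0 : a1 != 0 by rewrite a1E !mulf_neq0 // ?oppr_eq0 // gt_eqF.
pose T1 y := rho y `^ (eb - 1); pose T y := rho y `^ eb.
have Hx (y : R) : 0 < y -> is_derive y 1 x (al / (1 + y) ^+ 2) by exact: fold_derive.
have HT (y : R) : 0 < y -> is_derive y 1 T (ka * eb * T1 y).
  by move=> y0; exact: (is_derive_powR1 eb (ka1 y0)).
have sT1 : smooth T1.
  by move=> y y0; exact: is_derive_derivable (is_derive_powR1 (eb - 1) (ka1 y0)).
have ET y : 0 < y -> T y = rho y * T1 y.
  by move=> y0; rewrite /T /T1 mulrC -powR_succ ?subrK //; exact: ka1.
have Hr y : 0 < y -> `|rho y| <= (1 + ka) * (1 + y).
  move=> y0; rewrite ger0_norm; last by rewrite ltW // ka1.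
  have k0 : 0 < ka := ka0.
  have -> : (1 + ka) * (1 + y) = rho y + (y + ka) by rewrite /rho; ring.
  by rewrite lerDl addr_ge0 // ltW.
have x0 y : 0 < y -> 0 < x y by move=> y0; have /andP[] := fold_bound al0 y0.
have xa y : 0 < y -> x y <= al by move=> y0; have /andP[] := fold_bound al0 y0.
have T10 y : 0 < y -> 0 < T1 y by move=> y0; rewrite powR_gt0 // ka1.
have HB n : exists C : R, forall y, 0 < y ->
    x y ^+ n * T1 y <= C * (1 + y) `^ (q - e0 - 1 - ea).
  have -> : q - e0 - 1 - ea = eb - 1 by rewrite -sumE; ring.
  (* Since rho y lies between c0 (1 + y) and c1 (1 + y), its power is bounded by the same power of 1
     + y whatever the sign of eb - 1. *)
  pose c1 := Num.max 1 ka; pose c0 := Num.min 1 ka.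
  have k0 : 0 < ka := ka0.
  have c00 : 0 < c0 by rewrite lt_min ltr01.
  exists (al ^+ n * (c1 `^ (eb - 1) + c0 `^ (eb - 1))) => y y0.
  have y1 : 0 < 1 + y by rewrite addr_gt0.
  rewrite -mulrA; apply: ler_pM.
  - by rewrite exprn_ge0 // ltW // x0.
  - by rewrite ltW // T10.
  - by apply: lerXn2r; rewrite ?nnegrE ?(ltW (x0 y y0)) ?(ltW al0) ?xa.
  have up : rho y <= c1 * (1 + y).
    have h1 : 1 <= c1 by rewrite le_max lexx.
    have h2 : ka * y <= c1 * y by rewrite ler_wpM2r ?(ltW y0) // le_max lexx orbT.
    by rewrite /rho mulrDr mulr1 lerD.
  have dn : c0 * (1 + y) <= rho y.
    have h1 : c0 <= 1 by rewrite ge_min lexx.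
    have h2 : c0 * y <= ka * y by rewrite ler_wpM2r ?(ltW y0) // ge_min lexx orbT.
    by rewrite /rho mulrDr mulr1 lerD.
  have c10 : 0 < c1 by rewrite lt_max ltr01.
  rewrite mulrDl /T1; have r0 := ka1 y0.
  have [e1|e1] := leP 0 (eb - 1).
    apply: (@le_trans _ _ ((c1 * (1 + y)) `^ (eb - 1))).
      by apply: ge0_ler_powR; rewrite ?nnegrE ?(ltW r0) ?mulr_ge0 ?(ltW c10) ?(ltW y1).
    by rewrite powRM ?(ltW c10) ?(ltW y1) // lerDl mulr_ge0 ?powR_ge0.
  apply: (@le_trans _ _ ((c0 * (1 + y)) `^ (eb - 1))).
    have -> : eb - 1 = - (1 - eb) by ring.
    have e2 : 0 <= 1 - eb by rewrite subr_ge0; apply: ltW; rewrite -subr_lt0.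
    have z1 : 0 < c0 * (1 + y) by exact: mulr_gt0.
    rewrite !powRN lef_pV2 ?posrE ?powR_gt0 //.
    by apply: ge0_ler_powR; rewrite ?nnegrE ?(ltW r0) ?(ltW z1).
  by rewrite powRM ?(ltW c00) ?(ltW y1) // lerDr mulr_ge0 ?powR_ge0.
pose k := - a1^-1.
have kn0 : k != 0 by rewrite oppr_eq0 invr_eq0.
have an0 : al != 0 by rewrite gt_eqF.
have c1 y : 0 < y -> al / (1 + y) ^+ 2 * (y / (1 + y)) * rho y =
    x y * (a3 * x y ^+ 2 - a2 * x y - a1) * k.
  move=> y0; have y1 : 1 + y != 0 by rewrite gt_eqF // addr_gt0.
  rewrite /x /rho /ka /k a2E a1E; field; rewrite ?y1 ?ben0 ?a3n0 ?an0 //.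
have b2E : b2 = (b3 * be ^+ 2 - b1 - eb * be * (a3 * (be - al))) / be.
  by rewrite ebE; field.
have c2 y : 0 < y -> (y / (1 + y)) * (rho y * (e0 / y - q / (1 + y)) + ka * eb) =
    (b3 * x y ^+ 2 - b2 * x y - b1) * k.
  move=> y0; have y1 : 1 + y != 0 by rewrite gt_eqF // addr_gt0.
  rewrite /x /rho /ka /k b2E b3E b1E a1E; field; rewrite ?y1 ?ben0 ?a3n0 ?an0 ?(gt_eqF y0) //.
have S := moment_sol D0 e01 ea0 kn0 Hx HT sT1 ET Hr x0 T10 HB c1 c2.
have W := ig_weight D0 e01 ea0 Hx sT1 x0 T10 HB.
exists (moment D x T1 e0 q); split.
- exact: S.
- by move=> n; exact: (moment_gt0 D0 e01 ea0 Hx sT1 x0 T10 HB).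
- by move=> n; exact: (moment_le D0 e01 ea0 Hx sT1 x0 T10 HB _ xa).
move=> X Y.
have E y : 0 < y -> Y * (x y ^+ 0 * weight T1 e0 q y) + - X * (x y ^+ 1 * weight T1 e0 q y) =
   (Y + (Y - X * al) * y) * (1 + (1 - al / be) * y) `^ (eb - 1) * (y `^ (e0 - 1) * (1 + y) `^ (- q)).
  move=> y0; have y1 : 0 < 1 + y by rewrite addr_gt0.
  rewrite expr0 expr1 /weight -/ka -/(rho y) -/(T1 y) (_ : 1 - q = - q + 1); last by ring.
  rewrite powR_succ // /x; field; rewrite gt_eqF //.
have [I V] := IO_lin Y (- X) (W 0%N) (W 1%N).
split; first exact: ig_eq E I.
by rewrite -(IO_eq E) V mulNr.
Qed.

End Distinct.

Section Exponential.
Variables (a3 b3 a2 b2 a1 b1 e0 q k : R) (x x' E tau rho T1 : R -> R) (Cr eps : R).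
Hypothesis e01 : 1 <= e0.
Hypothesis eps0 : 0 < eps.
Hypothesis k0 : k != 0.
Hypothesis Hx : forall y : R, 0 < y -> is_derive y 1 x (x' y).
Hypothesis x0 : forall y, 0 < y -> 0 < x y.
Hypothesis sT1 : smooth T1.
Hypothesis T10 : forall y, 0 < y -> 0 < T1 y.
Hypothesis HE : forall y : R, 0 < y -> is_derive y 1 E (tau y * T1 y).
Hypothesis ET : forall y, 0 < y -> E y = rho y * T1 y.
Hypothesis Hrho : forall y, 0 < y -> `|rho y| <= Cr * (1 + y).
Hypothesis HB : forall n, exists C : R, forall y, 0 < y ->
  x y ^+ n * T1 y <= C * (1 + y) `^ (q - e0 - 1 - eps).
Hypothesis c1 : forall y, 0 < y ->
  x' y * (y / (1 + y)) * rho y = x y * (a3 * x y ^+ 2 - a2 * x y - a1) * k.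
Hypothesis c2 : forall y, 0 < y ->
  (y / (1 + y)) * (rho y * (e0 / y - q / (1 + y)) + tau y) =
  (b3 * x y ^+ 2 - b2 * x y - b1) * k.

Lemma moments_general (F : R -> R -> R -> R) (al : R) :
  (forall X Y y, 0 < y -> (Y - X * x y) * weight T1 e0 q y = F X Y y) ->
  exists m : nat -> R,
  [/\ asol a3 b3 a2 b2 a1 b1 m, forall n, 0 < m n,
     (forall y, 0 < y -> x y <= al) -> forall n, m n <= al ^+ n * m 0%N /\ m n.+1 <= al * m n,
     forall n, m n.+1 ^+ 2 <= m n * m n.+2 & represents m F].
Proof.
move=> HF.
have S := moment_sol D0 e01 eps0 k0 Hx HE sT1 ET Hrho x0 T10 HB c1 c2.
have W := ig_weight D0 e01 eps0 Hx sT1 x0 T10 HB.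
exists (moment D x T1 e0 q); split.
- exact: S.
- by move=> n; exact: (moment_gt0 D0 e01 eps0 Hx sT1 x0 T10 HB).
- by move=> xa n; exact: (moment_le D0 e01 eps0 Hx sT1 x0 T10 HB _ xa).
- by move=> n; exact: (moment_logconvex D0 e01 eps0 Hx sT1 x0 T10 HB).
move=> X Y.
have E' y : 0 < y -> Y * (x y ^+ 0 * weight T1 e0 q y) + - X * (x y ^+ 1 * weight T1 e0 q y) = F X Y y.
  by move=> y0; rewrite -HF // expr0 expr1; ring.
have [I V] := IO_lin Y (- X) (W 0%N) (W 1%N).
split; first exact: ig_eq E' I.
by rewrite -(IO_eq E') V mulNr.
Qed.

End Exponential.

Lemma smooth_exp (g : R -> R) (g' : R -> R) : (forall y : R, 0 < y -> is_derive y 1 g (g' y)) ->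
  smooth (fun y => expR (g y)).
Proof. by move=> H y y0; exact: is_derive_derivable (exp_derive (H y y0)). Qed.

Lemma smooth_divS (f : R -> R) : smooth f -> smooth (fun y => f y / (1 + y)).
Proof.
move=> sf y y0; have y1 : 1 + y != 0 by rewrite gt_eqF // addr_gt0.
have H : is_derive y 1 (fun y : R => 1 + y) 1 by apply: is_derive_eq; rewrite /GRing.scale /=; ring.
have HV := @is_deriveV R (fun y : R => 1 + y) y 1 1 y1 H.
by apply: derivableM; [exact: sf|exact: is_derive_derivable HV].
Qed.

(** When the two roots merge, the powers at al and be degenerate into exp (- c y), where y = x / (al
    - x) has its pole at the double root; c is B(al) / a1 for B = b3 X^2 - b2 X - b1. *)
Lemma moments_double (a3 b3 a2 b2 a1 b1 al c e0 q : R) : a3 != 0 -> 0 < al ->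
  a2 = 2 * a3 * al -> a1 = - a3 * al ^+ 2 -> 0 < c ->
  c * a1 = b3 * al ^+ 2 - b2 * al - b1 ->
  b1 = e0 * a1 -> b3 = q * a3 -> 1 <= e0 ->
  exists m : nat -> R,
  [/\ asol a3 b3 a2 b2 a1 b1 m, forall n, 0 < m n,
     forall n, m n <= al ^+ n * m 0%N /\ m n.+1 <= al * m n &
     represents m (fun X Y y => expR (- (c * y)) * (Y + (Y - X * al) * y + 0 * y ^+ 2) *
       (y `^ (e0 - 1) * (1 + y) `^ (- q)))].
Proof.
move=> a3n0 al0 a2E a1E c0 cE b1E b3E e01.
have an0 : al != 0 by rewrite gt_eqF.
have a1n0 : a1 != 0 by rewrite a1E mulf_neq0 ?oppr_eq0 // expf_neq0.
have Hc (y : R) : is_derive y 1 (fun y => - (c * y)) (- c).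
  by apply: is_derive_eq; rewrite /GRing.scale /=; ring.
pose x (y : R) := al * y / (1 + y).
have xb y : 0 < y -> 0 < x y <= al by exact: fold_bound.
have [||||||||||||m [M1 M2 M3 M4 M5]] := @moments_general a3 b3 a2 b2 a1 b1 e0 q (- a1^-1) x (fun y => al / (1 + y) ^+ 2)
  (fun y => expR (- (c * y))) (fun=> - c) (fun=> 1) (fun y => expR (- (c * y))) 1 1 e01 ltr01 _ _ _ _ _ _ _ _ _ _ _
  (fun X Y y => expR (- (c * y)) * (Y + (Y - X * al) * y + 0 * y ^+ 2) *
       (y `^ (e0 - 1) * (1 + y) `^ (- q))) al _.
- by rewrite oppr_eq0 invr_eq0.
- by move=> y y0; exact: fold_derive.
- by move=> y /xb/andP[].
- by apply: (@smooth_exp _ (fun=> - c)) => y _.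
- by move=> y _; exact: expR_gt0.
- by move=> y y0; exact: exp_derive.
- by move=> y _; rewrite mul1r.
- by move=> y y0; rewrite normr1 mul1r lerDl ltW.
- move=> n; have [C HC] := exp_decay (q - e0 - 1 - 1) c0; exists (al ^+ n * C) => y y0.
  have /andP[h1 h2] := xb y y0; rewrite -mulrA; apply: ler_pM; rewrite ?expR_ge0 ?exprn_ge0 ?(ltW h1) //.
    by apply: lerXn2r; rewrite ?nnegrE ?(ltW h1) ?(ltW al0).
  exact: HC.
- move=> y y0; have y1 : 1 + y != 0 by rewrite gt_eqF // addr_gt0.
  by rewrite /x a2E a1E; field; rewrite ?y1 ?a3n0 ?an0.
- move=> y y0; have y1 : 1 + y != 0 by rewrite gt_eqF // addr_gt0.
  have b2E : b2 = (b3 * al ^+ 2 - b1 - c * a1) / al by rewrite cE; field.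
  by rewrite /x b2E b3E b1E a1E; field; rewrite ?y1 ?a3n0 ?an0 ?(gt_eqF y0).
- move=> X Y y y0; have y1 : 0 < 1 + y by rewrite addr_gt0.
  rewrite /weight (_ : 1 - q = - q + 1); last by ring.
  by rewrite powR_succ // /x; field; rewrite gt_eqF.
by exists m; split=> //; apply: M3 => y /xb/andP[].
Qed.

(** Up to a constant, Kummer's integral of x^(n+e0-1) (al - x)^(ea-1) exp (- la x / al) over 0 < x <
    al. *)
Lemma moments_linear (b3 a2 b2 a1 b1 al la ea e0 : R) : a2 != 0 -> 0 < al ->
  a1 = - a2 * al -> b1 = e0 * a1 -> 1 <= e0 -> 0 < ea ->
  la = b3 * al / a2 -> ea * al * a2 = - (b3 * al ^+ 2 - b2 * al - b1) ->
  exists m : nat -> R,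
  [/\ asol 0 b3 a2 b2 a1 b1 m, forall n, 0 < m n,
     forall n, m n <= al ^+ n * m 0%N /\ m n.+1 <= al * m n &
     represents m (fun X Y y => expR (- (la * y / (1 + y))) * (Y + (Y - X * al) * y + 0 * y ^+ 2) *
       (y `^ (e0 - 1) * (1 + y) `^ (- (e0 + ea + 1))))].
Proof.
move=> a2n0 al0 a1E b1E e01 ea0 laE eaE.
have an0 : al != 0 by rewrite gt_eqF.
have a1n0 : a1 != 0 by rewrite a1E mulf_neq0 ?oppr_eq0.
pose x (y : R) := al * y / (1 + y).
have xb y : 0 < y -> 0 < x y <= al by exact: fold_bound.
have Hl (y : R) : 0 < y -> is_derive y 1 (fun y => - (la * y / (1 + y))) (- (la / (1 + y) ^+ 2)).
  by move=> y0; have H := fold_derive la y0; exact: is_deriveN.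
have Eb y : 0 < y -> expR (- (la * y / (1 + y))) <= expR `|la|.
  move=> y0; have y1 : 0 < 1 + y by rewrite addr_gt0.
  rewrite ler_expR; apply: le_trans (ler_norm _) _.
  rewrite normrN !normrM normfV (gtr0_norm y0) (gtr0_norm y1) ler_pdivrMr //.
  by rewrite ler_wpM2l // lerDr.
have [||||||||||||m [M1 M2 M3 M4 M5]] := @moments_general 0 b3 a2 b2 a1 b1 e0 (e0 + ea) (- a1^-1) x (fun y => al / (1 + y) ^+ 2)
  (fun y => expR (- (la * y / (1 + y)))) (fun y => - la / (1 + y)) (fun y => 1 + y)
  (fun y => expR (- (la * y / (1 + y))) / (1 + y)) 1 ea e01 ea0 _ _ _ _ _ _ _ _ _ _ _
  (fun X Y y => expR (- (la * y / (1 + y))) * (Y + (Y - X * al) * y + 0 * y ^+ 2) *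
       (y `^ (e0 - 1) * (1 + y) `^ (- (e0 + ea + 1)))) al _.
- by rewrite oppr_eq0 invr_eq0.
- by move=> y y0; exact: fold_derive.
- by move=> y /xb/andP[].
- apply: smooth_divS; exact: smooth_exp Hl.
- by move=> y y0; rewrite divr_gt0 ?expR_gt0 ?addr_gt0.
- move=> y y0; have y1 : 1 + y != 0 by rewrite gt_eqF // addr_gt0.
  have -> : - la / (1 + y) * (expR (- (la * y / (1 + y))) / (1 + y)) = - (la / (1 + y) ^+ 2) * expR (- (la * y / (1 + y))) by field.
  exact: exp_derive (Hl y y0).
- move=> y y0; have y1 : 1 + y != 0 by rewrite gt_eqF // addr_gt0.
  by field.
- by move=> y y0; rewrite mul1r ger0_norm // addr_ge0 ?ltW.
- move=> n; exists (al ^+ n * expR `|la|) => y y0.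
  have y1 : 0 < 1 + y by rewrite addr_gt0.
  have -> : e0 + ea - e0 - 1 - ea = -1 by ring.
  rewrite powR_inv1 ?(ltW y1) //.
  have /andP[h1 h2] := xb y y0; rewrite mulrA ler_wpM2r ?invr_ge0 ?(ltW y1) //.
  apply: ler_pM; rewrite ?expR_ge0 ?exprn_ge0 ?(ltW h1) ?Eb //.
  by apply: lerXn2r; rewrite ?nnegrE ?(ltW h1) ?(ltW al0).
- move=> y y0; have y1 : 1 + y != 0 by rewrite gt_eqF // addr_gt0.
  by rewrite /x a1E; field; rewrite ?y1 ?a2n0 ?an0.
- move=> y y0; have y1 : 1 + y != 0 by rewrite gt_eqF // addr_gt0.
  have b2E : b2 = (b3 * al ^+ 2 - b1 + ea * al * a2) / al by rewrite eaE; field.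
  have b3E : b3 = la * a2 / al by rewrite laE; field; rewrite an0.
  by rewrite /x b2E b3E b1E a1E; field; rewrite ?y1 ?a2n0 ?an0 ?(gt_eqF y0).
- move=> X Y y y0; have y1 : 0 < 1 + y by rewrite addr_gt0.
  rewrite /weight (_ : 1 - (e0 + ea) = - (e0 + ea + 1) + 1 + 1); last by ring.
  by rewrite !powR_succ // /x; field; rewrite gt_eqF.
by exists m; split=> //; apply: M3 => y /xb/andP[].
Qed.

Lemma moments_gauss (b3 b2 a1 b1 a b e0 : R) : a1 != 0 ->
  b3 = 2 * a * a1 -> b2 = - b * a1 -> b1 = e0 * a1 -> 0 < a -> 0 < b -> 1 <= e0 ->
  exists m : nat -> R,
  [/\ asol 0 b3 0 b2 a1 b1 m, forall n, 0 < m n,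
     forall n, m n.+1 ^+ 2 <= m n * m n.+2 &
     represents m (fun X Y y => expR (- (a * y ^+ 2 + b * y)) * (Y + (Y - X) * y + - X * y ^+ 2) *
       (y `^ (e0 - 1) * (1 + y) `^ (- 1)))].
Proof.
move=> a1n0 b3E b2E b1E a0 b0 e01.
have Hg (y : R) : is_derive y 1 (fun y => - (a * y ^+ 2 + b * y)) (- (2 * a * y + b)).
  have H := is_derive_exp 2 y; apply: is_derive_eq; rewrite /GRing.scale /=; ring.
have [|||||||||||m [M1 M2 M3 M4 M5]] := @moments_general 0 b3 0 b2 a1 b1 e0 0 (- a1^-1) id (fun=> 1)
  (fun y => expR (- (a * y ^+ 2 + b * y))) (fun y => - (2 * a * y + b) * (1 + y)) (fun y => 1 + y)
  (fun y => expR (- (a * y ^+ 2 + b * y)) / (1 + y)) 1 1 e01 ltr01 _ (fun y _ => is_derive_id y 1) _ _ _ _ _ _ _ _ _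
  (fun X Y y => expR (- (a * y ^+ 2 + b * y)) * (Y + (Y - X) * y + - X * y ^+ 2) *
       (y `^ (e0 - 1) * (1 + y) `^ (- 1))) 1 _.
- by rewrite oppr_eq0 invr_eq0.
- by [].
- by apply: smooth_divS; apply: (@smooth_exp _ (fun y => - (2 * a * y + b))) => y _.
- by move=> y y0; rewrite divr_gt0 ?expR_gt0 ?addr_gt0.
- move=> y y0; have y1 : 1 + y != 0 by rewrite gt_eqF // addr_gt0.
  have -> : - (2 * a * y + b) * (1 + y) * (expR (- (a * y ^+ 2 + b * y)) / (1 + y)) = - (2 * a * y + b) * expR (- (a * y ^+ 2 + b * y)) by field.
  exact: exp_derive (Hg y).
- move=> y y0; have y1 : 1 + y != 0 by rewrite gt_eqF // addr_gt0.
  by field.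
- by move=> y y0; rewrite mul1r ger0_norm // addr_ge0 ?ltW.
- move=> n; have [C HC] := exp_decay (0 - e0 - 1 - 1 - n%:R) b0; exists C => y y0.
  have y1 : 0 < 1 + y by rewrite addr_gt0.
  have -> : 0 - e0 - 1 - 1 = 0 - e0 - 1 - 1 - n%:R + n%:R by ring.
  rewrite powRD; last by rewrite (gt_eqF y1) implybT.
  rewrite powR_mulrn ?(ltW y1) // [leRHS]mulrA [leLHS]mulrC.
  apply: ler_pM.
  - by rewrite divr_ge0 ?expR_ge0 ?(ltW y1).
  - by rewrite exprn_ge0 // ltW.
  - apply: le_trans (HC y y0); apply: (@le_trans _ _ (expR (- (a * y ^+ 2 + b * y)))).
      by rewrite ler_pdivrMr // ler_peMr ?expR_ge0 // lerDl ltW.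
    by rewrite ler_expR lerN2 lerDr mulr_ge0 ?sqr_ge0 // ltW.
  - by apply: lerXn2r; rewrite ?nnegrE ?(ltW y0) ?(ltW y1) // lerDr.
- move=> y y0; have y1 : 1 + y != 0 by rewrite gt_eqF // addr_gt0.
  by field; rewrite ?y1 ?a1n0.
- move=> y y0; have y1 : 1 + y != 0 by rewrite gt_eqF // addr_gt0.
  by rewrite b2E b3E b1E; field; rewrite ?y1 ?a1n0 ?(gt_eqF y0).
- move=> X Y y y0; have y1 : 0 < 1 + y by rewrite addr_gt0.
  rewrite /weight subr0 powRr1 ?(ltW y1) // powR_inv1 ?(ltW y1) //.
  by field; rewrite gt_eqF.
by exists m; split.
Qed.

End Classes.
End MomentSolutions.


Module BesselIntegrals.
From mathcomp Require Import all_boot all_order all_algebra.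
From mathcomp Require Import complex.
From mathcomp Require mpoly.
Import -(notations) mpoly.
From mathcomp Require Import all_classical all_reals all_analysis.
From mathcomp Require Import measurable_realfun.
From mathcomp Require Import zify ring lra.
Require Import Defs.
Import Recursive LinearRecurrences SubdominantGrowth Oscillation OscillationLowDegree AffineRecurrences HalfLineIntegrals DecayAndSmoothness Fibres MomentSolutions.
Set Implicit Arguments.
Unset Strict Implicit.
Unset Printing Implicit Defensive.
Import Order.TTheory GRing.Theory Num.Theory numFieldNormedType.Exports.
Local Open Scope classical_set_scope.
Local Open Scope ring_scope.

(** * Bessel-type integrals *)

Section Bessel.
Variable R : realType.
Variable D : nat.
Hypothesis D0 : (0 < D)%N.
Variable e0 : R.
Hypothesis e01 : 1 <= e0.

(** With v = y / (1 + y) one has x = v (1 - v) and w dy = (v (1 - v))^(e0-1) dv, and [G] is x^e0.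
    For a kernel with second derivative Z2 Th in v, [bes] is Poisson's integral for Bessel
    functions. *)
Let x (y : R) := y * (1 + y) ^- 2.
Let w (y : R) := y `^ (e0 - 1) * (1 + y) `^ (- (2 * e0)).
Let G (y : R) := y `^ e0 * (1 + y) `^ (- (2 * e0)).

Let D1p (y : R) : is_derive y 1 (fun y : R => 1 + y) 1.
Proof. by apply: is_derive_eq; rewrite /GRing.scale /=; ring. Qed.

Let Dv (y : R) : 0 < y -> is_derive y 1 (fun y => (1 + y)^-1) (- (1 + y) ^- 2).
Proof.
move=> y0; have y1 : 1 + y != 0 by rewrite gt_eqF // addr_gt0.
have HV := @is_deriveV R (fun y : R => 1 + y) y 1 1 y1 (D1p y).
by apply: is_derive_eq; rewrite /GRing.scale /= mulr1.
Qed.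

Let xE y : x y = y * ((1 + y)^-1 * (1 + y)^-1).
Proof. by rewrite /x -invfM -expr2. Qed.

Let Dx (y : R) : 0 < y -> is_derive y 1 x ((1 - y) / (1 + y) ^+ 3).
Proof.
move=> y0; have y1 : 1 + y != 0 by rewrite gt_eqF // addr_gt0.
have H := Dv y0.
rewrite (_ : x = fun y => y * ((1 + y)^-1 * (1 + y)^-1)); last by apply/funext => z; rewrite xE.
by apply: is_derive_eq; rewrite /GRing.scale /=; field.
Qed.

Let DG (y : R) : 0 < y -> is_derive y 1 G (e0 * (1 - y) / (1 + y) * w y).
Proof.
move=> y0; have y1 : 0 < 1 + 1 * y by rewrite mul1r addr_gt0.
have A := is_derive1_powR e0 y0; have B := is_derive_powR1 (- (2 * e0)) y1.
rewrite (_ : G = fun y => y `^ e0 * (1 + 1 * y) `^ (- (2 * e0))); last first.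
  by apply/funext => z; rewrite mul1r.
apply: is_derive_eq; rewrite /GRing.scale /= /w !mul1r in y1 *.
have -> : y `^ e0 = y `^ (e0 - 1) * y by rewrite -powR_succ // subrK.
have -> : (1 + y) `^ (- (2 * e0)) = (1 + y) `^ (- (2 * e0) - 1) * (1 + y).
  by rewrite -powR_succ // subrK.
by field; rewrite gt_eqF.
Qed.

Let x01 y : 0 < y -> 0 < x y <= 1.
Proof.
move=> y0; have y1 : 0 < 1 + y by rewrite addr_gt0.
rewrite /x divr_gt0 ?exprn_gt0 //= ler_pdivrMr ?exprn_gt0 // mul1r.
have -> : (1 + y) ^+ 2 = y + (1 + y + y ^+ 2) by ring.
by rewrite lerDl !addr_ge0 ?sqr_ge0 // ltW.
Qed.

Let w_gt0 y : 0 < y -> 0 < w y.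
Proof. by move=> y0; rewrite mulr_gt0 ?powR_gt0 // addr_gt0. Qed.

Let GE y : 0 < y -> G y = w y * y.
Proof.
move=> y0; rewrite /G /w; have -> : y `^ e0 = y `^ (e0 - 1) * y by rewrite -powR_succ // subrK.
by ring.
Qed.

Let wb y : 0 < y -> w y <= (1 + y) `^ (- (e0 + 1)).
Proof.
move=> y0; have y1 : 0 < 1 + y by rewrite addr_gt0.
rewrite (_ : - (e0 + 1) = (e0 - 1) + - (2 * e0)); last by ring.
rewrite powRD; last by rewrite (gt_eqF y1) implybT.
rewrite ler_wpM2r ?powR_ge0 //; have h := e01.
by apply: ge0_ler_powR; rewrite ?nnegrE ?subr_ge0 ?(ltW y0) ?(ltW y1) // lerDr.
Qed.

Section Kernel.
Variables (Z2 C : R) (Th Th1 : R -> R).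
Hypothesis DTh : forall y : R, 0 < y -> is_derive y 1 Th (Th1 y * (1 + y) ^- 2).
Hypothesis DTh1 : forall y : R, 0 < y -> is_derive y 1 Th1 (Z2 * Th y * (1 + y) ^- 2).
Hypothesis bTh : forall y, 0 < y -> `|Th y| <= C.
Hypothesis bTh1 : forall y, 0 < y -> `|Th1 y| <= C.

Definition bes n : R := IO D (fun y => x y ^+ n * (Th y * w y)).

Let sw : smooth w.
Proof.
move=> y y0; have y1 : 0 < 1 + 1 * y by rewrite mul1r addr_gt0.
rewrite (_ : w = fun y => y `^ (e0 - 1) * (1 + 1 * y) `^ (- (2 * e0))); last first.
  by apply/funext => z; rewrite mul1r.
apply: derivableM; first exact: is_derive_derivable (is_derive1_powR _ y0).
exact: is_derive_derivable (is_derive_powR1 _ y1).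
Qed.

Let sx n : smooth (fun y => x y ^+ n).
Proof.
move=> y y0; exact: is_derive_derivable (@is_derive1_comp R (fun z => z ^+ n) x y _ _ (is_derive_exp n (x y)) (Dx y0)).
Qed.

Let sTh : smooth Th. Proof. by move=> y y0; exact: is_derive_derivable (DTh y0). Qed.

Let sI n : smooth (fun y => x y ^+ n * (Th y * w y)).
Proof.
move=> y y0; apply: derivableM; first exact: sx.
by apply: derivableM; [exact: sTh|exact: sw].
Qed.

Let bI n y : 0 < y -> `|x y ^+ n * (Th y * w y)| <= C * w y.
Proof.
move=> y0; have /andP[h1 h2] := x01 y0; have w0 := ltW (w_gt0 y0).
rewrite (normrM (x y ^+ n)) (normrM (Th y) (w y)) (ger0_norm w0) normrX (gtr0_norm h1) mulrA ler_wpM2r //.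
apply: le_trans (bTh y0); rewrite ler_piMl // exprn_ile1 // ltW.
all: by [].
Qed.

Lemma bes_smooth n : smooth (fun y => x y ^+ n * (Th y * w y)).
Proof. exact: sI. Qed.

Lemma ig_bes n : ig D (fun y => x y ^+ n * (Th y * w y)).
Proof.
have C0 : 0 <= C by have := bTh ltr01; apply: le_trans.
apply: (@ig_decay _ D D0 _ (e0 + 1)); [by have h := e01; lra|exact: sI|].
exists C => y y0; apply: le_trans (bI n y0) _; rewrite ler_wpM2l //; exact: wb.
Qed.

Lemma bes_le n : `|bes n| <= C * IO D w.
Proof.
have C0 : 0 <= C by have := bTh ltr01; apply: le_trans.
have Iw : ig D w.
  apply: (@ig_decay _ D D0 _ (e0 + 1)); [by have h := e01; lra|exact: sw|].
  by exists 1 => y y0; rewrite mul1r gtr0_norm ?w_gt0 // wb.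
have [I E] := IO_lin C 0 Iw Iw.
have -> : C * IO D w = IO D (fun y => C * w y + 0 * w y) by rewrite E mul0r addr0.
apply: IO_norm => //; first exact: ig_bes.
by move=> y y0; rewrite mul0r addr0 bI.
Qed.

(** Two integrations by parts in v, combined in the single primitive H; there (y - 1) / (1 + y) is 2
    v - 1, the opposite of the derivative of v (1 - v). *)
Lemma bes_rec n : let N := n%:R + 1 + e0 in
  Z2 * bes n.+2 = - (2 * N * (2 * N - 1)) * bes n.+1 + N * (N - 1) * bes n.
Proof.
move=> N.
have C0 : 0 <= C by have := bTh ltr01; apply: le_trans.
have e1 := e01.
have N0 : 0 <= N by rewrite /N addr_ge0 ?addr_ge0 ?ler0n //; lra.
have [I1 E1] := IO_lin Z2 (2 * N * (2 * N - 1)) (ig_bes n.+2) (ig_bes n.+1).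
have [I2 E2] := IO_lin 1 (- (N * (N - 1))) I1 (ig_bes n).
pose H y := x y ^+ n.+1 * G y * Th1 y + N * ((y - 1) * (1 + y)^-1) * (x y ^+ n * G y) * Th y.
have Z : IO D (fun y => 1 * (Z2 * (x y ^+ n.+2 * (Th y * w y)) + 2 * N * (2 * N - 1) * (x y ^+ n.+1 * (Th y * w y))) +
    - (N * (N - 1)) * (x y ^+ n * (Th y * w y))) = 0 - 0.
  have bd y : 0 < y -> `|H y| <= C * (1 + N) * G y.
    move=> y0; have /andP[h1 h2] := x01 y0; have y1 : 0 < 1 + y by rewrite addr_gt0.
    have g0 : 0 <= G y by rewrite GE // mulr_ge0 ?(ltW y0) // ltW // w_gt0.
    have xn m : 0 <= x y ^+ m <= 1 by rewrite exprn_ge0 ?exprn_ile1 // ltW.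
    have tb : `|(y - 1) * (1 + y)^-1| <= 1.
      rewrite normrM normfV (gtr0_norm y1) ler_pdivrMr // mul1r ler_norml.
      by apply/andP; split; lra.
    have /andP[p1 p2] := xn n.+1; have /andP[p3 p4] := xn n.
    apply: le_trans (ler_normD _ _) _.
    rewrite (_ : C * (1 + N) * G y = 1 * G y * C + N * 1 * (1 * G y) * C); last by ring.
    rewrite (normrM (x y ^+ n.+1 * G y)) (normrM (x y ^+ n.+1) (G y)) (ger0_norm g0) (ger0_norm p1).
    rewrite (normrM (N * ((y - 1) * (1 + y)^-1) * (x y ^+ n * G y))) (normrM (N * ((y - 1) * (1 + y)^-1))).
    rewrite (normrM N) (normrM (x y ^+ n) (G y)) (ger0_norm g0) (ger0_norm p3) (ger0_norm N0).
    apply: lerD; apply: ler_pM => //; try by rewrite ?mulr_ge0.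
    - by rewrite mulr_ge0.
    - by rewrite ler_wpM2r.
    - exact: bTh1.
    - by rewrite mulr_ge0 // mulr_ge0.
    - by apply: ler_pM; [rewrite mulr_ge0|rewrite mulr_ge0|rewrite ler_wpM2l|rewrite ler_wpM2r].
    - exact: bTh.
  apply: (@IO_FTC _ D D0 H).
  - move=> y y0; have y1 : 1 + y != 0 by rewrite gt_eqF // addr_gt0.
    have d1 := DTh y0; have d2 := DTh1 y0; have d3 := DG y0; have d4 := Dv y0.
    have d5 m : is_derive y 1 (fun y => x y ^+ m) (m%:R * x y ^+ m.-1 * ((1 - y) / (1 + y) ^+ 3)).
      exact: (@is_derive1_comp R (fun z => z ^+ m) x y _ _ (is_derive_exp m (x y)) (Dx y0)).
    have d6 := d5 n; have d7 := d5 n.+1.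
    apply: is_derive_eq; rewrite /GRing.scale /= !GE // -[n.+1%:R]natr1.
    have K1 : n%:R * x y ^+ n.-1 * ((1 - y) / (1 + y) ^+ 3) * y = n%:R * x y ^+ n * ((1 - y) / (1 + y)).
      have -> : n%:R * x y ^+ n = n%:R * (x y ^+ n.-1 * x y) by case: (n) => [|j]; [rewrite !mul0r|rewrite exprSr].
      by rewrite xE; field.
    have K2 : forall c : R, n%:R * x y ^+ n.-1 * ((1 - y) / (1 + y) ^+ 3) * (w y * y) * c =
       n%:R * x y ^+ n * ((1 - y) / (1 + y)) * w y * c by move=> c; rewrite -K1; ring.
    rewrite !exprS.
    have K3 : (1 + y) ^- 2 = (1 + y)^-1 * (1 + y)^-1 by rewrite -invfM -expr2.
    transitivity ((x y * x y ^+ n * (w y * y) * (Z2 * Th y * (1 + y) ^- 2)) +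
      Th1 y * (x y * x y ^+ n * (e0 * (1 - y) / (1 + y) * w y) + w y * y * ((n%:R + 1) * x y ^+ n * ((1 - y) / (1 + y) ^+ 3))) +
      N * ((y - 1) * (1 + y)^-1) * (x y ^+ n * (w y * y)) * (Th1 y * (1 + y) ^- 2) +
      Th y * (N * ((y - 1) * (1 + y)^-1) * (x y ^+ n * (e0 * (1 - y) / (1 + y) * w y)) +
        N * ((y - 1) * (1 + y)^-1) * (n%:R * x y ^+ n * ((1 - y) / (1 + y)) * w y) +
        x y ^+ n * (w y * y) * (N * (2 * (1 + y) ^- 2)))); last first.
      by rewrite /N K3 xE; field.
    rewrite -[X in _ = _ + Th y * (_ + X + _)](_ : N * ((y - 1) * (1 + y)^-1) * (n%:R * x y ^+ n.-1 * ((1 - y) / (1 + y) ^+ 3) * y * w y) = _); last by rewrite K1; ring.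
    by rewrite K3; field.
  - move=> y y0.
    have S1 := @smooth_lin R Z2 (2 * N * (2 * N - 1)) _ _ (@sI n.+2) (@sI n.+1).
    exact: (@smooth_lin R 1 (- (N * (N - 1))) _ _ S1 (@sI n)).
  - exact: I2.
  - apply: (@lim0_bound _ _ (C * (1 + N))) => y y0 yl; apply: le_trans (bd y y0) _.
    have CN : 0 <= C * (1 + N).
      by apply: mulr_ge0 => //; apply: addr_ge0; [exact: ler01|exact: N0].
    apply: (ler_wpM2l CN).
    rewrite (GE y0); apply: ler_piMl; first exact: ltW.
    apply: le_trans (wb y0) _; rewrite powRN invf_le1 ?powR_gt0 ?addr_gt0 //.
    by rewrite -[leLHS](powRr0 (1 + y)); apply: ler_powR; lra.
  - apply: (@lim1_decay _ _ e0); first lra.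
    exists (C * (1 + N)) => y y0; apply: le_trans (bd y y0) _.
    have y1 : 0 < 1 + y by rewrite addr_gt0.
    have CN : 0 <= C * (1 + N).
      by apply: mulr_ge0 => //; apply: addr_ge0; [exact: ler01|exact: N0].
    apply: (ler_wpM2l CN).
    rewrite (GE y0) (_ : - e0 = - (e0 + 1) + 1); last by ring.
    rewrite powR_succ //; apply: ler_pM; rewrite ?(ltW y0) ?(ltW (w_gt0 y0)) ?wb //.
    by rewrite lerDr.
move: Z; rewrite E2 E1 subr0 -/(bes n) -/(bes n.+1) -/(bes n.+2) => Z; lra.
Qed.

End Kernel.
End Bessel.
End BesselIntegrals.


Module MinimalityCriteria.
From mathcomp Require Import all_boot all_order all_algebra.
From mathcomp Require Import complex.
From mathcomp Require mpoly.
Import -(notations) mpoly.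
From mathcomp Require Import all_classical all_reals all_analysis.
From mathcomp Require Import measurable_realfun.
From mathcomp Require Import zify ring lra.
Require Import Defs.
Import Recursive LinearRecurrences SubdominantGrowth Oscillation OscillationLowDegree AffineRecurrences HalfLineIntegrals DecayAndSmoothness Fibres MomentSolutions BesselIntegrals.
Set Implicit Arguments.
Unset Strict Implicit.
Unset Printing Implicit Defensive.
Import Order.TTheory GRing.Theory Num.Theory numFieldNormedType.Exports.
Local Open Scope classical_set_scope.
Local Open Scope ring_scope.

(** * Minimality criteria *)

Section Criteria.
Variable R : realType.
Implicit Types (m v : nat -> R).

Lemma aff_ev (a b : R) : 0 < a -> exists N, forall n, (N <= n)%N -> 0 < aff a b n.
Proof. exact: affine_ev. Qed.

Lemma small_bound (al : R) m : 0 < al -> (forall n, 0 < m n) ->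
  (forall n, m n <= al ^+ n * m 0%N) -> small al m.
Proof.
move=> al0 m0 mb rho ar; exists (m 0%N); first exact: ltW.
move=> n; rewrite gtr0_norm // mulrC; apply: le_trans (mb n) _.
rewrite ler_wpM2r ?(ltW (m0 _)) //; apply: lerXn2r; rewrite ?nnegrE ?(ltW al0) ?(ltW ar) //.
exact: ltW (lt_trans al0 ar).
Qed.

(** A rate strictly between al and |be| is propagated, namely their mean. For be < - al the dominant
    solution alternates in sign; for be > al the middle term outweighs the last one. *)
Lemma grows_distinct (a3 b3 a2 b2 a1 b1 al be : R) : 0 < a3 -> 0 < al ->
  (be < - al \/ al < be) -> a2 = a3 * (al + be) -> a1 = - a3 * al * be ->
  (forall n, aff a3 b3 n != 0) -> (forall n, aff a1 b1 n != 0) ->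
  grows al (aff a3 b3) (aff a2 b2) (aff a1 b1).
Proof.
move=> a30 al0 [bl|bl] a2E a1E g3 g1; have [N3 H3] := aff_ev b3 a30.
  pose rho := (al - be) / 2.
  have r1 : al < rho by rewrite /rho; lra.
  have a20 : 0 < - a2 by rewrite a2E -mulrN pmulr_rgt0 //; lra.
  have a10 : 0 < a1.
    by rewrite a1E (_ : - a3 * al * be = a3 * al * - be) ?mulr_gt0 //; [lra|ring].
  have s0 : 0 < - a2 * rho + a1 - a3 * rho ^+ 2.
    rewrite a2E a1E (_ : _ - _ = a3 * ((rho + al) * - (rho + be))); last by ring.
    by rewrite !mulr_gt0 // /rho; lra.
  have [N2 H2] := aff_ev (- b2) a20; have [N1 H1] := aff_ev b1 a10.
  have [N4 H4] := aff_ev (- b2 * rho + b1 - b3 * rho ^+ 2) s0.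
  apply: (@grows_alternating _ _ _ _ al rho (N1 + N2 + N3 + N4)%N) => // n Hn.
  have h1 := H1 n (leq_trans (leq_trans (leq_addr _ _) (leq_trans (leq_addr _ _) (leq_addr _ _))) Hn).
  have h2 := H2 n (leq_trans (leq_trans (leq_addl _ _) (leq_trans (leq_addr _ _) (leq_addr _ _))) Hn).
  have h3 := H3 n (leq_trans (leq_trans (leq_addl _ _) (leq_addr _ _)) Hn).
  have h4 := H4 n (leq_trans (leq_addl _ _) Hn).
  split=> //; [|exact: ltW|].
    by move: h2; rewrite /aff => h; lra.
  by move: h4; rewrite /aff => h; lra.
pose rho := (al + be) / 2.
have r1 : al < rho by rewrite /rho; lra.
have a20 : 0 < a2 by rewrite a2E mulr_gt0 //; lra.
have a10 : 0 < - a1 by rewrite a1E !mulNr opprK !mulr_gt0 //; lra.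
have s0 : 0 < a2 * rho + a1 - a3 * rho ^+ 2.
  rewrite a2E a1E (_ : _ - _ = a3 * ((rho - al) * (be - rho))); last by ring.
  by rewrite !mulr_gt0 // /rho; lra.
have [N2 H2] := aff_ev b2 a20; have [N1 H1] := aff_ev (- b1) a10.
have [N4 H4] := aff_ev (b2 * rho + b1 - b3 * rho ^+ 2) s0.
apply: (@grows_abs _ _ _ _ al rho (N1 + N2 + N3 + N4)%N) => // n Hn.
have h1 := H1 n (leq_trans (leq_trans (leq_addr _ _) (leq_trans (leq_addr _ _) (leq_addr _ _))) Hn).
have h2 := H2 n (leq_trans (leq_trans (leq_addl _ _) (leq_trans (leq_addr _ _) (leq_addr _ _))) Hn).
have h3 := H3 n (leq_trans (leq_trans (leq_addl _ _) (leq_addr _ _)) Hn).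
have h4 := H4 n (leq_trans (leq_addl _ _) Hn).
split=> //; rewrite (gtr0_norm h2).
have -> : `|aff a1 b1 n| = - aff a1 b1 n.
  by rewrite ltr0_norm //; move: h1; rewrite /aff => h; lra.
by move: h4; rewrite /aff => h; lra.
Qed.

Lemma grows_dominant (b3 a2 b2 a1 b1 al rho : R) : 0 < b3 -> 0 < al -> al < rho ->
  `|a1| < `|a2| * rho -> (forall n, aff a1 b1 n != 0) ->
  grows al (aff 0 b3) (aff a2 b2) (aff a1 b1).
Proof.
move=> b30 al0 ar dom g1; have r0 : 0 < rho := lt_trans al0 ar.
have s0 : 0 < `|a2| * rho - `|a1| by rewrite subr_gt0.
have [N H] := aff_ev (- (b3 * rho ^+ 2 + `|b1| + `|b2| * rho)) s0.
have e3 n : aff 0 b3 n = b3 by rewrite /aff mul0r add0r.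
apply: (@grows_abs _ _ _ _ al rho N) => // [n|n Hn]; first by rewrite e3 gt_eqF.
rewrite e3; split=> //; have h := H n Hn; move: h; rewrite /aff => h.
have t1 : `|a1 * n%:R + b1| <= `|a1| * n%:R + `|b1|.
  by apply: le_trans (ler_normD _ _) _; rewrite normrM normr_nat.
have t2 : `|a2| * n%:R - `|b2| <= `|a2 * n%:R + b2|.
  by have := lerB_normD (a2 * n%:R) b2; rewrite normrM normr_nat.
have t3 : (`|a2| * n%:R - `|b2|) * rho <= `|a2 * n%:R + b2| * rho by rewrite ler_wpM2r // ltW.
lra.
Qed.

Lemma crit_distinct (a3 b3 a2 b2 a1 b1 al be : R) K m : 0 < a3 -> 0 < al ->
  (be < - al \/ al < be) -> a2 = a3 * (al + be) -> a1 = - a3 * al * be ->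
  (forall k n, aff a3 (b3 + 2 * a3 * k%:R) n != 0) -> (forall n, aff a1 b1 n != 0) ->
  (forall k, (k < K)%N ->
     (b3 + 2 * a3 * k%:R) * be ^+ 2 - (b2 + a2 * k%:R) * be - b1 != 0) ->
  asol a3 (b3 + 2 * a3 * K%:R) a2 (b2 + a2 * K%:R) a1 b1 m ->
  (forall n, 0 < m n) -> (forall n, m n <= al ^+ n * m 0%N) ->
  forall v, asol a3 b3 a2 b2 a1 b1 v ->
  amini a3 b3 a2 b2 a1 b1 v <->
    (v 0%N != 0 \/ v 1%N != 0) /\
    let u := iter K (ashift a3 a2 a1) v in u 1%N * m 0%N - u 0%N * m 1%N = 0.
Proof.
move=> a30 al0 bl a2E a1E g3 g1 HB Sm m0 mb.
apply: (mini_ashift al0) => //.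
- by move=> k; apply: (grows_distinct _ a30 al0 bl a2E a1E).
- move=> k w kK Sw; apply: (ashift_small_quad al0 _ a2E a1E (HB k kK) Sw).
  by rewrite gt_eqF.
- by exists 0%N; rewrite gt_eqF.
- exact: small_bound.
Qed.

Lemma crit_linear (b3 a2 b2 a1 b1 al : R) K m : 0 < b3 -> a2 != 0 -> 0 < al -> a1 = - a2 * al ->
  (forall n, aff a1 b1 n != 0) ->
  asol 0 b3 a2 (b2 + a2 * K%:R) a1 b1 m ->
  (forall n, 0 < m n) -> (forall n, m n <= al ^+ n * m 0%N) ->
  forall v, asol 0 b3 a2 b2 a1 b1 v ->
  amini 0 b3 a2 b2 a1 b1 v <->
    (v 0%N != 0 \/ v 1%N != 0) /\
    let u := iter K (ashift 0 a2 a1) v in u 1%N * m 0%N - u 0%N * m 1%N = 0.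
Proof.
move=> b30 a2n0 al0 a1E g1 Sm m0 mb.
have b3k k : b3 + 2 * 0 * k = b3 by ring.
apply: (mini_ashift al0) => //.
- by move=> k n; rewrite b3k /aff mul0r add0r gt_eqF.
- move=> k; rewrite b3k; apply: (@grows_dominant _ _ _ _ _ al (2 * al)) => //; first lra.
  rewrite a1E mulNr normrN normrM (gtr0_norm al0) ltr_pM2l ?normr_gt0 //; lra.
- by move=> k w kK Sw; exact: ashift_small_lin.
- by rewrite b3k.
- by exists 0%N; rewrite gt_eqF.
- exact: small_bound.
Qed.

(** With a2 = 0 the characteristic roots are opposite, so there is no exponential gap. The constant
    c comes from g3 n <= (|a3| + |b3|) (n + 1) and m (n+2) <= al m (n+1). *)
Lemma mini_symmetric (a3 b3 b2 a1 b1 al : R) m : 0 < a3 -> 0 < a1 -> b2 < 0 -> 0 < al ->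
  (forall n, aff a3 b3 n != 0) -> (forall n, aff a1 b1 n != 0) ->
  asol a3 b3 0 b2 a1 b1 m -> (forall n, 0 < m n) -> (forall n, m n.+1 <= al * m n) ->
  amini a3 b3 0 b2 a1 b1 m.
Proof.
move=> a30 a10 b20 al0 g3 g1 Sm m0 ma.
have [N3 H3] := aff_ev b3 a30; have [N1 H1] := aff_ev b1 a10.
have A0 : 0 < `|a3| + `|b3| by rewrite ltr_wpDr // normr_gt0 gt_eqF.
pose c := - b2 / ((`|a3| + `|b3|) * al).
have c0 : 0 < c by rewrite divr_gt0 ?mulr_gt0 // oppr_gt0.
apply: (@mini_alternating _ _ _ _ m c (N1 + N3)%N) => // n Hn.
have h1 := H1 n (leq_trans (leq_addr _ _) Hn); have h3 := H3 n (leq_trans (leq_addl _ _) Hn).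
split=> //; first by rewrite /aff mul0r add0r.
have e2 : aff 0 b2 n = b2 by rewrite /aff mul0r add0r.
rewrite e2; apply: (@le_trans _ _ (c * ((`|a3| + `|b3|) * n.+1%:R * (al * m n.+1)))).
  rewrite ler_pM2l //; apply: ler_pM; rewrite ?(ltW h3) ?(ltW (m0 _)) //.
  exact: affine_le.
rewrite le_eqVlt; apply/orP; left; apply/eqP; rewrite /c.
by field; rewrite !gt_eqF.
Qed.

(** Log-convexity makes m (n+1) / m n nondecreasing, hence at least m 1 / m 0. This is the lower
    bound on m (n+1) that the alternating criterion requires. *)
Lemma mini_gauss (b3 b2 a1 b1 : R) m : 0 < b3 -> b2 < 0 -> 0 < a1 ->
  (forall n, aff a1 b1 n != 0) ->
  asol 0 b3 0 b2 a1 b1 m -> (forall n, 0 < m n) ->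
  (forall n, m n.+1 ^+ 2 <= m n * m n.+2) -> amini 0 b3 0 b2 a1 b1 m.
Proof.
move=> b30 b20 a10 g1 Sm m0 lc.
have [N H] := aff_ev b1 a10.
have ratio n : m 1%N * m n <= m 0%N * m n.+1.
  elim: n => [|n IH]; first by rewrite mulrC.
  have := lc n; rewrite expr2 => L.
  rewrite -(ler_pM2r (m0 n)).
  apply: (@le_trans _ _ (m 0%N * m n.+1 * m n.+1)).
    by rewrite mulrAC ler_wpM2r // ltW.
  by rewrite -mulrA -[leRHS]mulrA ler_pM2l // [leRHS]mulrC.
have A0 : 0 < `|a1| + `|b1| by rewrite ltr_wpDr // normr_gt0 gt_eqF.
pose c := - b2 * m 1%N / ((`|a1| + `|b1|) * m 0%N).
have nb2 : 0 < - b2 by rewrite oppr_gt0.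
have c0 : 0 < c by rewrite divr_gt0 ?mulr_gt0.
have e3 n : aff 0 b3 n = b3 by rewrite /aff mul0r add0r.
have e2 n : aff 0 b2 n = b2 by rewrite /aff mul0r add0r.
apply: (@mini_alternating _ _ _ _ m c N) => // [n|n Hn]; first by rewrite e3 gt_eqF.
have h1 := H n Hn; rewrite e3 e2; split=> //.
have up : b3 * m n.+2 <= (`|a1| + `|b1|) * n.+1%:R * m n.
  have := Sm n; rewrite e3 e2 => ->.
  apply: (@le_trans _ _ (aff a1 b1 n * m n)).
    by rewrite gerDr mulr_le0_ge0 ?(ltW b20) // ltW.
  by rewrite ler_wpM2r ?(ltW (m0 _)) // affine_le.
apply: (@le_trans _ _ (c * ((`|a1| + `|b1|) * n.+1%:R * m n))); first by rewrite ler_pM2l.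
have -> : c * ((`|a1| + `|b1|) * n.+1%:R * m n) = n.+1%:R * (- b2) * (m 1%N * m n) / m 0%N.
  by rewrite /c; field; rewrite !gt_eqF.
rewrite ler_pdivrMr // -!mulrA; do 2![rewrite ler_wpM2l ?ler0n ?(ltW nb2) //].
by rewrite [leRHS]mulrC; exact: ratio.
Qed.

(** The Casoratian is al^(2n) p n with p n = (e0)_n / (q)_n in Pochhammer symbols. Because e0 >= q -
    1, p n is at least (q - 1)_n / (q)_n, which telescopes to (q - 1) / (n + q - 1): just the order
    1/n that the harmonic series tolerates. *)
Lemma mini_double (a3 b3 a2 b2 a1 b1 al e0 q : R) m : 0 < a3 -> 0 < al -> a1 = - a3 * al ^+ 2 ->
  b1 = e0 * a1 -> b3 = q * a3 -> 0 < e0 -> 1 < q -> -1 <= e0 - q ->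
  (forall n, aff a3 b3 n != 0) -> (forall n, aff a1 b1 n != 0) ->
  asol a3 b3 a2 b2 a1 b1 m -> (forall n, 0 < m n) ->
  (forall n, m n <= al ^+ n * m 0%N) -> amini a3 b3 a2 b2 a1 b1 m.
Proof.
move=> a30 al0 a1E b1E b3E e00 q1 dl g3 g1 Sm m0 mb.
pose fix p n : R := if n is k.+1 then p k * ((k%:R + e0) / (k%:R + q)) else 1.
have kq k : 0 < k%:R + q :> R by rewrite ltr_wpDl ?ler0n //; lra.
have kq1 k : 0 < k%:R + q - 1 :> R by have := ler0n R k; lra.
have pb n : (q - 1) / (n%:R + q - 1) <= p n.
  elim: n => [|n IH] /=; first by rewrite add0r divff // gt_eqF //; lra.
  have t : (n%:R + q - 1) / (n%:R + q) <= (n%:R + e0) / (n%:R + q).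
    by rewrite ler_pM2r ?invr_gt0 //; lra.
  have t0 : 0 <= (n%:R + q - 1) / (n%:R + q) by rewrite divr_ge0 // ltW.
  have s0 : 0 <= (q - 1) / (n%:R + q - 1) by rewrite divr_ge0 ?(ltW (kq1 n)) //; lra.
  apply: le_trans (ler_pM s0 t0 IH t); rewrite -(natr1 n).
  have -> : n%:R + 1 + q - 1 = n%:R + q :> R by ring.
  rewrite le_eqVlt; apply/orP; left; apply/eqP; field.
  by rewrite !gt_eqF.
pose P n := al ^+ (n + n) * p n.
have M0 := m0 0%N.
pose c := (q - 1) / (q * al * m 0%N ^+ 2).
have q10 : 0 < q - 1 by lra. have q0 : 0 < q by lra.
have c0 : 0 < c by rewrite divr_gt0 // !mulr_gt0 ?exprn_gt0.
apply: (@mini_positive _ _ _ _ m P c 0%N) => //.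
- by rewrite /P /= expr0 mul1r.
- move=> n _; rewrite /P /= addnS addSn !exprS /aff b3E b1E a1E.
  have k1 := kq n; rewrite (_ : a3 * n%:R + q * a3 = a3 * (n%:R + q)); last by ring.
  by field; rewrite gt_eqF.
move=> n _; split=> //.
apply: (@le_trans _ _ (c * (al ^+ n * m 0%N * (al ^+ n.+1 * m 0%N)))).
  by rewrite ler_pM2l //; apply: ler_pM; rewrite ?(ltW (m0 _)).
have -> : c * (al ^+ n * m 0%N * (al ^+ n.+1 * m 0%N)) = al ^+ (n + n) * ((q - 1) / q).
  by rewrite /c (exprS al) exprD; field; rewrite !gt_eqF.
have -> : n.+1%:R * P n = al ^+ (n + n) * (n.+1%:R * p n) by rewrite /P; ring.
rewrite ler_pM2l ?exprn_gt0 //.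
apply: (@le_trans _ _ (n.+1%:R * ((q - 1) / (n%:R + q - 1)))); last first.
  by rewrite ler_wpM2l ?ler0n.
rewrite mulrCA ler_pM2l // ler_pdivlMr // mulrC ler_pdivrMr // -(natr1 n).
have := ler0n R n => n0; have nq : 0 <= n%:R * (q - 1) by rewrite mulr_ge0 // ltW.
lra.
Qed.

End Criteria.
End MinimalityCriteria.


(** * Bessel-type recurrences: only the middle coefficient depends on n *)

Module BesselClass.
From mathcomp Require Import all_boot all_order all_algebra.
From mathcomp Require Import complex.
From mathcomp Require mpoly.
Import -(notations) mpoly.
From mathcomp Require Import all_classical all_reals all_analysis.
From mathcomp Require Import measurable_realfun.
From mathcomp Require Import zify ring lra.
Require Import Defs.
Import Recursive LinearRecurrences SubdominantGrowth Oscillation OscillationLowDegree AffineRecurrences HalfLineIntegrals DecayAndSmoothness Fibres MomentSolutions BesselIntegrals MinimalityCriteria.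
Set Implicit Arguments.
Unset Strict Implicit.
Unset Printing Implicit Defensive.
Import Order.TTheory GRing.Theory Num.Theory numFieldNormedType.Exports.
Local Open Scope classical_set_scope.
Local Open Scope ring_scope.

Section BesselClass.
Variable R : realType.
Variable D : nat.
Hypothesis D0 : (0 < D)%N.

Lemma cos_ge1 (a : R) : 1 - `|a| <= cos a.
Proof.
wlog a0 : a / 0 <= a.
  move=> H; have [/H//|a0] := leP 0 a.
  by have := H (- a); rewrite oppr_ge0 cosN normrN; apply; exact: ltW.
rewrite ger0_norm //; move: a0; rewrite le_eqVlt => /orP[/eqP <-|a0]; first by rewrite cos0 subr0.
have dc x : x \in `]0, a[%R -> is_derive x 1 (@cos R) (- sin x) by move=> _; exact: is_derive_cos.
have cc : {within `[0, a], continuous (@cos R)} by apply: continuous_subspaceT; exact: continuous_cos.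
have [c _ E] := MVT a0 dc cc.
move: E; rewrite cos0 subr0 => E.
have s1 := sin_le1 c; have : sin c * a <= 1 * a by rewrite ler_wpM2r // ltW.
by move: E; rewrite mulNr mul1r => E h; lra.
Qed.

Section Coefficients.
Variables (b3 a2 b2 b1 e0 Z2 : R).
Hypothesis b30 : 0 < b3.
Hypothesis b1n0 : b1 != 0.
Hypothesis a2n0 : a2 != 0.
Hypothesis e01 : 1 <= e0.
Hypothesis e0E : 2 * b2 - a2 = 2 * a2 * e0.
Hypothesis Z2E : Z2 * a2 ^+ 2 = 16 * b1 * b3.

(** The normalization (- 4 b1 / a2)^n / (e0)_n of Poisson's formula. It turns [bes_rec] into the
    given recurrence and is bounded, since its successive ratios tend to 0. *)
Let c := fix c n : R := if n is k.+1 then c k * (- 4 * b1 / a2 / (k%:R + e0)) else 1.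
Definition besF (Th : R -> R) (X Y y : R) := Th y * ((2 * b2 - a2) * Y +
  (2 * (2 * b2 - a2) * Y + 8 * b1 * X) * y + (2 * b2 - a2) * Y * y ^+ 2) *
  (y `^ (e0 - 1) * (1 + y) `^ (- (2 * e0 + 2))).

Definition kernel (Th : R -> R) (Z : R) := exists (Th1 : R -> R) (C : R),
  [/\ forall y : R, 0 < y -> is_derive y 1 Th (Th1 y * (1 + y) ^- 2),
      forall y : R, 0 < y -> is_derive y 1 Th1 (Z * Th y * (1 + y) ^- 2),
      forall y, 0 < y -> `|Th y| <= C & forall y, 0 < y -> `|Th1 y| <= C].

Let cn0 n : c n != 0.
Proof.
elim: n => [|n IH] /=; first exact: oner_neq0.
have k0 : n%:R + e0 != 0 by rewrite gt_eqF // ltr_wpDl ?ler0n //; have h := e01; lra.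
by rewrite !mulf_neq0 // ?invr_eq0 // oppr_eq0 pnatr_eq0.
Qed.

Let cbd : exists M : R, forall n, `|c n| <= M.
Proof.
pose K := `|- 4 * b1 / a2|.
pose N := (Num.truncn K).+1.
have KN : K <= N%:R by apply: ltW; exact: truncnS_gt.
have st n : `|c n.+1| = `|c n| * (K / (n%:R + e0)).
  have k0 : 0 < n%:R + e0 by rewrite ltr_wpDl ?ler0n //; have h := e01; lra.
  by rewrite /= normrM [`|- 4 * b1 / a2 / _|]normrM normfV (gtr0_norm k0).
have big n : (N <= n)%N -> `|c n.+1| <= `|c n|.
  move=> Nn; have k0 : 0 < n%:R + e0 by rewrite ltr_wpDl ?ler0n //; have h := e01; lra.
  rewrite st ler_piMr // ler_pdivrMr // mul1r; apply: le_trans KN _.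
  have : (N%:R : R) <= n%:R by rewrite ler_nat.
  by have h := e01; lra.
exists (\sum_(i < N.+1) `|c i|) => n.
have low k : (k <= N)%N -> `|c k| <= \sum_(i < N.+1) `|c i|.
  move=> kN; rewrite (bigD1 (Ordinal (kN : (k < N.+1)%N))) //= lerDl sumr_ge0 //.
have [nN|/ltnW Nn] := leqP n N; first exact: low.
rewrite -(subnKC Nn); elim: (n - N)%N => [|j IH]; first by rewrite addn0 low.
by rewrite addnS; apply: le_trans (big _ (leq_addr _ _)) IH.
Qed.

Lemma bessel_solution Th : kernel Th Z2 -> exists u : nat -> R,
  [/\ asol 0 b3 a2 b2 0 b1 u, small 1 u, forall n, u n = c n * bes D e0 Th n &
   forall X Y, ig D (besF Th X Y) /\ IO D (besF Th X Y) = (2 * b2 - a2) * (Y * u 0%N - X * u 1%N)].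
Proof.
move=> [Th1 [C [H1 H2 H3 H4]]].
exists (fun n => c n * bes D e0 Th n); split=> //.
- move=> n; have r := bes_rec D0 e01 H1 H2 H3 H4 n.
  have k0 : n%:R + e0 != 0 by rewrite gt_eqF // ltr_wpDl ?ler0n //; have h := e01; lra.
  have k1 : n%:R + 1 + e0 != 0.
    by rewrite gt_eqF // ltr_wpDl ?addr_ge0 ?ler0n //; have h := e01; lra.
  rewrite /aff !mul0r !add0r /= -(natr1 n).
  move: r; move: (bes _ _ _ n.+2) (bes _ _ _ n.+1) (bes _ _ _ n) => i2 i1 i0 r.
  have b3E : b3 = Z2 * a2 ^+ 2 / (16 * b1) by rewrite Z2E; field.
  have b2E : b2 = a2 * e0 + a2 / 2 by have h := e0E; lra.
  have -> : b3 * (c n * (- 4 * b1 / a2 / (n%:R + e0)) * (- 4 * b1 / a2 / (n%:R + 1 + e0)) * i2) =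
     c n * b1 / ((n%:R + e0) * (n%:R + 1 + e0)) * (Z2 * i2).
    by rewrite b3E; field; rewrite ?k0 ?k1 ?a2n0 ?b1n0.
  by rewrite r b2E; field; rewrite ?k0 ?k1 ?a2n0.
- have [M HM] := cbd; move=> rho r1; have C0 : 0 <= C by have := H3 _ ltr01; apply: le_trans.
  exists (M * (C * IO D (fun y : R => y `^ (e0 - 1) * (1 + y) `^ (- (2 * e0))))).
    rewrite mulr_ge0 //; first by have := HM 0%N; apply: le_trans.
    by have := bes_le D0 e01 H1 H3 0%N; apply: le_trans.
  move=> n; rewrite normrM; apply: (@le_trans _ _ (M * (C * IO D (fun y : R => y `^ (e0 - 1) * (1 + y) `^ (- (2 * e0)))))).
    by apply: ler_pM => //; exact: (bes_le D0 e01 H1 H3).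
  rewrite ler_peMr //; last by rewrite exprn_ege1 // ltW.
  rewrite mulr_ge0 //; first by have := HM 0%N; apply: le_trans.
  by have := bes_le D0 e01 H1 H3 0%N; apply: le_trans.
move=> X Y.
have W := ig_bes D0 e01 H1 H3.
have [I V] := IO_lin ((2 * b2 - a2) * Y) (8 * b1 * X) (W 0%N) (W 1%N).
have E y : 0 < y -> (2 * b2 - a2) * Y * ((y * (1 + y) ^- 2) ^+ 0 * (Th y * (y `^ (e0 - 1) * (1 + y) `^ (- (2 * e0))))) +
    8 * b1 * X * ((y * (1 + y) ^- 2) ^+ 1 * (Th y * (y `^ (e0 - 1) * (1 + y) `^ (- (2 * e0))))) = besF Th X Y y.
  move=> y0; have y1 : 0 < 1 + y by rewrite addr_gt0.
  rewrite /besF (_ : - (2 * e0) = - (2 * e0 + 2) + 1 + 1); last by ring.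
  by rewrite !powR_succ // expr0 expr1; field; rewrite gt_eqF.
split; first exact: ig_eq E I.
rewrite -(IO_eq D E) V -/(bes D e0 Th 0) -/(bes D e0 Th 1) /= add0r e0E mul1r.
have k0 : e0 != 0 by rewrite gt_eqF //; have h := e01; lra.
by field; rewrite k0 a2n0.
Qed.

Let Dfold (k y : R) : 0 < y -> is_derive y 1 (fun y => k * y / (1 + y)) (k * (1 + y) ^- 2).
Proof. by move=> y0; exact: fold_derive. Qed.

Let vb (y : R) : 0 < y -> 0 < y / (1 + y) < 1.
Proof. by move=> y0; have y1 : 0 < 1 + y by [rewrite addr_gt0]; rewrite divr_gt0 //= ltr_pdivrMr // mul1r ltrDr. Qed.

Lemma kernel_exp (z : R) : kernel (fun y => expR (z * y / (1 + y))) (z ^+ 2).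
Proof.
exists (fun y => z * expR (z * y / (1 + y))), ((1 + `|z|) * expR `|z|).
have b y : 0 < y -> expR (z * y / (1 + y)) <= expR `|z|.
  move=> y0; have /andP[v0 v1] := vb y0; rewrite ler_expR; apply: le_trans (ler_norm _) _.
  by rewrite -mulrA normrM ler_piMr // gtr0_norm // ltW.
have e0' := expR_ge0 `|z|.
split.
- by move=> y y0; have H := exp_derive (Dfold z y0); rewrite (_ : _ * _ = z * (1 + y) ^- 2 * expR (z * y / (1 + y))) //; ring.
- move=> y y0; have H := exp_derive (Dfold z y0); apply: is_derive_eq; rewrite /GRing.scale /=; ring.
- move=> y y0; rewrite ger0_norm ?expR_ge0 // mulrDl mul1r; apply: le_trans (b y y0) _.
  by rewrite lerDl mulr_ge0.
- move=> y y0; rewrite normrM [`|expR _|]ger0_norm ?expR_ge0 // mulrDl mul1r.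
  apply: (@le_trans _ _ (`|z| * expR `|z|)); last by rewrite lerDr.
  by rewrite ler_wpM2l // b.
Qed.

Lemma kernel_cos (o d : R) : kernel (fun y => cos (o * y / (1 + y) + d)) (- o ^+ 2).
Proof.
have Da (y : R) : 0 < y -> is_derive y 1 (fun y => o * y / (1 + y) + d) (o * (1 + y) ^- 2).
  by move=> y0; have H := Dfold o y0; apply: is_derive_eq; rewrite addr0.
have Dc (y : R) : 0 < y -> is_derive y 1 (fun y => cos (o * y / (1 + y) + d)) (- sin (o * y / (1 + y) + d) * (o * (1 + y) ^- 2)).
  by move=> y0; exact: (@is_derive1_comp R cos (fun y => o * y / (1 + y) + d) y _ _ (is_derive_cos _) (Da y y0)).
have Ds (y : R) : 0 < y -> is_derive y 1 (fun y => sin (o * y / (1 + y) + d)) (cos (o * y / (1 + y) + d) * (o * (1 + y) ^- 2)).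
  by move=> y0; exact: (@is_derive1_comp R sin (fun y => o * y / (1 + y) + d) y _ _ (is_derive_sin _) (Da y y0)).
exists (fun y => - o * sin (o * y / (1 + y) + d)), (1 + `|o|); split.
- by move=> y y0; have H := Dc y y0; rewrite (_ : - o * _ * _ = - sin (o * y / (1 + y) + d) * (o * (1 + y) ^- 2)) //; ring.
- move=> y y0; have H := Ds y y0; apply: is_derive_eq; rewrite /GRing.scale /=; ring.
- move=> y y0; apply: (@le_trans _ _ 1); last by rewrite lerDl.
  by rewrite ler_norml cos_geN1 cos_le1.
- move=> y y0; rewrite normrM normrN; apply: (@le_trans _ _ `|o|); last by rewrite lerDr.
  by rewrite ler_piMr // ler_norml sin_geN1 sin_le1.
Qed.

Lemma kernel_cst : kernel (fun=> 1) 0.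
Proof.
exists (fun=> 0), 1; split=> y y0; rewrite ?normr1 ?normr0 ?mul0r //; exact: is_derive_cst.
Qed.

(** The kernel is cos (o (v - 1/2)), equal to 1 at v = 1/2, where x^n concentrates for large n.
    Quantitatively, cos t >= 1 - |t| >= 3/4 - t^2 with t^2 = o^2 (1 - 4 x) / 4, and the recurrence
    for the constant kernel shows that the mean of 1 - 4 x is 1 / (2 N - 1) with N = n + 1 + e0. *)
Lemma bes_cos_neq0 (o : R) : exists n, bes D e0 (fun y => cos (o * y / (1 + y) - o / 2)) n != 0.
Proof.
have e1 := e01.
have [T1 [C1 [H1 H2 H3 H4]]] := kernel_cst.
have [T2 [C2 [G1 G2 G3 G4]]] := kernel_cos o (- (o / 2)).
pose I n := bes D e0 (fun=> 1) n.
have rc n : (2 * (n%:R + 1 + e0) - 1) * (I n - 4 * I n.+1) = I n.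
  have r := bes_rec D0 e01 H1 H2 H3 H4 n; move: r; rewrite -/(I n) -/(I n.+1) mul0r.
  have N0 : n%:R + 1 + e0 != 0 by rewrite gt_eqF // ltr_wpDl ?addr_ge0 ?ler0n //; lra.
  move: (n%:R + 1 + e0) N0 (I n) (I n.+1) => N N0 i0 i1 r.
  apply: (mulfI N0); apply/eqP; rewrite -subr_eq0; apply/eqP; move/esym/eqP: r; rewrite addr_eq0 => /eqP r.
  have -> : N * ((2 * N - 1) * (i0 - 4 * i1)) - N * i0 = 2 * (N * (N - 1) * i0) - 2 * (2 * N * (2 * N - 1) * i1) by ring.
  lra.
pose n := (Num.truncn (o ^+ 2)).+1.
have on : o ^+ 2 <= n%:R by apply: ltW; exact: truncnS_gt.
have In0 : 0 < I n.
  apply: (IO_gt0 D0) (ig_bes D0 e01 H1 H3 n) _ => y y0.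
    exact: (bes_smooth (e0 := e0) H1 (n := n) y0).
  have y1 : 0 < 1 + y by rewrite addr_gt0.
  by rewrite !mulr_gt0 ?exprn_gt0 ?powR_gt0 ?mulr_gt0 ?invr_gt0 ?exprn_gt0.
exists n; rewrite gt_eqF //.
have [J1 K1] := IO_lin (3 / 4 - o ^+ 2 / 4) (o ^+ 2) (ig_bes D0 e01 H1 H3 n) (ig_bes D0 e01 H1 H3 n.+1).
have J2 := ig_bes D0 e01 G1 G3 n.
apply: lt_le_trans (_ : _ <= _); last first.
  apply: (IO_le D0 J1 J2) => y y0.
  have y1 : 0 < 1 + y by rewrite addr_gt0.
  set w := y `^ (e0 - 1) * _; set x := y * (1 + y) ^- 2.
  have x0 : 0 < x by rewrite mulr_gt0 // invr_gt0 exprn_gt0.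
  have w0 : 0 < w by rewrite mulr_gt0 ?powR_gt0.
  have -> : (3 / 4 - o ^+ 2 / 4) * (x ^+ n * (1 * w)) + o ^+ 2 * (x ^+ n.+1 * (1 * w)) =
    x ^+ n * ((3 / 4 - o ^+ 2 / 4 * (1 - 4 * x)) * w).
    by rewrite [x ^+ n.+1]exprS; move: (x ^+ n) => xn; field.
  rewrite ler_pM2l ?exprn_gt0 // ler_pM2r //.
  apply: le_trans (cos_ge1 _).
  set a := `|_|.
  have a2' : a ^+ 2 = o ^+ 2 / 4 * (1 - 4 * x).
    by rewrite /a -normrX ger0_norm ?sqr_ge0 // /x; field; rewrite gt_eqF.
  by have := sqr_ge0 (a - 1 / 2); rewrite sqrrB -a2'; lra.
rewrite K1 -/(bes D e0 (fun=> 1) n) -/(bes D e0 (fun=> 1) n.+1) -/(I n) -/(I n.+1).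
have := rc n; move: In0 on; have n0 := ler0n R n.
move: (I n) (I n.+1) (n%:R : R) n0 => i0 i1 nn n0 i00 on r.
pose d := i0 - 4 * i1.
have dE : (2 * (nn + 1 + e0) - 1) * d = i0 by [].
have d0 : 0 <= d.
  have : 0 < (2 * (nn + 1 + e0) - 1) * d by rewrite dE.
  by rewrite pmulr_rgt0; [exact: ltW|lra].
have od : o ^+ 2 * d <= nn * d by rewrite ler_wpM2r.
have nd : nn * d <= i0.
  have e0d : 0 <= (1 + 2 * e0) * d by rewrite mulr_ge0 //; lra.
  have nnd : 0 <= nn * d by exact: mulr_ge0.
  rewrite -dE (_ : (2 * (nn + 1 + e0) - 1) * d = nn * d + nn * d + (1 + 2 * e0) * d); [lra|ring].
have od' : o ^+ 2 * d = o ^+ 2 * i0 - 4 * (o ^+ 2 * i1) by rewrite /d; ring.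
have -> : (3 / 4 - o ^+ 2 / 4) * i0 + o ^+ 2 * i1 =
  3 / 4 * i0 - (o ^+ 2 * i0 - 4 * (o ^+ 2 * i1)) / 4.
  by move: (o ^+ 2) => o2; field.
by rewrite -od'; move: od nd; move: (o ^+ 2 * d) (nn * d) => s1 s2 od nd; lra.
Qed.

Section Test.
Hypothesis v_n0 : forall n, aff (0 : R) b1 n != 0.
Variable v : nat -> R.
Hypothesis Sv : asol 0 b3 a2 b2 0 b1 v.

Let g3 n : aff 0 b3 n != 0. Proof. by rewrite /aff mul0r add0r gt_eqF. Qed.
Let gr : grows 1 (aff 0 b3) (aff a2 b2) (aff 0 b1).
Proof.
apply: (@grows_dominant _ _ _ _ _ _ 1 2) => //; first by lra.
by rewrite normr0 mulr_gt0 ?normr_gt0.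
Qed.
Let qn0 : 2 * b2 - a2 != 0.
Proof. by rewrite e0E !mulf_neq0 ?pnatr_eq0 // gt_eqF //; have h := e01; lra. Qed.

Lemma bessel_test_exp (z : R) : z ^+ 2 = Z2 ->
  [/\ ig D (besF (fun y => expR (z * y / (1 + y))) (v 0%N) (v 1%N)) &
   amini 0 b3 a2 b2 0 b1 v <-> (v 0%N != 0 \/ v 1%N != 0) /\
   IO D (besF (fun y => expR (z * y / (1 + y))) (v 0%N) (v 1%N)) = 0].
Proof.
move=> zE; have K := kernel_exp z; have K' := K; rewrite zE in K'.
have [u [Su smu uE HF]] := bessel_solution K'.
have [I V] := HF (v 0%N) (v 1%N); split=> //.
have un0 : exists n, u n != 0.
  exists 0%N; rewrite uE mulf_neq0 //.
  have [T1 [C1 [H1 H2 H3 H4]]] := K.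
  rewrite gt_eqF //; apply: (IO_gt0 D0) (ig_bes D0 e01 H1 H3 0) _ => [|y y0].
    exact: (bes_smooth (e0 := e0) H1 (n := 0%N)).
  have y1 : 0 < 1 + y by rewrite addr_gt0.
  by rewrite !mulr_gt0 ?exprn_gt0 ?powR_gt0 ?expR_gt0 ?mulr_gt0 ?invr_gt0 ?exprn_gt0.
have Mu := small_mini ltr01 gr Su un0 smu.
rewrite V /amini (mini_crit (@g3) v_n0 Su Mu Sv); split=> -[vn E]; split=> //; first by rewrite E mulr0.
by move/eqP: E; rewrite mulf_eq0 (negbTE qn0) /= => /eqP.
Qed.

(** The cosine or the sine kernel alone might give the zero solution. Both solutions are small,
    hence proportional to the nonzero solution m with kernel cos (o (v - 1/2)), which is a
    combination of the two. So the Casoratian with m vanishes iff both of theirs do, that is iff one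
    complex integral with kernel e^(i o v) vanishes. *)
Lemma bessel_test_cos (o : R) : - o ^+ 2 = Z2 ->
  [/\ ig D (besF (fun y => cos (o * y / (1 + y))) (v 0%N) (v 1%N)),
   ig D (besF (fun y => sin (o * y / (1 + y))) (v 0%N) (v 1%N)) &
   amini 0 b3 a2 b2 0 b1 v <-> (v 0%N != 0 \/ v 1%N != 0) /\
   IO D (besF (fun y => cos (o * y / (1 + y))) (v 0%N) (v 1%N)) = 0 /\
   IO D (besF (fun y => sin (o * y / (1 + y))) (v 0%N) (v 1%N)) = 0].
Proof.
move=> oE.
have Kc : kernel (fun y => cos (o * y / (1 + y))) Z2.
  by rewrite -oE; have := kernel_cos o 0; under eq_fun do rewrite addr0.
have Ks : kernel (fun y => sin (o * y / (1 + y))) Z2.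
  rewrite -oE; have := kernel_cos o (- (pi / 2)).
  rewrite (_ : (fun y : R => cos (o * y / (1 + y) + - (pi / 2))) = fun y : R => sin (o * y / (1 + y))) //.
  by apply/funext => y; rewrite cosD cosN sinN cos_pihalf sin_pihalf mulr0 add0r mulrN opprK mulr1.
have Km := kernel_cos o (- (o / 2)); rewrite oE in Km.
have [uc [Sc smc uce HFc]] := bessel_solution Kc.
have [us [Ss sms use HFs]] := bessel_solution Ks.
have [m [Sm smm me _]] := bessel_solution Km.
have [Ic Vc] := HFc (v 0%N) (v 1%N); have [Is Vs] := HFs (v 0%N) (v 1%N).
split=> //.
have mn0 : exists n, m n != 0.
  by have [n hn] := bes_cos_neq0 o; exists n; rewrite me mulf_neq0.
have Mm := small_mini ltr01 gr Sm mn0 smm.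
have lin n : m n = cos (o / 2) * uc n + sin (o / 2) * us n.
  rewrite me uce use.
  have [T1 [C1 [H1 _ H3 _]]] := Kc; have [T2 [C2 [G1 _ G3 _]]] := Ks.
  have [_ E] := IO_lin (cos (o / 2)) (sin (o / 2)) (ig_bes D0 e01 H1 H3 n) (ig_bes D0 e01 G1 G3 n).
  rewrite mulrCA [sin _ * _]mulrCA -mulrDr; congr (_ * _); rewrite /bes -E.
  by apply: IO_eq => y y0; rewrite cosD cosN sinN; ring.
rewrite Vc Vs /amini (mini_crit (@g3) v_n0 Sm Mm Sv).
have Z (a : R) : (2 * b2 - a2) * a = 0 <-> a = 0.
  by split=> [/eqP|->]; rewrite ?mulr0 // mulf_eq0 (negbTE qn0) /= => /eqP.
have par u : asol 0 b3 a2 b2 0 b1 u -> small 1 u -> u 1%N * m 0%N = u 0%N * m 1%N.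
  move=> Su smu; have [H _] := small_cas ltr01 (@g3) v_n0 gr Sm mn0 smm Su.
  by apply/eqP; rewrite -subr_eq0; apply/eqP; exact: H smu.
have pc := par _ Sc smc; have ps := par _ Ss sms.
have m01 : m 0%N != 0 \/ m 1%N != 0 by exact/(sol_n0 (@g3) v_n0 Sm).
have tst u : u 1%N * m 0%N = u 0%N * m 1%N -> v 1%N * m 0%N - v 0%N * m 1%N = 0 ->
    v 1%N * u 0%N - v 0%N * u 1%N = 0.
  move=> pu pv; case: m01 => h; apply: (mulfI h); rewrite mulr0.
    have -> : m 0%N * (v 1%N * u 0%N - v 0%N * u 1%N) =
      (v 1%N * m 0%N - v 0%N * m 1%N) * u 0%N - v 0%N * (u 1%N * m 0%N - u 0%N * m 1%N) by ring.
    by rewrite pv pu subrr mul0r mulr0 subrr.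
  have -> : m 1%N * (v 1%N * u 0%N - v 0%N * u 1%N) =
    (v 1%N * m 0%N - v 0%N * m 1%N) * u 1%N - v 1%N * (u 1%N * m 0%N - u 0%N * m 1%N) by ring.
  by rewrite pv pu subrr mul0r mulr0 subrr.
split=> [[vn E]|[vn [/Z E1 /Z E2]]]; split=> //.
  by split; apply/Z; exact: tst.
rewrite !lin; have -> : v 1%N * (cos (o / 2) * uc 0%N + sin (o / 2) * us 0%N) -
  v 0%N * (cos (o / 2) * uc 1%N + sin (o / 2) * us 1%N) =
  cos (o / 2) * (v 1%N * uc 0%N - v 0%N * uc 1%N) + sin (o / 2) * (v 1%N * us 0%N - v 0%N * us 1%N) by ring.
by rewrite E1 E2 !mulr0 addr0.
Qed.

End Test.
End Coefficients.
End BesselClass.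
End BesselClass.


Module ComputableParameters.
From mathcomp Require Import all_boot all_order all_algebra.
From mathcomp Require Import complex.
From mathcomp Require mpoly.
Import -(notations) mpoly.
From mathcomp Require Import all_classical all_reals all_analysis.
From mathcomp Require Import measurable_realfun.
From mathcomp Require Import zify ring lra.
Require Import Defs.
Import Recursive LinearRecurrences SubdominantGrowth Oscillation OscillationLowDegree AffineRecurrences HalfLineIntegrals DecayAndSmoothness Fibres Fibres3 Descriptors ExponentialPeriods PeriodLike MomentSolutions BesselIntegrals MinimalityCriteria BesselClass.
Set Implicit Arguments.
Unset Strict Implicit.
Unset Printing Implicit Defensive.
Import Order.TTheory GRing.Theory Num.Theory numFieldNormedType.Exports.
Local Open Scope classical_set_scope.
Local Open Scope ring_scope.

(** * Computable maps on parameters *)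

Section ParameterSpace.

Definition prm : Type := (int * int * int * int * int * int * int * int)%type.

Definition el (k c : nat) : nat := hdc (iter k tlc c).
(** Each integer occupies two list entries, whose difference it is; the two natural functions given
    by [recZ] can then be stored without normalization. *)
Definition ci (k c : nat) : int := (el (k + k) c)%:Z - (el (k + k).+1 c)%:Z.
Definition theta (c : nat) : prm :=
  (ci 0 c, ci 1 c, ci 2 c, ci 3 c, ci 4 c, ci 5 c, ci 6 c, ci 7 c).

Definition head0 (xs : seq nat) := nth 0%N xs 0.
Definition zc (G : prm -> int) := recZ 1 (fun xs => G (theta (head0 xs))).
Definition nc (G : prm -> nat) := recn 1 (fun xs => G (theta (head0 xs))).
Definition bc (G : prm -> bool) := recB 1 (fun xs => G (theta (head0 xs))).
Definition tc (T : countType) (G : prm -> T) := recT 1 (fun xs => G (theta (head0 xs))).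
(** The map is realized on codes because primitive recursion iterates functions of a single
    number. *)
Definition cmap (t : prm -> prm) := exists f : nat -> nat,
  recn 1 (fun xs => f (head0 xs)) /\ forall c, theta (f c) = t (theta c).

Definition pa3 (p : prm) := let: (x,_,_,_,_,_,_,_) := p in x.
Definition pb3 (p : prm) := let: (_,x,_,_,_,_,_,_) := p in x.
Definition pa2 (p : prm) := let: (_,_,x,_,_,_,_,_) := p in x.
Definition pb2 (p : prm) := let: (_,_,_,x,_,_,_,_) := p in x.
Definition pa1 (p : prm) := let: (_,_,_,_,x,_,_,_) := p in x.
Definition pb1 (p : prm) := let: (_,_,_,_,_,x,_,_) := p in x.
Definition pX (p : prm) := let: (_,_,_,_,_,_,x,_) := p in x.
Definition pY (p : prm) := let: (_,_,_,_,_,_,_,x) := p in x.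

Lemma rec_el n k f : recn n f -> recn n (fun xs => el k (f xs)).
Proof.
move=> Hf; apply: rec_hdc; elim: k => [|k IH] //=; exact: rec_tlc.
Qed.

Lemma recZ_ci n k f : recn n f -> recZ n (fun xs => ci k (f xs)).
Proof.
move=> Hf; apply: recZ_add; first by apply: recZ_nat; exact: rec_el.
by apply: recZ_opp; apply: recZ_nat; exact: rec_el.
Qed.

Lemma rec_head0 : recn 1 head0. Proof. exact: rec_proj. Qed.

Lemma zc_a3 : zc pa3. Proof. exact: (recZ_ci 0 rec_head0). Qed.
Lemma zc_b3 : zc pb3. Proof. exact: (recZ_ci 1 rec_head0). Qed.
Lemma zc_a2 : zc pa2. Proof. exact: (recZ_ci 2 rec_head0). Qed.
Lemma zc_b2 : zc pb2. Proof. exact: (recZ_ci 3 rec_head0). Qed.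
Lemma zc_a1 : zc pa1. Proof. exact: (recZ_ci 4 rec_head0). Qed.
Lemma zc_b1 : zc pb1. Proof. exact: (recZ_ci 5 rec_head0). Qed.
Lemma zc_X : zc pX. Proof. exact: (recZ_ci 6 rec_head0). Qed.
Lemma zc_Y : zc pY. Proof. exact: (recZ_ci 7 rec_head0). Qed.

Lemma zc_const k : zc (fun=> k). Proof. exact: recZ_const. Qed.
Lemma zc_add F G : zc F -> zc G -> zc (fun p => F p + G p). Proof. exact: recZ_add. Qed.
Lemma zc_mul F G : zc F -> zc G -> zc (fun p => F p * G p). Proof. exact: recZ_mul. Qed.
Lemma zc_opp F : zc F -> zc (fun p => - F p). Proof. exact: recZ_opp. Qed.
Lemma zc_if b F G : bc b -> zc F -> zc G -> zc (fun p => if b p then F p else G p).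
Proof. exact: recZ_if. Qed.
Lemma zc_nat F : nc F -> zc (fun p => (F p)%:Z). Proof. exact: recZ_nat. Qed.
Lemma nc_abs F : zc F -> nc (fun p => `|F p|%N). Proof. exact: rec_abs. Qed.
Lemma nc_const k : nc (fun=> k). Proof. exact: rec_const. Qed.
Lemma nc_add F G : nc F -> nc G -> nc (fun p => F p + G p)%N. Proof. exact: rec_add. Qed.
Lemma nc_mul F G : nc F -> nc G -> nc (fun p => F p * G p)%N. Proof. exact: rec_mul. Qed.
Lemma nc_pred F : nc F -> nc (fun p => (F p).-1)%N. Proof. exact: rec_pred. Qed.
Lemma nc_succ F : nc F -> nc (fun p => (F p).+1)%N. Proof. exact: rec_succ. Qed.
Lemma bc_lt F G : zc F -> zc G -> bc (fun p => F p < G p). Proof. exact: recB_lt. Qed.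
Lemma bc_le F G : zc F -> zc G -> bc (fun p => F p <= G p). Proof. exact: recB_le. Qed.
Lemma bc_eq F G : zc F -> zc G -> bc (fun p => F p == G p). Proof. exact: recB_eq. Qed.
Lemma bc_and F G : bc F -> bc G -> bc (fun p => F p && G p). Proof. exact: recB_and. Qed.
Lemma bc_or F G : bc F -> bc G -> bc (fun p => F p || G p). Proof. exact: recB_or. Qed.
Lemma bc_neg F : bc F -> bc (fun p => ~~ F p). Proof. exact: recB_neg. Qed.

Lemma tc_const (T : countType) (x : T) : tc (fun=> x). Proof. exact: recT_const. Qed.
Lemma tc_pair (T U : countType) (F : prm -> T) (G : prm -> U) :
  tc F -> tc G -> tc (fun p => (F p, G p)).
Proof. exact: recT_pair. Qed.
Lemma tc_cons (T : countType) (F : prm -> T) (G : prm -> seq T) :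
  tc F -> tc G -> tc (fun p => F p :: G p).
Proof. exact: recT_cons. Qed.
Lemma tc_inl (T U : countType) (F : prm -> T) : tc F -> tc (fun p => inl (F p) : (T + U)%type).
Proof. exact: recT_inl. Qed.
Lemma tc_inr (T U : countType) (F : prm -> U) : tc F -> tc (fun p => inr (F p) : (T + U)%type).
Proof. exact: recT_inr. Qed.
Lemma tc_if (T : countType) b (F G : prm -> T) : bc b -> tc F -> tc G ->
  tc (fun p => if b p then F p else G p).
Proof. exact: recT_if. Qed.
Lemma tc_ratz F f : zc F -> nc f -> tc (fun p => ratz (F p) (f p)). Proof. exact: recT_ratz. Qed.
Lemma tc_poly (F : prm -> seq rat) : (forall p, last 1 (F p) != 0) -> tc F -> tc (fun p => Poly (F p)).
Proof. by move=> l Hf; apply: recT_poly => // xs; exact: l. Qed.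

Lemma code_map n (s : seq (seq nat -> nat)) : (forall f, List.In f s -> recn n f) ->
  recn n (fun xs => CodeSeq.code [seq f xs | f <- s]).
Proof.
elim: s => [|f s IH] H /=; first exact: rec_code_nil.
apply: rec_code_cons; first by apply: H; left.
by apply: IH => g gs; apply: H; right.
Qed.

Lemma el_code k s : el k (CodeSeq.code s) = nth 0%N s k.
Proof.
rewrite /el; have -> : iter k tlc (CodeSeq.code s) = CodeSeq.code (drop k s).
  elim: k s => [|k IH] [|x s] //; first by rewrite iterSr (_ : tlc (CodeSeq.code [::]) = CodeSeq.code [::]) // IH.
  by rewrite iterSr tlc_code IH.
by rewrite -[k in RHS]addn0 -nth_drop; case: (drop k s) => [|x r] //; rewrite hdc_code.
Qed.

Lemma cmap_intro G0 G1 G2 G3 G4 G5 G6 G7 : zc G0 -> zc G1 -> zc G2 -> zc G3 -> zc G4 -> zc G5 ->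
  zc G6 -> zc G7 -> cmap (fun p => (G0 p, G1 p, G2 p, G3 p, G4 p, G5 p, G6 p, G7 p)).
Proof.
move=> [f0 [g0 [h0 k0 e0]]] [f1 [g1 [h1 k1 e1]]] [f2 [g2 [h2 k2 e2]]] [f3 [g3 [h3 k3 e3]]]
  [f4 [g4 [h4 k4 e4]]] [f5 [g5 [h5 k5 e5]]] [f6 [g6 [h6 k6 e6]]] [f7 [g7 [h7 k7 e7]]].
pose s := [:: f0; g0; f1; g1; f2; g2; f3; g3; f4; g4; f5; g5; f6; g6; f7; g7].
exists (fun c => CodeSeq.code [seq f [:: c] | f <- s]); split.
  apply: (@eq_recn 1 (fun xs => CodeSeq.code [seq f xs | f <- s])).
    by case=> [|x []].
  apply: code_map => f; rewrite /s /=; do 16?[case=> [<- //|]]; by [].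
move=> c; rewrite (e0 [:: c]) // (e1 [:: c]) // (e2 [:: c]) // (e3 [:: c]) //.
rewrite (e4 [:: c]) // (e5 [:: c]) // (e6 [:: c]) // (e7 [:: c]) //.
by rewrite /theta /ci !el_code.
Qed.

Lemma tc_cmap (T : countType) (G : prm -> T) t : tc G -> cmap t -> tc (fun p => G (t p)).
Proof.
move=> HG [f [Hf fE]].
apply: (@eq_recn 1 (fun xs => pickle (G (theta (f (head0 xs)))))).
  by move=> xs _; rewrite fE.
exact: (rec_un (h := fun c => pickle (G (theta c))) HG Hf).
Qed.

Lemma cmap_comp t u : cmap t -> cmap u -> cmap (fun p => t (u p)).
Proof.
move=> [f [Hf fE]] [g [Hg gE]]; exists (fun c => f (g c)); split.
  exact: (rec_un (h := f) Hf Hg).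
by move=> c; rewrite fE gE.
Qed.

Lemma cmap_iter t K : cmap t -> nc K -> cmap (fun p => iter (K p) t p).
Proof.
move=> [f [Hf fE]] HK; exists (fun c => iter (K (theta c)) f c); split.
  have H := @rec_prec 1 (fun xs => K (theta (head0 xs))) head0 (fun ys => f (nth 0%N ys 1)) HK rec_head0 _.
  apply: (eq_recn _ (H _)) => [xs sx|].
    by elim: (K _) => //= k ->.
  by apply: (rec_un (h := f) Hf); exact: rec_proj.
by move=> c; elim: (K (theta c)) => //= k IH; rewrite fE IH.
Qed.

Lemma cmap_if b t u : bc b -> cmap t -> cmap u -> cmap (fun p => if b p then t p else u p).
Proof.
move=> Hb [f [Hf fE]] [g [Hg gE]].
exists (fun c => if b (theta c) then f c else g c); split; first exact: rec_if.
by move=> c; case: ifP => _; rewrite ?fE ?gE.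
Qed.

End ParameterSpace.

Ltac zhyp := match goal with
  | H : zc ?f |- zc ?f => exact: H
  | H : zc ?f |- zc (fun p => ?f p) => exact: H
  | H : nc ?f |- nc ?f => exact: H
  | H : nc ?f |- nc (fun p => ?f p) => exact: H
  | H : bc ?f |- bc ?f => exact: H
  | H : bc ?f |- bc (fun p => ?f p) => exact: H
  end.

Ltac zcomp := repeat first [zhyp | lazymatch goal with
  | |- zc (fun _ => ?k) => exact: (zc_const k)
  | |- nc (fun _ => ?k) => exact: (nc_const k)
  | |- zc (fun p => pa3 p) => exact: zc_a3 | |- zc pa3 => exact: zc_a3
  | |- zc (fun p => pb3 p) => exact: zc_b3 | |- zc pb3 => exact: zc_b3
  | |- zc (fun p => pa2 p) => exact: zc_a2 | |- zc pa2 => exact: zc_a2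
  | |- zc (fun p => pb2 p) => exact: zc_b2 | |- zc pb2 => exact: zc_b2
  | |- zc (fun p => pa1 p) => exact: zc_a1 | |- zc pa1 => exact: zc_a1
  | |- zc (fun p => pb1 p) => exact: zc_b1 | |- zc pb1 => exact: zc_b1
  | |- zc (fun p => pX p) => exact: zc_X | |- zc pX => exact: zc_X
  | |- zc (fun p => pY p) => exact: zc_Y | |- zc pY => exact: zc_Y
  | |- zc (fun p => GRing.add _ _) => apply: zc_add
  | |- zc (fun p => GRing.mul _ _) => apply: zc_mul
  | |- zc (fun p => GRing.opp _) => apply: zc_opp
  | |- zc (fun p => Posz _) => apply: zc_nat
  | |- zc (fun p => if _ then _ else _) => apply: zc_if
  | |- nc (fun p => absz _) => apply: nc_abs
  | |- nc (fun p => addn _ _) => apply: nc_add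
  | |- nc (fun p => muln _ _) => apply: nc_mul
  | |- nc (fun p => predn _) => apply: nc_pred
  | |- nc (fun p => S _) => apply: nc_succ
  | |- bc (fun p => andb _ _) => apply: bc_and
  | |- bc (fun p => orb _ _) => apply: bc_or
  | |- bc (fun p => negb _) => apply: bc_neg
  | |- bc (fun p => Order.lt _ _) => apply: bc_lt
  | |- bc (fun p => Order.le _ _) => apply: bc_le
  | |- bc (fun p => eq_op _ _) => apply: bc_eq
  end].

Ltac tcomp := repeat lazymatch goal with
  | |- tc (fun _ => ?k) => exact: (tc_const k)
  | |- tc (fun p => pair _ _) => apply: tc_pair
  | |- tc (fun p => cons _ _) => apply: tc_cons
  | |- tc (fun p => ratz _ _) => apply: tc_ratz; zcomp
  | |- zc _ => zcomp
  | |- nc _ => zcomp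
  | |- tc _ => assumption
  end.

Section Codes.

Lemma tc_quadp u w d t : zc u -> zc w -> zc d -> nc t ->
  tc (fun p => quadp (u p) (w p) (d p) (t p)).
Proof.
move=> Hu Hw Hd Ht.
apply: (@tc_poly (fun p => [:: ratz (u p * u p + (- (w p * w p * d p))) (t p * t p)%N;
  ratz (- (2 * u p)) (t p); 1])); first by move=> p; exact: oner_neq0.
by tcomp.
Qed.

Lemma tc_rquad u w d t : zc u -> zc w -> zc d -> nc t ->
  tc (fun p => rquad (u p) (w p) (d p) (t p)).
Proof.
move=> Hu Hw Hd Ht; apply: tc_pair; last by tcomp.
exact: tc_quadp.
Qed.

Lemma tc_cal u w d t : zc u -> zc w -> zc d -> nc t ->
  tc (fun p => cal (rquad (u p) (w p) (d p) (t p))).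
Proof.
move=> Hu Hw Hd Ht; apply: tc_pair; last first.
  apply: (@tc_pair _ _ (fun p => (ratz (if 0 <= w p then u p else u p + w p * (d p + 1)) (t p),
    ratz (if 0 <= w p then u p + w p * (d p + 1) else u p) (t p))) (fun=> (0, 0))).
    by tcomp.
  exact: tc_const.
exact: tc_quadp.
Qed.

Lemma tc_cint k : zc k -> tc (fun p => cint (k p)).
Proof. by move=> Hk; apply: tc_cal; zcomp. Qed.

Lemma tc_csqrtd m : zc m -> tc (fun p => csqrtd (m p)).
Proof.
move=> Hm; apply: tc_pair; last by tcomp.
apply: (@tc_poly (fun p => [:: ratz (- m p) 1; 0; 1])); first by move=> p; exact: oner_neq0.
by tcomp.
Qed.

End Codes.

Ltac tcomp2 := repeat lazymatch goal with
  | |- tc (fun _ => ?k) => exact: (tc_const k)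
  | |- tc (fun p => pair _ _) => apply: tc_pair
  | |- tc (fun p => cons _ _) => apply: tc_cons
  | |- tc (fun p => cint _) => apply: tc_cint; zcomp
  | |- tc (fun p => cal _) => apply: tc_cal; zcomp
  | |- tc (fun p => rquad _ _ _ _) => apply: tc_rquad; zcomp
  | |- tc (fun p => csqrtd _) => apply: tc_csqrtd; zcomp
  | |- zc _ => zcomp
  | |- nc _ => zcomp
  | |- tc _ => assumption
  end.

Section Encodings.

Lemma tc_num F : nc F -> tc F. Proof. by []. Qed.

Lemma tc_enc2 D P r d0 d1 c0 c1 c2 q0 q1 q2 : nc D -> nc P -> nc r -> zc d0 -> zc d1 ->
  tc c0 -> tc c1 -> tc c2 -> zc q0 -> zc q1 -> zc q2 ->
  tc (fun p => enc2 (D p) (P p) (r p) (d0 p) (d1 p) (c0 p) (c1 p) (c2 p) (q0 p) (q1 p) (q2 p)).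
Proof.
move=> HD HP Hr Hd0 Hd1 Hc0 Hc1 Hc2 Hq0 Hq1 Hq2; rewrite /enc2 /enc2f /enc2g /dom2.
have H0 := tc_num HD; have H1 := tc_num HP; have H2 := tc_num Hr.
have H3 : tc (fun p => D p + D p)%N by apply: tc_num; zcomp.
have H4 : tc (fun p => P p + D p)%N by apply: tc_num; zcomp.
have H5 : tc (fun p => P p + (D p + D p))%N by apply: tc_num; zcomp.
by tcomp2.
Qed.

Lemma tc_enc1 D P r u0 w0 t0 u1 w1 t1 um wm tm ue we te d :
  nc D -> nc P -> nc r -> zc d -> zc u0 -> zc w0 -> nc t0 -> zc u1 -> zc w1 -> nc t1 ->
  zc um -> zc wm -> nc tm -> zc ue -> zc we -> nc te ->
  tc (fun p => enc1 (D p) (P p) (r p) (rquad (u0 p) (w0 p) (d p) (t0 p))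
    (rquad (u1 p) (w1 p) (d p) (t1 p)) (rquad (- u0 p) (- w0 p) (d p) (t0 p))
    (rquad (- u1 p) (- w1 p) (d p) (t1 p)) (rquad (um p) (wm p) (d p) (tm p))
    (rquad (ue p) (we p) (d p) (te p))).
Proof.
move=> HD HP Hr Hd Hu0 Hw0 Ht0 Hu1 Hw1 Ht1 Hum Hwm Htm Hue Hwe Hte.
rewrite /enc1 /enc1f /enc1h /dom3 /dom2; cbn [cat].
have H0 := tc_num HD; have H1 := tc_num HP; have H2 := tc_num Hr.
have H3 : tc (fun p => D p + D p)%N by apply: tc_num; zcomp.
have H4 : tc (fun p => P p + D p)%N by apply: tc_num; zcomp.
have H5 : tc (fun p => P p + (D p + D p))%N by apply: tc_num; zcomp.
have H6 : tc (fun p => (P p).+1) by apply: tc_num; zcomp.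
have H7 : tc (fun p => (r p).+1) by apply: tc_num; zcomp.
by tcomp2.
Qed.

End Encodings.
End ComputableParameters.


(** * Transformations of integer parameters and solvable classes *)

Module ParameterMaps.
From mathcomp Require Import all_boot all_order all_algebra.
From mathcomp Require Import complex.
From mathcomp Require mpoly.
Import -(notations) mpoly.
From mathcomp Require Import all_classical all_reals all_analysis.
From mathcomp Require Import measurable_realfun.
From mathcomp Require Import zify ring lra.
Require Import Defs.
Import Recursive LinearRecurrences SubdominantGrowth Oscillation OscillationLowDegree AffineRecurrences HalfLineIntegrals DecayAndSmoothness Fibres Fibres3 Descriptors ExponentialPeriods PeriodLike MomentSolutions BesselIntegrals MinimalityCriteria BesselClass ComputableParameters.
Set Implicit Arguments.
Unset Strict Implicit.
Unset Printing Implicit Defensive.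
Import Order.TTheory GRing.Theory Num.Theory numFieldNormedType.Exports.
Local Open Scope classical_set_scope.
Local Open Scope ring_scope.

Ltac cm := apply: cmap_intro; zcomp.

Section Maps.
Variable R : realType.
Local Notation r x := (x%:~R : R).

Definition vp (p : prm) := forall n : nat, [/\ pa3 p * n%:Z + pb3 p != 0,
  pa2 p * n%:Z + pb2 p != 0 & pa1 p * n%:Z + pb1 p != 0].
(** The transformations introduce denominators in the initial values. The factor c absorbs them, so
    the parameters stay integral; minimality is insensitive to c when c != 0. *)
Definition psol (c : R) (p : prm) (v : nat -> R) :=
  [/\ asol (r (pa3 p)) (r (pb3 p)) (r (pa2 p)) (r (pb2 p)) (r (pa1 p)) (r (pb1 p)) v,
      v 0%N = c * r (pX p) & v 1%N = c * r (pY p)].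
Definition pmini (p : prm) (v : nat -> R) :=
  amini (r (pa3 p)) (r (pb3 p)) (r (pa2 p)) (r (pb2 p)) (r (pa1 p)) (r (pb1 p)) v.
Definition Mn (p : prm) := exists2 v, psol 1 p v & pmini p v.

Lemma affz (a b : int) n : aff (r a) (r b) n = r (a * n%:Z + b).
Proof. by rewrite /aff intrD intrM. Qed.

Lemma vp3 p : vp p -> forall n, aff (r (pa3 p)) (r (pb3 p)) n != 0.
Proof. by move=> V n; rewrite affz intr_eq0; case: (V n). Qed.

Lemma vp1 p : vp p -> forall n, aff (r (pa1 p)) (r (pb1 p)) n != 0.
Proof. by move=> V n; rewrite affz intr_eq0; case: (V n). Qed.

Lemma mini_scale (g3 g2 g1 v : nat -> R) (c : R) : c != 0 ->
  mini g3 g2 g1 v -> mini g3 g2 g1 (fun n => c * v n).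
Proof.
move=> c0 [[n vn] [w [Sw d]]]; split; first by exists n; rewrite mulf_neq0.
exists w; split=> // e e0; have c0' : 0 < `|c| by rewrite normr_gt0.
have [N HN] := d (e / `|c|) (divr_gt0 e0 c0'); exists N => k Nk; have [h w0] := HN k Nk.
split=> //; rewrite normrM; apply: le_trans (ler_wpM2l (ltW c0') h) _.
by rewrite mulrA mulrCA mulfV ?gt_eqF // mulr1.
Qed.

Lemma psol_ex p : vp p -> exists v, psol 1 p v.
Proof.
move=> V; have [v [S v0 v1]] := sol_ex (aff (r (pa2 p)) (r (pb2 p))) (aff (r (pa1 p)) (r (pb1 p)))
  (vp3 V) (r (pX p)) (r (pY p)).
by exists v; split; rewrite ?mul1r.
Qed.

Lemma MnE p c v : vp p -> c != 0 -> psol c p v -> Mn p <-> pmini p v.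
Proof.
move=> V c0 [Sv v0 v1].
have key w : psol 1 p w -> forall n, v n = c * w n.
  move=> [Sw w0 w1] n.
  apply: (sol_eq (vp3 V) Sv (v := fun n => c * w n)); rewrite ?w0 ?w1 ?mul1r //.
  by move=> k; rewrite mulrCA (Sw k); ring.
split=> [[w Sw Mw]|Mv].
  by rewrite (_ : v = fun n => c * w n); [exact: mini_scale|apply/funext => n; exact: key].
have [w Sw] := psol_ex V; exists w => //.
rewrite (_ : w = fun n => c^-1 * v n); first by apply: mini_scale; rewrite // invr_eq0.
by apply/funext => n; rewrite (key w Sw) mulrA mulVf // mul1r.
Qed.

Lemma Mn_trans p p' : vp p -> vp p' ->
  (forall v, psol 1 p v -> exists c v', [/\ c != 0, psol c p' v' & pmini p v <-> pmini p' v']) ->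
  Mn p <-> Mn p'.
Proof.
move=> V V' H; have [v Sv] := psol_ex V; have [c [v' [c0 Sv' E]]] := H v Sv.
by rewrite (MnE V (oner_neq0 _) Sv) (MnE V' c0 Sv').
Qed.

Definition pshift (p : prm) : prm := (pa3 p, pa3 p + pb3 p, pa2 p, pa2 p + pb2 p, pa1 p, pa1 p + pb1 p,
  pb3 p * pY p, pb2 p * pY p + pb1 p * pX p).
Definition pneg (p : prm) : prm := (- pa3 p, - pb3 p, - pa2 p, - pb2 p, - pa1 p, - pb1 p, pX p, pY p).
Definition pflip (p : prm) : prm := (pa3 p, pb3 p, - pa2 p, - pb2 p, pa1 p, pb1 p, pX p, - pY p).
Definition pswap (p : prm) : prm := (pa1 p, pa1 p + pb1 p, pa2 p, pb2 p, pa3 p, pb3 p + - pa3 p,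
  pX p * pb1 p, pY p * (pb3 p + - pa3 p)).
(** The last two entries are the values of A(S) v at 0 and 1, multiplied by b3 (a3 + b3) after v 2
    and v 3 have been eliminated by the recurrence. *)
Definition pT (p : prm) : prm :=
  (pa3 p, pb3 p + 2 * pa3 p, pa2 p, pb2 p + pa2 p, pa1 p, pb1 p,
   (pa3 p + pb3 p) * (pa3 p * (pb2 p * pY p + pb1 p * pX p) + - (pb3 p * (pa2 p * pY p + pa1 p * pX p))),
   pa3 p * ((pa2 p + pb2 p) * (pb2 p * pY p + pb1 p * pX p) + (pa1 p + pb1 p) * pb3 p * pY p) +
   - ((pa3 p + pb3 p) * (pa2 p * (pb2 p * pY p + pb1 p * pX p) + pa1 p * pb3 p * pY p))).

Lemma cm_shift : cmap pshift. Proof. by cm. Qed.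
Lemma cm_neg : cmap pneg. Proof. by cm. Qed.
Lemma cm_flip : cmap pflip. Proof. by cm. Qed.
Lemma cm_swap : cmap pswap. Proof. by cm. Qed.
Lemma cm_T : cmap pT. Proof. by cm. Qed.

Lemma psol2 p v c : vp p -> psol c p v ->
  r (pb3 p) != 0 /\ r (pb3 p) * v 2%N = c * r (pb2 p * pY p + pb1 p * pX p).
Proof.
move=> V [Sv v0 v1]; have := vp3 V 0; have := Sv 0%N.
rewrite /aff !mulr0 !add0r => -> ->; split=> //; rewrite v0 v1 intrD !intrM; ring.
Qed.

Lemma vp_shift p : vp p -> vp (pshift p).
Proof.
move=> V n; have [h1 h2 h3] := V n.+1.
have E (a b : int) : a * n%:Z + (a + b) = a * n.+1%:Z + b by rewrite intS; ring.
by split; rewrite /pshift /= E.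
Qed.

Lemma vp_neg p : vp p -> vp (pneg p).
Proof.
move=> V n; have [h1 h2 h3] := V n; split; rewrite /pneg /= mulNr -opprD oppr_eq0 //.
Qed.

Lemma vp_flip p : vp p -> vp (pflip p).
Proof.
by move=> V n; have [h1 h2 h3] := V n; split; rewrite /pflip /= ?mulNr -?opprD ?oppr_eq0.
Qed.

Lemma vp_swap p : vp p -> pb3 p + - pa3 p != 0 -> vp (pswap p).
Proof.
move=> V h n; have [h1 h2 h3] := V n; have [k1 k2 k3] := V n.+1; rewrite /pswap; split=> //=.
  by rewrite (_ : _ + _ = pa1 p * n.+1%:Z + pb1 p) // intS; ring.
case: n {h1 h2 h3 k1 k2 k3} => [|n]; first by rewrite mulr0 add0r.
have [h1 _ _] := V n; rewrite (_ : _ + _ = pa3 p * n%:Z + pb3 p) // intS; ring.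
Qed.

Lemma vp_T p : vp p -> vp (pT p).
Proof.
move=> V n; have [h1 h2 h3] := V n; have [_ k2 _] := V n.+1; have [l1 _ _] := V n.+2.
rewrite /pT; split=> //=.
  by rewrite (_ : _ + _ = pa3 p * n.+2%:Z + pb3 p) // !intS; ring.
by rewrite (_ : _ + _ = pa2 p * n.+1%:Z + pb2 p) // !intS; ring.
Qed.

Lemma Mn_shift p : vp p -> Mn p <-> Mn (pshift p).
Proof.
move=> V; apply: Mn_trans => // [|v S]; first exact: vp_shift.
have [b0 E] := psol2 V S; have [Sv v0 v1] := S.
have [Sw M] := amini_shift (vp3 V) (vp1 V) Sv.
exists (r (pb3 p))^-1, (v \o succn); split; first by rewrite invr_eq0.
  split; rewrite /pshift /= ?intrD //; first by rewrite v1 intrM mulrA mulVf // !mul1r.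
  by rewrite -intrD; apply: (mulfI b0); rewrite mulVKf // [LHS]E mul1r.
by rewrite /pmini /pshift /= !intrD.
Qed.

Lemma Mn_neg p : vp p -> Mn p <-> Mn (pneg p).
Proof.
move=> V; apply: Mn_trans => // [|v [Sv v0 v1]]; first exact: vp_neg.
have [A B] := amini_neg (r (pa3 p)) (r (pb3 p)) (r (pa2 p)) (r (pb2 p)) (r (pa1 p)) (r (pb1 p)) v.
exists 1, v; split; first exact: oner_neq0.
  by split=> //; rewrite /pneg /= !intrN; apply/A.
by rewrite /pmini /pneg /= !intrN.
Qed.

Lemma Mn_flip p : vp p -> Mn p <-> Mn (pflip p).
Proof.
move=> V; apply: Mn_trans => // [|v [Sv v0 v1]]; first exact: vp_flip.
have [u [Su u0 u1 M]] := amini_flip Sv.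
exists 1, u; split; first exact: oner_neq0.
  by split=> //; rewrite /pflip /= ?intrN // ?u0 // u1 v1 mulrN.
by rewrite /pmini /pflip /= !intrN.
Qed.

Lemma Mn_swap p : vp p -> pb3 p + - pa3 p != 0 -> Mn p <-> Mn (pswap p).
Proof.
move=> V h; apply: Mn_trans => // [|v [Sv v0 v1]]; first exact: vp_swap.
have h' : r (pb3 p) - r (pa3 p) != 0 by rewrite -intrB intr_eq0.
have [u [Su u0 u1 M]] := amini_swap h' (vp3 V) (vp1 V) Sv.
exists 1, u; split; first exact: oner_neq0.
  split; rewrite /pswap /=; first by rewrite !intrD intrN.
    by rewrite u0 v0 !mul1r intrM.
  by rewrite u1 v1 !mul1r intrM intrD intrN.
by rewrite /pmini /pswap /= !intrD intrN.
Qed.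

Lemma psol_T p c v : vp p -> c != 0 -> psol c p v ->
  exists2 c', c' != 0 & psol c' (pT p) (ashift (r (pa3 p)) (r (pa2 p)) (r (pa1 p)) v).
Proof.
move=> V c0 S; have [b0 E] := psol2 V S; have [Sv v0 v1] := S.
have g1 := vp3 V 1; have E1 := Sv 1%N; rewrite /aff !mulr1 in g1 E1.
have v2 : v 2%N = c * r (pb2 p * pY p + pb1 p * pX p) / r (pb3 p).
  by rewrite -E mulrAC mulfV // mul1r.
have v3 : v 3%N = ((r (pa2 p) + r (pb2 p)) * v 2%N + (r (pa1 p) + r (pb1 p)) * v 1%N) / (r (pa3 p) + r (pb3 p)).
  by rewrite -E1 mulrAC mulfV // mul1r.
exists (c / (r (pb3 p) * (r (pa3 p) + r (pb3 p)))).
  by rewrite mulf_neq0 // invr_eq0 mulf_neq0.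
split.
- have := ashift_sol Sv; rewrite /pT /= !intrD !intrM; exact.
- rewrite /ashift /pT /= v2 v1 v0 !(intrD, intrM, intrN); field; exact/andP.
- rewrite /ashift /pT /= v3 v2 v1 !(intrD, intrM, intrN); field; exact/andP.
Qed.

Lemma iterT p K : [/\ pa3 (iter K pT p) = pa3 p, pb3 (iter K pT p) = pb3 p + 2 * pa3 p * K%:Z,
  pa2 (iter K pT p) = pa2 p, pb2 (iter K pT p) = pb2 p + pa2 p * K%:Z &
  pa1 (iter K pT p) = pa1 p /\ pb1 (iter K pT p) = pb1 p].
Proof.
elim: K => [|K [E1 E2 E3 E4 [E5 E6]]] /=; first by rewrite !mulr0 !addr0.
by rewrite E1 E2 E3 E4 E5 E6 intS; split=> //; ring.
Qed.

Lemma psol_iterT p c v K : vp p -> c != 0 -> psol c p v ->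
  vp (iter K pT p) /\ exists2 c', c' != 0 &
    psol c' (iter K pT p) (iter K (ashift (r (pa3 p)) (r (pa2 p)) (r (pa1 p))) v).
Proof.
move=> V c0 S; elim: K => [|K [VK [c' c'0 SK]]] /=; first by split=> //; exists c.
split; first exact: vp_T.
have [c2 c20 S2] := psol_T VK c'0 SK; have [E1 _ E3 _ [E5 _]] := iterT p K.
by rewrite E1 E3 E5 in S2; exists c2.
Qed.

Lemma iter_shift p N : [/\ pa3 (iter N pshift p) = pa3 p, pb3 (iter N pshift p) = pb3 p + pa3 p * N%:Z,
  pa2 (iter N pshift p) = pa2 p, pb2 (iter N pshift p) = pb2 p + pa2 p * N%:Z &
  pa1 (iter N pshift p) = pa1 p /\ pb1 (iter N pshift p) = pb1 p + pa1 p * N%:Z].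
Proof.
elim: N => [|K [E1 E2 E3 E4 [E5 E6]]] /=; first by rewrite !mulr0 !addr0.
by rewrite E1 E2 E3 E4 E5 E6 intS; split; [|ring| |ring|split; [|ring]].
Qed.

Lemma Mn_iter_shift p N : vp p -> vp (iter N pshift p) /\ (Mn p <-> Mn (iter N pshift p)).
Proof.
move=> V; elim: N => [|N [VN IH]] //=; split; first exact: vp_shift.
by rewrite IH; exact: Mn_shift.
Qed.

(** F is computable everywhere but meaningful only on the class P, which need not be decidable; only
    the tests that split a class must be computable. *)
Definition solv (P : prm -> Prop) := exists F : prm -> integral_desc, tc F /\
  forall p, vp p -> P p -> integral_ok R (F p) /\ (Mn p <-> integral_zero R (F p)).

Lemma solv_map t (P Q : prm -> Prop) : cmap t ->
  (forall p, vp p -> P p -> [/\ vp (t p), Q (t p) & Mn p <-> Mn (t p)]) -> solv Q -> solv P.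
Proof.
move=> Ct H [F [CF HF]]; exists (fun p => F (t p)); split; first exact: tc_cmap.
by move=> p V Pp; have [V' Q' E] := H p V Pp; have [ok E'] := HF _ V' Q'; rewrite E.
Qed.

Lemma solv_if b (P : prm -> Prop) : bc b -> solv (fun p => P p /\ b p) ->
  solv (fun p => P p /\ ~~ b p) -> solv P.
Proof.
move=> Hb [F [CF HF]] [G [CG HG]]; exists (fun p => if b p then F p else G p).
split; first exact: tc_if.
by move=> p V Pp; case: ifP => h; [apply: HF|apply: HG]; rewrite ?h.
Qed.

Lemma solv_sub (P Q : prm -> Prop) : (forall p, vp p -> P p -> Q p) -> solv Q -> solv P.
Proof. by move=> H [F [CF HF]]; exists F; split=> // p V Pp; apply: HF => //; exact: H. Qed.

(** Instances decided outright are sent to integrals of 1 over R^0: the empty disjunction [[::]] is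
    the empty set, with value 0, and [[:: [::]]] is the single point, with value 1. *)
Definition zero_desc : integral_desc := inl (inl ((0%N, [:: (1, [::])], [:: (1, [::])], [::]),
  (0%N, [:: (1, [::])], [:: (1, [::])], [::]))).
Definition one_desc : integral_desc := inl (inl ((0%N, [:: (1, [::])], [:: (1, [::])], [:: [::]]),
  (0%N, [:: (1, [::])], [:: (1, [::])], [::]))).

Let one_eval (x : 0.-tuple R) : mpol_eval (ratr : rat -> R) [:: ((1 : rat), ([::] : seq nat))] x = 1.
Proof. by rewrite mpol_evalE !big_cons !big_nil big_ord0 /= rmorph1 mulr1 addr0. Qed.

Let one_n0 : mpoly_of 0 (ratr : rat -> R) [:: ((1 : rat), ([::] : seq nat))] != 0.
Proof.
apply: contra_neq (@oner_neq0 R) => E; have := one_eval [tuple].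
by rewrite /mpol_eval E mpoly.meval0 => <-.
Qed.

Let set0E : @semialg_set R rat ratr 0 [::] = set0.
Proof. by apply/seteqP; split. Qed.

Let oneE : @rat_integrand R 0 [:: ((1 : rat), ([::] : seq nat))] [:: ((1 : rat), ([::] : seq nat))] = cst 1.
Proof. by apply/funext => x; rewrite /rat_integrand one_eval divr1. Qed.

Lemma zero_descP : integral_ok R zero_desc /\ integral_zero R zero_desc.
Proof.
split.
  by split; (split; first exact: one_n0); rewrite /abs_cvg set0E; exact: integrable_set0.
by rewrite /integral_zero /= /period_val /= /rint set0E !Rintegral_set0.
Qed.

Lemma one_descP : integral_ok R one_desc /\ ~ integral_zero R one_desc.
Proof.
have sT : @semialg_set R rat ratr 0 [:: [::]] = setT by apply/seteqP; split.
split.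
  split; (split; first exact: one_n0); rewrite /abs_cvg; last by rewrite set0E; exact: integrable_set0.
  rewrite sT oneE; apply: (@finite_measure_integrable_cst _ _ _ (lebesgue_n R 0)).
  exact: measurableT.
have K : rat_integral_val R (0%N, [:: (1, [::])], [:: (1, [::])], [:: [::]]) = 1.
  rewrite /rat_integral_val sT oneE /rint /Rintegral; under eq_integral do rewrite /=.
  have L : lebesgue_n R 0 [set: euclid R 0] = 1%E.
    by rewrite /lebesgue_n; first [exact: diracT | rewrite diracE in_setT | rewrite /dirac indicE in_setT].
  by rewrite integral_cst // [X in (_ * X)%E](_ : _ = 1%E) ?mule1; last exact: L.
move=> H; have := congr1 (@complex.Re R) H.
rewrite (_ : complex.Re _ = rat_integral_val R (0%N, [:: (1, [::])], [:: (1, [::])], [:: [::]])) //.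
by rewrite K => /eqP; rewrite oner_eq0.
Qed.

Lemma solv_dec b (P : prm -> Prop) : bc b -> (forall p, vp p -> P p -> Mn p <-> b p) -> solv P.
Proof.
move=> Hb H; exists (fun p => if b p then zero_desc else one_desc); split.
  by apply: tc_if; [exact: Hb|exact: tc_const|exact: tc_const].
move=> p V Pp; have E := H p V Pp; have [z1 z2] := zero_descP; have [u1 u2] := one_descP.
case: (b p) E => E; first by split; [exact: z1|split=> _; [exact: z2|exact/E]].
by split; [exact: u1|split=> [/E|/u2] //].
Qed.

Lemma solv_no (P : prm -> Prop) : (forall p, vp p -> P p -> ~ Mn p) -> solv P.
Proof.
move=> H; apply: (@solv_dec (fun=> false)); first exact: rec_const.
by move=> p V Pp; split=> // /H; case.
Qed.

Lemma Mn0 p v : vp p -> psol 1 p v -> pX p = 0 -> pY p = 0 -> ~ Mn p.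
Proof.
move=> V S X0 Y0 /(MnE V (oner_neq0 _) S) [[n]]; have [Sv v0 v1] := S.
have := sol_n0 (vp3 V) (vp1 V) Sv; rewrite v0 v1 X0 Y0 mulr0 eqxx => -[h _] vn.
by have [] : false \/ false by apply: h; exists n.
Qed.

(** The zero solution has vanishing Casoratian without being minimal, so it is split off before the
    integral is used. *)
Lemma solv_leaf F (P : prm -> Prop) : tc F ->
  (forall p, vp p -> P p -> integral_ok R (F p) /\
    (forall v, psol 1 p v -> pmini p v <-> (v 0%N != 0 \/ v 1%N != 0) /\ integral_zero R (F p))) ->
  solv P.
Proof.
move=> CF H; apply: (solv_if (b := fun p => (pX p == 0) && (pY p == 0))); first by zcomp.
  apply: solv_no => p V [_ /andP[/eqP X0 /eqP Y0]].
  by have [v Sv] := psol_ex V; exact: Mn0 V Sv X0 Y0.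
exists F; split=> // p V [Pp h]; have [ok M] := H p V Pp; split=> //.
have [v Sv] := psol_ex V; rewrite (MnE V (oner_neq0 _) Sv) (M v Sv).
split=> [[]|z] //; split=> //; have [_ -> ->] := Sv; rewrite !mul1r !intr_eq0.
by apply/orP; rewrite -negb_and.
Qed.

End Maps.
End ParameterMaps.


Module Encodings.
From mathcomp Require Import all_boot all_order all_algebra.
From mathcomp Require Import complex.
From mathcomp Require mpoly.
Import -(notations) mpoly.
From mathcomp Require Import all_classical all_reals all_analysis.
From mathcomp Require Import measurable_realfun.
From mathcomp Require Import zify ring lra.
Require Import Defs.
Import Recursive LinearRecurrences SubdominantGrowth Oscillation OscillationLowDegree AffineRecurrences HalfLineIntegrals DecayAndSmoothness Fibres Fibres3 Descriptors ExponentialPeriods PeriodLike MomentSolutions BesselIntegrals MinimalityCriteria BesselClass ComputableParameters ParameterMaps.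
Set Implicit Arguments.
Unset Strict Implicit.
Unset Printing Implicit Defensive.
Import Order.TTheory GRing.Theory Num.Theory numFieldNormedType.Exports.
Local Open Scope classical_set_scope.
Local Open Scope ring_scope.
Local Open Scope complex_scope.

Section Encoded.
Variable R : realType.
Local Notation r x := (x%:~R : R).

Lemma cexp_real (x : R) : cexp x%:C = (expR x)%:C.
Proof.
rewrite /cexp /= cos0 sin0; apply/eqP; rewrite eq_complex /=.
by rewrite mulr1 !mul0r mulr0 subr0 addr0 !eqxx.
Qed.

Lemma ig_zero D (f : R -> R) : ig D f -> ig D (fun=> 0 : R) /\ IO D (fun=> 0 : R) = 0.
Proof.
move=> If; have [I E] := IO_lin 0 0 If If.
have Z : (fun y => 0 * f y + 0 * f y) = fun=> 0 by apply/funext => y; rewrite !mul0r addr0.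
by move: I E; rewrite Z !mul0r addr0.
Qed.

Section Exponential.
Variables (D P k : nat) (q0 q1 q2 : int) (e0 s : R).
Hypothesis D0 : (0 < D)%N.
Hypothesis e0E : e0 * D%:R = P%:R + 1.
Hypothesis sE : s * D%:R = k.+1%:R.

Lemma enc2_exp (d0 d1 c1 c2 : int) (g F : R -> R) :
  (forall y : R, 0 < y -> r d0 + r d1 * y != 0) ->
  g = (fun y => (r c1 * y + r c2 * y ^+ 2) / (r d0 + r d1 * y)) ->
  F = (fun y => expR (g y) * (r q0 + r q1 * y + r q2 * y ^+ 2) * (y `^ (e0 - 1) * (1 + y) `^ (- s))) ->
  ig D F ->
  integral_ok R (inl (inr (enc2 D P k d0 d1 (cint 0) (cint c1) (cint c2) q0 q1 q2))) /\
  (integral_zero R (inl (inr (enc2 D P k d0 d1 (cint 0) (cint c1) (cint c2) q0 q1 q2))) <-> IO D F = 0).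
Proof.
move=> dn gE FE IF; have [I0 Z0] := ig_zero IF.
have HE y : 0 < y -> cexp (- phi2 d0 d1 (0%:~R)%:C (r c1)%:C (r c2)%:C y) = expR (g y) +i* 0.
  move=> y0; rewrite (_ : - phi2 _ _ _ _ _ _ = (g y)%:C) ?cexp_real //.
  rewrite /phi2 gE mulNr opprK !(rmorphM, fmorphV, rmorphD) /= mulr0z rmorph0 add0r //.
have dg y : 0 < y -> derivable g y 1.
  move=> y0; rewrite gE; apply: derivableM.
    by apply: derivableD; apply: derivableM => //; apply: derivableX.
  by apply: derivableV; [exact: dn|apply: derivableD => //; apply: derivableM].
have sg : smooth (fun y => expR (g y)).
  by apply: (smooth_exp (g' := fun y => 'D_1 g y)) => y y0; apply: derivableP; exact: dg.
have s0 : smooth (fun=> 0 : R) by move=> y _; exact: derivable_cst.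
have I1 : ig D (fun y => 0 * quad2 q0 q1 q2 y * (y `^ (e0 - 1) * (1 + y) `^ (- s))).
  by apply: (ig_eq _ I0) => y _; rewrite !mul0r.
have I2 : ig D (fun y => expR (g y) * quad2 q0 q1 q2 y * (y `^ (e0 - 1) * (1 + y) `^ (- s))).
  by rewrite FE in IF.
have [ok Z] := enc2P D0 (cintP R 0) (cintP R c1) (cintP R c2) dn HE e0E sE sg s0 I2 I1.
split; first exact: ok.
rewrite /integral_zero /= Z FE; split=> [[]|h] //; split=> //.
by rewrite -[RHS]Z0; apply: IO_eq => y _; rewrite !mul0r.
Qed.

Lemma enc2_expE (d0 d1 c1 c2 : int) (F : R -> R) :
  (forall y : R, 0 < y -> r d0 + r d1 * y != 0) ->
  (forall y : R, 0 < y -> F y = expR ((r c1 * y + r c2 * y ^+ 2) / (r d0 + r d1 * y)) *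
    (r q0 + r q1 * y + r q2 * y ^+ 2) * (y `^ (e0 - 1) * (1 + y) `^ (- s))) ->
  ig D F ->
  integral_ok R (inl (inr (enc2 D P k d0 d1 (cint 0) (cint c1) (cint c2) q0 q1 q2))) /\
  (integral_zero R (inl (inr (enc2 D P k d0 d1 (cint 0) (cint c1) (cint c2) q0 q1 q2))) <-> IO D F = 0).
Proof.
move=> dn FE IF; rewrite (IO_eq D FE); apply: (enc2_exp dn erefl erefl).
exact: ig_eq FE IF.
Qed.

Let twist (z u w d : R[i]) : - (- (0 + z * u + 0 * w) / d) = z * (u / d).
Proof. by rewrite mulNr opprK mul0r add0r addr0 mulrA. Qed.

Let phiE (a m : int) (y : R) : - phi2 a a (0%:~R)%:C (csqrtz R m) (0%:~R)%:C y =
  csqrtz R m * (y / (r a + r a * y))%:C.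
Proof. by rewrite /phi2 mulr0z rmorph0 twist rmorphM fmorphV. Qed.

Let dn (a : int) (y : R) : 0 < a -> 0 < y -> r a + r a * y != 0.
Proof. by move=> a0 y0; rewrite gt_eqF // addr_gt0 ?mulr_gt0 ?ltr0z. Qed.

Let arg (a : int) (x y : R) : 0 < a -> 0 < y -> x * (y / (r a + r a * y)) = x / r a * y / (1 + y).
Proof.
move=> a0 y0; have a0' : r a != 0 by rewrite intr_eq0 gt_eqF.
have y1 : 1 + y != 0 by rewrite gt_eqF // addr_gt0.
by field; rewrite a0' y1 -[X in X + _]mulr1 -mulrDr mulf_neq0.
Qed.

Let sk (z : R) : smooth (fun y : R => z * y / (1 + y)).
Proof.
move=> y y0; apply: derivableM; first exact: derivableM.
by apply: derivableV; [rewrite gt_eqF // addr_gt0|apply: derivableD].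
Qed.

Lemma enc2_bessel_exp (a m : int) (z : R) (F : R -> R) : 0 < a -> 0 <= m -> z = Num.sqrt (r m) / r a ->
  F = (fun y => expR (z * y / (1 + y)) * (r q0 + r q1 * y + r q2 * y ^+ 2) *
    (y `^ (e0 - 1) * (1 + y) `^ (- s))) -> ig D F ->
  integral_ok R (inl (inr (enc2 D P k a a (cint 0) (csqrtd m) (cint 0) q0 q1 q2))) /\
  (integral_zero R (inl (inr (enc2 D P k a a (cint 0) (csqrtd m) (cint 0) q0 q1 q2))) <-> IO D F = 0).
Proof.
move=> a0 m0 zE FE IF; have [I0 Z0] := ig_zero IF.
have HE y : 0 < y -> cexp (- phi2 a a (0%:~R)%:C (csqrtz R m) (0%:~R)%:C y) =
    expR (z * y / (1 + y)) +i* 0.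
  move=> y0; rewrite phiE /csqrtz m0 -rmorphM arg // -zE; exact: cexp_real.
have sg : smooth (fun y => expR (z * y / (1 + y))).
  apply: (smooth_exp (g' := fun y => 'D_1 (fun y : R => z * y / (1 + y)) y)) => y y0.
  by apply: derivableP; exact: (@sk z y y0).
have s0 : smooth (fun=> 0 : R) by move=> y _; exact: derivable_cst.
have I1 : ig D (fun y => 0 * quad2 q0 q1 q2 y * (y `^ (e0 - 1) * (1 + y) `^ (- s))).
  by apply: (ig_eq _ I0) => y _; rewrite !mul0r.
have I2 : ig D (fun y => expR (z * y / (1 + y)) * quad2 q0 q1 q2 y * (y `^ (e0 - 1) * (1 + y) `^ (- s))).
  by rewrite FE in IF.
have [ok Z] := enc2P D0 (cintP R 0) (csqrtdP R m) (cintP R 0) (fun y => @dn a y a0) HE e0E sE sg s0 I2 I1.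
split; first exact: ok.
rewrite /integral_zero /= Z FE; split=> [[]|h] //; split=> //.
by rewrite -[RHS]Z0; apply: IO_eq => y _; rewrite !mul0r.
Qed.

Lemma enc2_bessel_cos (a m : int) (o : R) (F G : R -> R) : 0 < a -> m < 0 -> o = Num.sqrt (- r m) / r a ->
  F = (fun y => cos (o * y / (1 + y)) * (r q0 + r q1 * y + r q2 * y ^+ 2) *
    (y `^ (e0 - 1) * (1 + y) `^ (- s))) ->
  G = (fun y => sin (o * y / (1 + y)) * (r q0 + r q1 * y + r q2 * y ^+ 2) *
    (y `^ (e0 - 1) * (1 + y) `^ (- s))) -> ig D F -> ig D G ->
  integral_ok R (inl (inr (enc2 D P k a a (cint 0) (csqrtd m) (cint 0) q0 q1 q2))) /\
  (integral_zero R (inl (inr (enc2 D P k a a (cint 0) (csqrtd m) (cint 0) q0 q1 q2))) <->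
   IO D F = 0 /\ IO D G = 0).
Proof.
move=> a0 m0 zE FE GE IF IG.
have HE y : 0 < y -> cexp (- phi2 a a (0%:~R)%:C (csqrtz R m) (0%:~R)%:C y) =
    cos (o * y / (1 + y)) +i* sin (o * y / (1 + y)).
  move=> y0; rewrite phiE /csqrtz leNgt m0 /=.
  have -> : (0 +i* Num.sqrt (- r m)) * (y / (r a + r a * y))%:C = 0 +i* (o * y / (1 + y)).
    apply/eqP; rewrite eq_complex /=; apply/andP; split; apply/eqP; first by rewrite mul0r mulr0 subr0.
    by rewrite mul0r add0r arg // -zE.
  by rewrite /cexp /= expR0 mul1r.
have sc : smooth (fun y : R => cos (o * y / (1 + y))).
  move=> y y0; have h := derivableP (@sk o y y0).
  exact: (@ex_derive _ _ _ _ _ _ _ (is_derive1_comp (is_derive_cos _) h)).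
have ss : smooth (fun y : R => sin (o * y / (1 + y))).
  move=> y y0; have h := derivableP (@sk o y y0).
  exact: (@ex_derive _ _ _ _ _ _ _ (is_derive1_comp (is_derive_sin _) h)).
have I1 : ig D (fun y => cos (o * y / (1 + y)) * quad2 q0 q1 q2 y * (y `^ (e0 - 1) * (1 + y) `^ (- s))).
  by rewrite FE in IF.
have I2 : ig D (fun y => sin (o * y / (1 + y)) * quad2 q0 q1 q2 y * (y `^ (e0 - 1) * (1 + y) `^ (- s))).
  by rewrite GE in IG.
have [ok Z] := enc2P D0 (cintP R 0) (csqrtdP R m) (cintP R 0) (fun y => @dn a y a0) HE e0E sE sc ss I1 I2.
by split; [exact: ok|rewrite /integral_zero /= Z FE GE].
Qed.

End Exponential.

Lemma natz (x : int) : ((absz (x)%R))%:R = `|r x|.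
Proof. by rewrite natr_absz intr_norm. Qed.

Lemma natz1 (x : int) : x != 0 -> ((absz (x)%R).-1)%:R + 1 = `|r x|.
Proof. by move=> x0; rewrite natr1 prednK ?absz_gt0 // natz. Qed.

Lemma natz2 (x : int) : x != 0 -> ((absz (x)%R).-1.+1)%:R = `|r x|.
Proof. by move=> x0; rewrite prednK ?absz_gt0 // natz. Qed.

Lemma okq (u w d t : int) (x : R) : t != 0 -> 0 <= d ->
  x = (r u + r w * Num.sqrt (r d)) / `|r t| ->
  ralg_ok R (rquad u w d (absz (t)%R)) /\ ralg_val R (rquad u w d (absz (t)%R)) = x.
Proof.
move=> t0 d0 ->; have [|A B] := @rquadP R u w d (absz (t)%R) _ d0; first by rewrite absz_gt0.
by split=> //; rewrite B -natz.
Qed.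

End Encoded.

(** * The integral attached to a recurrence *)

Section Leaves.
Variable R : realType.
Local Notation r x := (x%:~R : R).
Local Notation psol := (@psol R).
Local Notation pmini := (@pmini R).

Definition dd p := pa2 p * pa2 p + 4 * pa3 p * pa1 p.
Definition sg p : int := if 0 < pa1 p then 1 else -1.
(** The exponents at the two roots are ea = (UU + WW sqrt dd) / QQ and eb = (UU - WW sqrt dd) / QQ.
    Their sum is mm / (a1 a3) = q - e0, where q = b3 / a3. *)
Definition mm p := pb3 p * pa1 p + - (pa3 p * pb1 p).
Definition WW p := 2 * pa1 p * (pb3 p * pa2 p + - (pa3 p * pb2 p)) + - (mm p * pa2 p).
Definition UU p := sg p * mm p * dd p.
Definition QQ p := 2 * (sg p * pa1 p) * pa3 p * dd p.
Definition posq (U W d : int) := ((0 <= U) && (0 <= W) && ((0 < U) || (0 < W))) ||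
  ((0 < U) && (W < 0) && (W * W * d < U * U)) || ((U < 0) && (0 < W) && (U * U < W * W * d)).

Lemma posqP (U W d : int) : 0 < d -> posq U W d = (0 < r U + r W * Num.sqrt (r d)).
Proof.
move=> d0; have d0' : 0 < r d by rewrite ltr0z.
rewrite /posq -!(ltr_int R) -!(ler_int R) !intrM.
have s0 : 0 < Num.sqrt (r d) by rewrite sqrtr_gt0.
rewrite -[r d in LHS](sqr_sqrtr (ltW d0')).
move: (Num.sqrt (r d)) (r U) (r W) s0 => s u w s0.
have ws : (w * w * s ^+ 2 = (w * s) ^+ 2) by ring.
rewrite ws -expr2; have sgn : (0 < w * s) = (0 < w) by rewrite pmulr_lgt0.
have sgn' : (w * s < 0) = (w < 0) by rewrite pmulr_llt0.
move: sgn sgn' {ws}; set t := w * s => sgn sgn'.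
case: (ltrgtP u 0) => hu; case: (ltrgtP w 0) => hw; rewrite ?hu ?hw ?lexx ?(ltW hu) ?(ltW hw) /= ?orbF.
all: try (have ht : t < 0 by rewrite sgn'); try (have ht : 0 < t by rewrite sgn).
all: try (have ht : t = 0 by rewrite /t hw mul0r).
all: try (by apply/esym/negbTE; rewrite -leNgt; lra).
all: try (by apply/esym; lra).
- apply/idP/idP => h; last by nra.
  by rewrite -subr_gt0 -(pmulr_rgt0 _ (_ : 0 < t - u)); [nra|lra].
- apply/idP/idP => h; last by nra.
  by rewrite -(pmulr_rgt0 _ (_ : 0 < u - t)); [nra|lra].
Qed.

(** The sign of a1 selects the root: for a1 > 0 the roots have opposite signs and [al] is the
    positive one; for a1 < 0 < a2 both are positive and [al] is the smaller. *)
Definition al p : R := (r (pa2 p) + r (sg p) * Num.sqrt (r (dd p))) / (2 * r (pa3 p)).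
Definition be p : R := (r (pa2 p) - r (sg p) * Num.sqrt (r (dd p))) / (2 * r (pa3 p)).

Lemma roots_data (a3 a2 a1 b3 b2 b1 g s : R) : 0 < a3 -> s ^+ 2 = a2 ^+ 2 + 4 * a3 * a1 -> 0 < s ->
  (g = 1 /\ 0 < a1) \/ (g = -1 /\ (a1 < 0 /\ 0 < a2)) ->
  let al := (a2 + g * s) / (2 * a3) in let be := (a2 - g * s) / (2 * a3) in
  let m := b3 * a1 - a3 * b1 in let W := 2 * a1 * (b3 * a2 - a3 * b2) - m * a2 in
  let Q := 2 * (g * a1) * a3 * s ^+ 2 in
  [/\ 0 < al, be != 0, a2 = a3 * (al + be), a1 = - a3 * al * be &
   [/\ 0 < 1 - al / be, 1 - al / be = (g * s ^+ 2 + a2 * s) / (2 * a3 * (g * a1)),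
     (g * m * s ^+ 2 - W * s) / Q * be * (a3 * (be - al)) = b3 * be ^+ 2 - b2 * be - b1,
     (g * m * s ^+ 2 + W * s) / Q + (g * m * s ^+ 2 - W * s) / Q = b3 / a3 - b1 / a1 &
     ((0 < a1 -> be < 0) /\ (a1 < 0 -> al < be)) /\ 0 < Q]].
Proof.
move=> a30 sE s0 H al be m W Q.
have a3n : a3 != 0 by rewrite gt_eqF.
have sn : s != 0 by rewrite gt_eqF.
have a1S : a1 = (s ^+ 2 - a2 ^+ 2) / (4 * a3) by rewrite sE; field.
have a1n : a1 != 0 by case: H => [[_ h]|[_ [h _]]]; [rewrite gt_eqF|rewrite lt_eqF].
have pn : s ^+ 2 - a2 ^+ 2 != 0.
  by apply: contra_neq a1n => h; rewrite a1S h mul0r.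
have [gP qp1 qp2] : [/\ g = 1 \/ g = -1, s - a2 != 0 & s + a2 != 0].
  split; first by case: H => [[-> _]|[-> _]]; [left|right].
    by apply: contra_neq pn => h; rewrite subr_sqr h mul0r.
  by apply: contra_neq pn => h; rewrite subr_sqr h mulr0.
have al0 : 0 < al.
  rewrite divr_gt0 ?mulr_gt0 //; case: H => [[-> h]|[-> [h k]]].
    have : 0 < a3 * a1 by exact: mulr_gt0.
    by move=> ?; rewrite mul1r; nra.
  have : 0 < a3 * (- a1) by rewrite mulr_gt0 // oppr_gt0.
  by move=> ?; rewrite mulN1r subr_gt0; nra.
have b1' : 0 < a1 -> be < 0.
  move=> h; rewrite pmulr_llt0 ?invr_gt0 ?mulr_gt0 //; case: H => [[-> _]|[_ [k _]]]; last by lra.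
  have : 0 < a3 * a1 by exact: mulr_gt0.
  by move=> ?; rewrite mul1r; nra.
have b2' : a1 < 0 -> al < be.
  move=> h; rewrite ltr_pM2r ?invr_gt0 ?mulr_gt0 //; case: H => [[_ k]|[-> _]]; first by lra.
  by rewrite mulN1r opprK; lra.
have ben : be != 0.
  by case: H => [[_ h]|[_ [h _]]]; [rewrite lt_eqF ?b1'|rewrite gt_eqF // (lt_trans al0) ?b2'].
have a2E : a2 = a3 * (al + be) by rewrite /al /be; field.
have a1E : a1 = - a3 * al * be by rewrite /al /be; case: gP => ->; rewrite {1}a1S; field.
have dE : be - al = - (g * s) / a3 by rewrite /al /be; field.
have nE : g * s ^+ 2 + a2 * s = 2 * a3 * al * s.
  by rewrite /al; case: gP => ->; field.
split=> //; split=> //.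
- rewrite -(mulfV ben) -mulrBl; case: H => [[gE h]|[gE [h _]]].
    by rewrite nmulr_lgt0 ?invr_lt0 ?b1' // subr_lt0 (lt_trans (b1' h)).
  by rewrite mulr_gt0 ?invr_gt0 ?subr_gt0 ?b2' // (lt_trans al0) ?b2'.
- by rewrite nE -{1}(mulfV ben) -mulrBl dE {1}a1E; clearbody al be; case: gP => ->; field; rewrite a3n ben gt_eqF.
- rewrite dE /Q.
  have -> : (g * m * s ^+ 2 - W * s) / (2 * (g * a1) * a3 * s ^+ 2) * be * (a3 * (- (g * s) / a3)) =
      (2 * a1 * (b3 * a2 - a3 * b2) - m * (a2 + g * s)) * be / (2 * a1 * a3).
    by rewrite /W; clearbody be m; case: gP => ->; field; rewrite a1n a3n sn.
  have -> : (2 * a1 * (b3 * a2 - a3 * b2) - m * (a2 + g * s)) * be =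
      2 * a1 * (b3 * a2 - a3 * b2) * be - 2 * a3 * m * (al * be).
    have -> : a2 + g * s = 2 * a3 * al by rewrite /al; field.
    by clearbody al be; ring.
  have -> : al * be = - (a1 / a3) by rewrite a1E; clearbody al be; field.
  have -> : be ^+ 2 = (a2 * be + a1) / a3 by rewrite {1}a2E {1}a1E; clearbody al be; field.
  by rewrite /m; clearbody be; field; rewrite a1n a3n.
- by rewrite /Q /m; clearbody W; case: gP => ->; field; rewrite a1n a3n sn.
- split=> //; have ga : 0 < g * a1.
    by case: H => [[-> h]|[-> [h _]]]; rewrite ?mul1r ?mulN1r ?oppr_gt0.
  by rewrite /Q; apply: mulr_gt0; [apply: mulr_gt0 => //; exact: mulr_gt0|exact: exprn_gt0].
Qed.

(** |a1 a3| is a common denominator of e0 = b1 / a1 and q = b3 / a3, and the next two arguments are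
    D e0 - 1 and D q - 1. The unsimplified signs match the syntactic form of [tc_enc1]. *)
Definition ddesc (p : prm) : integral_desc := inr (enc1 ((absz (pa1 p * pa3 p)%R)) ((absz (pb1 p * pa3 p)%R).-1)
  ((absz (pb3 p * pa1 p)%R).-1) (rquad (pY p) 0 (dd p) (absz (1)%R))
  (rquad (2 * pa3 p * pY p + - (pX p * pa2 p)) (- (sg p * pX p)) (dd p) (absz (2 * pa3 p)%R))
  (rquad (- pY p) (- 0) (dd p) (absz (1)%R))
  (rquad (- (2 * pa3 p * pY p + - (pX p * pa2 p))) (- (- (sg p * pX p))) (dd p) (absz (2 * pa3 p)%R))
  (rquad (- (sg p * dd p)) (- pa2 p) (dd p) (absz (2 * pa3 p * pa1 p)%R))
  (rquad (UU p + - QQ p) (- WW p) (dd p) (absz (QQ p)%R))).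

Lemma zc_dd : zc dd. Proof. by rewrite /dd; zcomp. Qed.
Lemma zc_sg : zc sg. Proof. by rewrite /sg; zcomp. Qed.
Lemma zc_mm : zc mm. Proof. by rewrite /mm; zcomp. Qed.
Lemma zc_WW : zc WW. Proof. by rewrite /WW; have h := zc_mm; zcomp. Qed.
Lemma zc_UU : zc UU.
Proof. by rewrite /UU; have h := zc_mm; have h1 := zc_sg; have h2 := zc_dd; zcomp. Qed.
Lemma zc_QQ : zc QQ.
Proof. by rewrite /QQ; have h1 := zc_sg; have h2 := zc_dd; zcomp. Qed.

Lemma tc_ddesc : tc ddesc.
Proof.
have h0 := zc_dd; have h1 := zc_sg; have h2 := zc_WW; have h3 := zc_UU; have h4 := zc_QQ.
apply: tc_inr.
apply: (@tc_enc1 (fun p => absz (pa1 p * pa3 p)) (fun p => (absz (pb1 p * pa3 p)).-1)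
  (fun p => (absz (pb3 p * pa1 p)).-1) (fun p => pY p) (fun=> 0) (fun=> absz 1)
  (fun p => 2 * pa3 p * pY p + - (pX p * pa2 p)) (fun p => - (sg p * pX p)) (fun p => absz (2 * pa3 p))
  (fun p => - (sg p * dd p)) (fun p => - pa2 p) (fun p => absz (2 * pa3 p * pa1 p))
  (fun p => UU p + - QQ p) (fun p => - WW p) (fun p => absz (QQ p)) dd); zcomp.
Qed.

(** The last two conditions are e0 >= 1, multiplied by a1^2 to stay integral, and q > 0. *)
Definition dok p := [/\ 0 < pa3 p, pa1 p != 0, 0 < dd p, pa1 p < 0 -> 0 < pa2 p &
  pa1 p * pa1 p <= pb1 p * pa1 p /\ 0 < pb3 p].

Lemma sgP p : pa1 p != 0 -> r (sg p) * r (pa1 p) = `|r (pa1 p)|.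
Proof.
move=> h; rewrite /sg; case: ltrP => k; first by rewrite mul1r gtr0_norm ?ltr0z.
by rewrite mulN1r ler0_norm ?lerz0.
Qed.

Lemma dok_data p : dok p -> let s : R := Num.sqrt (r (dd p)) in
  [/\ 0 < s, s ^+ 2 = r (dd p), s ^+ 2 = r (pa2 p) ^+ 2 + 4 * r (pa3 p) * r (pa1 p),
    0 < r (pa3 p) & (r (sg p) = 1 /\ 0 < r (pa1 p)) \/ (r (sg p) = -1 /\ (r (pa1 p) < 0 /\ 0 < r (pa2 p)))].
Proof.
case=> [h3 h1 hd h2 _] s; have d0 : 0 < r (dd p) by rewrite ltr0z.
have sE : s ^+ 2 = r (dd p) by rewrite sqr_sqrtr ?ltW.
split=> //; first by rewrite sqrtr_gt0.
- by rewrite sE /dd !(intrD, intrM) expr2.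
- by rewrite ltr0z.
rewrite /sg; case: ltrP => k; [left|right]; first by rewrite ltr0z.
have k' : pa1 p < 0 by rewrite lt_neqAle h1.
by rewrite ltrz0 ltr0z; split=> //; split=> //; exact: h2.
Qed.

Lemma e0_ge1 (a b : int) : a != 0 -> a * a <= b * a -> 1 <= r b / r a /\ b != 0.
Proof.
move=> a0 h; have a0' : r a != 0 by rewrite intr_eq0.
have aa : 0 < r a * r a by rewrite -expr2 exprn_even_gt0.
have h' : r a * r a <= r b * r a by rewrite -!intrM ler_int.
split; first by rewrite (_ : r b / r a = r b * r a / (r a * r a)) ?ler_pdivlMr ?mul1r //; field.
apply: contraTneq h => ->; rewrite mul0r -ltNge; move: aa; rewrite -intrM ltr0z //.
Qed.

Lemma ddescP p : dok p -> posq (UU p) (WW p) (dd p) ->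
  integral_ok R (ddesc p) /\ exists m,
  [/\ asol (r (pa3 p)) (r (pb3 p)) (r (pa2 p)) (r (pb2 p)) (r (pa1 p)) (r (pb1 p)) m,
    forall n, 0 < m n, forall n, m n <= al p ^+ n * m 0%N /\ m n.+1 <= al p * m n &
    integral_zero R (ddesc p) <-> r (pY p) * m 0%N - r (pX p) * m 1%N = 0].
Proof.
move=> ok pos; have [s0 sd sE a30 H] := dok_data ok.
have [_ h1 hd _ [h4 h5]] := ok; rewrite posqP // in pos.
set s := Num.sqrt _ in s0 sd sE pos.
have [al0 ben a2E a1E [ka0 kaE ebE sumE [_ Q0]]] :=
  @roots_data _ _ _ (r (pb3 p)) (r (pb2 p)) (r (pb1 p)) _ _ a30 sE s0 H.
have h3 : pa3 p != 0 by case: ok => /gt_eqF ->.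
have a1n : r (pa1 p) != 0 by rewrite intr_eq0.
have a3n : r (pa3 p) != 0 by rewrite intr_eq0.
have [e01 b1n] := e0_ge1 h1 h4.
have b3n : pb3 p != 0 by rewrite gt_eqF.
set Q := 2 * _ * _ * _ in ebE sumE Q0.
have QE : r (QQ p) = Q by rewrite /QQ /Q sd !intrM.
set U := r (sg p) * _ * _ in ebE sumE.
have UE : r (UU p) = U by rewrite /UU /U sd /mm !(intrM, intrD, intrN).
set W := 2 * _ * _ - _ in ebE sumE.
have WE : r (WW p) = W by rewrite /WW /W /mm !(intrM, intrD, intrN).
rewrite UE WE in pos.
have D0 : (0 < absz (pa1 p * pa3 p)%R)%N by rewrite absz_gt0 mulf_neq0.
have e0E : r (pb1 p) / r (pa1 p) * ((absz (pa1 p * pa3 p)%R))%:R = ((absz (pb1 p * pa3 p)%R).-1)%:R + 1.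
  rewrite natz1 ?mulf_neq0 // natz !intrM !normrM mulrA; congr (_ * _).
  rewrite -[X in X * _](ger0_norm (le_trans ler01 e01)) -normrM.
  by rewrite mulfVK.
have q0 : 0 < r (pb3 p) / r (pa3 p) by rewrite divr_gt0 // ltr0z.
have sE' : r (pb3 p) / r (pa3 p) * ((absz (pa1 p * pa3 p)%R))%:R = ((absz (pb3 p * pa1 p)%R).-1.+1)%:R.
  rewrite natz2 ?mulf_neq0 // natz !intrM !normrM mulrCA mulrC; congr (_ * _).
  by rewrite -[X in X * _](gtr0_norm q0) -normrM mulfVK.
have ea0 : 0 < (U + W * s) / Q by rewrite divr_gt0.
have sumE' : r (pb1 p) / r (pa1 p) + (U + W * s) / Q + (U - W * s) / Q = r (pb3 p) / r (pa3 p).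
  by rewrite -addrA sumE addrC subrK.
have [m [Sm mp ml rep]] := moments_distinct D0 a3n al0 ben a2E a1E ka0
  (esym (mulfVK a1n _) : r (pb1 p) = r (pb1 p) / r (pa1 p) * r (pa1 p))
  (esym (mulfVK a3n _) : r (pb3 p) = r (pb3 p) / r (pa3 p) * r (pa3 p)) e01 ea0 ebE sumE'.
have d0 : 0 <= dd p by exact: ltW.
have okY : ralg_ok R (rquad (pY p) 0 (dd p) (absz (1)%R)) /\ ralg_val R (rquad (pY p) 0 (dd p) (absz (1)%R)) = r (pY p).
  by apply: okq => //; rewrite mul0r addr0 normr1 divr1.
have okYn : ralg_ok R (rquad (- pY p) (- 0) (dd p) (absz (1)%R)) /\
    ralg_val R (rquad (- pY p) (- 0) (dd p) (absz (1)%R)) = - r (pY p).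
  by apply: okq => //; rewrite oppr0 mul0r addr0 normr1 divr1 intrN.
have t3 : 2 * pa3 p != 0 by rewrite mulf_neq0.
have n3 : `|r (2 * pa3 p)| = 2 * r (pa3 p) by rewrite intrM gtr0_norm // mulr_gt0.
have ok1 := @okq R (2 * pa3 p * pY p + - (pX p * pa2 p)) (- (sg p * pX p)) (dd p) (2 * pa3 p)
  (r (pY p) - r (pX p) * ((r (pa2 p) + r (sg p) * s) / (2 * r (pa3 p)))) t3 d0.
have okn1 := @okq R (- (2 * pa3 p * pY p + - (pX p * pa2 p))) (- (- (sg p * pX p))) (dd p) (2 * pa3 p)
  (- (r (pY p) - r (pX p) * ((r (pa2 p) + r (sg p) * s) / (2 * r (pa3 p))))) t3 d0.
have t1 : 2 * pa3 p * pa1 p != 0 by rewrite mulf_neq0.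
have n1 : `|r (2 * pa3 p * pa1 p)| = 2 * r (pa3 p) * (r (sg p) * r (pa1 p)).
  by rewrite intrM normrM (sgP h1); congr (_ * _); rewrite n3.
have okm := @okq R (- (sg p * dd p)) (- pa2 p) (dd p) (2 * pa3 p * pa1 p)
  (- (1 - (r (pa2 p) + r (sg p) * s) / (2 * r (pa3 p)) / ((r (pa2 p) - r (sg p) * s) / (2 * r (pa3 p))))) t1 d0.
have tQ : QQ p != 0 by rewrite -(intr_eq0 R) QE gt_eqF.
have oke := @okq R (UU p + - QQ p) (- WW p) (dd p) (QQ p) ((U - W * s) / Q - 1) tQ d0.
have [I V] := rep (r (pX p)) (r (pY p)).
have x1 : r (pY p) - r (pX p) * ((r (pa2 p) + r (sg p) * s) / (2 * r (pa3 p))) =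
    (r (2 * pa3 p * pY p + - (pX p * pa2 p)) + r (- (sg p * pX p)) * s) / `|r (2 * pa3 p)|.
  by rewrite n3 !(intrD, intrN) !intrM; field.
have xn1 : - (r (pY p) - r (pX p) * ((r (pa2 p) + r (sg p) * s) / (2 * r (pa3 p)))) =
    (r (- (2 * pa3 p * pY p + - (pX p * pa2 p))) + r (- (- (sg p * pX p))) * s) / `|r (2 * pa3 p)|.
  by rewrite x1 !intrN -mulNr; congr (_ / _); ring.
have xm : - (1 - (r (pa2 p) + r (sg p) * s) / (2 * r (pa3 p)) / ((r (pa2 p) - r (sg p) * s) / (2 * r (pa3 p)))) =
    (r (- (sg p * dd p)) + r (- pa2 p) * s) / `|r (2 * pa3 p * pa1 p)|.
  by rewrite n1 kaE !intrN [r (sg p * dd p)]intrM -sd -mulNr; congr (_ / _); ring.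
have xe : (U - W * s) / Q - 1 = (r (UU p + - QQ p) + r (- WW p) * s) / `|r (QQ p)|.
  by rewrite QE gtr0_norm // intrD !intrN UE WE QE; field; rewrite gt_eqF.
have [ok' Z] := enc1P D0 okY (ok1 x1) okYn (okn1 xn1) (okm xm) (oke xe) (ltW ka0) e0E sE' I.
split; first exact: ok'.
exists m; split=> //.
by rewrite -V -Z /integral_zero.
Qed.

End Leaves.
End Encodings.


(** * Recurrences with quadratic leading polynomial and real roots *)

Module QuadraticClasses.
From mathcomp Require Import all_boot all_order all_algebra.
From mathcomp Require Import complex.
From mathcomp Require mpoly.
Import -(notations) mpoly.
From mathcomp Require Import all_classical all_reals all_analysis.
From mathcomp Require Import measurable_realfun.
From mathcomp Require Import zify ring lra.
Require Import Defs.
Import Recursive LinearRecurrences SubdominantGrowth Oscillation OscillationLowDegree AffineRecurrences HalfLineIntegrals DecayAndSmoothness Fibres Fibres3 Descriptors ExponentialPeriods PeriodLike MomentSolutions BesselIntegrals MinimalityCriteria BesselClass ComputableParameters ParameterMaps Encodings.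
Set Implicit Arguments.
Unset Strict Implicit.
Unset Printing Implicit Defensive.
Import Order.TTheory GRing.Theory Num.Theory numFieldNormedType.Exports.
Local Open Scope classical_set_scope.
Local Open Scope ring_scope.

Section SolvableClasses.
Variable R : realType.
Local Notation r x := (x%:~R : R).
Local Notation solv := (solv R).

Lemma solv_wrap (P : prm -> Prop) F : tc F -> (forall p, vp p -> P p -> integral_ok R (F p) /\
  exists m c, [/\ c != 0 :> R,
    asol (r (pa3 p)) (r (pb3 p)) (r (pa2 p)) (r (pb2 p)) (r (pa1 p)) (r (pb1 p)) m, pmini p m &
    integral_zero R (F p) <-> c * (r (pY p) * m 0%N - r (pX p) * m 1%N) = 0]) -> solv P.
Proof.
move=> CF H; apply: (solv_leaf CF) => p V Pp; have [ok [m [c [c0 Sm Mm Z]]]] := H p V Pp.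
split=> // v [Sv v0 v1].
rewrite /pmini /amini (mini_crit (vp3 R V) (vp1 R V) Sm Mm Sv) Z v0 v1 !mul1r.
by split=> -[h E]; split=> //; [rewrite E mulr0|move/eqP: E; rewrite mulf_eq0 (negbTE c0) => /eqP].
Qed.

Lemma solv_symmetric : solv (fun p => [/\ dok p, posq (UU p) (WW p) (dd p), 0 < pa1 p, pa2 p = 0 & pb2 p < 0]).
Proof.
apply: (solv_wrap tc_ddesc) => p V [dk pos a10 a2E b20].
have [ok [m [Sm mp ml Z]]] := ddescP R dk pos; split=> //.
exists m, 1; split; [exact: oner_neq0|exact: Sm| |by rewrite mul1r].
have [h3 _ _ _ _] := dk; have A2 : r (pa2 p) = 0 by rewrite a2E.
have [s0 sd sE a30 H] := dok_data R dk.
have [al0 _ _ _ _] := @roots_data _ _ _ _ (r (pb3 p)) (r (pb2 p)) (r (pb1 p)) _ _ a30 sE s0 H.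
rewrite /pmini; move: Sm; rewrite A2 => Sm.
apply: (mini_symmetric (al := al R p) a30 _ _ al0 (vp3 R V) (vp1 R V) Sm mp) => [||n].
- by rewrite ltr0z.
- by rewrite ltrz0.
- by case: (ml n).
Qed.

(** Each [pT] adds QQ to UU, hence 1 to ea and to eb. Coming back through A(S) at level k requires
    B(be) != 0 there, that is eb + k != 0; this holds if eb > 0 at the start, and K = 0 leaves
    nothing to undo. *)
Lemma solv_distinct K (P : prm -> Prop) : nc K ->
  (forall p, vp p -> P p -> [/\ dok p, 0 < pa1 p -> pa2 p < 0,
    posq (UU (iter (K p) pT p)) (WW p) (dd p) & posq (UU p) (- WW p) (dd p) \/ K p = 0%N]) -> solv P.
Proof.
move=> HK H; apply: (@solv_leaf R (fun p => ddesc (iter (K p) pT p))).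
  by apply: (tc_cmap tc_ddesc); apply: cmap_iter => //; exact: cm_T.
move=> p V Pp; have [dk cond pos alt] := H p V Pp.
have [E3 F3 E2 F2 [E1 F1]] := iterT p (K p).
set p' := iter (K p) pT p in E3 F3 E2 F2 E1 F1 pos *.
have dE : dd p' = dd p by rewrite /dd E3 E2 E1.
have sE : sg p' = sg p by rewrite /sg E1.
have WE : WW p' = WW p by rewrite /WW /mm E3 E2 E1 F1 F3 F2; ring.
have aE : al R p' = al R p by rewrite /al E3 E2 dE sE.
have [h3 h1 hd h2 [h4 h5]] := dk.
have dk' : dok p'.
  rewrite /dok E3 E1 dE E2 F1 F3; split=> //; split=> //.
  by rewrite ltr_pwDl // mulr_ge0 // mulr_ge0 // ltW.
rewrite -WE -dE in pos.
have [ok [m [Sm mp ml Z]]] := ddescP R dk' pos; split=> // v Sv.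
have [s0 sd ssE a30 S] := dok_data R dk.
have [al0 ben a2E a1E [_ _ ebE _ [[b1 b2] Q0]]] := @roots_data _ _ _ _ (r (pb3 p)) (r (pb2 p)) (r (pb1 p)) _ _ a30 ssE s0 S.
rewrite -/(al R p) -/(be R p) in al0 ben a2E a1E ebE b1 b2.
rewrite aE E3 E2 E1 F1 in Sm ml.
have FR : r (pb3 p') = r (pb3 p) + 2 * r (pa3 p) * (K p)%:R by rewrite F3 intrD !intrM.
have FR2 : r (pb2 p') = r (pb2 p) + r (pa2 p) * (K p)%:R by rewrite F2 intrD !intrM.
rewrite FR FR2 in Sm.
have bb : be R p < - al R p \/ al R p < be R p.
  case: S => [[_ k]|[_ [k _]]]; [left|right; exact: b2].
  have : r (pa2 p) < 0 by rewrite ltrz0; apply: cond; rewrite -(ltr0z R).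
  by rewrite a2E pmulr_rlt0 // => ?; lra.
have nz k : (k < K p)%N -> (r (pb3 p) + 2 * r (pa3 p) * k%:R) * be R p ^+ 2 -
    (r (pb2 p) + r (pa2 p) * k%:R) * be R p - r (pb1 p) != 0.
  move=> kK; case: alt => [|K0]; last by rewrite K0 in kK.
  rewrite (posqP R) // => eb.
  have -> : (r (pb3 p) + 2 * r (pa3 p) * k%:R) * be R p ^+ 2 -
    (r (pb2 p) + r (pa2 p) * k%:R) * be R p - r (pb1 p) =
    (r (pb3 p) * be R p ^+ 2 - r (pb2 p) * be R p - r (pb1 p)) +
    k%:R * be R p * (r (pa3 p) * (be R p - al R p)).
    by rewrite [in X in X = _]a2E; ring.
  rewrite -ebE -mulrDl -mulrDl; have bn : be R p - al R p != 0.
    by rewrite subr_eq0; case: bb => h; [rewrite lt_eqF // (lt_trans h) // (lt_trans _ al0) // oppr_lt0|rewrite gt_eqF].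
  apply: mulf_neq0; last by rewrite mulf_neq0 ?(gt_eqF a30).
  apply: mulf_neq0 => //; rewrite gt_eqF // ltr_wpDr ?ler0n // divr_gt0 //.
  rewrite sd; move: eb; rewrite /UU /WW /mm /dd !(intrM, intrD, intrN) => eb.
  by apply: (lt_le_trans eb); rewrite le_eqVlt; apply/orP; left; apply/eqP; ring.
have g3 k n : aff (r (pa3 p)) (r (pb3 p) + 2 * r (pa3 p) * k%:R) n != 0.
  have := vp3 R V (n + 2 * k)%N; rewrite /aff natrD natrM mulrDr.
  by congr (_ != 0); ring.
have cr := crit_distinct a30 al0 bb a2E a1E g3 (vp1 R V) nz Sm mp (fun n => proj1 (ml n)).
have [Sv' _ _] := Sv; rewrite /pmini (cr _ Sv') /= Z.
have [_ [c c0 [_ u0 u1]]] := psol_iterT (K p) V (oner_neq0 R) Sv.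
rewrite -/p' in u0 u1; rewrite u0 u1.
have -> : c * r (pY p') * m 0%N - c * r (pX p') * m 1%N = c * (r (pY p') * m 0%N - r (pX p') * m 1%N) by ring.
by split=> -[h E]; split=> //; [move/eqP: E; rewrite mulf_eq0 (negbTE c0) => /eqP|rewrite E mulr0].
Qed.

(** This is 4 a3^2 B(al) at the double root al = a2 / (2 a3). Its sign separates a decaying
    exponential kernel, an exact solution al^n, and oscillation. *)
Definition GG p := pb3 p * (pa2 p * pa2 p) + - (2 * pb2 p * pa2 p * pa3 p) + - (4 * pb1 p * (pa3 p * pa3 p)).
(** The last three conditions are e0 >= 1, q > 1 and q - e0 <= 1, cleared of denominators with a1 <
    0. *)
Definition dbl p := [/\ 0 < pa3 p, pa1 p < 0, 0 < pa2 p, dd p = 0 &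
  [/\ pa1 p * pa1 p <= pb1 p * pa1 p, pa3 p < pb3 p & pa3 p * pa1 p <= mm p]].

Lemma dbl_data p : dbl p -> let al := r (pa2 p) / (2 * r (pa3 p)) in
  [/\ 0 < r (pa3 p), r (pa1 p) < 0, 0 < al, r (pa2 p) = 2 * r (pa3 p) * al &
  [/\ r (pa1 p) = - r (pa3 p) * al ^+ 2, 1 <= r (pb1 p) / r (pa1 p), 1 < r (pb3 p) / r (pa3 p),
    -1 <= r (pb1 p) / r (pa1 p) - r (pb3 p) / r (pa3 p) &
    r (GG p) / (4 * r (pa3 p) ^+ 2) = r (pb3 p) * al ^+ 2 - r (pb2 p) * al - r (pb1 p)]].
Proof.
case=> h3 h1 h2 hd [k1 k2 k3] al.
have a30 : 0 < r (pa3 p) by rewrite ltr0z.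
have a10 : r (pa1 p) < 0 by rewrite ltrz0.
have a20 : 0 < r (pa2 p) by rewrite ltr0z.
have a3n : r (pa3 p) != 0 by rewrite gt_eqF.
have a1n : r (pa1 p) != 0 by rewrite lt_eqF.
have dE : r (pa2 p) ^+ 2 = - (4 * r (pa3 p) * r (pa1 p)).
  have E := congr1 (fun z : int => r z) hd; rewrite /dd !(intrD, intrM) mulr0z in E.
  by apply/eqP; rewrite -subr_eq0 opprK expr2; apply/eqP; exact: E.
split=> //; [by rewrite divr_gt0 ?mulr_gt0|by rewrite /al; field|split=> //].
- by rewrite /al expr_div_n dE; field.
- have a1z : pa1 p != 0 by rewrite lt_eqF.
  by have [] := e0_ge1 R a1z k1.
- by rewrite ltr_pdivlMr // mul1r ltr_int.
- have : r (pa3 p) * r (pa1 p) <= r (pb3 p) * r (pa1 p) - r (pa3 p) * r (pb1 p).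
    by rewrite -!intrM -intrB ler_int.
  have X0 : 0 < r (pa3 p) * - r (pa1 p) by rewrite mulr_gt0 // oppr_gt0.
  move=> h; rewrite -(ler_pM2r X0).
  rewrite (_ : (_ / _ - _) * _ = r (pb3 p) * r (pa1 p) - r (pa3 p) * r (pb1 p)); last by field; rewrite a1n a3n.
  by rewrite mulN1r mulrN opprK.
- by rewrite /GG /al !(intrM, intrD, intrN); field.
Qed.

Definition edesc (p : prm) : integral_desc := inl (inr (enc2 (absz (pa1 p * pa3 p)%R) ((absz (pb1 p * pa3 p)%R).-1)
  ((absz (pb3 p * pa1 p)%R).-1) (- (4 * pa3 p * pa3 p * pa1 p)) 0 (cint 0) (cint (GG p)) (cint 0)
  (2 * pa3 p * pY p) (2 * pa3 p * pY p + - (pX p * pa2 p)) 0)).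

Lemma zc_GG : zc GG. Proof. by rewrite /GG; zcomp. Qed.

Lemma tc_edesc : tc edesc.
Proof.
have h := zc_GG; apply: tc_inl; apply: tc_inr.
apply: (@tc_enc2 (fun p => absz (pa1 p * pa3 p)) (fun p => (absz (pb1 p * pa3 p)).-1)
  (fun p => (absz (pb3 p * pa1 p)).-1) (fun p => - (4 * pa3 p * pa3 p * pa1 p)) (fun=> 0)
  (fun=> cint 0) (fun p => cint (GG p)) (fun=> cint 0) (fun p => 2 * pa3 p * pY p)
  (fun p => 2 * pa3 p * pY p + - (pX p * pa2 p)) (fun=> 0)); zcomp; by [exact: tc_const|apply: tc_cint; zcomp].
Qed.

Lemma exps (a3 b3 a1 b1 : int) : a3 != 0 -> a1 != 0 -> b1 != 0 -> b3 != 0 ->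
  0 < r b1 / r a1 -> 0 < r b3 / r a3 ->
  [/\ (0 < `|(a1 * a3)%R|)%N,
    r b1 / r a1 * ((absz (a1 * a3)%R))%:R = ((absz (b1 * a3)%R).-1)%:R + 1 &
    r b3 / r a3 * ((absz (a1 * a3)%R))%:R = ((absz (b3 * a1)%R).-1.+1)%:R].
Proof.
move=> a3n a1n b1n b3n e0 q0; have a3n' : r a3 != 0 by rewrite intr_eq0.
have a1n' : r a1 != 0 by rewrite intr_eq0.
split; first by rewrite absz_gt0 mulf_neq0.
  rewrite natz1 ?mulf_neq0 // natz -[X in X * _](gtr0_norm e0) -normrM; congr `|_|.
  by rewrite !intrM; field.
rewrite natz2 ?mulf_neq0 // natz -[X in X * _](gtr0_norm q0) -normrM; congr `|_|.
by rewrite !intrM; field.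
Qed.

Lemma solv_double : solv (fun p => dbl p /\ GG p < 0).
Proof.
apply: (solv_wrap tc_edesc) => p V [db G0].
have [a30 a10 al0 a2E [a1E e01 q1 eq GE]] := dbl_data db; have [h3 h1 h2 hd [k1 k2 k3]] := db.
have a3n : r (pa3 p) != 0 by rewrite gt_eqF.
have a1n : r (pa1 p) != 0 by rewrite lt_eqF.
have a1z : pa1 p != 0 by rewrite lt_eqF.
have a3z : pa3 p != 0 by rewrite gt_eqF.
have [_ b1n] := e0_ge1 R a1z k1.
have b3n : pb3 p != 0 by rewrite gt_eqF // (lt_trans h3).
have q0 := lt_trans ltr01 q1; have e00 := lt_le_trans ltr01 e01.
have [D0 e0E sE] := exps a3z a1z b1n b3n e00 q0.
set alp := r (pa2 p) / _ in al0 a2E a1E GE.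
pose c := r (GG p) / (4 * r (pa3 p) ^+ 2) / r (pa1 p).
have c0 : 0 < c.
  rewrite /c mulrC nmulr_lgt0 ?invr_lt0 // pmulr_llt0 ?ltrz0 // invr_gt0 mulr_gt0 // exprn_gt0 //.
have cE : c * r (pa1 p) = r (pb3 p) * alp ^+ 2 - r (pb2 p) * alp - r (pb1 p) by rewrite /c mulfVK // GE.
have [m [Sm mp ml rep]] := moments_double D0 a3n al0 a2E a1E c0 cE
  (esym (mulfVK a1n _)) (esym (mulfVK a3n _)) e01.
have [I Z] := rep (2 * r (pa3 p) * r (pX p)) (2 * r (pa3 p) * r (pY p)).
have dn y : 0 < y -> r (- (4 * pa3 p * pa3 p * pa1 p)) + r 0 * y != 0.
  by move=> y0; rewrite mulr0z mul0r addr0 intr_eq0 oppr_eq0 !mulf_neq0 // ?gt_eqF ?lt_eqF.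
have G1 y : - (c * y) = (r (GG p) * y + r 0 * y ^+ 2) / (r (- (4 * pa3 p * pa3 p * pa1 p)) + r 0 * y).
  by rewrite mulr0z !mul0r !addr0 intrN !intrM /c; field; rewrite a1n a3n.
have G3 : 2 * r (pa3 p) * r (pY p) - 2 * r (pa3 p) * r (pX p) * alp = r (2 * pa3 p * pY p + - (pX p * pa2 p)).
  by rewrite intrD intrN !intrM a2E; ring.
have G2 : 2 * r (pa3 p) * r (pY p) = r (2 * pa3 p * pY p) by rewrite !intrM.
have [ok Z'] := enc2_expE D0 e0E sE dn
  (F := fun y => expR (- (c * y)) * (2 * r (pa3 p) * r (pY p) +
    (2 * r (pa3 p) * r (pY p) - 2 * r (pa3 p) * r (pX p) * alp) * y + 0 * y ^+ 2) *
     (y `^ (r (pb1 p) / r (pa1 p) - 1) * (1 + y) `^ (- (r (pb3 p) / r (pa3 p)))))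
  (c1 := GG p) (c2 := 0) (q0 := 2 * pa3 p * pY p) (q1 := 2 * pa3 p * pY p + - (pX p * pa2 p)) (q2 := 0)
  ltac:(by move=> y y0; rewrite G3 G2 -[r 0]/(0 : R) -G1) I.
split; first exact: ok.
exists m, (2 * r (pa3 p)); split; [by rewrite mulf_neq0|exact: Sm| |].
  exact: (mini_double a30 al0 a1E (esym (mulfVK a1n _)) (esym (mulfVK a3n _)) e00 q1 eq (vp3 R V) (vp1 R V)
    Sm mp (fun n => proj1 (ml n))).
rewrite Z' Z.
have -> : 2 * r (pa3 p) * r (pY p) * m 0%N - 2 * r (pa3 p) * r (pX p) * m 1%N =
  2 * r (pa3 p) * (r (pY p) * m 0%N - r (pX p) * m 1%N) by ring.
by [].
Qed.

(** B(al) = 0 makes al^n an exact minimal solution, and al is rational, so the Casoratian is tested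
    by an integer equality. *)
Lemma solv_double_root : solv (fun p => dbl p /\ GG p = 0).
Proof.
apply: (@solv_dec R (fun p => ~~ ((pX p == 0) && (pY p == 0)) && (2 * pa3 p * pY p == pX p * pa2 p))); first by zcomp.
move=> p V [db G0].
have [a30 a10 al0 a2E [a1E e01 q1 eq GE]] := dbl_data db.
set alp := r (pa2 p) / _ in al0 a2E a1E GE.
have a3n : r (pa3 p) != 0 by rewrite gt_eqF.
have a1n : r (pa1 p) != 0 by rewrite lt_eqF.
have Sm : asol (r (pa3 p)) (r (pb3 p)) (r (pa2 p)) (r (pb2 p)) (r (pa1 p)) (r (pb1 p)) (fun n => alp ^+ n).
  move: GE; rewrite G0 mul0r => GE n; rewrite /aff a2E [r (pa1 p)]a1E.
  have -> : r (pb1 p) = r (pb3 p) * alp ^+ 2 - r (pb2 p) * alp by apply/eqP; rewrite eq_sym -subr_eq0 -GE.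
  by rewrite !exprS; ring.
have Mm := mini_double a30 al0 a1E (esym (mulfVK a1n _)) (esym (mulfVK a3n _)) (lt_le_trans ltr01 e01) q1 eq
  (vp3 R V) (vp1 R V) Sm (fun n => exprn_gt0 n al0) (fun n => _).
have {}Mm := Mm ltac:(by move=> n; rewrite expr0 mulr1).
have [v Sv] := psol_ex R V; rewrite (MnE V (oner_neq0 R) Sv).
have [Sv' v0 v1] := Sv; rewrite /pmini /amini (mini_crit (vp3 R V) (vp1 R V) Sm Mm Sv') v0 v1 !mul1r.
rewrite expr0 expr1 mulr1 !intr_eq0.
have E : (2 * pa3 p * pY p == pX p * pa2 p) = (r (pY p) - r (pX p) * alp == 0).
  rewrite -(inj_eq (@intr_inj R)) !intrM a2E subr_eq0.
  rewrite (_ : _ * (_ * alp) = 2 * r (pa3 p) * (r (pX p) * alp)); last by ring.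
  by rewrite (inj_eq (mulfI _)) // mulf_neq0.
rewrite E negb_and; split=> [[/orP h /eqP z]|/andP[/orP h /eqP z]] //; exact/andP.
Qed.

Lemma solv_double_pos : solv (fun p => dbl p /\ 0 < GG p).
Proof.
apply: solv_no => p V [db G0] [v [Sv _ _]].
have [a30 a10 al0 a2E [a1E e01 q1 eq GE]] := dbl_data db.
set alp := r (pa2 p) / _ in al0 a2E a1E GE.
pose ga := r (GG p) / (4 * r (pa3 p) ^+ 2).
have ga0 : 0 < ga by rewrite divr_gt0 ?ltr0z // mulr_gt0 // exprn_gt0.
pose h := 2 * r (pb3 p) * alp - r (pb2 p).
pose c := ga / (4 * (alp + 1)).
have c0 : 0 < c by rewrite divr_gt0 // mulr_gt0 // ltr_wpDr // ltW.
pose C := (h ^+ 2 / (2 * ga) + `|r (pb3 p)| + c) / r (pa3 p).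
apply: (@osc_quadratic R _ _ _ _ _ _ C c a30 a10 _ c0 _ (vp3 R V) (vp1 R V) _ _ v Sv).
- by rewrite a2E; apply: mulr_ge0; [apply: mulr_ge0 => //; exact: ltW|exact: ltW].
- move=> z; have a20 : 0 < r (pa2 p).
    by rewrite a2E; apply: mulr_gt0 => //; apply: mulr_gt0.
  by rewrite z ltxx in a20.
- move=> x y; rewrite /qform a2E a1E (_ : _ - _ = r (pa3 p) * (x - alp * y) ^+ 2); last by ring.
  by rewrite mulr_ge0 ?sqr_ge0 // ltW.
move=> x y.
have -> : C * qform (r (pa3 p)) (r (pa2 p)) (r (pa1 p)) x y =
    (h ^+ 2 / (2 * ga) + `|r (pb3 p)| + c) * (x - alp * y) ^+ 2.
  by rewrite /C /qform a2E a1E; field; rewrite (gt_eqF a30) (gt_eqF ga0).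
have -> : qform (r (pb3 p)) (r (pb2 p)) (r (pb1 p)) x y =
    r (pb3 p) * (x - alp * y) ^+ 2 + h * (x - alp * y) * y + ga * y ^+ 2.
  by rewrite /ga GE /h /qform; ring.
set t := x - alp * y; have xE : x = alp * y + t by rewrite /t; ring.
have k1 : 0 <= (`|r (pb3 p)| + r (pb3 p)) * t ^+ 2.
  by rewrite mulr_ge0 ?sqr_ge0 // -lerBlDr sub0r -normrN ler_norm.
have k2 : 0 <= (h * t + ga * y) ^+ 2 / (2 * ga) by rewrite divr_ge0 ?sqr_ge0 // mulr_ge0 // ltW.
have k3 : c * `|x * y| <= c * (alp * y ^+ 2) + c * (t ^+ 2 + y ^+ 2 / 4).
  rewrite -mulrDr ler_pM2l // xE mulrDl -mulrA -expr2; apply: le_trans (ler_normD _ _) _.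
  have aY : 0 <= alp * y ^+ 2 by apply: mulr_ge0; [exact: ltW|exact: sqr_ge0].
  rewrite (ger0_norm aY) lerD2l.
  have q2 := sqr_ge0 (t - y / 2); have q3 := sqr_ge0 (t + y / 2).
  by rewrite ler_norml; apply/andP; split; nra.
have k4 : c * (alp * y ^+ 2 + y ^+ 2 / 4) <= ga / 4 * y ^+ 2.
  have -> : ga / 4 * y ^+ 2 = c * ((alp + 1) * y ^+ 2).
    by rewrite /c; field; rewrite gt_eqF // ltr_wpDr // ltW.
  by rewrite ler_pM2l //; have := sqr_ge0 y; nra.
have k5 := mulr_ge0 (ltW ga0) (sqr_ge0 y).
have k6 : (h * t + ga * y) ^+ 2 / (2 * ga) = h ^+ 2 / (2 * ga) * t ^+ 2 + h * t * y + ga * y ^+ 2 / 2.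
  by field; rewrite gt_eqF.
rewrite k6 in k2; move: k1 k2 k3 k4 k5; rewrite !mulrDl !mulrDr.
move: (h ^+ 2 / _ * t ^+ 2) (h * t * y) (c * t ^+ 2) (c * (alp * y ^+ 2)) (c * (y ^+ 2 / 4)) (`|_| * t ^+ 2)
  (r (pb3 p) * t ^+ 2) => *; lra.
Qed.

End SolvableClasses.
End QuadraticClasses.


(** * Degenerate leading coefficients: Kummer, Gaussian and Bessel kernels *)

Module LowDegreeClasses.
From mathcomp Require Import all_boot all_order all_algebra.
From mathcomp Require Import complex.
From mathcomp Require mpoly.
Import -(notations) mpoly.
From mathcomp Require Import all_classical all_reals all_analysis.
From mathcomp Require Import measurable_realfun.
From mathcomp Require Import zify ring lra.
Require Import Defs.
Import Recursive LinearRecurrences SubdominantGrowth Oscillation OscillationLowDegree AffineRecurrences HalfLineIntegrals DecayAndSmoothness Fibres Fibres3 Descriptors ExponentialPeriods PeriodLike MomentSolutions BesselIntegrals MinimalityCriteria BesselClass ComputableParameters ParameterMaps Encodings.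
Set Implicit Arguments.
Unset Strict Implicit.
Unset Printing Implicit Defensive.
Import Order.TTheory GRing.Theory Num.Theory numFieldNormedType.Exports.
Local Open Scope classical_set_scope.
Local Open Scope ring_scope.

Section LowDegree.
Variable R : realType.
Local Notation r x := (x%:~R : R).
Local Notation solv := (solv R).

(** EE / (a1 a2^2) is the exponent ea at the root al = - a1 / a2. *)
Definition EE p := pb3 p * pa1 p * pa1 p + pb2 p * pa1 p * pa2 p + - (pb1 p * pa2 p * pa2 p).
Definition lin p := [/\ pa3 p = 0, 0 < pb3 p, pa1 p * pa2 p < 0 & pa1 p * pa1 p <= pb1 p * pa1 p].
Definition ldesc (p : prm) : integral_desc := inl (inr (enc2 (absz (pa1 p * pa2 p * pa2 p)%R)
  (absz (pb1 p * pa2 p * pa2 p)%R).-1 (absz (pa1 p * (pb3 p * pa1 p + pb2 p * pa2 p + pa2 p * pa2 p))%R).-1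
  (pa2 p * pa2 p) (pa2 p * pa2 p) (cint 0) (cint (pb3 p * pa1 p)) (cint 0)
  (pa2 p * pY p) (pa2 p * pY p + pa1 p * pX p) 0)).

Lemma zc_EE : zc EE. Proof. by rewrite /EE; zcomp. Qed.

Lemma tc_ldesc : tc ldesc.
Proof.
apply: tc_inl; apply: tc_inr.
apply: (@tc_enc2 (fun p => absz (pa1 p * pa2 p * pa2 p)) (fun p => (absz (pb1 p * pa2 p * pa2 p)).-1)
  (fun p => (absz (pa1 p * (pb3 p * pa1 p + pb2 p * pa2 p + pa2 p * pa2 p))).-1)
  (fun p => pa2 p * pa2 p) (fun p => pa2 p * pa2 p) (fun=> cint 0) (fun p => cint (pb3 p * pa1 p))
  (fun=> cint 0) (fun p => pa2 p * pY p) (fun p => pa2 p * pY p + pa1 p * pX p) (fun=> 0)); zcomp;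
  by [exact: tc_const|apply: tc_cint; zcomp].
Qed.

Lemma ldescP p : lin p -> 0 < EE p * pa1 p -> integral_ok R (ldesc p) /\
  let al := - r (pa1 p) / r (pa2 p) in exists m,
  [/\ asol 0 (r (pb3 p)) (r (pa2 p)) (r (pb2 p)) (r (pa1 p)) (r (pb1 p)) m,
    forall n, 0 < m n, forall n, m n <= al ^+ n * m 0%N &
    integral_zero R (ldesc p) <-> r (pY p) * m 0%N - r (pX p) * m 1%N = 0].
Proof.
case=> h3 hb3 h12 k1 hE.
have a1z : pa1 p != 0 by apply: contraTneq h12 => ->; rewrite mul0r ltxx.
have a2z : pa2 p != 0 by apply: contraTneq h12 => ->; rewrite mulr0 ltxx.
have a1n : r (pa1 p) != 0 by rewrite intr_eq0.
have a2n : r (pa2 p) != 0 by rewrite intr_eq0.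
have [e01 b1n] := e0_ge1 R a1z k1.
have e00 : 0 < r (pb1 p) / r (pa1 p) := lt_le_trans ltr01 e01.
pose ea := r (EE p) / (r (pa1 p) * r (pa2 p) ^+ 2).
have ea0 : 0 < ea.
  rewrite (_ : ea = r (EE p) * r (pa1 p) / (r (pa1 p) * r (pa2 p)) ^+ 2).
    by rewrite divr_gt0 //; [rewrite -intrM ltr0z|rewrite exprn_even_gt0 //= mulf_neq0].
  by rewrite /ea; field; rewrite a1n a2n.
set al := - r (pa1 p) / r (pa2 p).
have al0 : 0 < al.
  rewrite (_ : al = - (r (pa1 p) * r (pa2 p)) / r (pa2 p) ^+ 2); last by rewrite /al; field.
  by rewrite divr_gt0 //; [rewrite oppr_gt0 -intrM ltrz0|rewrite exprn_even_gt0].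
have sK : (r (pb1 p) / r (pa1 p) + ea + 1) * r (pa1 p * pa2 p * pa2 p) =
    r (pa1 p * (pb3 p * pa1 p + pb2 p * pa2 p + pa2 p * pa2 p)).
  by rewrite /ea /EE !(intrM, intrD, intrN); field; rewrite a1n a2n.
have s0 : 0 < r (pb1 p) / r (pa1 p) + ea + 1 by rewrite !addr_gt0.
have Dz : pa1 p * pa2 p * pa2 p != 0 by rewrite !mulf_neq0.
have D0 : (0 < absz (pa1 p * pa2 p * pa2 p)%R)%N by rewrite absz_gt0.
have e0E : r (pb1 p) / r (pa1 p) * (absz (pa1 p * pa2 p * pa2 p)%R)%:R =
    ((absz (pb1 p * pa2 p * pa2 p)%R).-1)%:R + 1.
  rewrite natz1 ?mulf_neq0 // natz -[X in X * _](gtr0_norm e00) -normrM; congr `|_|.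
  by rewrite !intrM; field.
have sE : (r (pb1 p) / r (pa1 p) + ea + 1) * (absz (pa1 p * pa2 p * pa2 p)%R)%:R =
    ((absz (pa1 p * (pb3 p * pa1 p + pb2 p * pa2 p + pa2 p * pa2 p))%R).-1.+1)%:R.
  rewrite natz2; last by rewrite -(intr_eq0 R) -sK mulf_neq0 ?(gt_eqF s0) // intr_eq0.
  by rewrite natz -[X in X * _](gtr0_norm s0) -normrM sK.
have a1E : r (pa1 p) = - r (pa2 p) * al by rewrite /al; field.
have eE : ea * al * r (pa2 p) = - (r (pb3 p) * al ^+ 2 - r (pb2 p) * al - r (pb1 p)).
  by rewrite /ea /al /EE !(intrM, intrD, intrN); field; rewrite a1n a2n.
have [m [Sm mp ml rep]] := moments_linear D0 a2n al0 a1E (esym (mulfVK a1n _)) e01 ea0 erefl eE.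
have [I Z] := rep (r (pa2 p) * r (pX p)) (r (pa2 p) * r (pY p)).
have dn (y : R) : 0 < y -> r (pa2 p * pa2 p) + r (pa2 p * pa2 p) * y != 0.
  move=> y0; rewrite -[X in X + _]mulr1 -mulrDr mulf_neq0 ?intr_eq0 ?mulf_neq0 //.
  by rewrite gt_eqF // addr_gt0.
have G1 (y : R) : 0 < y -> - (r (pb3 p) * al / r (pa2 p) * y / (1 + y)) =
    (r (pb3 p * pa1 p) * y + r 0 * y ^+ 2) / (r (pa2 p * pa2 p) + r (pa2 p * pa2 p) * y).
  move=> y0; have y1 : 1 + y != 0 by rewrite gt_eqF // addr_gt0.
  rewrite mulr0z mul0r addr0 !intrM.
  rewrite (_ : _ + _ * y = r (pa2 p) * r (pa2 p) * (1 + y)); last by ring.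
  by rewrite /al; field; rewrite a2n y1.
have G3 : r (pa2 p) * r (pY p) - r (pa2 p) * r (pX p) * al = r (pa2 p * pY p + pa1 p * pX p).
  by rewrite intrD !intrM a1E; ring.
have G2 : r (pa2 p) * r (pY p) = r (pa2 p * pY p) by rewrite !intrM.
have [ok Z'] := enc2_expE D0 e0E sE dn
  (F := fun y => expR (- (r (pb3 p) * al / r (pa2 p) * y / (1 + y))) * (r (pa2 p) * r (pY p) +
    (r (pa2 p) * r (pY p) - r (pa2 p) * r (pX p) * al) * y + 0 * y ^+ 2) *
    (y `^ (r (pb1 p) / r (pa1 p) - 1) * (1 + y) `^ (- (r (pb1 p) / r (pa1 p) + ea + 1))))
  (c1 := pb3 p * pa1 p) (c2 := 0)
  (q0 := pa2 p * pY p) (q1 := pa2 p * pY p + pa1 p * pX p) (q2 := 0)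
  ltac:(by move=> y y0; rewrite -(G1 y y0) -G2 -G3) I.
split; first exact: ok.
exists m; split=> // [n|]; first by case: (ml n).
rewrite Z' Z -!mulrA -mulrBr; split=> [/eqP|->]; last by rewrite mulr0.
by rewrite mulf_eq0 (negbTE a2n) => /eqP.
Qed.

(** With a3 = 0, each [pT] adds (a1 a2)^2 >= 1 to EE a1, so |EE a1| + 1 applications make ea
    positive. Here S - al can always be undone on small sequences, so no exponent has to avoid 0 on
    the way. *)
Lemma solv_lin : solv lin.
Proof.
have hE := zc_EE.
apply: (@solv_leaf R (fun p => ldesc (iter (absz (EE p * pa1 p)%R).+1 pT p))).
  by apply: (tc_cmap tc_ldesc); apply: cmap_iter; [exact: cm_T|zcomp].
move=> p V [h3 hb3 h12 k1]; set K := (absz _).+1.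
have [E3 F3 E2 F2 [E1 F1]] := iterT p K; set p' := iter K pT p in E3 F3 E2 F2 E1 F1 *.
rewrite h3 mulr0 mul0r addr0 in F3; rewrite h3 in E3.
have l' : lin p' by rewrite /lin E3 F3 E1 E2 F1.
have pos : 0 < EE p' * pa1 p'.
  rewrite /EE F3 E1 F1 E2 F2.
  rewrite (_ : _ * _ = EE p * pa1 p + K%:Z * ((pa1 p * pa2 p) * (pa1 p * pa2 p))); last by rewrite /EE; ring.
  have : 1 <= (pa1 p * pa2 p) * (pa1 p * pa2 p) by move: (pa1 p * pa2 p) h12 => t; nia.
  rewrite /K; move: (EE p * pa1 p) ((pa1 p * pa2 p) * (pa1 p * pa2 p)) => e t ht.
  have : (absz e).+1%:Z <= (absz e).+1%:Z * t by nia.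
  by lia.
have [ok [m [Sm mp ml Z]]] := ldescP l' pos; split=> // v Sv.
rewrite E1 E2 F1 F3 in Sm ml.
have FR2 : r (pb2 p') = r (pb2 p) + r (pa2 p) * K%:R by rewrite F2 intrD !intrM.
rewrite FR2 in Sm.
have a2z : pa2 p != 0 by apply: contraTneq h12 => ->; rewrite mulr0 ltxx.
have a2n : r (pa2 p) != 0 by rewrite intr_eq0.
have al0 : 0 < - r (pa1 p) / r (pa2 p).
  rewrite (_ : _ / _ = - (r (pa1 p) * r (pa2 p)) / r (pa2 p) ^+ 2); last by field.
  by rewrite divr_gt0 //; [rewrite oppr_gt0 -intrM ltrz0|rewrite exprn_even_gt0].
have b30 : 0 < r (pb3 p) by rewrite ltr0z.
have a1E : r (pa1 p) = - r (pa2 p) * (- r (pa1 p) / r (pa2 p)) by field.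
have [Sv' _ _] := Sv; have A3 : r (pa3 p) = 0 by rewrite h3.
rewrite A3 in Sv'.
have cr := crit_linear b30 a2n al0 a1E (vp1 R V) Sm mp ml Sv'.
lazy zeta in cr.
have [_ [c c0 [_ u0 u1]]] := psol_iterT K V (oner_neq0 R) Sv.
rewrite -[iter K pT p]/p' A3 in u0 u1; rewrite u0 u1 in cr; rewrite /pmini A3 cr Z.
have -> : c * r (pY p') * m 0%N - c * r (pX p') * m 1%N = c * (r (pY p') * m 0%N - r (pX p') * m 1%N) by ring.
by split=> -[h E]; split=> //; [move/eqP: E; rewrite mulf_eq0 (negbTE c0) => /eqP|rewrite E mulr0].
Qed.

Definition gau p := [/\ pa3 p = 0, pa2 p = 0, 0 < pb3 p, pb2 p < 0 & 0 < pa1 p /\ pa1 p <= pb1 p].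
Definition gdesc (p : prm) : integral_desc := inl (inr (enc2 (absz (pa1 p)) (absz (pb1 p)).-1 (absz (pa1 p)).-1
  (2 * pa1 p) 0 (cint 0) (cint (2 * pb2 p)) (cint (- pb3 p)) (pY p) (pY p + - pX p) (- pX p))).

Lemma tc_gdesc : tc gdesc.
Proof.
apply: tc_inl; apply: tc_inr.
apply: (@tc_enc2 (fun p => absz (pa1 p)) (fun p => (absz (pb1 p)).-1) (fun p => (absz (pa1 p)).-1)
  (fun p => 2 * pa1 p) (fun=> 0) (fun=> cint 0) (fun p => cint (2 * pb2 p)) (fun p => cint (- pb3 p))
  (fun p => pY p) (fun p => pY p + - pX p) (fun p => - pX p)); zcomp;
  by [exact: tc_const|apply: tc_cint; zcomp].
Qed.

Lemma solv_gauss : solv gau.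
Proof.
apply: (solv_leaf tc_gdesc) => p V [h3 h2 hb3 hb2 [h1 k1]].
have a10 : 0 < r (pa1 p) by rewrite ltr0z.
have b30 : 0 < r (pb3 p) by rewrite ltr0z.
have b20 : r (pb2 p) < 0 by rewrite ltrz0.
have a1n : r (pa1 p) != 0 by rewrite gt_eqF.
have b10 : 0 < pb1 p := lt_le_trans h1 k1.
have e01 : 1 <= r (pb1 p) / r (pa1 p) by rewrite ler_pdivlMr // mul1r ler_int.
have D0 : (0 < absz (pa1 p))%N by rewrite absz_gt0 gt_eqF.
have e0E : r (pb1 p) / r (pa1 p) * (absz (pa1 p))%:R = ((absz (pb1 p)).-1)%:R + 1.
  by rewrite natz1 ?gt_eqF // natz !gtr0_norm ?ltr0z // mulfVK.
have sE : 1 * (absz (pa1 p))%:R = ((absz (pa1 p)).-1.+1)%:R :> R by rewrite mul1r prednK.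
have A0 : 0 < r (pb3 p) / (2 * r (pa1 p)) by rewrite divr_gt0 ?mulr_gt0.
have B0 : 0 < - r (pb2 p) / r (pa1 p) by rewrite divr_gt0 ?oppr_gt0.
have E3 : r (pb3 p) = 2 * (r (pb3 p) / (2 * r (pa1 p))) * r (pa1 p) by field.
have E2 : r (pb2 p) = - (- r (pb2 p) / r (pa1 p)) * r (pa1 p) by field.
have [m [Sm mp ml rep]] := moments_gauss D0 a1n E3 E2 (esym (mulfVK a1n _)) A0 B0 e01.
have [I Z] := rep (r (pX p)) (r (pY p)).
have dn (y : R) : 0 < y -> r (2 * pa1 p) + r 0 * y != 0.
  by move=> y0; rewrite mulr0z mul0r addr0 intrM mulf_neq0.
have G1 (y : R) : - (r (pb3 p) / (2 * r (pa1 p)) * y ^+ 2 + - r (pb2 p) / r (pa1 p) * y) =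
    (r (2 * pb2 p) * y + r (- pb3 p) * y ^+ 2) / (r (2 * pa1 p) + r 0 * y).
  by rewrite mulr0z mul0r addr0 intrN !intrM; field.
have [ok Z'] := enc2_expE D0 e0E sE dn (c1 := 2 * pb2 p) (c2 := - pb3 p)
  (q0 := pY p) (q1 := pY p + - pX p) (q2 := - pX p)
  ltac:(by move=> y y0; rewrite -G1 intrD !intrN) I.
split; first exact: ok.
move=> v [Sv v0 v1]; have A3 : r (pa3 p) = 0 by rewrite h3.
have A2 : r (pa2 p) = 0 by rewrite h2.
rewrite A3 A2 in Sv.
have Mm := mini_gauss b30 b20 a10 (vp1 R V) Sm mp ml.
have g3 n : aff 0 (r (pb3 p)) n != 0 by rewrite /aff mul0r add0r gt_eqF.
by rewrite /pmini A3 A2 /amini (mini_crit g3 (vp1 R V) Sm Mm Sv) Z' Z v0 v1 !mul1r.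
Qed.

(** The last condition is e0 >= 1 for e0 = (2 b2 - a2) / (2 a2). *)
Definition bsl p := [/\ pa3 p = 0, pa1 p = 0, 0 < pb3 p, pa2 p != 0 & 3 * (pa2 p * pa2 p) <= 2 * (pb2 p * pa2 p)].
(** The kernel is the exponential of sqrt (16 b1 b3) / |a2| times y / (1 + y). As [csqrtd] covers
    both signs, the same description gives a real kernel for b1 > 0 and an oscillating one for b1 <
    0. *)
Definition bdesc (p : prm) : integral_desc := inl (inr (enc2 (absz (2 * pa2 p)%R)
  (absz (2 * pb2 p + - pa2 p)%R).-1 (absz (4 * pb2 p + 2 * pa2 p)%R).-1
  (absz (pa2 p))%:Z (absz (pa2 p))%:Z (cint 0) (csqrtd (16 * pb1 p * pb3 p)) (cint 0)
  ((2 * pb2 p + - pa2 p) * pY p) (2 * (2 * pb2 p + - pa2 p) * pY p + 8 * pb1 p * pX p)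
  ((2 * pb2 p + - pa2 p) * pY p))).

Lemma tc_bdesc : tc bdesc.
Proof.
apply: tc_inl; apply: tc_inr.
apply: (@tc_enc2 (fun p => absz (2 * pa2 p)) (fun p => (absz (2 * pb2 p + - pa2 p)).-1)
  (fun p => (absz (4 * pb2 p + 2 * pa2 p)).-1) (fun p => (absz (pa2 p))%:Z) (fun p => (absz (pa2 p))%:Z)
  (fun=> cint 0) (fun p => csqrtd (16 * pb1 p * pb3 p)) (fun=> cint 0)
  (fun p => (2 * pb2 p + - pa2 p) * pY p) (fun p => 2 * (2 * pb2 p + - pa2 p) * pY p + 8 * pb1 p * pX p)
  (fun p => (2 * pb2 p + - pa2 p) * pY p)); zcomp; by [exact: tc_const|apply: tc_csqrtd; zcomp].
Qed.

Lemma solv_bessel : solv bsl.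
Proof.
apply: (solv_leaf tc_bdesc) => p V [h3 h1 hb3 h2 k].
have b30 : 0 < r (pb3 p) by rewrite ltr0z.
have a2n : r (pa2 p) != 0 by rewrite intr_eq0.
have hb1 : pb1 p != 0 by case: (V 0%N) => _ _; rewrite mulr0 add0r.
have b1n : r (pb1 p) != 0 by rewrite intr_eq0.
pose e0 := (2 * r (pb2 p) - r (pa2 p)) / (2 * r (pa2 p)).
have a22 : 0 < r (pa2 p) ^+ 2 by rewrite exprn_even_gt0.
have e01 : 1 <= e0.
  rewrite (_ : e0 = (2 * (r (pb2 p) * r (pa2 p)) - r (pa2 p) ^+ 2) / (2 * r (pa2 p) ^+ 2)); last first.
    by rewrite /e0; field.
  have D2 : 0 < 2 * r (pa2 p) ^+ 2 by rewrite mulr_gt0.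
  rewrite (ler_pdivlMr _ _ D2) mul1r.
  have : (3 * (r (pa2 p) * r (pa2 p)) <= 2 * (r (pb2 p) * r (pa2 p))).
    by move: k; rewrite -(ler_int R) !intrM.
  by rewrite -expr2; lra.
have e00 : 0 < e0 := lt_le_trans ltr01 e01.
have e0E' : 2 * r (pb2 p) - r (pa2 p) = 2 * r (pa2 p) * e0 by rewrite /e0; field.
pose Z2 := 16 * r (pb1 p) * r (pb3 p) / r (pa2 p) ^+ 2.
have Z2E : Z2 * r (pa2 p) ^+ 2 = 16 * r (pb1 p) * r (pb3 p) by rewrite /Z2 mulfVK ?gt_eqF.
have D0 : (0 < absz (2 * pa2 p)%R)%N by rewrite absz_gt0 mulf_neq0.
have K1 : e0 * r (2 * pa2 p) = r (2 * pb2 p + - pa2 p) by rewrite intrD intrN !intrM e0E' mulrC.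
have K2 : (2 * e0 + 2) * r (2 * pa2 p) = r (4 * pb2 p + 2 * pa2 p).
  by rewrite !(intrD, intrM) /e0; field.
have t2 : r (2 * pa2 p) != 0 by rewrite intr_eq0 mulf_neq0.
have s0 : 0 < 2 * e0 + 2.
  by apply: addr_gt0; [apply: mulr_gt0; [exact: ltr0Sn|exact: e00]|exact: ltr0Sn].
have e0E : e0 * (absz (2 * pa2 p)%R)%:R = ((absz (2 * pb2 p + - pa2 p)%R).-1)%:R + 1.
  rewrite natz1; last by rewrite -(intr_eq0 R) -K1 mulf_neq0 // gt_eqF.
  by rewrite natz -[X in X * _](gtr0_norm e00) -normrM K1.
have sE : (2 * e0 + 2) * (absz (2 * pa2 p)%R)%:R = ((absz (4 * pb2 p + 2 * pa2 p)%R).-1.+1)%:R.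
  rewrite natz2; last by rewrite -(intr_eq0 R) -K2 mulf_neq0 // gt_eqF.
  by rewrite natz -[X in X * _](gtr0_norm s0) -normrM K2.
have A3 : r (pa3 p) = 0 by rewrite h3.
have A1 : r (pa1 p) = 0 by rewrite h1.
have [v Sv] := psol_ex R V; have [Sv' v0 v1] := Sv; rewrite A3 A1 in Sv'.
have g1 n : aff (0 : R) (r (pb1 p)) n != 0 by rewrite /aff mul0r add0r.
have a0 : 0 < (absz (pa2 p))%:Z by rewrite ltz_nat absz_gt0.
have aR : r (absz (pa2 p))%:Z = `|r (pa2 p)| by rewrite -natz.
have a0' : `|r (pa2 p)| != 0 by rewrite normr_eq0.
have uniqv (w : nat -> R) : psol 1 p w -> w = v.
  move=> [Sw w0 w1]; have [Sv2 _ _] := Sv; apply/funext => n.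
  by apply: (sol_eq (vp3 R V) Sw Sv2); rewrite ?w0 ?w1 ?v0 ?v1.
have FE (Th : R -> R) : besF (r (pa2 p)) (r (pb2 p)) (r (pb1 p)) e0 Th (v 0%N) (v 1%N) =
    (fun y => Th y * (r ((2 * pb2 p + - pa2 p) * pY p) +
      r (2 * (2 * pb2 p + - pa2 p) * pY p + 8 * pb1 p * pX p) * y +
      r ((2 * pb2 p + - pa2 p) * pY p) * y ^+ 2) * (y `^ (e0 - 1) * (1 + y) `^ (- (2 * e0 + 2)))).
  apply/funext => y; rewrite /besF v0 v1 !mul1r; congr (_ * (_ + _ * _ + _ * _) * _);
  by rewrite !(intrM, intrD, intrN).
have [m0|m0] := leP 0 (16 * pb1 p * pb3 p).
  pose z := Num.sqrt (r (16 * pb1 p * pb3 p)) / r (absz (pa2 p))%:Z.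
  have zE : z ^+ 2 = Z2.
    rewrite /z expr_div_n sqr_sqrtr ?ler0z // aR real_normK ?num_real // /Z2 !intrM //.
  have [I T] := bessel_test_exp D0 b30 b1n a2n e01 e0E' Z2E g1 Sv' zE.
  have [ok Z'] := enc2_bessel_exp D0 e0E sE a0 m0 erefl (FE _) I.
  split; first exact: ok.
  by move=> w /uniqv ->; rewrite /pmini A3 A1 T Z'.
pose z := Num.sqrt (- r (16 * pb1 p * pb3 p)) / r (absz (pa2 p))%:Z.
have zE : - z ^+ 2 = Z2.
  rewrite /z expr_div_n sqr_sqrtr ?oppr_ge0 ?lerz0 ?(ltW m0) // aR real_normK ?num_real // /Z2 !intrM.
  by rewrite mulNr opprK.
have [I J T] := bessel_test_cos D0 b30 b1n a2n e01 e0E' Z2E g1 Sv' zE.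
have [ok Z'] := enc2_bessel_cos D0 e0E sE a0 m0 erefl (FE _) (FE _) I J.
split; first exact: ok.
by move=> w /uniqv ->; rewrite /pmini A3 A1 T Z'.
Qed.

End LowDegree.
End LowDegreeClasses.


(** * The computable case distinction over all recurrences *)

Module DecisionTree.
From mathcomp Require Import all_boot all_order all_algebra.
From mathcomp Require Import complex.
From mathcomp Require mpoly.
Import -(notations) mpoly.
From mathcomp Require Import all_classical all_reals all_analysis.
From mathcomp Require Import measurable_realfun.
From mathcomp Require Import zify ring lra.
Require Import Defs.
Import Recursive LinearRecurrences SubdominantGrowth Oscillation OscillationLowDegree AffineRecurrences HalfLineIntegrals DecayAndSmoothness Fibres Fibres3 Descriptors ExponentialPeriods PeriodLike MomentSolutions BesselIntegrals MinimalityCriteria BesselClass ComputableParameters ParameterMaps Encodings QuadraticClasses LowDegreeClasses.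
Set Implicit Arguments.
Unset Strict Implicit.
Unset Printing Implicit Defensive.
Import Order.TTheory GRing.Theory Num.Theory numFieldNormedType.Exports.
Local Open Scope classical_set_scope.
Local Open Scope ring_scope.

Section DecisionTree.
Variable R : realType.
Local Notation r x := (x%:~R : R).
Local Notation solv := (solv R).
Local Notation Mn := (Mn R).
Implicit Types P Q : prm -> Prop.

Lemma solv_cond b t P Q : bc b -> cmap t ->
  (forall p, vp p -> P p -> b p -> [/\ vp (t p), Q (t p) & Mn p <-> Mn (t p)]) ->
  (forall p, vp p -> P p -> ~~ b p -> Q p) -> solv Q -> solv P.
Proof.
move=> Hb Ct H H' SQ; apply: (solv_if Hb).
  by apply: (solv_map Ct _ SQ) => p V [Pp bp]; exact: H.
by apply: (solv_sub _ SQ) => p V [Pp nb]; exact: H'.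
Qed.

Lemma solv_neg b P Q : bc b -> (forall p, vp p -> P p -> b p -> Q (pneg p)) ->
  (forall p, vp p -> P p -> ~~ b p -> Q p) -> solv Q -> solv P.
Proof.
move=> Hb H; apply: (solv_cond Hb cm_neg) => p V Pp bp.
by split; [exact: vp_neg|exact: H|exact: Mn_neg].
Qed.

Lemma solv_flip b P Q : bc b -> (forall p, vp p -> P p -> b p -> Q (pflip p)) ->
  (forall p, vp p -> P p -> ~~ b p -> Q p) -> solv Q -> solv P.
Proof.
move=> Hb H; apply: (solv_cond Hb cm_flip) => p V Pp bp.
by split; [exact: vp_flip|exact: H|exact: Mn_flip].
Qed.

Lemma solv_shift N P Q : nc N -> (forall p, vp p -> P p -> Q (iter (N p) pshift p)) -> solv Q -> solv P.
Proof.
move=> HN H; apply: (solv_map (cmap_iter cm_shift HN)) => p V Pp.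
by have [V' E] := Mn_iter_shift R (N p) V; split=> //; exact: H.
Qed.

Definition pswn p := if 0 < pa1 p then pswap p else pflip (pneg (pswap p)).

Lemma cm_swn : cmap pswn.
Proof.
apply: (cmap_if (b := fun p => 0 < pa1 p)); [by zcomp|exact: cm_swap|].
exact: (cmap_comp cm_flip (cmap_comp cm_neg cm_swap)).
Qed.

Lemma swnP p : vp p -> pb3 p + - pa3 p != 0 -> vp (pswn p) /\ (Mn p <-> Mn (pswn p)).
Proof.
move=> V h; have V1 := vp_swap V h; have E1 := Mn_swap R V h; rewrite /pswn; case: ifP => _ //.
have V2 := vp_neg V1; split; first exact: vp_flip.
by rewrite E1 (Mn_neg R V1) (Mn_flip R V2).
Qed.

(** UU becomes QQ - UU while WW and dd are unchanged: the exchange replaces ea by 1 - eb. The sign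
    changes in [pswn] restore a3 > 0 and keep a2 and the sign of a1. *)
Lemma swn_data p : 0 < pa3 p -> pa1 p != 0 ->
  [/\ 0 < pa3 (pswn p), pa1 (pswn p) != 0, pa2 (pswn p) = pa2 p, pb2 (pswn p) = pb2 p &
  [/\ dd (pswn p) = dd p, UU (pswn p) = QQ p - UU p, WW (pswn p) = WW p,
    (0 < pa1 (pswn p)) = (0 < pa1 p) & (2 * pa3 p <= pb3 p -> pa1 p * pa1 p <= pb1 p * pa1 p ->
    pa1 (pswn p) * pa1 (pswn p) <= pb1 (pswn p) * pa1 (pswn p) /\ pa3 (pswn p) < pb3 (pswn p))]].
Proof.
move=> h3 h1; rewrite /UU /QQ /WW /mm /sg /dd /pswn; case: ifP => h; rewrite /pflip /pneg /pswap /=.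
  rewrite h3 ?h; split=> //; first by rewrite gt_eqF.
  by split=> //; try ring; move=> k1 k2; split; nia.
have h' : pa1 p < 0 by rewrite lt_neqAle h1 /= leNgt h.
have n3 : (0 < - pa3 p) = false by apply/negbTE; rewrite -leNgt; lia.
rewrite n3; split=> //; [lia|lia|lia|lia|].
by split=> //; try ring; move=> k1 k2; split; nia.
Qed.

Lemma vp0 p : vp p -> [/\ pb3 p != 0, pb2 p != 0 & pb1 p != 0].
Proof. by move/(_ 0%N); rewrite !mulr0 !add0r. Qed.

(** For integers b / a >= - |b|, so |b| + k index shifts bring the ratio b / a to at least k;
    multiplying by a^2 avoids a case distinction on the sign of a. *)
Lemma shift_ge (a b : int) (N k : nat) : (absz b + k <= N)%N -> k%:Z * (a * a) <= (b + a * N%:Z) * a.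
Proof.
move=> h; rewrite -subr_ge0 (_ : _ - _ = a * (b + (N%:Z - k%:Z) * a)); last by ring.
have hb : (absz b)%:Z <= N%:Z - k%:Z by lia.
move: (N%:Z - k%:Z) hb => t hb; have : - t <= b <= t by lia.
case: (ltrgtP a 0) => [a0|a0|->] ht; last by rewrite mul0r.
  by rewrite nmulr_rge0 //; nia.
by rewrite pmulr_rge0 //; nia.
Qed.

Lemma solv_const_neg : solv (fun p => [/\ pa3 p = 0, pa2 p = 0, pa1 p = 0, 0 < pb3 p &
  pb2 p * pb2 p + 4 * pb3 p * pb1 p < 0]).
Proof.
apply: solv_no => p V [h3 h2 h1 hb3 hd] [v [Sv _ _]].
have b30 : 0 < r (pb3 p) by rewrite ltr0z.
have d0 : r (pb2 p) ^+ 2 + 4 * r (pb3 p) * r (pb1 p) < 0.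
  by have := hd; rewrite -(ltr_int R) !(intrD, intrM) expr2.
have b10 : r (pb1 p) < 0 by have := sqr_ge0 (r (pb2 p)); nra.
pose q := Num.sqrt (4 * r (pb3 p) * - r (pb1 p)).
have q2 : q ^+ 2 = 4 * r (pb3 p) * - r (pb1 p).
  by rewrite sqr_sqrtr // !mulr_ge0 ?ltW // oppr_gt0.
have q0 : 0 <= q by exact: sqrtr_ge0.
have qb : `|r (pb2 p)| < q.
  rewrite -(ltr_pXn2r (n := 2)) ?nnegrE // q2 real_normK ?num_real //; nra.
rewrite /pmini h3 h2 h1 !mulr0z in Sv *.
apply: (osc_constant (c := q - `|r (pb2 p)|) b30 b10 _ _ Sv); first by rewrite subr_gt0.
move=> x y; rewrite /qform normrM.
have k1 : r (pb2 p) * x * y <= `|r (pb2 p)| * (`|x| * `|y|).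
  by rewrite -normrM -normrM mulrA; exact: ler_norm.
have k2 : 0 <= (2 * r (pb3 p) * `|x| - q * `|y|) ^+ 2 by exact: sqr_ge0.
have nx : `|x| ^+ 2 = x ^+ 2 by rewrite real_normK ?num_real.
have ny : `|y| ^+ 2 = y ^+ 2 by rewrite real_normK ?num_real.
have k3 : (2 * r (pb3 p) * `|x| - q * `|y|) ^+ 2 =
  4 * r (pb3 p) * (r (pb3 p) * x ^+ 2 - r (pb1 p) * y ^+ 2 - q * (`|x| * `|y|)).
  rewrite -nx -ny; transitivity (4 * r (pb3 p) ^+ 2 * `|x| ^+ 2 - 4 * r (pb3 p) * q * (`|x| * `|y|) +
    q ^+ 2 * `|y| ^+ 2); [ring|rewrite q2; ring].
rewrite k3 pmulr_rge0 ?mulr_gt0 // in k2; rewrite mulrBl; lra.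
Qed.

Lemma solv_const_pos : solv (fun p => [/\ pa3 p = 0, pa2 p = 0, pa1 p = 0 & [/\ 0 < pb3 p, 0 < pb2 p &
  0 <= pb2 p * pb2 p + 4 * pb3 p * pb1 p]]).
Proof.
apply: (@solv_dec R (fun p => ~~ ((pX p == 0) && (pY p == 0)) &&
  ((0 <= pX p * (pb2 p * pX p + - (2 * pb3 p * pY p))) &&
  ((2 * pb3 p * pY p + - (pb2 p * pX p)) * (2 * pb3 p * pY p + - (pb2 p * pX p)) ==
   (pb2 p * pb2 p + 4 * pb3 p * pb1 p) * (pX p * pX p))))); first by zcomp.
move=> p V [h3 h2 h1 [hb3 hb2 hd]].
have b30 : 0 < r (pb3 p) by rewrite ltr0z.
have b20 : 0 < r (pb2 p) by rewrite ltr0z.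
have [_ _ b1z] := vp0 V; have b1n : r (pb1 p) != 0 by rewrite intr_eq0.
pose D := r (pb2 p * pb2 p + 4 * pb3 p * pb1 p); have D0 : 0 <= D by rewrite ler0z.
have DE : D = r (pb2 p) ^+ 2 + 4 * r (pb3 p) * r (pb1 p) by rewrite /D !(intrD, intrM) expr2.
pose s := Num.sqrt D; have s0 : 0 <= s by exact: sqrtr_ge0.
have s2 : s ^+ 2 = D by rewrite sqr_sqrtr.
pose la := (r (pb2 p) - s) / (2 * r (pb3 p)); pose mu := (r (pb2 p) + s) / (2 * r (pb3 p)).
have b1E : r (pb1 p) = (s ^+ 2 - r (pb2 p) ^+ 2) / (4 * r (pb3 p)) by rewrite s2 DE; field; rewrite gt_eqF.
have sol (x : R) : r (pb3 p) * x ^+ 2 = r (pb2 p) * x + r (pb1 p) ->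
  asol 0 (r (pb3 p)) 0 (r (pb2 p)) 0 (r (pb1 p)) (fun n => x ^+ n).
  move=> E n; rewrite /aff !mul0r !add0r !exprS.
  have -> : r (pb3 p) * (x * (x * x ^+ n)) = (r (pb3 p) * x ^+ 2) * x ^+ n by ring.
  by rewrite E; ring.
have Sla : asol 0 (r (pb3 p)) 0 (r (pb2 p)) 0 (r (pb1 p)) (fun n => la ^+ n).
  by apply: sol; rewrite b1E /la; field; rewrite gt_eqF.
have Smu : asol 0 (r (pb3 p)) 0 (r (pb2 p)) 0 (r (pb1 p)) (fun n => mu ^+ n).
  by apply: sol; rewrite b1E /mu; field; rewrite gt_eqF.
have lan : la != 0.
  apply: contra_neq b1n => l0; have := Sla 0%N; rewrite /aff !mul0r !add0r l0 !expr0n /= mulr0 mulr1 => E.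
  by move: E; rewrite mulr0 add0r.
have g3 n : aff 0 (r (pb3 p)) n != 0 by rewrite /aff mul0r add0r gt_eqF.
have g1 n : aff 0 (r (pb1 p)) n != 0 by rewrite /aff mul0r add0r.
have Mm : amini 0 (r (pb3 p)) 0 (r (pb2 p)) 0 (r (pb1 p)) (fun n => la ^+ n).
  move: s0; rewrite le_eqVlt => /orP[/eqP sz|sp].
    split; first by exists 0%N; rewrite expr0 oner_neq0.
    exists (fun n => n%:R * la ^+ n); split.
      have E2 : r (pb2 p) = 2 * r (pb3 p) * la by rewrite /la -sz; field; rewrite gt_eqF.
      have E1 : r (pb1 p) = - r (pb3 p) * la ^+ 2 by rewrite b1E E2 -sz; field; rewrite gt_eqF.
      move=> n; rewrite /aff !mul0r !add0r E2 E1 !exprS -!natr1; ring.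
    move=> e e0; exists (Num.truncn e^-1).+1 => n nN.
    have n0 : 0 < n%:R :> R by rewrite ltr0n; apply: leq_trans nN.
    have ln : la ^+ n != 0 by rewrite expf_neq0.
    split; last by rewrite mulf_neq0 // gt_eqF.
    rewrite normrM mulrA ler_peMl // gtr0_norm //.
    have : e^-1 <= n%:R by apply: le_trans (ltW (truncnS_gt _)) _; rewrite ler_nat.
    by move=> h; have := ler_wpM2l (ltW e0) h; rewrite mulfV ?gt_eqF.
  have lm : `|la| < mu.
    rewrite ltr_norml /la /mu -mulNr !ltr_pM2r ?invr_gt0 ?mulr_gt0 //; apply/andP; split; lra.
  have la0 : 0 < `|la| by rewrite normr_gt0.
  apply: (small_mini la0 _ Sla); last first.
  - move=> rho h; exists 1 => // n; rewrite mul1r normrX.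
    apply: (lerXn2r n _ _ (ltW h)); rewrite nnegrE //; exact: le_trans (normr_ge0 la) (ltW h).
  - by exists 0%N; rewrite expr0 oner_neq0.
  have mu0 : 0 <= mu by apply: le_trans (normr_ge0 la) (ltW lm).
  exists (fun n => mu ^+ n), mu, 0%N; split=> // n _.
  by rewrite ger0_norm // exprn_ge0.
have [v Sv] := psol_ex R V; rewrite (MnE V (oner_neq0 R) Sv).
have [Sv' v0 v1] := Sv; rewrite /pmini h3 h2 h1 !mulr0z in Sv' *.
rewrite /amini (mini_crit g3 g1 Sla Mm Sv') v0 v1 !mul1r expr0 expr1 mulr1 !intr_eq0.
pose x := r (pX p); pose z := 2 * r (pb3 p) * r (pY p) - r (pb2 p) * x.
have zE : r (pY p) - x * la = (z + s * x) / (2 * r (pb3 p)).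
  by rewrite /z /la; field; rewrite gt_eqF.
(* The test z + s x = 0 with s = sqrt D is decided over the integers as z^2 = D x^2 together with x
   z <= 0. *)
have B : ((0 <= pX p * (pb2 p * pX p + - (2 * pb3 p * pY p))) &&
  ((2 * pb3 p * pY p + - (pb2 p * pX p)) * (2 * pb3 p * pY p + - (pb2 p * pX p)) ==
   (pb2 p * pb2 p + 4 * pb3 p * pb1 p) * (pX p * pX p))) = (z + s * x == 0).
  rewrite -(ler_int R) -(inj_eq (@intr_inj R)) [r (_ * (pX p * pX p))]intrM -/D -s2 !(intrM, intrD, intrN) -/x.
  rewrite (_ : x * _ = - (x * z)); last by rewrite /z; ring.
  rewrite (_ : (_ - _) * _ = z ^+ 2); last by rewrite /z; ring.
  rewrite -expr2 -exprMn mulr0z; apply/andP/eqP => [[k /eqP E]|E]; last first.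
    have -> : z = - (s * x) by apply/eqP; rewrite -subr_eq0 opprK E.
    by split; [rewrite mulrN opprK mulrCA mulr_ge0 // -expr2 sqr_ge0|rewrite sqrrN].
  move/eqP: E; rewrite eqf_sqr => /orP[] /eqP E; last by rewrite E addNr.
  move: k; rewrite E mulrCA oppr_ge0 -expr2 => k.
  have : s * x ^+ 2 = 0 by apply/le_anti; rewrite k mulr_ge0 ?sqr_ge0.
  move/eqP; rewrite mulf_eq0 expf_eq0 /= => /orP[] /eqP ->; by rewrite ?mul0r ?mulr0 addr0.
rewrite B negb_and -/x zE; split=> [[/orP -> E]|/andP[/orP h /eqP ->]] /=; last by rewrite mul0r.
by move/eqP: E; rewrite mulf_eq0 invr_eq0 mulf_eq0 (gt_eqF b30) pnatr_eq0 /= orbF.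
Qed.

Lemma solv_a3_0 : solv (fun p => pa3 p = 0).
Proof.
pose Q p := pa3 p = 0 /\ 0 < pb3 p.
apply: (solv_neg (b := fun p => pb3 p < 0) (Q := Q)); first by zcomp.
- by move=> p V h; rewrite /Q /= h oppr0 oppr_gt0.
- move=> p V h; rewrite -leNgt => k; split=> //; rewrite lt_neqAle k andbT eq_sym.
  by case: (vp0 V).
apply: (solv_if (b := fun p => pa1 p == 0)); first by zcomp.
  apply: (solv_if (b := fun p => pa2 p == 0)); first by zcomp.
    apply: (solv_if (b := fun p => pb2 p * pb2 p + 4 * pb3 p * pb1 p < 0)); first by zcomp.
      by apply: (solv_sub _ solv_const_neg) => p V [[[[h3 k] /eqP h1] /eqP h2] d].
    apply: (solv_flip (b := fun p => pb2 p < 0) _ _ _ solv_const_pos); first by zcomp.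
      move=> p V [[[[h3 k] /eqP h1] /eqP h2]]; rewrite -leNgt => d b.
      by rewrite /= h2 oppr0 mulrNN oppr_gt0.
    move=> p V [[[[h3 k] /eqP h1] /eqP h2]]; rewrite -leNgt => d; rewrite -leNgt => b.
    by split=> //; split=> //; rewrite lt_neqAle b andbT eq_sym; case: (vp0 V).
  apply: (solv_shift (N := fun p => (absz (pb2 p) + 2)%N) _ _ (solv_bessel R)); first by zcomp.
  move=> p V [[[h3 k] /eqP h1] h2]; have [E3 F3 E2 F2 [E1 F1]] := iter_shift p (absz (pb2 p) + 2)%N.
  rewrite /bsl E3 F3 E2 F2 E1 h3 h1 mul0r addr0; split=> //.
  have := @shift_ge (pa2 p) (pb2 p) _ 2 (leqnn _); have : 0 <= pa2 p * pa2 p by rewrite -expr2 sqr_ge0.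
  by move: (pa2 p * pa2 p) ((_ + _) * _) => *; lia.
apply: (solv_if (b := fun p => pa2 p == 0)); first by zcomp.
  apply: (solv_if (b := fun p => pa1 p < 0)); first by zcomp.
    apply: (solv_flip (b := fun p => pb2 p < 0) (Q := fun p => [/\ Q p, pa2 p = 0, pa1 p < 0 & 0 < pb2 p])).
    - by zcomp.
    - by move=> p V [[[[h3 k] _] /eqP h2] h1] b; rewrite /Q /= h2 oppr0 oppr_gt0.
    - move=> p V [[[[h3 k] _] /eqP h2] h1]; rewrite -leNgt => b; split=> //.
      by rewrite lt_neqAle b andbT eq_sym; case: (vp0 V).
    apply: solv_no => p V [[h3 k] h2 h1 b] [v [Sv _ _] M].
    have a10 : r (pa1 p) < 0 by rewrite ltrz0.
    have b30 : 0 < r (pb3 p) by rewrite ltr0z.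
    have b20 : 0 < r (pb2 p) by rewrite ltr0z.
    move: Sv M; rewrite /pmini h3 h2 !mulr0z; exact: (osc_linear a10 b30 b20 (vp1 R V)).
  apply: (solv_flip (b := fun p => 0 < pb2 p)
    (Q := fun p => [/\ Q p, pa2 p = 0, 0 < pa1 p & pb2 p < 0])); first by zcomp.
  - move=> p V [[[[h3 k] a1] /eqP h2]]; rewrite -leNgt => h1 b; rewrite /Q /= h2 oppr0 oppr_lt0; split=> //.
    by rewrite lt_neqAle eq_sym a1.
  - move=> p V [[[[h3 k] a1] /eqP h2]]; rewrite -leNgt => h1; rewrite -leNgt => b; split=> //.
      by rewrite lt_neqAle eq_sym a1.
    by rewrite lt_neqAle b andbT; case: (vp0 V).
  apply: (solv_shift (N := fun p => (absz (pb1 p) + 1)%N) _ _ (solv_gauss R)); first by zcomp.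
  move=> p V [[h3 k] h2 h1 b]; have [E3 F3 E2 F2 [E1 F1]] := iter_shift p (absz (pb1 p) + 1)%N.
  rewrite /gau E3 F3 E2 F2 E1 F1 h3 h2 !mul0r !addr0; split=> //; split=> //.
  have := @shift_ge (pa1 p) (pb1 p) _ 1 (leqnn _); rewrite mul1r ler_pM2r //.
apply: (solv_flip (b := fun p => 0 < pa1 p * pa2 p)
  (Q := fun p => [/\ Q p, pa1 p != 0 & pa1 p * pa2 p < 0])); first by zcomp.
- by move=> p V [[[h3 k] a1] a2] b; rewrite /Q /= mulrN oppr_lt0.
- move=> p V [[[h3 k] a1] a2]; rewrite -leNgt => b; split=> //.
  by rewrite lt_neqAle b andbT mulf_neq0.
apply: (solv_shift (N := fun p => (absz (pb1 p) + 1)%N) _ _ (solv_lin R)); first by zcomp.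
move=> p V [[h3 k] h1 b]; have [E3 F3 E2 F2 [E1 F1]] := iter_shift p (absz (pb1 p) + 1)%N.
rewrite /lin E3 F3 E2 E1 F1 h3 mul0r addr0; split=> //.
by have := @shift_ge (pa1 p) (pb1 p) _ 1 (leqnn _); rewrite mul1r.
Qed.

Definition gen p := [/\ 0 < pa3 p, pa1 p != 0, pa1 p * pa1 p <= pb1 p * pa1 p & 2 * pa3 p <= pb3 p].

(** Complex roots make the leading form A definite: - dd (x^2 + y^2) <= 4 (a3 - a1) A. A large
    multiple of A therefore dominates both the constant form and |x y|. *)
Lemma solv_dd_neg : solv (fun p => [/\ gen p, dd p < 0, 0 <= pa2 p & pa2 p = 0 -> 0 <= pb2 p]).
Proof.
apply: solv_no => p V [[h3 h1 _ _] hd h2 h2'] [v [Sv _ _] M].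
have a30 : 0 < r (pa3 p) by rewrite ltr0z.
have d0 : r (pa2 p) ^+ 2 + 4 * r (pa3 p) * r (pa1 p) < 0.
  by have := hd; rewrite /dd -(ltr_int R) !(intrD, intrM) expr2.
have a10 : r (pa1 p) < 0 by have := sqr_ge0 (r (pa2 p)); nra.
have a20 : 0 <= r (pa2 p) by rewrite ler0z.
have a20' : r (pa2 p) = 0 -> 0 <= r (pb2 p).
  by move/eqP; rewrite intr_eq0 ler0z => /eqP.
set d := _ + _ in d0.
pose M0 := `|r (pb3 p)| + `|r (pb2 p)| + `|r (pb1 p)|.
pose C := (M0 + 1) * (4 * (r (pa3 p) - r (pa1 p))) / (- d).
have nd : 0 < - d by rewrite oppr_gt0.
apply: (@osc_quadratic R _ _ _ _ _ _ C 1 a30 a10 a20 ltr01 a20' (vp3 R V) (vp1 R V) _ _ v Sv M).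
  move=> x y; have : 0 <= 4 * r (pa3 p) * qform (r (pa3 p)) (r (pa2 p)) (r (pa1 p)) x y.
    rewrite (_ : _ * _ = (2 * r (pa3 p) * x - r (pa2 p) * y) ^+ 2 + (- d) * y ^+ 2); last by rewrite /d /qform; ring.
    by rewrite addr_ge0 ?sqr_ge0 // mulr_ge0 ?sqr_ge0 // ltW.
  by rewrite pmulr_rge0 // mulr_gt0.
move=> x y; set A := qform _ _ (r (pa1 p)) x y.
have k1 : - d * (x ^+ 2 + y ^+ 2) <= 4 * (r (pa3 p) - r (pa1 p)) * A.
  rewrite -subr_ge0 (_ : _ - _ = (2 * r (pa3 p) * x - r (pa2 p) * y) ^+ 2 +
    (2 * - r (pa1 p) * y - r (pa2 p) * x) ^+ 2); last by rewrite /d /A /qform; ring.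
  by rewrite addr_ge0 ?sqr_ge0.
have M00 : 0 <= M0 by rewrite !addr_ge0.
have k2 : (M0 + 1) * (x ^+ 2 + y ^+ 2) <= C * A.
  rewrite /C -mulrA [(- d)^-1 * A]mulrC mulrA -mulrA -mulrA ler_pM2l; last by rewrite ltr_wpDl.
  by rewrite mulrA ler_pdivlMr // mulrC.
apply: le_trans (lerD k2 (lexx _)); rewrite mul1r /qform mulrDl mul1r.
have xy : `|x * y| <= (x ^+ 2 + y ^+ 2) / 2.
  have q2 := sqr_ge0 (x - y); have q3 := sqr_ge0 (x + y).
  by rewrite ler_norml; apply/andP; split; nra.
have l3 : - (`|r (pb3 p)| * x ^+ 2) <= r (pb3 p) * x ^+ 2.
  by rewrite -mulNr ler_wpM2r ?sqr_ge0 // lerNl -normrN ler_norm.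
have l1 : r (pb1 p) * y ^+ 2 <= `|r (pb1 p)| * y ^+ 2 by rewrite ler_wpM2r ?sqr_ge0 // ler_norm.
have l2 : r (pb2 p) * x * y <= `|r (pb2 p)| * ((x ^+ 2 + y ^+ 2) / 2).
  rewrite -mulrA; apply: le_trans (ler_norm _) _; rewrite normrM ler_wpM2l //.
have X0 := sqr_ge0 x; have Y0 := sqr_ge0 y.
have n1 := mulr_ge0 (normr_ge0 (r (pb1 p))) X0; have n3 := mulr_ge0 (normr_ge0 (r (pb3 p))) Y0.
have n2 := mulr_ge0 (normr_ge0 (r (pb2 p))) X0; have n4 := mulr_ge0 (normr_ge0 (r (pb2 p))) Y0.
rewrite /M0; lra.
Qed.

Lemma solv_dbl : solv dbl.
Proof.
have hG := zc_GG.
apply: (solv_if (b := fun p => GG p < 0)); [by zcomp|exact: solv_double|].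
apply: (solv_if (b := fun p => GG p == 0)); first by zcomp.
  by apply: (solv_sub _ (solv_double_root R)) => p V [[db _] /eqP].
apply: (solv_sub _ (solv_double_pos R)) => p V [[db]]; rewrite -leNgt => h n; split=> //.
by rewrite lt_neqAle eq_sym n.
Qed.

Lemma gen_swap p : gen p -> pb3 p + - pa3 p != 0.
Proof. by case=> h3 _ _ k; rewrite gt_eqF //; lia. Qed.

Lemma QQ_gt0 p : 0 < pa3 p -> pa1 p != 0 -> 0 < dd p -> 0 < QQ p.
Proof.
move=> h3 h1 hd; have s0 : 0 < sg p * pa1 p.
  rewrite /sg; case: (ltrP 0 (pa1 p)) => k; first by rewrite mul1r.
  by rewrite mulN1r oppr_gt0 lt_neqAle h1.
by rewrite /QQ; apply: mulr_gt0 => //; apply: mulr_gt0 => //; exact: mulr_gt0.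
Qed.

(** The roots have equal modulus, so without an exponential gap A(S) is of no help. But WW = - 2 a1
    a3 b2 > 0 gives ea > eb: if ea <= 0, then 1 - eb > 0, and the exchanged recurrence has a
    convergent integral. *)
Lemma solv_sym : solv (fun p => [/\ gen p, 0 < dd p, pa2 p = 0 & pb2 p < 0]).
Proof.
have h1 := zc_UU; have h2 := zc_WW; have h3 := zc_dd.
apply: (solv_cond (b := fun p => ~~ posq (UU p) (WW p) (dd p)) _ cm_swn _ _ (solv_symmetric R)).
- by rewrite /posq; zcomp.
- move=> p V [g d a2 b2]; rewrite (posqP R) // -leNgt => np.
  have [V' E] := swnP V (gen_swap g); have [k3 k1 l1 l2] := g.
  have [A3 A1 A2 B2 [Ed EU EW Es /(_ l2 l1)[F1 F3]]] := swn_data k3 k1.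
  have a10 : 0 < pa1 p by move: d; rewrite /dd a2; nia.
  have Q0 : 0 < r (QQ p) by rewrite ltr0z QQ_gt0.
  have W0 : 0 <= r (WW p) * Num.sqrt (r (dd p)).
    by rewrite mulr_ge0 ?sqrtr_ge0 // ler0z /WW /mm a2; nia.
  split=> //; split; rewrite ?A2 ?B2 ?Es //; last first.
    by rewrite (posqP R) ?Ed // EU EW intrB; lra.
  by split; rewrite ?Ed //; [rewrite leNgt in W0; lia|split=> //; lia].
- move=> p V [g d a2 b2]; rewrite negbK => np; have [k3 k1 l1 l2] := g.
  have a10 : 0 < pa1 p by move: d; rewrite /dd a2; nia.
  by split=> //; split=> //; [lia|split=> //; lia].
Qed.

Lemma gen_dok p : gen p -> 0 < dd p -> pa1 p * pa2 p < 0 -> dok p /\ (0 < pa1 p -> pa2 p < 0).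
Proof.
case=> k3 k1 l1 l2 d s; split; last by move=> h; rewrite pmulr_rlt0 in s.
split=> //; last by split=> //; lia.
by move=> h; rewrite nmulr_rlt0 in s.
Qed.

Lemma solv_gen_distinct : solv (fun p => [/\ gen p, 0 < dd p & pa1 p * pa2 p < 0]).
Proof.
have h1 := zc_UU; have h2 := zc_WW; have h3 := zc_dd.
apply: (solv_if (b := fun p => posq (UU p) (- WW p) (dd p))); first by rewrite /posq; zcomp.
  (* Since QQ >= 1 and sqrt dd <= dd, this many steps make UU + K QQ + WW sqrt dd positive, that is
     ea > 0. *)
  pose K p := (absz (UU p) + absz (WW p) * absz (dd p)).+1.
  apply: (@solv_distinct R K); first by rewrite /K; zcomp.
  move=> p V [[g d s] pq]; have [dk cnd] := gen_dok g d s; split=> //; last by left.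
  have [k3 k1 _ _] := g; have [E3 F3 E2 F2 [E1 F1]] := iterT p (K p).
  rewrite (posqP R) //.
  have -> : UU (iter (K p) pT p) = UU p + (K p)%:Z * QQ p.
    by rewrite /UU /QQ /sg /mm /dd E3 F3 E2 E1 F1; ring.
  have Q1 : 1 <= r (QQ p) by rewrite ler1z -gtz0_ge1 QQ_gt0.
  have d1 : 1 <= r (dd p) by rewrite ler1z -gtz0_ge1.
  set t := Num.sqrt _; have t0 : 0 <= t by exact: sqrtr_ge0.
  have t2 : t ^+ 2 = r (dd p) by rewrite sqr_sqrtr // (le_trans ler01).
  have td : t <= r (dd p) by nra.
  have KE : r (K p)%:Z = `|r (UU p)| + `|r (WW p)| * r (dd p) + 1.
    rewrite -[r _]/((K p)%:R : R) /K -natr1 natrD natrM !natz (ger0_norm (le_trans ler01 d1)) //.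
  have w1 : - (`|r (WW p)| * r (dd p)) <= r (WW p) * t.
    apply: le_trans (_ : - (`|r (WW p)| * t) <= _); first by rewrite lerN2 ler_wpM2l.
    by rewrite -mulNr ler_wpM2r // lerNl -normrN ler_norm.
  have u1 : - `|r (UU p)| <= r (UU p) by rewrite lerNl -normrN ler_norm.
  have k0 : 1 <= r (K p)%:Z by rewrite KE lerDr addr_ge0 // mulr_ge0 // (le_trans ler01).
  have kq : r (K p)%:Z <= r (K p)%:Z * r (QQ p) by rewrite ler_peMr // (le_trans ler01).
  by rewrite intrD intrM; move: kq; rewrite KE; lra.
pose Q p := [/\ dok p, 0 < pa1 p -> pa2 p < 0 & posq (UU p) (WW p) (dd p)].
apply: (solv_map (Q := Q) cm_swn) => [p V [[g d s]]|]; last first.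
  by apply: (@solv_distinct R (fun=> 0%N)) => [|p V [? ? ?]]; [exact: nc_const|split=> //; right].
rewrite (posqP R) // -leNgt => np.
have [V' E] := swnP V (gen_swap g); have [k3 k1 l1 l2] := g.
have [A3 A1 A2 B2 [Ed EU EW Es /(_ l2 l1)[F1 F3]]] := swn_data k3 k1.
have [dk cnd] := gen_dok g d s.
have Q0 : 0 < r (QQ p) by rewrite ltr0z QQ_gt0.
split=> //; split; rewrite ?Es ?A2 //; last first.
  by rewrite (posqP R) ?Ed // EU EW intrB; move: np; rewrite intrN mulNr; lra.
split; rewrite ?Ed ?A2 //; last by split=> //; lia.
move=> h; have [_ _ _ c _] := dk; apply: c; rewrite lt_neqAle k1 leNgt -Es -leNgt; exact: ltW.
Qed.

Lemma solv_gen : solv gen.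
Proof.
have h3 := zc_dd; have hm := zc_mm.
apply: (solv_if (b := fun p => dd p < 0)); first by zcomp.
  apply: (solv_flip (b := fun p => (pa2 p < 0) || ((pa2 p == 0) && (pb2 p < 0))) _ _ _ solv_dd_neg).
  - by zcomp.
  - move=> p V [[k3 k1 l1 l2] d] b; rewrite /gen /dd /= in d *; split=> //; first by rewrite mulrNN.
      by case/orP: b => [|/andP[/eqP]]; lia.
    by move=> z; case/orP: b => [|/andP[_]]; lia.
  - move=> p V [g d]; rewrite negb_or negb_and => /andP[a b]; split=> //; first by rewrite leNgt.
    by move=> z; rewrite z eqxx /= in b; rewrite leNgt.
apply: (solv_if (b := fun p => dd p == 0)); first by zcomp.
  pose Q p := [/\ gen p, dd p = 0, 0 < pa2 p & pa1 p < 0].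
  apply: (solv_flip (b := fun p => pa2 p < 0) (Q := Q)); first by zcomp.
  - move=> p V [[[k3 k1 l1 l2] _] /eqP d] b; rewrite /Q /gen /dd /= in d *.
    split=> //; [by rewrite mulrNN|lia|]; nia.
  - move=> p V [[[k3 k1 l1 l2] _] /eqP d]; rewrite -leNgt => b; rewrite /dd in d.
    by split=> //; nia.
  (* The test is q - e0 > 1, the case excluded from [dbl]; the exchange replaces q - e0 by 2 - (q -
     e0), which is then below 1. *)
  apply: (solv_cond (b := fun p => mm p < pa3 p * pa1 p) _ cm_swn _ _ solv_dbl); first by zcomp.
  - move=> p V [g d a2 a1] b; have [V' E] := swnP V (gen_swap g); have [k3 k1 l1 l2] := g.
    have [A3 A1 A2 B2 [Ed EU EW Es /(_ l2 l1)[F1 F3]]] := swn_data k3 k1.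
    split=> //; split; rewrite ?A2 ?Ed //.
      by rewrite lt_neqAle A1 leNgt Es -leNgt ltW.
    split=> //; move: b; rewrite /mm /pswn (lt_gtF a1) /=; clear; nia.
  - move=> p V [[k3 k1 l1 l2] d a2 a1]; rewrite -leNgt => b; split=> //; split=> //; lia.
apply: (solv_if (b := fun p => pa2 p == 0)); first by zcomp.
  apply: (solv_flip (b := fun p => 0 < pb2 p) _ _ _ solv_sym); first by zcomp.
  - move=> p V [[[[k3 k1 l1 l2] n] n'] /eqP z] b; rewrite /gen /dd /= in n n' *.
    by split=> //; rewrite ?z ?oppr0 // -?leNgt; lia.
  - move=> p V [[[g n] n'] /eqP z]; rewrite -leNgt => b; split=> //; first by lia.
    by rewrite lt_neqAle b andbT; case: (vp0 V).
apply: (solv_flip (b := fun p => 0 < pa1 p * pa2 p) _ _ _ solv_gen_distinct); first by zcomp.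
- move=> p V [[[[k3 k1 l1 l2] n] n'] z] b; rewrite /gen /dd /= in n n' *.
  by split=> //; [rewrite mulrNN; lia|rewrite mulrN oppr_lt0].
- move=> p V [[[g n] n'] z]; rewrite -leNgt => b; split=> //; first by lia.
  by rewrite lt_neqAle b andbT mulf_neq0 //; case: g.
Qed.

Theorem solv_all : solv (fun=> True).
Proof.
apply: (solv_if (b := fun p => pa3 p == 0)); first by zcomp.
  by apply: (solv_sub _ solv_a3_0) => p V [_ /eqP].
apply: (solv_if (b := fun p => pa1 p == 0)); first by zcomp.
  (* The exchange needs b3 - a3 != 0; after one index shift this difference is the old b3. *)
  apply: (solv_map (cmap_comp cm_swap cm_shift) _ solv_a3_0) => p V [[_ h3] /eqP h1].
  have V1 := vp_shift V; have n3 : pb3 (pshift p) + - pa3 (pshift p) != 0.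
    by rewrite /pshift /= [pa3 p + _]addrC addrK; case: (vp0 V).
  split; [exact: vp_swap|by []|].
  by rewrite (Mn_shift R V) (Mn_swap R V1 n3).
pose g1 p := [/\ pa3 p != 0, pa1 p != 0, pa1 p * pa1 p <= pb1 p * pa1 p & 2 * (pa3 p * pa3 p) <= pb3 p * pa3 p].
(* The aim is b1 / a1 >= 1 and b3 / a3 >= 2; the second bound has a margin of 1 because an exchange
   makes b3 / a3 - 1 the new e0. *)
apply: (solv_shift (N := fun p => (absz (pb3 p) + absz (pb1 p) + 2)%N) (Q := g1)); first by zcomp.
  move=> p V [[_ h3] h1]; set N := (_ + 2)%N; have [E3 F3 E2 F2 [E1 F1]] := iter_shift p N.
  rewrite /g1 E3 F3 E1 F1; split=> //.
    by have := @shift_ge (pa1 p) (pb1 p) N 1; rewrite mul1r; apply; rewrite /N; lia.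
  by apply: (@shift_ge (pa3 p) (pb3 p) N 2); rewrite /N; lia.
apply: (solv_neg (b := fun p => pa3 p < 0) _ _ _ solv_gen); first by zcomp.
  move=> p V [h3 h1 k1 k3] b; rewrite /gen /= mulrNN oppr_eq0 mulrNN; split=> //; nia.
move=> p V [h3 h1 k1 k3]; rewrite -leNgt => b; have a3 : 0 < pa3 p by rewrite lt_neqAle eq_sym h3.
by split=> //; nia.
Qed.

End DecisionTree.
End DecisionTree.


From mathcomp Require Import all_boot all_order all_algebra.
From mathcomp Require Import complex.
From mathcomp Require mpoly.
Import -(notations) mpoly.
From mathcomp Require Import all_classical all_reals all_analysis.
From mathcomp Require Import measurable_realfun.
From mathcomp Require Import zify ring lra.
Require Import Defs.
Import Recursive LinearRecurrences SubdominantGrowth Oscillation OscillationLowDegree AffineRecurrences HalfLineIntegrals DecayAndSmoothness Fibres Fibres3 Descriptors ExponentialPeriods PeriodLike MomentSolutions BesselIntegrals MinimalityCriteria BesselClass ComputableParameters ParameterMaps Encodings QuadraticClasses LowDegreeClasses DecisionTree.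
Set Implicit Arguments.
Unset Strict Implicit.
Unset Printing Implicit Defensive.
Import Order.TTheory GRing.Theory Num.Theory numFieldNormedType.Exports.
Local Open Scope classical_set_scope.
Local Open Scope ring_scope.

(** * Reading the rational recurrence from its code, and the reduction *)

Section Decoding.

Definition dz (c : nat) : int :=
  if hdc c == 0%N then - ((hdc (hdc (tlc c))).+1)%:Z else (hdc (hdc c))%:Z.

Lemma code_gt0 x s : (0 < CodeSeq.code (x :: s))%N.
Proof. by rewrite /= muln_gt0 expn_gt0. Qed.

Lemma dzK (z : int) : dz (pickle z) = z.
Proof.
case: z => n.
  rewrite -[pickle _]/(CodeSeq.code [:: CodeSeq.code [:: n]; 0%N]) /dz !hdc_code.
  by rewrite gtn_eqF // code_gt0.
rewrite -[pickle _]/(CodeSeq.code [:: 0%N; CodeSeq.code [:: n]]) /dz hdc_code tlc_code !hdc_code.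
by rewrite eqxx NegzE.
Qed.

(** Beyond the end of a coefficient list [el] reads 0, which is not the code of a rational. Decoding
    it as 0/1 supplies the missing coefficient of a constant polynomial. *)
Definition qn (c : nat) : int := if c == 0%N then 0 else dz (hdc c).
Definition qd (c : nat) : int := if c == 0%N then 1 else dz (hdc (tlc c)).

Lemma pickle_rat (q : rat) : pickle q = CodeSeq.code [:: pickle (numq q); pickle (denq q)].
Proof. by rewrite -[LHS]/(pickle (valq q)) [valq q]surjective_pairing. Qed.

Lemma qnK q : qn (pickle q) = numq q.
Proof. by rewrite pickle_rat /qn gtn_eqF ?code_gt0 // hdc_code dzK. Qed.

Lemma qdK q : qd (pickle q) = denq q.
Proof. by rewrite pickle_rat /qd gtn_eqF ?code_gt0 // tlc_code hdc_code dzK. Qed.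

Lemma pickle_poly (g : {poly rat}) : pickle g = CodeSeq.code (map pickle (polyseq g)).
Proof. by []. Qed.

Lemma coefK (g : {poly rat}) i :
  qn (el i (pickle g)) = numq g`_i /\ qd (el i (pickle g)) = denq g`_i.
Proof.
rewrite pickle_poly el_code; have [h|h] := ltnP i (size g).
  by rewrite (nth_map 0) // qnK qdK.
by rewrite !nth_default ?size_map.
Qed.

Lemma recZ_dz n f : recn n f -> recZ n (fun xs => dz (f xs)).
Proof.
move=> Hf; have Hh := rec_hdc Hf; have Hn := rec_hdc (rec_hdc (rec_tlc Hf)).
apply: recZ_if; first exact: rec_eqn Hh (rec_const n 0).
  by apply: recZ_opp; apply: recZ_nat; exact: rec_succ.
by apply: recZ_nat; exact: rec_hdc.
Qed.

Lemma recZ_qn n f : recn n f -> recZ n (fun xs => qn (f xs)).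
Proof.
move=> Hf; apply: recZ_if; first exact: rec_eqn Hf (rec_const n 0).
  exact: recZ_const.
by apply: recZ_dz; exact: rec_hdc.
Qed.

Lemma recZ_qd n f : recn n f -> recZ n (fun xs => qd (f xs)).
Proof.
move=> Hf; apply: recZ_if; first exact: rec_eqn Hf (rec_const n 0).
  exact: recZ_const.
by apply: recZ_dz; apply: rec_hdc; exact: rec_tlc.
Qed.

Definition zd (G : nat -> int) := recZ 1 (fun xs => G (head0 xs)).

Lemma theta_intro G0 G1 G2 G3 G4 G5 G6 G7 : zd G0 -> zd G1 -> zd G2 -> zd G3 -> zd G4 -> zd G5 ->
  zd G6 -> zd G7 -> exists f : nat -> nat, recn 1 (fun xs => f (head0 xs)) /\
  forall c, theta (f c) = (G0 c, G1 c, G2 c, G3 c, G4 c, G5 c, G6 c, G7 c).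
Proof.
move=> [f0 [g0 [h0 k0 e0]]] [f1 [g1 [h1 k1 e1]]] [f2 [g2 [h2 k2 e2]]] [f3 [g3 [h3 k3 e3]]]
  [f4 [g4 [h4 k4 e4]]] [f5 [g5 [h5 k5 e5]]] [f6 [g6 [h6 k6 e6]]] [f7 [g7 [h7 k7 e7]]].
pose s := [:: f0; g0; f1; g1; f2; g2; f3; g3; f4; g4; f5; g5; f6; g6; f7; g7].
exists (fun c => CodeSeq.code [seq f [:: c] | f <- s]); split.
  apply: (@eq_recn 1 (fun xs => CodeSeq.code [seq f xs | f <- s])).
    by case=> [|x []].
  apply: code_map => f; rewrite /s /=; do 16?[case=> [<- //|]]; by [].
move=> c; rewrite (e0 [:: c]) // (e1 [:: c]) // (e2 [:: c]) // (e3 [:: c]) //.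
rewrite (e4 [:: c]) // (e5 [:: c]) // (e6 [:: c]) // (e7 [:: c]) //.
by rewrite /theta /ci !el_code.
Qed.

Lemma zd_add F G : zd F -> zd G -> zd (fun c => F c + G c). Proof. exact: recZ_add. Qed.
Lemma zd_mul F G : zd F -> zd G -> zd (fun c => F c * G c). Proof. exact: recZ_mul. Qed.

Definition fb (c : nat) := hdc (tlc c).
Definition fa (c : nat) := hdc (tlc (hdc c)).
Definition f1 (c : nat) := hdc (tlc (hdc (hdc c))).
Definition f2 (c : nat) := hdc (tlc (hdc (hdc (hdc c)))).
Definition f3 (c : nat) := hdc (hdc (hdc (hdc c))).

(* The recurrence is multiplied by all denominators, which makes it integral, and shifted by one,
   since [solution] only constrains [n >= 1]. *)
Definition den (f : nat -> nat) i c := qd (el i (f c)).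
Definition num (f : nat -> nat) i c := qn (el i (f c)).
Definition A3 c := num f3 1 c * (den f3 0 c * (den f2 0 c * den f2 1 c) * (den f1 0 c * den f1 1 c)).
Definition B3 c := num f3 0 c * (den f3 1 c * (den f2 0 c * den f2 1 c) * (den f1 0 c * den f1 1 c)) + A3 c.
Definition A2 c := num f2 1 c * (den f2 0 c * (den f3 0 c * den f3 1 c) * (den f1 0 c * den f1 1 c)).
Definition B2 c := num f2 0 c * (den f2 1 c * (den f3 0 c * den f3 1 c) * (den f1 0 c * den f1 1 c)) + A2 c.
Definition A1 c := num f1 1 c * (den f1 0 c * (den f3 0 c * den f3 1 c) * (den f2 0 c * den f2 1 c)).
Definition B1 c := num f1 0 c * (den f1 1 c * (den f3 0 c * den f3 1 c) * (den f2 0 c * den f2 1 c)) + A1 c.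
Definition X0 c := qn (fa c) * qd (fb c).
Definition Y0 c := qn (fb c) * qd (fa c).

Lemma decode : exists f : nat -> nat, recn 1 (fun xs => f (head0 xs)) /\
  forall c, theta (f c) = (A3 c, B3 c, A2 c, B2 c, A1 c, B1 c, X0 c, Y0 c).
Proof.
have h := rec_head0.
have r1 : recn 1 (fun xs => f1 (head0 xs)) by exact: rec_hdc (rec_tlc (rec_hdc (rec_hdc h))).
have r2 : recn 1 (fun xs => f2 (head0 xs)) by exact: rec_hdc (rec_tlc (rec_hdc (rec_hdc (rec_hdc h)))).
have r3 : recn 1 (fun xs => f3 (head0 xs)) by exact: rec_hdc (rec_hdc (rec_hdc (rec_hdc h))).
have ra : recn 1 (fun xs => fa (head0 xs)) by exact: rec_hdc (rec_tlc (rec_hdc h)).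
have rb : recn 1 (fun xs => fb (head0 xs)) by exact: rec_hdc (rec_tlc h).
have zn f i : recn 1 (fun xs => f (head0 xs)) -> zd (num f i).
  by move=> rf; apply: recZ_qn; exact: rec_el.
have ze f i : recn 1 (fun xs => f (head0 xs)) -> zd (den f i).
  by move=> rf; apply: recZ_qd; exact: rec_el.
have p2 f g i j k : recn 1 (fun xs => f (head0 xs)) -> recn 1 (fun xs => g (head0 xs)) ->
    forall f', recn 1 (fun xs => f' (head0 xs)) -> forall i',
    zd (fun c => num f' i' c * (den f' k c * (den f i c * den f j c) * (den g i c * den g j c))).
  move=> rf rg f' rf' i'; apply: zd_mul; first exact: zn.
  by apply: zd_mul; [apply: zd_mul; [exact: ze|apply: zd_mul; exact: ze]|apply: zd_mul; exact: ze].
have zA3 : zd A3 by exact: p2.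
have zA2 : zd A2 by exact: p2.
have zA1 : zd A1 by exact: p2.
apply: theta_intro; [exact: zA3|by apply: zd_add; [exact: p2|exact: zA3]|exact: zA2
  |by apply: zd_add; [exact: p2|exact: zA2]|exact: zA1|by apply: zd_add; [exact: p2|exact: zA1]| |].
  by apply: zd_mul; [exact: recZ_qn|exact: recZ_qd].
by apply: zd_mul; [exact: recZ_qn|exact: recZ_qd].
Qed.

End Decoding.

Section Minimality.
Variable R : realType.
Local Notation r x := (x%:~R : R).

Lemma num_den (q : rat) : ((numq q)%:~R : rat) = q * (denq q)%:~R.
Proof. exact: numqE. Qed.

Lemma horner2 (g : {poly rat}) (x : rat) : (size g <= 2)%N -> g.[x] = g`_0 + g`_1 * x.
Proof.
by move=> s; rewrite (horner_coef_wide _ s) !big_ord_recl big_ord0 /= expr0 mulr1 expr1 addr0.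
Qed.

Section Instance.
Variables (g3 g2 g1 : {poly rat}) (a b : rat).
Hypothesis s3 : (size g3 <= 2)%N.
Hypothesis s2 : (size g2 <= 2)%N.
Hypothesis s1 : (size g1 <= 2)%N.
Hypothesis gn : forall n : nat, [/\ g3.[n%:R] != 0, g2.[n%:R] != 0 & g1.[n%:R] != 0].

Let c := pickle (g3, g2, g1, a, b).
Let p : prm := (A3 c, B3 c, A2 c, B2 c, A1 c, B1 c, X0 c, Y0 c).

Let cE : [/\ f3 c = pickle g3, f2 c = pickle g2, f1 c = pickle g1, fa c = pickle a & fb c = pickle b].
Proof.
have E : c = CodeSeq.code [:: CodeSeq.code [:: CodeSeq.code [:: CodeSeq.code [:: pickle g3; pickle g2];
  pickle g1]; pickle a]; pickle b] by [].
by rewrite /f3 /f2 /f1 /fa /fb E !(hdc_code, tlc_code).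
Qed.

Let L : rat := (denq g3`_0 * denq g3`_1 * (denq g2`_0 * denq g2`_1) * (denq g1`_0 * denq g1`_1))%:~R.

Let L0 : L != 0.
Proof. by rewrite /L intr_eq0 !mulf_neq0 // denq_neq0. Qed.

Let affE (n : nat) : [/\ ((pa3 p * n%:Z + pb3 p)%:~R : rat) = L * g3.[n.+1%:R],
  ((pa2 p * n%:Z + pb2 p)%:~R : rat) = L * g2.[n.+1%:R] &
  ((pa1 p * n%:Z + pb1 p)%:~R : rat) = L * g1.[n.+1%:R]].
Proof.
have [E3 E2 E1 _ _] := cE.
have K f (g : {poly rat}) i : f c = pickle g -> num f i c = numq g`_i /\ den f i c = denq g`_i.
  by move=> E; rewrite /num /den E; exact: coefK.
have [n30 d30] := K _ _ 0%N E3; have [n31 d31] := K _ _ 1%N E3.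
have [n20 d20] := K _ _ 0%N E2; have [n21 d21] := K _ _ 1%N E2.
have [n10 d10] := K _ _ 0%N E1; have [n11 d11] := K _ _ 1%N E1.
rewrite /p /= /B3 /B2 /B1 /A3 /A2 /A1 !(n30, n31, n20, n21, n10, n11, d30, d31, d20, d21, d10, d11).
have nE : ((n%:Z)%:~R : rat) = n%:R by [].
by split; rewrite horner2 // /L !(intrD, intrM) !num_den nE -natr1; ring.
Qed.

Lemma instance_vp : vp p.
Proof.
move=> n; have [h3 h2 h1] := affE n; have [k3 k2 k1] := gn n.+1.
by split; rewrite -(intr_eq0 rat) ?h3 ?h2 ?h1 mulf_neq0.
Qed.

Let affR (n : nat) : [/\ aff (r (pa3 p)) (r (pb3 p)) n = ratr L * ratr g3.[n.+1%:R],
  aff (r (pa2 p)) (r (pb2 p)) n = ratr L * ratr g2.[n.+1%:R] &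
  aff (r (pa1 p)) (r (pb1 p)) n = ratr L * ratr g1.[n.+1%:R]].
Proof.
have [h3 h2 h1] := affE n.
have K (z : int) (x : rat) : (z%:~R : rat) = L * x -> r z = ratr L * ratr x.
  by move=> E; rewrite -rmorphM -E rmorph_int.
by rewrite !affz (K _ _ h3) (K _ _ h2) (K _ _ h1).
Qed.

Let Lr : ratr L != 0 :> R. Proof. by rewrite fmorph_eq0. Qed.

Let solE (v : nat -> R) : solution g3 g2 g1 v <->
  asol (r (pa3 p)) (r (pb3 p)) (r (pa2 p)) (r (pb2 p)) (r (pa1 p)) (r (pb1 p)) v.
Proof.
split=> S n.
  have [-> -> ->] := affR n; have := S n.+1 isT; rewrite /= => E.
  move: E; move: (ratr L : R) (ratr g3.[_] : R) (ratr g2.[_] : R) (ratr g1.[_] : R) => x y z t E.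
  by rewrite -!mulrA E mulrDr.
case: n => // n _; have := S n; have [-> -> ->] := affR n; rewrite [n.+1.-1]/=.
move: (ratr L : R) Lr (ratr g3.[_] : R) (ratr g2.[_] : R) (ratr g1.[_] : R) => x x0 y z t E.
by apply: (mulfI x0); rewrite mulrDr !mulrA.
Qed.

Let miniE (v : nat -> R) : minimal g3 g2 g1 v <-> pmini p v.
Proof.
split=> [[vn [w [Sw li wn vw]]]|[vn [w [Sw d]]]]; split=> //; exists w.
  split; first exact/solE.
  move=> e e0; move/cvgrPdist_le : vw => /(_ e e0) [N _ HN]; case: wn => M _ HM.
  exists (maxn N M) => n; rewrite geq_max => /andP[Nn Mn]; have wn0 := HM n Mn; split=> //.
  have := HN n Nn; rewrite /= sub0r normrN normrM normfV.
  by rewrite ler_pdivrMr // normr_gt0.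
split; first exact/solE.
- move=> x y E; have [n vn0] := vn.
  suff y0 : y = 0.
    by split=> //; have := E n; rewrite y0 mul0r addr0 => /eqP; rewrite mulf_eq0 (negbTE vn0) orbF => /eqP.
  (* Domination excludes dependence: otherwise w = - t v, and |v N| <= |w N| / (|t| + 1) is smaller
     than |v N|. *)
  apply/eqP/negPn/negP => y0.
  pose t := x / y.
  have wE k : w k = - t * v k.
    by apply: (mulfI y0); apply/eqP; rewrite -subr_eq0 -(E k) /t; apply/eqP; field.
  clearbody t.
  have q0 : 0 < `|t| + 1 by rewrite ltr_wpDl.
  have qi : 0 < (`|t| + 1)^-1 by rewrite invr_gt0.
  have [N HN] := d _ qi; have [h w0] := HN N (leqnn N).
  have v0 : 0 < `|v N|.
    by rewrite normr_gt0; apply: contra_neq w0 => z; rewrite wE z mulr0.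
  have := ler_wpM2l (ltW q0) h; rewrite mulrA mulfV ?gt_eqF // mul1r wE normrM normrN ler_pM2r // => ?; lra.
- by have [N HN] := d 1 ltr01; exists N => // n /= Nn; have [] := HN n Nn.
apply/cvgrPdist_le => e e0; have [N HN] := d e e0; exists N => // n /= Nn; have [h wn] := HN n Nn.
by rewrite sub0r normrN normrM normfV ler_pdivrMr // normr_gt0.
Qed.

Lemma instance_minimal : is_minimal R (g3, g2, g1, a, b) <-> Mn R p.
Proof.
have [_ _ _ Ea Eb] := cE.
pose k : R := ((denq a)%:~R * (denq b)%:~R)^-1.
have da : (denq a)%:~R != 0 :> R by rewrite intr_eq0 denq_neq0.
have db : (denq b)%:~R != 0 :> R by rewrite intr_eq0 denq_neq0.
have k0 : k != 0 by rewrite invr_eq0 mulf_neq0.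
have aE : ratr a = k * r (pX p).
  by rewrite /p /= /X0 Ea Eb qnK qdK intrM /k /ratr; field; rewrite da db.
have bE : ratr b = k * r (pY p).
  by rewrite /p /= /Y0 Ea Eb qnK qdK intrM /k /ratr; field; rewrite da db.
split=> [[v [/solE Sv v0 v1 /miniE Mv]]|[v [Sv v0 v1] Mv]].
  by apply/(MnE instance_vp k0 _ : Mn R p <-> pmini p v) => //; split=> //; rewrite ?v0 ?v1.
exists (fun n => k * v n); split.
- apply/solE => n; rewrite mulrCA (Sv n); ring.
- by rewrite v0 aE mul1r.
- by rewrite v1 bE mul1r.
- by apply/miniE; exact: mini_scale.
Qed.

End Instance.
End Minimality.

Theorem theorem26 (R : realType) (j k l : nat)
    (hj : (j <= 1)%N) (hk : (k <= 1)%N) (hl : (l <= 1)%N) :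
  reduces_to (valid_recurrence j k l) (is_minimal R)
    (@integral_ok R) (@integral_zero R).
Proof.
have [F [[prog Hp] HF]] := solv_all R.
have [f [Hf fE]] := decode.
have [q Hq] := rec_un (h := fun c => pickle (F (theta c))) (ex_intro _ prog Hp) Hf.
exists q => -[[[[g3 g2] g1] a] b] [s3 s2 s1 gn].
have t3 : (size g3 <= 2)%N by rewrite s3.
have t2 : (size g2 <= 2)%N by rewrite s2.
have t1 : (size g1 <= 2)%N by rewrite s1.
set c := pickle (g3, g2, g1, a, b).
have V := instance_vp a b t3 t2 t1 gn.
have [ok E] := HF _ V I.
exists (F (theta (f c))); rewrite fE; split.
- by have := Hq [:: c] erefl; rewrite /head0 /= fE.
- exact: ok.
- by rewrite (instance_minimal R a b t3 t2 t1 gn).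
Qed.
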